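(* Let $\theta(q,x)=\sum_{j=0}^{\infty}q^{j(j+1)/2}x^j$, and let $\tilde q_1\in(0,1)$, $\bar q_1,\bar q_2\in(-1,0)$ be the spectral values defined in the context. (1) For every $q\in(\tilde q_1,1)$, there exists $a\geq5$ such that the line $\{\mathrm{Re}\,x=-a\}$ is a separating line: all real zeros of $\theta(q,\cdot)$ are to its left and all complex conjugate pairs of non-real zeros are to its right. (2) For every $q\in(-1,\bar q_1)$, there exists $a\geq2.4$ such that the line $\{\mathrm{Re}\,x=-a\}$ is a left separating line: all negative real zeros of $\theta(q,\cdot)$ are to its left, while all complex conjugate pairs of non-real zeros and all positive real zeros are to its right. (3) For every $q\in(-1,\bar q_2)$, there exists $a\geq3.2$ such that the line $\{\mathrm{Re}\,x=a\}$ is a right separating line: all negative real zeros of $\theta(q,\cdot)$, its smallest positive real zero and all complex conjugate pairs of non-real zeros are to its left, while all positive real zeros except the smallest one are to its right.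
   Context: The spectrum of $\theta$ is the set of $q$ for which $\theta(q,\cdot)$ has a multiple zero. For $q\in(0,1)$ the spectrum consists of values $0<\tilde q_1<\tilde q_2<\cdots$ tending to $1$; $\tilde q_1=0.3092493386\ldots$ is the smallest one, and for $q\in(0,\tilde q_1)$ all zeros of $\theta(q,\cdot)$ are negative and distinct. For $q\in(-1,0)$ with $|q|$ small, all zeros of $\theta(q,\cdot)$ are real and simple; denote them $x_j(q)$, $j\geq1$, where $x_j(q)$ is asymptotically equivalent to $-q^{-j}$ as $q\to0^-$, and follow them continuously as $q$ decreases to $-1$ until they coalesce. Then $\bar q_1=-0.72713332\ldots$ is the value of $q$ at which the negative zeros $x_2$ and $x_4$ coalesce into a double real zero, and $\bar q_2=-0.78374209\ldots$ is the value of $q$ at which the positive zeros $x_3$ and $x_5$ coalesce into a double real zero. These are the first two values of $q$, as $q$ decreases from $0$ to $-1$, for which $\theta(q,\cdot)$ has a multiple real zero. *)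

(* Defs.v *)
From Stdlib Require Export Reals Lra.
From Coquelicot Require Export Coquelicot.

Open Scope R_scope.

(* The partial theta function; the series converges for every x when |q| < 1,
   and the value is irrelevant otherwise.  The division is exact. *)
Definition theta (q : R) (x : C) : C :=
  iota (fun v : C_CompleteNormedModule =>
    is_pseries (K := C_AbsRing) (V := C_NormedModule)
      (fun j : nat => RtoC (q ^ (j * (j + 1) / 2))) x v).

Lemma theta_eq (q : R) (x v : C) :
  is_pseries (K := C_AbsRing) (V := C_NormedModule)
    (fun j : nat => RtoC (q ^ (j * (j + 1) / 2))) x v ->
  theta q x = v.
Proof.
intros H.
apply (iota_filterlim_locally (K := C_AbsRing) (V := C_CompleteNormedModule)
         (F := eventually) _ v H).
Qed.

(* C_derive is only applied to entire functions, on which it is the complex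
   derivative. *)
Definition simple_zero (f : C -> C) (z : C) : Prop :=
  f z = RtoC 0 /\ C_derive f z <> RtoC 0.

Definition multiple_zero (f : C -> C) (z : C) : Prop :=
  f z = RtoC 0 /\ C_derive f z = RtoC 0.

Definition double_zero (f : C -> C) (z : C) : Prop :=
  multiple_zero f z /\ C_derive (C_derive f) z <> RtoC 0.

Definition spectrum (q : R) : Prop :=
  exists z : C, multiple_zero (theta q) z.

Definition is_q_tilde_1 (q1 : R) : Prop :=
  0 < q1 < 1 /\ spectrum q1 /\
  (forall q : R, 0 < q < 1 -> spectrum q -> q1 <= q).

(* x is the zero x_j(q) ~ - q^(-j) (q -> 0-), followed continuously as q
   decreases from 0 to q0.  Simplicity on the whole of (q0, 0) makes the
   continuation unique. *)
Definition followed_zero (j : nat) (q0 : R) (x : R -> R) : Prop :=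
  (forall q : R, q0 < q < 0 -> simple_zero (theta q) (RtoC (x q))) /\
  (forall q : R, q0 < q < 0 -> continuous x q) /\
  is_equiv (at_left 0) x (fun q : R => - / q ^ j).

Definition coalesce_at (j k : nat) (q0 : R) : Prop :=
  -1 < q0 < 0 /\
  exists (x y : R -> R) (xi : R),
    followed_zero j q0 x /\ followed_zero k q0 y /\
    filterlim x (at_right q0) (locally xi) /\
    filterlim y (at_right q0) (locally xi) /\
    double_zero (theta q0) (RtoC xi).

Definition is_q_bar_1 (q0 : R) : Prop := coalesce_at 2 4 q0.
Definition is_q_bar_2 (q0 : R) : Prop := coalesce_at 3 5 q0.

Definition real_zero (q x : R) : Prop := theta q (RtoC x) = RtoC 0.

(* The coefficients are real, so the non-real zeros are exactly the members of
   the complex conjugate pairs. *)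
Definition nonreal_zero (q : R) (z : C) : Prop :=
  theta q z = RtoC 0 /\ Im z <> 0.

(* In the three definitions below the line is Re x = c. *)
Definition separating_line (q c : R) : Prop :=
  (forall x : R, real_zero q x -> x < c) /\
  (forall z : C, nonreal_zero q z -> c < Re z).

Definition left_separating_line (q c : R) : Prop :=
  (forall x : R, real_zero q x -> x < 0 -> x < c) /\
  (forall z : C, nonreal_zero q z -> c < Re z) /\
  (forall x : R, real_zero q x -> 0 < x -> c < x).

Definition smallest_positive_zero (q x : R) : Prop :=
  real_zero q x /\ 0 < x /\
  (forall y : R, real_zero q y -> 0 < y -> x <= y).

Definition right_separating_line (q c : R) : Prop :=
  (forall x : R, real_zero q x -> x < 0 -> x < c) /\
  (forall z : C, nonreal_zero q z -> Re z < c) /\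
  exists x1 : R, smallest_positive_zero q x1 /\ x1 < c /\
    (forall x : R, real_zero q x -> 0 < x -> x <> x1 -> c < x).

(* Main.v *)
Require Import Defs.
From Stdlib Require Import Lia Psatz Classical Compare_dec ZArith Ranalysis5.

(* Let J(x) = theta(x) + theta(1/x)/x, which is an infinite product by Jacobi's triple product
   identity, and F(x) = x J(x) / theta(1/x). For |x| > 1 the zeros of theta are the solutions of
   F = 1. Put z = x on the left side and z = -x on the right side. On a half-plane Re z <= -B the
   contribution of the zeros of J to the logarithmic derivative of F dominates that of theta(1/x),
   so that - Im (log F)' > 0 above the real axis. As in Noshiro's univalence criterion,
   integration along a segment from a real r to z = r + u + i t gives
     t ln |F(z)/F(r)| - u (arg F(z) - arg F(r)) > 0.
   Let a0 be the real zero beyond which the line is sought. The points r = a0 |q|^(-m k) satisfy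
   F(r) >= 1, and their arguments grow by 2 pi k; hence a zero z of theta off the real axis with
   Re z beyond a0, or within a small distance of it, contradicts the inequality for one of these r.

   It remains to bound a0. Where J does not have a sign that excludes zeros of theta, |F| < 1 is
   checked on boxes with interval arithmetic on the product, and for q near -1 by splitting the
   product into residue classes whose ratio lies in a fixed interval.

   For q = -p and positive x, put K(p,s) = s theta(-p,-s). Then theta(-p,x) = 1 - K(p,p x) and
   2 p K_p = s^2 K_ss, and a minimum principle for K_s shows that theta is decreasing on [0, 1/p];
   this gives the uniqueness of the smallest positive zero. If p < 0.8, zeros between p^(-3) and
   p^(-5) are excluded as follows: F(p^(-s)) decreases in p for fixed s, and for 3 < s < 5 it takes
   the value 1 at some p <= -q_bar_2, because the followed zeros x_3 ~ p^(-3) and x_5 ~ p^(-5)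
   coalesce at q_bar_2. *)

(** No branch of log F is ever chosen. Each linear factor of a truncated product has its own
    argument in [0, PI] on the closed upper half-plane, these arguments are added, and only
    differences between two points are passed to the limit. At a zero of theta and at a0 the
    function F equals 1, so such a difference tends to 2 PI k. The sign of k decides the base point:
    k >= 0 uses the far point of rank k, k < 0 uses a0 itself, or, for a zero slightly to the right
    of a0, the real point below that zero. The zeros of J enter through elementary quotients |z|^2 /
    |z + c|^2, so the domination over theta(1/x) becomes a comparison of real sums with a constant
    that depends only on bounds for |q| and 1/B. For negative q some of the terms have the
    unfavourable sign, hence the pairing of neighbouring indices and the case splits in |q|. The
    margin to the right of a0 is what makes the line strict: a0 must lie strictly to its left, and
    non-real zeros near Re z = a0 have to be kept off without knowing that there are finitely
    many. *)

Definition tri (j : nat) : nat := (j * (j + 1) / 2)%nat.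

Lemma tri_S (j : nat) : tri (S j) = (tri j + S j)%nat.
Proof.
unfold tri.
replace (S j * (S j + 1))%nat with (j * (j + 1) + S j * 2)%nat by lia.
now rewrite Nat.div_add by lia.
Qed.

Lemma tri_double (j : nat) : (2 * tri j = j * (j + 1))%nat.
Proof. induction j as [|j IH]; [reflexivity|rewrite tri_S; lia]. Qed.

(** * Finite sums and products *)

Fixpoint rsum (f : nat -> R) (n : nat) : R :=
  match n with O => 0 | S m => rsum f m + f m end.
Fixpoint rprod (f : nat -> R) (n : nat) : R :=
  match n with O => 1 | S m => rprod f m * f m end.
Fixpoint csum (f : nat -> C) (n : nat) : C :=
  match n with O => RtoC 0 | S m => (csum f m + f m)%C end.
Fixpoint cprod (f : nat -> C) (n : nat) : C :=
  match n with O => RtoC 1 | S m => (cprod f m * f m)%C end.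

Lemma rsum_ext (f g : nat -> R) (n : nat) :
  (forall j, (j < n)%nat -> f j = g j) -> rsum f n = rsum g n.
Proof.
induction n as [|n IH]; intros H; simpl; [reflexivity|].
rewrite IH, H; auto.
Qed.

Lemma rsum_le (f g : nat -> R) (n : nat) :
  (forall j, (j < n)%nat -> f j <= g j) -> rsum f n <= rsum g n.
Proof.
induction n as [|n IH]; intros H; simpl; [lra|].
apply Rplus_le_compat; auto.
Qed.

Lemma rsum_ge0 (f : nat -> R) (n : nat) :
  (forall j, (j < n)%nat -> 0 <= f j) -> 0 <= rsum f n.
Proof.
induction n as [|n IH]; intros H; simpl; [lra|].
apply Rplus_le_le_0_compat; auto.
Qed.

Lemma rsum_plus (f g : nat -> R) (n : nat) :
  rsum (fun j => f j + g j) n = rsum f n + rsum g n.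
Proof. induction n as [|n IH]; simpl; [|rewrite IH]; ring. Qed.

Lemma rsum_scal (c : R) (f : nat -> R) (n : nat) :
  rsum (fun j => c * f j) n = c * rsum f n.
Proof. induction n as [|n IH]; simpl; [|rewrite IH]; ring. Qed.

Lemma rsum_abs (f : nat -> R) (n : nat) :
  Rabs (rsum f n) <= rsum (fun j => Rabs (f j)) n.
Proof.
induction n as [|n IH]; simpl; [rewrite Rabs_R0; lra|].
eapply Rle_trans; [apply Rabs_triang|lra].
Qed.

Lemma rsum_S_l (f : nat -> R) (n : nat) :
  rsum f (S n) = f O + rsum (fun j => f (S j)) n.
Proof.
induction n as [|n IH]; [simpl; ring|].
change (rsum f (S (S n))) with (rsum f (S n) + f (S n)).
rewrite IH. simpl. ring.
Qed.

Lemma rsum_app (f : nat -> R) (n m : nat) :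
  rsum f (n + m) = rsum f n + rsum (fun j => f (n + j)%nat) m.
Proof.
induction m as [|m IH]; simpl.
- rewrite Nat.add_0_r. ring.
- rewrite Nat.add_succ_r. simpl. rewrite IH. ring.
Qed.

Lemma rsum_sum_n (f : nat -> R) (n : nat) : rsum f (S n) = sum_n f n.
Proof.
induction n as [|n IH].
- rewrite sum_O. simpl. ring.
- rewrite sum_Sn, <- IH. reflexivity.
Qed.

Lemma rsum_mono (f : nat -> R) (n m : nat) :
  (forall j, 0 <= f j) -> (n <= m)%nat -> rsum f n <= rsum f m.
Proof.
intros H Hnm. replace m with (n + (m - n))%nat by lia. rewrite rsum_app.
assert (0 <= rsum (fun j => f (n + j)%nat) (m - n)) by (apply rsum_ge0; auto).
lra.
Qed.

Lemma rprod_ext (f g : nat -> R) (n : nat) :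
  (forall j, (j < n)%nat -> f j = g j) -> rprod f n = rprod g n.
Proof.
induction n as [|n IH]; intros H; simpl; [reflexivity|].
rewrite IH, H; auto.
Qed.

Lemma rprod_mult (f g : nat -> R) (n : nat) :
  rprod (fun j => f j * g j) n = rprod f n * rprod g n.
Proof. induction n as [|n IH]; simpl; [|rewrite IH]; ring. Qed.

Lemma rprod_ge0 (f : nat -> R) (n : nat) :
  (forall j, (j < n)%nat -> 0 <= f j) -> 0 <= rprod f n.
Proof.
induction n as [|n IH]; intros H; simpl; [lra|].
apply Rmult_le_pos; auto.
Qed.

Lemma rprod_gt0 (f : nat -> R) (n : nat) :
  (forall j, (j < n)%nat -> 0 < f j) -> 0 < rprod f n.
Proof.
induction n as [|n IH]; intros H; simpl; [lra|].
apply Rmult_lt_0_compat; auto.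
Qed.

Lemma rprod_neq0 (f : nat -> R) (n : nat) :
  (forall j, (j < n)%nat -> f j <> 0) -> rprod f n <> 0.
Proof.
induction n as [|n IH]; intros H; simpl; [lra|].
apply Rmult_integral_contrapositive; split; auto.
Qed.

Lemma rprod_le (f g : nat -> R) (n : nat) :
  (forall j, (j < n)%nat -> 0 <= f j <= g j) -> rprod f n <= rprod g n.
Proof.
induction n as [|n IH]; intros H; simpl; [lra|].
apply Rmult_le_compat.
- apply rprod_ge0. intros j Hj. apply H; lia.
- apply H; lia.
- apply IH. intros j Hj. apply H; lia.
- apply H; lia.
Qed.

Lemma rprod_le1 (f : nat -> R) (n : nat) :
  (forall j, (j < n)%nat -> 0 <= f j <= 1) -> rprod f n <= 1.
Proof.
induction n as [|n IH]; intros H; simpl; [lra|].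
rewrite <- (Rmult_1_l 1). apply Rmult_le_compat.
- apply rprod_ge0. intros j Hj. apply H; lia.
- apply H; lia.
- apply IH. intros j Hj. apply H; lia.
- apply H; lia.
Qed.

Lemma rprod_abs (f : nat -> R) (n : nat) :
  Rabs (rprod f n) = rprod (fun j => Rabs (f j)) n.
Proof.
induction n as [|n IH]; simpl; [apply Rabs_R1|].
rewrite Rabs_mult, IH. reflexivity.
Qed.

Lemma rprod_S_l (f : nat -> R) (n : nat) :
  rprod f (S n) = f O * rprod (fun j => f (S j)) n.
Proof.
induction n as [|n IH]; [simpl; ring|].
change (rprod f (S (S n))) with (rprod f (S n) * f (S n)).
rewrite IH. simpl. ring.
Qed.

Lemma rprod_app (f : nat -> R) (n m : nat) :
  rprod f (n + m) = rprod f n * rprod (fun j => f (n + j)%nat) m.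
Proof.
induction m as [|m IH]; simpl.
- rewrite Nat.add_0_r. ring.
- rewrite Nat.add_succ_r. simpl. rewrite IH. ring.
Qed.

Lemma rprod_pairs (f : nat -> R) (n : nat) :
  rprod f (2 * n) = rprod (fun i => f (2 * i)%nat * f (2 * i + 1)%nat) n.
Proof.
induction n as [|n IH]; [reflexivity|].
replace (2 * S n)%nat with (S (S (2 * n))) by lia.
change (rprod f (2 * n) * f (2 * n)%nat * f (S (2 * n)) =
  rprod (fun i => f (2 * i)%nat * f (2 * i + 1)%nat) n
    * (f (2 * n)%nat * f (2 * n + 1)%nat)).
rewrite IH. replace (2 * n + 1)%nat with (S (2 * n)) by lia. ring.
Qed.

Lemma rsum_pairs (f : nat -> R) (n : nat) :
  rsum f (2 * n) = rsum (fun i => f (2 * i)%nat + f (2 * i + 1)%nat) n.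
Proof.
induction n as [|n IH]; [reflexivity|].
replace (2 * S n)%nat with (S (S (2 * n))) by lia.
change (rsum f (2 * n) + f (2 * n)%nat + f (S (2 * n)) =
  rsum (fun i => f (2 * i)%nat + f (2 * i + 1)%nat) n
    + (f (2 * n)%nat + f (2 * n + 1)%nat)).
rewrite IH. replace (2 * n + 1)%nat with (S (2 * n)) by lia. ring.
Qed.

Lemma csum_ext (f g : nat -> C) (n : nat) :
  (forall j, (j < n)%nat -> f j = g j) -> csum f n = csum g n.
Proof.
induction n as [|n IH]; intros H; simpl; [reflexivity|].
rewrite IH, H; auto.
Qed.

Lemma csum_plus (f g : nat -> C) (n : nat) :
  csum (fun j => f j + g j)%C n = (csum f n + csum g n)%C.
Proof. induction n as [|n IH]; simpl; [|rewrite IH]; ring. Qed.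

Lemma csum_scal (c : C) (f : nat -> C) (n : nat) :
  csum (fun j => c * f j)%C n = (c * csum f n)%C.
Proof. induction n as [|n IH]; simpl; [|rewrite IH]; ring. Qed.

Lemma csum_S_l (f : nat -> C) (n : nat) :
  csum f (S n) = (f O + csum (fun j => f (S j)) n)%C.
Proof.
induction n as [|n IH]; [simpl; ring|].
change (csum f (S (S n))) with (csum f (S n) + f (S n))%C.
rewrite IH. simpl. ring.
Qed.

Lemma Cmod_csum (f : nat -> C) (n : nat) :
  Cmod (csum f n) <= rsum (fun j => Cmod (f j)) n.
Proof.
induction n as [|n IH]; simpl; [rewrite Cmod_0; lra|].
eapply Rle_trans; [apply Cmod_triangle|lra].
Qed.

Lemma csum_RtoC (f : nat -> R) (n : nat) :
  csum (fun j => RtoC (f j)) n = RtoC (rsum f n).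
Proof.
induction n as [|n IH]; simpl; [reflexivity|].
now rewrite IH, RtoC_plus.
Qed.

Lemma cprod_ext (f g : nat -> C) (n : nat) :
  (forall j, (j < n)%nat -> f j = g j) -> cprod f n = cprod g n.
Proof.
induction n as [|n IH]; intros H; simpl; [reflexivity|].
rewrite IH, H; auto.
Qed.

Lemma cprod_RtoC (f : nat -> R) (n : nat) :
  cprod (fun j => RtoC (f j)) n = RtoC (rprod f n).
Proof.
induction n as [|n IH]; simpl; [reflexivity|].
now rewrite IH, RtoC_mult.
Qed.

(** * Limits of complex sequences *)

Definition Clim (u : nat -> C) (l : C) : Prop :=
  is_lim_seq (fun n => Cmod (u n - l)%C) 0.

Lemma is_lim_seq_squeeze0 (u v : nat -> R) :
  (forall n, 0 <= u n <= v n) -> is_lim_seq v 0 -> is_lim_seq u 0.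
Proof.
intros H Hv.
apply is_lim_seq_le_le with (u := fun _ => 0) (w := v); auto.
apply is_lim_seq_const.
Qed.

Lemma Clim_ext (u v : nat -> C) (l : C) :
  (forall n, u n = v n) -> Clim u l -> Clim v l.
Proof.
intros H. apply is_lim_seq_ext. intros n. now rewrite H.
Qed.

Lemma Clim_unique (u : nat -> C) (l l' : C) : Clim u l -> Clim u l' -> l = l'.
Proof.
intros H H'.
assert (L : is_lim_seq (fun _ : nat => Cmod (l' - l)%C) 0).
{ apply is_lim_seq_squeeze0 with
    (v := fun n => Cmod (u n - l)%C + Cmod (u n - l')%C).
  - intros n. split; [apply Cmod_ge_0|].
    replace (l' - l)%C with ((u n - l) + - (u n - l'))%C by ring.
    rewrite <- (Cmod_opp (u n - l')). apply Cmod_triangle.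
  - replace (Finite 0) with (Rbar_plus 0 0) by (simpl; f_equal; ring).
    apply is_lim_seq_plus'; assumption. }
apply is_lim_seq_unique in L. rewrite Lim_seq_const in L.
injection L as L. apply Cmod_eq_0 in L.
replace l with (l' - (l' - l))%C by ring. rewrite L. ring.
Qed.

Lemma Clim_plus (u v : nat -> C) (a b : C) :
  Clim u a -> Clim v b -> Clim (fun n => u n + v n)%C (a + b)%C.
Proof.
intros H H'. apply is_lim_seq_squeeze0 with
    (v := fun n => Cmod (u n - a)%C + Cmod (v n - b)%C).
- intros n. split; [apply Cmod_ge_0|].
  replace (u n + v n - (a + b))%C with ((u n - a) + (v n - b))%C by ring.
  apply Cmod_triangle.
- replace (Finite 0) with (Rbar_plus 0 0) by (simpl; f_equal; ring).
  apply is_lim_seq_plus'; assumption.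
Qed.

Lemma Clim_const (a : C) : Clim (fun _ => a) a.
Proof.
unfold Clim. replace (a - a)%C with (RtoC 0) by ring. rewrite Cmod_0.
apply is_lim_seq_const.
Qed.

Lemma Clim_Cmod (u : nat -> C) (l : C) :
  Clim u l -> is_lim_seq (fun n => Cmod (u n)) (Cmod l).
Proof.
intros H.
assert (Hd : is_lim_seq (fun n => Cmod (u n) - Cmod l) 0).
{ apply is_lim_seq_abs_0. apply is_lim_seq_squeeze0 with (2 := H).
  intros n. split; [apply Rabs_pos|].
  apply Rabs_le.
  pose proof (Cmod_triangle (u n - l) l) as H1.
  pose proof (Cmod_triangle (u n) (- (u n - l))) as H2.
  rewrite Cmod_opp in H2.
  replace (u n - l + l)%C with (u n) in H1 by ring.
  replace (u n + - (u n - l))%C with l in H2 by ring. lra. }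
apply is_lim_seq_ext with (fun n => (Cmod (u n) - Cmod l) + Cmod l).
- intros n. ring.
- replace (Finite (Cmod l)) with (Finite (0 + Cmod l)) by (f_equal; ring).
  apply is_lim_seq_plus'; [assumption|apply is_lim_seq_const].
Qed.

Lemma Clim_mult (u v : nat -> C) (a b : C) :
  Clim u a -> Clim v b -> Clim (fun n => u n * v n)%C (a * b)%C.
Proof.
intros H H'. apply is_lim_seq_squeeze0 with
    (v := fun n => Cmod (u n - a)%C * Cmod (v n) + Cmod a * Cmod (v n - b)%C).
- intros n. split; [apply Cmod_ge_0|].
  replace (u n * v n - a * b)%C with ((u n - a) * v n + a * (v n - b))%C by ring.
  rewrite <- !Cmod_mult. apply Cmod_triangle.
- replace (Finite 0) with (Finite (0 * Cmod b + Cmod a * 0)) by (f_equal; ring).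
  apply is_lim_seq_plus'.
  + apply is_lim_seq_mult'; [assumption|now apply Clim_Cmod].
  + apply is_lim_seq_mult'; [apply is_lim_seq_const|assumption].
Qed.

Lemma Clim_Re (u : nat -> C) (l : C) :
  Clim u l -> is_lim_seq (fun n => Re (u n)) (Re l).
Proof.
intros H.
assert (Hd : is_lim_seq (fun n => Re (u n) - Re l) 0).
{ apply is_lim_seq_abs_0. apply is_lim_seq_squeeze0 with (2 := H).
  intros n. split; [apply Rabs_pos|].
  exact (re_le_Cmod (u n - l)). }
apply is_lim_seq_ext with (fun n => (Re (u n) - Re l) + Re l).
- intros n. ring.
- replace (Finite (Re l)) with (Finite (0 + Re l)) by (f_equal; ring).
  apply is_lim_seq_plus'; [assumption|apply is_lim_seq_const].
Qed.

Lemma Im_le_Cmod (c : C) : Rabs (Im c) <= Cmod c.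
Proof.
eapply Rle_trans; [|apply Rmax_Cmod]. apply Rmax_r.
Qed.

Lemma Clim_Im (u : nat -> C) (l : C) :
  Clim u l -> is_lim_seq (fun n => Im (u n)) (Im l).
Proof.
intros H.
assert (Hd : is_lim_seq (fun n => Im (u n) - Im l) 0).
{ apply is_lim_seq_abs_0. apply is_lim_seq_squeeze0 with (2 := H).
  intros n. split; [apply Rabs_pos|].
  exact (Im_le_Cmod (u n - l)). }
apply is_lim_seq_ext with (fun n => (Im (u n) - Im l) + Im l).
- intros n. ring.
- replace (Finite (Im l)) with (Finite (0 + Im l)) by (f_equal; ring).
  apply is_lim_seq_plus'; [assumption|apply is_lim_seq_const].
Qed.

Lemma Clim_RtoC (u : nat -> R) (l : R) :
  is_lim_seq u l -> Clim (fun n => RtoC (u n)) (RtoC l).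
Proof.
intros H. unfold Clim.
apply is_lim_seq_ext with (fun n => Rabs (u n - l)).
- intros n. now rewrite <- RtoC_minus, Cmod_R.
  replace (Finite 0) with (Rbar_abs (Finite (l - l)))
    by (simpl; f_equal; rewrite Rminus_diag; apply Rabs_R0).
  apply is_lim_seq_abs. apply is_lim_seq_minus'; [assumption|].
  apply is_lim_seq_const.
Qed.

Lemma Clim_subseq (u : nat -> C) (l : C) (phi : nat -> nat) :
  filterlim phi Hierarchy.eventually Hierarchy.eventually -> Clim u l -> Clim (fun n => u (phi n)) l.
Proof.
intros Hphi H. unfold Clim in *.
apply (is_lim_seq_subseq (fun n => Cmod (u n - l)%C)); assumption.
Qed.

(** * Convergence of the theta series and its functional equation *)

Section Summability.

Variable p : R.
Hypothesis Hp : 0 < p < 1.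

Lemma ex_series_tri_pos (r : R) : 0 < r -> ex_series (fun n => p ^ tri n * r ^ n).
Proof.
intros Hr.
assert (Hpos : forall n, 0 < p ^ tri n * r ^ n).
{ intros n. apply Rmult_lt_0_compat; apply pow_lt; lra. }
apply ex_series_ext with (fun n => Rabs (p ^ tri n * r ^ n)).
{ intros n. apply Rabs_pos_eq. left. apply Hpos. }
apply ex_series_DAlembert with 0; [lra| |].
- intros n. apply Rgt_not_eq, Hpos.
- apply is_lim_seq_ext with (fun n => p ^ (S n) * r).
  + intros n. rewrite Rabs_pos_eq.
    * rewrite tri_S, pow_add. simpl (r ^ S n). field.
      split; apply pow_nonzero; lra.
    * left. apply Rdiv_lt_0_compat; apply Hpos.
  + replace (Finite 0) with (Finite (0 * r)) by (f_equal; ring).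
    apply is_lim_seq_mult'; [|apply is_lim_seq_const].
    apply (is_lim_seq_incr_1 (fun n => p ^ n)).
    apply is_lim_seq_geom. rewrite Rabs_pos_eq; lra.
Qed.

(** The ratio test divides by the terms, so r = 0 is reached by comparison with r + 1. *)
Lemma ex_series_tri (r : R) : 0 <= r -> ex_series (fun n => p ^ tri n * r ^ n).
Proof.
intros Hr. apply (@ex_series_le R_AbsRing R_CompleteNormedModule)
  with (fun n => p ^ tri n * (r + 1) ^ n); [|apply ex_series_tri_pos; lra].
intros n. change norm with Rabs. simpl.
assert (0 <= p ^ tri n) by (apply pow_le; lra).
assert (0 <= r ^ n) by (now apply pow_le).
rewrite Rabs_pos_eq; [|now apply Rmult_le_pos].
apply Rmult_le_compat_l; [assumption|].
apply pow_incr. lra.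
Qed.

End Summability.

Lemma Rabs_pow_eq (x : R) (n : nat) : Rabs (x ^ n) = Rabs x ^ n.
Proof. symmetry. apply RPow_abs. Qed.

Definition tterm (q : R) (z : C) (j : nat) : C := (RtoC (q ^ tri j) * z ^ j)%C.

(** Replaces the [iota] of the definition by partial sums, which are dominated by
    [Rabs q ^ tri n * Cmod z ^ n]. Identities for theta are obtained afterwards by uniqueness of the
    limit. *)
Lemma theta_lim (q : R) (z : C) :
  0 < Rabs q < 1 -> Clim (csum (tterm q z)) (theta q z).
Proof.
intros Hq.
assert (Hs : ex_series (K := C_AbsRing) (V := C_CompleteNormedModule)
    (fun j => tterm q z j)).
{ apply (@ex_series_le C_AbsRing C_CompleteNormedModule)
    with (fun n => Rabs q ^ tri n * Cmod z ^ n).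
  - intros n. change norm with Cmod. unfold tterm.
    rewrite Cmod_mult, Cmod_R, Cmod_pow, Rabs_pow_eq. lra.
  - apply ex_series_tri; [assumption|apply Cmod_ge_0]. }
destruct Hs as [v Hv].
assert (Hsum : forall n, csum (tterm q z) (S n) = sum_n (tterm q z) n).
{ intros n. induction n as [|n IH].
  - rewrite sum_O. simpl. ring.
  - rewrite sum_Sn, <- IH. reflexivity. }
rewrite (theta_eq q z v).
- unfold Clim. apply is_lim_seq_incr_1.
  apply is_lim_seq_spec. intros eps.
  pose proof (proj1 (filterlim_locally_ball_norm (U := C_NormedModule)
     (sum_n (tterm q z)) v) Hv eps) as [N HN].
  exists N. intros n Hn. specialize (HN n Hn). rewrite Rminus_0_r.
  rewrite Rabs_pos_eq by apply Cmod_ge_0.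
  rewrite Hsum. exact HN.
- unfold is_pseries. eapply is_series_ext; [|exact Hv].
  intros n. unfold tterm, tri.
  change scal with Cmult. rewrite Cmult_comm. f_equal.
Qed.

Definition thr (q x : R) : R := Series (fun j => q ^ tri j * x ^ j).

Lemma ex_series_thr (q x : R) :
  0 < Rabs q < 1 -> ex_series (fun j => q ^ tri j * x ^ j).
Proof.
intros Hq. apply (@ex_series_le R_AbsRing R_CompleteNormedModule)
    with (fun n => Rabs q ^ tri n * Rabs x ^ n).
- intros n. change norm with Rabs. simpl.
  rewrite Rabs_mult, !Rabs_pow_eq. lra.
- apply ex_series_tri; [assumption|apply Rabs_pos].
Qed.

Lemma Series_lim (a : nat -> R) :
  ex_series a -> is_lim_seq (rsum a) (Series a).
Proof.
intros H. apply Series_correct in H. apply is_lim_seq_incr_1.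
apply is_lim_seq_ext with (sum_n a).
- intros n. symmetry. apply rsum_sum_n.
- exact H.
Qed.

Lemma thr_lim (q x : R) :
  0 < Rabs q < 1 -> is_lim_seq (rsum (fun j => q ^ tri j * x ^ j)) (thr q x).
Proof. intros Hq. now apply Series_lim, ex_series_thr. Qed.

Lemma theta_real (q x : R) :
  0 < Rabs q < 1 -> theta q (RtoC x) = RtoC (thr q x).
Proof.
intros Hq. eapply Clim_unique; [now apply theta_lim|].
eapply Clim_ext; [|apply Clim_RtoC, (thr_lim q x Hq)].
intros n. cbv beta; rewrite <- csum_RtoC. apply csum_ext. intros j _.
unfold tterm. rewrite RtoC_mult, <- RtoC_pow. reflexivity.
Qed.

Lemma real_zero_thr (q x : R) : 0 < Rabs q < 1 -> real_zero q x <-> thr q x = 0.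
Proof.
intros Hq. unfold real_zero. rewrite theta_real by assumption. split.
- intros H. now injection H.
- now intros ->.
Qed.

Lemma theta_conj (q : R) (z : C) :
  0 < Rabs q < 1 -> theta q (Cconj z) = Cconj (theta q z).
Proof.
intros Hq. eapply Clim_unique; [now apply theta_lim|].
unfold Clim.
apply is_lim_seq_ext with (fun n => Cmod (csum (tterm q z) n - theta q z)%C);
  [|now apply theta_lim].
intros n. rewrite <- Cmod_conj.
rewrite Cminus_conj. f_equal. f_equal.
induction n as [|n IH]; simpl.
- unfold Cconj, RtoC. simpl. f_equal. ring.
- rewrite Cplus_conj, IH. f_equal. unfold tterm.
  rewrite Cmult_conj, Cpow_conj. f_equal.
  unfold Cconj, RtoC. simpl. f_equal. ring.
Qed.

(** Since [tri (S j) = tri j + S j], the term of index j + 1 at z is q z times the term of index j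
    at q z. Iterated, the equation carries information from a neighbourhood of 0 outwards. *)
Lemma theta_eq1 (q : R) (z : C) :
  0 < Rabs q < 1 -> theta q z = (1 + q * z * theta q (q * z))%C.
Proof.
intros Hq. eapply Clim_unique; [now apply theta_lim|].
unfold Clim. apply is_lim_seq_incr_1.
change (Clim (fun n => csum (tterm q z) (S n)) (1 + q * z * theta q (q * z))%C).
apply Clim_ext with (fun n => 1 + q * z * csum (tterm q (q * z)) n)%C.
- intros n. rewrite csum_S_l, <- csum_scal. f_equal.
  + unfold tterm. simpl. ring.
  + apply csum_ext. intros j _. unfold tterm.
    rewrite tri_S, pow_add, RtoC_mult, Cpow_mult_l.
    simpl. rewrite RtoC_mult, !RtoC_pow. ring.
- apply Clim_plus; [apply Clim_const|].
  apply Clim_mult; [apply Clim_const|now apply theta_lim].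
Qed.

Lemma thr_eq1 (q x : R) : 0 < Rabs q < 1 -> thr q x = 1 + q * x * thr q (q * x).
Proof.
intros Hq. apply RtoC_inj. rewrite RtoC_plus, !RtoC_mult.
rewrite <- !theta_real by assumption. rewrite RtoC_mult. now apply theta_eq1.
Qed.

Lemma thr_0 (q : R) : 0 < Rabs q < 1 -> thr q 0 = 1.
Proof. intros Hq. rewrite thr_eq1 by assumption. ring. Qed.

(* The sum of q^(j(j+1)/2) x^j over all integers j. *)
Definition Jr (q x : R) : R := thr q x + thr q (/ x) / x.
Definition Jc (q : R) (z : C) : C := (theta q z + theta q (/ z) / z)%C.

(** The functional equation is used at x and at 1/(q x), and the two constant terms 1 trade places:
    this is the quasi-periodicity of the bilateral series. *)
Lemma Jr_scale (q x : R) :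
  0 < Rabs q < 1 -> x <> 0 -> Jr q x = q * x * Jr q (q * x).
Proof.
intros Hq Hx. unfold Jr.
assert (Hq0 : q <> 0) by (intros ->; rewrite Rabs_R0 in Hq; lra).
rewrite (thr_eq1 q x Hq), (thr_eq1 q (/ (q * x)) Hq).
replace (q * / (q * x)) with (/ x) by (field; auto).
field. auto.
Qed.

(** * The Jacobi triple product *)

Definition qf (q : R) (n : nat) : R := rprod (fun j => 1 - q ^ S j) n.

Section QFactorial.

Variable q : R.
Hypothesis Hq : 0 < Rabs q < 1.

Lemma pow_abs_lt1 (n : nat) : Rabs (q ^ S n) <= Rabs q.
Proof.
rewrite Rabs_pow_eq. simpl.
assert (Rabs q ^ n <= 1) by (rewrite <- (pow1 n); apply pow_incr; lra).
nra.
Qed.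

Lemma pow_abs_le_prev (n : nat) : Rabs (q ^ S n) <= Rabs q ^ n.
Proof.
rewrite Rabs_pow_eq. simpl.
assert (0 <= Rabs q ^ n) by (apply pow_le; lra). nra.
Qed.

Lemma qf_factor_gt0 (n : nat) : 0 < 1 - q ^ S n.
Proof.
pose proof (pow_abs_lt1 n). pose proof (Rle_abs (q ^ S n)). lra.
Qed.

Lemma qf_gt0 (n : nat) : 0 < qf q n.
Proof. apply rprod_gt0. intros j _. apply qf_factor_gt0. Qed.

Lemma rsum_geom (x : R) (n : nat) : 0 <= x < 1 -> rsum (fun j => x ^ j) n <= / (1 - x).
Proof.
intros Hx.
assert (H : rsum (fun j => x ^ j) n * (1 - x) = 1 - x ^ n).
{ induction n as [|n IH]; simpl; [ring|]. rewrite Rmult_plus_distr_r, IH. ring. }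
assert (0 <= x ^ n) by (apply pow_le; lra).
apply Rmult_le_reg_r with (1 - x); [lra|].
rewrite H, Rinv_l; lra.
Qed.

(** Each factor satisfies 1 - q^(j+1) <= 1 + |q|^j <= exp (|q|^j), and the exponents form a
    geometric series. *)
Lemma qf_upper : exists M, 0 < M /\ forall n, qf q n <= M.
Proof.
exists (exp (/ (1 - Rabs q))). split; [apply exp_pos|]. intros n.
assert (H : qf q n <= exp (rsum (fun j => Rabs q ^ j) n)).
{ unfold qf. induction n as [|n IH]; simpl; [rewrite exp_0; lra|].
  rewrite exp_plus.
  apply Rmult_le_compat; auto.
  - left. apply (qf_gt0 n).
  - left. apply (qf_factor_gt0 n).
  - assert (Rabs (q ^ S n) <= Rabs q ^ n).
    { apply pow_abs_le_prev. }
    pose proof (exp_ineq1_le (Rabs q ^ n)).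
    assert (- q ^ S n <= Rabs (q ^ S n)).
    { rewrite <- Rabs_Ropp. apply Rle_abs. }
    simpl in *. lra. }
eapply Rle_trans; [apply H|].
destruct (rsum_geom (Rabs q) n) as [L|L]; [lra| |rewrite L; lra].
left. now apply exp_increasing.
Qed.

(** For y = |q^(n+1)| <= |q| = 1 - d one has 1/(1 - y) <= 1 + y/d <= exp (y/d), so each factor is at
    least the exponential of minus a geometric term. *)
Lemma qf_lower : exists m, 0 < m /\ forall n, m <= qf q n.
Proof.
set (d := 1 - Rabs q).
assert (Hd : 0 < d) by (unfold d; lra).
exists (exp (- (/ d * / d))). split; [apply exp_pos|]. intros n.
assert (H : exp (- (/ d * rsum (fun j => Rabs q ^ j) n)) <= qf q n).
{ unfold qf. induction n as [|n IH]; simpl.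
  - rewrite Rmult_0_r, Ropp_0, exp_0. lra.
  - rewrite Rmult_plus_distr_l, Ropp_plus_distr, exp_plus.
    apply Rmult_le_compat; auto; try (left; apply exp_pos).
    set (y := Rabs (q ^ S n)).
    assert (Hy1 : y <= Rabs q) by apply pow_abs_lt1.
    assert (Hy0 : 0 <= y) by apply Rabs_pos.
    assert (Hy2 : y <= Rabs q ^ n).
    { unfold y. apply pow_abs_le_prev. }
    assert (H1 : 1 - y <= 1 - q ^ S n) by (pose proof (Rle_abs (q ^ S n)); unfold y; lra).
    apply Rle_trans with (1 - y); [|exact H1].
    assert (H2 : / (1 - y) <= exp (/ d * Rabs q ^ n)).
    { apply Rle_trans with (1 + / d * Rabs q ^ n); [|apply exp_ineq1_le].
      apply Rle_trans with (1 + / d * y).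
      - apply Rmult_le_reg_r with (1 - y); [unfold d in *; lra|].
        rewrite Rinv_l by (unfold d in *; lra).
        assert (y <= / d * y * (1 - y)).
        { replace y with (/ d * y * d) at 1 by (field; lra).
          apply Rmult_le_compat_l; [|unfold d; lra].
          apply Rmult_le_pos; [left; apply Rinv_0_lt_compat|]; assumption. }
        lra.
      - apply Rplus_le_compat_l, Rmult_le_compat_l; [|assumption].
        left; now apply Rinv_0_lt_compat. }
    rewrite exp_Ropp. rewrite <- (Rinv_inv (1 - y)).
    apply Rinv_le_contravar; [|exact H2].
    apply Rinv_0_lt_compat. unfold d in *; lra. }
eapply Rle_trans; [|apply H].
assert (L : rsum (fun j => Rabs q ^ j) n <= / d) by (apply rsum_geom; lra).
assert (L2 : - (/ d * / d) <= - (/ d * rsum (fun j => Rabs q ^ j) n)).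
{ apply Ropp_le_contravar, Rmult_le_compat_l; [|assumption].
  left; now apply Rinv_0_lt_compat. }
destruct L2 as [L2|L2]; [left; now apply exp_increasing|rewrite L2; lra].
Qed.

(** The increments - q^(n+1) [qf q n] are absolutely summable, so the product is 1 plus a convergent
    series. The uniform lower bound makes the limit positive, which allows dividing by it in
    [cf_lim]. *)
Lemma qf_cv : exists l, 0 < l /\ is_lim_seq (qf q) l.
Proof.
destruct qf_upper as [M [HM HM']]. destruct qf_lower as [m [Hm Hm']].
assert (Hs : ex_series (fun n => qf q n * - q ^ S n)).
{ apply (@ex_series_le R_AbsRing R_CompleteNormedModule)
    with (fun n => M * Rabs q ^ n).
  - intros n. change norm with Rabs. simpl (norm _).
    rewrite Rabs_mult, Rabs_Ropp, Rabs_pow_eq, Rabs_pos_eq by (left; apply qf_gt0).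
    apply Rmult_le_compat; auto.
    + left; apply qf_gt0.
    + apply pow_le; lra.
    + rewrite <- Rabs_pow_eq. apply pow_abs_le_prev.
  - apply (ex_series_scal (K := R_AbsRing) (V := R_NormedModule) M (fun n => Rabs q ^ n)). apply ex_series_geom.
    rewrite Rabs_Rabsolu. lra. }
exists (1 + Series (fun n => qf q n * - q ^ S n)).
assert (L : is_lim_seq (qf q) (1 + Series (fun n => qf q n * - q ^ S n))).
{ apply is_lim_seq_ext with (fun n => 1 + rsum (fun n => qf q n * - q ^ S n) n).
  - intros n. induction n as [|n IH].
    + unfold qf; simpl; ring.
    + unfold qf in *; simpl in *. lra.
  - apply is_lim_seq_plus'; [apply is_lim_seq_const|now apply Series_lim]. }
split; [|exact L].
apply Rlt_le_trans with m; [assumption|].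
apply (is_lim_seq_le (fun _ => m) (qf q) m
  (1 + Series (fun n => qf q n * - q ^ S n))); auto.
apply is_lim_seq_const.
Qed.

(* The q-binomial coefficient [2n choose n+j], extended by 0. *)
Definition qb (n j : nat) : R :=
  if Nat.leb j n then qf q (2 * n) / (qf q (n + j) * qf q (n - j)) else 0.

Lemma qb_in (n j d : nat) :
  n = (j + d)%nat -> qb n j = qf q (2 * n) / (qf q (n + j) * qf q d).
Proof.
intros ->. unfold qb. rewrite (proj2 (Nat.leb_le j (j + d))) by lia.
replace (j + d - j)%nat with d by lia. reflexivity.
Qed.

Lemma qb_out (n j : nat) : (n < j)%nat -> qb n j = 0.
Proof.
intros H. unfold qb. destruct (Nat.leb_spec j n); [lia|reflexivity].
Qed.

Lemma qf_S (n : nat) : qf q (S n) = qf q n * (1 - q ^ S n).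
Proof. reflexivity. Qed.

Lemma qf_neq0 (n : nat) : qf q n <> 0.
Proof. apply Rgt_not_eq, qf_gt0. Qed.

Lemma qfac_neq0 (n : nat) : 1 - q ^ S n <> 0.
Proof. apply Rgt_not_eq, qf_factor_gt0. Qed.

(** Passing from n to n + 1 multiplies the finite product by 1 + q^(2n+1) + q^(n+1) z + q^n / z. The
    coefficient of z^j being [qb n j] q^(tri j), comparison at z^(i+1) and division by q^(tri (i+1))
    give this recurrence. The truncated difference n - i is harmless because [qb n i] vanishes for i
    > n. *)
Lemma qb_rec (n i : nat) :
  qb (S n) (S i) = (1 + q ^ (2 * n + 1)) * qb n (S i)
    + q ^ (n - i) * qb n i + q ^ (n + i + 2) * qb n (S (S i)).
Proof.
destruct (le_lt_dec (i + 2) n) as [H|H].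
- destruct (Nat.le_exists_sub _ _ H) as [d [Hd _]].
  rewrite (qb_in (S n) (S i) (S (S d))) by lia.
  rewrite (qb_in n (S i) (S d)) by lia.
  rewrite (qb_in n i (S (S d))) by lia.
  rewrite (qb_in n (S (S i)) d) by lia.
  replace (2 * S n)%nat with (S (S (2 * n))) by lia.
  replace (S n + S i)%nat with (S (S (n + i))) by lia.
  replace (n + S i)%nat with (S (n + i)) by lia.
  replace (n + S (S i))%nat with (S (S (n + i))) by lia.
  replace (n - i)%nat with (S (S d)) by lia.
  rewrite !qf_S.
  replace (2 * n + 1)%nat with (S (2 * n)) by lia.
  replace (n + i + 2)%nat with (S (S (n + i))) by lia.
  pose proof (qf_neq0 (n + i)). pose proof (qf_neq0 d).
  pose proof (qfac_neq0 (n + i)). pose proof (qfac_neq0 (S (n + i))).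
  pose proof (qfac_neq0 d). pose proof (qfac_neq0 (S d)).
  set (a := qf q (2 * n)).
  assert (E : q ^ S (2 * n) = q ^ (n + i) * q ^ d * q ^ 3).
  { rewrite <- !pow_add. f_equal. lia. }
  assert (E2 : q ^ S (S (2 * n)) = q ^ (n + i) * q ^ d * q ^ 4).
  { rewrite <- !pow_add. f_equal. lia. }
  rewrite E, E2. simpl pow in *. field. repeat split; auto.
- destruct (le_lt_dec (i + 1) n) as [H'|H'].
  + assert (n = S i) by lia. subst n.
    rewrite (qb_in (S (S i)) (S i) 1) by lia.
    rewrite (qb_in (S i) (S i) 0) by lia.
    rewrite (qb_in (S i) i 1) by lia.
    rewrite (qb_out (S i) (S (S i))) by lia.
    replace (2 * S (S i))%nat with (S (S (2 * S i))) by lia.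
    replace (S (S i) + S i)%nat with (S (2 * S i)) by lia.
    replace (S i + S i)%nat with (2 * S i)%nat by lia.
    replace (S i + i)%nat with (S (2 * i)) by lia.
    replace (S i - i)%nat with 1%nat by lia.
    replace (2 * S i + 1)%nat with (S (2 * S i)) by lia.
    rewrite !qf_S.
    replace (2 * S i)%nat with (S (S (2 * i))) by lia.
    rewrite !qf_S.
    change (qf q 0) with 1.
    pose proof (qf_neq0 (2 * i)). pose proof (qfac_neq0 (2 * i)).
    pose proof (qfac_neq0 (S (2 * i))). pose proof (qfac_neq0 (S (S (2 * i)))).
    pose proof (qfac_neq0 0).
    rewrite <- !tech_pow_Rmult in *. simpl (q ^ 0) in *.
    assert (1 - q <> 0) by (rewrite <- (Rmult_1_r q); assumption).
    field. repeat split; auto.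
  + destruct (Nat.eq_dec i n) as [Hn|Hn]; [subst i|].
    * rewrite (qb_in (S n) (S n) 0) by lia. rewrite (qb_out n (S n)) by lia.
      rewrite (qb_out n (S (S n))) by lia. rewrite (qb_in n n 0) by lia.
      replace (S n + S n)%nat with (2 * S n)%nat by lia.
      replace (n + n)%nat with (2 * n)%nat by lia.
      rewrite Nat.sub_diag. change (qf q 0) with 1. simpl (q ^ 0).
      pose proof (qf_neq0 (2 * n)). pose proof (qf_neq0 (2 * S n)).
      field. auto.
    * rewrite !qb_out by lia. ring.
Qed.

(** Coefficient of z^0: the neighbours z and 1/z contribute equally by the symmetry of the
    coefficients, hence the factor 2. *)
Lemma qb_rec0 (n : nat) :
  qb (S n) 0 = (1 + q ^ (2 * n + 1)) * qb n 0 + 2 * q ^ (S n) * qb n 1.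
Proof.
destruct n as [|n].
- rewrite (qb_in 1 0 1), (qb_in 0 0 0), (qb_out 0 1) by lia.
  simpl (2 * 1)%nat. simpl (2 * 0)%nat. simpl (1 + 0)%nat. simpl (0 + 0)%nat.
  rewrite !qf_S. change (qf q 0) with 1.
  pose proof (qfac_neq0 0). simpl in *.
  assert (1 - q <> 0) by (rewrite <- (Rmult_1_r q); assumption).
  field. auto.
- rewrite (qb_in (S (S n)) 0 (S (S n))), (qb_in (S n) 0 (S n)), (qb_in (S n) 1 n) by lia.
  replace (2 * S (S n))%nat with (S (S (2 * S n))) by lia.
  rewrite !Nat.add_0_r.
  replace (S n + 1)%nat with (S (S n)) by lia.
  rewrite (qf_S (S (2 * S n))), (qf_S (2 * S n)), (qf_S (S n)), (qf_S n).
  pose proof (qf_neq0 n). pose proof (qfac_neq0 n). pose proof (qfac_neq0 (S n)).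
  set (a := qf q (2 * S n)).
  assert (E : q ^ S (2 * S n) = q ^ n * q ^ n * q ^ 3).
  { rewrite <- !pow_add. f_equal. lia. }
  assert (E1 : q ^ (2 * S n + 1) = q ^ n * q ^ n * q ^ 3).
  { rewrite <- !pow_add. f_equal. lia. }
  assert (E2 : q ^ S (S (2 * S n)) = q ^ n * q ^ n * q ^ 4).
  { rewrite <- !pow_add. f_equal. lia. }
  rewrite E, E1, E2. simpl pow in *. field. repeat split; auto.
Qed.

Definition Qn (n : nat) (z : C) : C :=
  cprod (fun j => (1 + q ^ S j * z) * (1 + q ^ j * / z))%C n.

Lemma Qn_S (n : nat) (z : C) :
  Qn (S n) z = (Qn n z * ((1 + q ^ S n * z) * (1 + q ^ n * / z)))%C.
Proof. reflexivity. Qed.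

(** [An] collects the powers z^j and [Bn], up to a factor 1/z, the powers z^(-j-1). For the latter
    the exponent (-j-1)(-j)/2 is again [tri j], while the binomial index is j + 1. *)
Definition An (n N : nat) (z : C) : C :=
  csum (fun j => RtoC (qb n j) * tterm q z j)%C N.
Definition Bn (n N : nat) (z : C) : C :=
  csum (fun j => RtoC (qb n (S j)) * tterm q (/ z) j)%C N.

Lemma An_S (n N : nat) (z : C) : (n < N)%nat -> An n (S N) z = An n N z.
Proof.
intros H. unfold An. simpl. rewrite qb_out by assumption. ring.
Qed.

Lemma Bn_S (n N : nat) (z : C) : (n <= N)%nat -> Bn n (S N) z = Bn n N z.
Proof.
intros H. unfold Bn. simpl. rewrite qb_out by lia. ring.
Qed.

Lemma tterm_S (z : C) (j : nat) :
  tterm q z (S j) = (RtoC (q ^ S j) * z * tterm q z j)%C.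
Proof.
unfold tterm. rewrite tri_S, pow_add, RtoC_mult. simpl (z ^ S j)%C. ring.
Qed.

(** Finite form of the triple product, by induction: the two new factors act on the coefficients as
    in [qb_rec] and [qb_rec0]. The summation ranges run past the degree, so that index shifts lose
    only vanishing coefficients. *)
Lemma finite_jacobi (n : nat) (z : C) :
  z <> RtoC 0 -> Qn n z = (An n (S (S n)) z + Bn n (S (S n)) z * / z)%C.
Proof.
intros Hz. induction n as [|n IH].
- unfold Qn, An, Bn. simpl.
  rewrite (qb_in 0 0 0), !(qb_out 0) by lia. simpl (2 * 0)%nat. simpl (0 + 0)%nat.
  change (qf q 0) with 1. unfold tterm. simpl.
  replace (1 / (1 * 1)) with 1 by field. ring.
- rewrite Qn_S, IH.
  set (N := S (S n)).
  assert (HA : An (S n) (S N) z = (RtoC (qb (S n) 0)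
     + RtoC (1 + q ^ (2 * n + 1)) * (An n (S N) z - RtoC (qb n 0))
     + RtoC (q ^ S n) * z * An n N z
     + RtoC (q ^ n) * / z * (An n (S (S N)) z - RtoC (qb n 0) - RtoC (qb n 1) * RtoC q * z))%C).
  { unfold An at 1. rewrite csum_S_l.
    transitivity (RtoC (qb (S n) 0) +
     (RtoC (1 + q ^ (2 * n + 1)) * csum (fun j => RtoC (qb n (S j)) * tterm q z (S j)) N
     + RtoC (q ^ S n) * z * csum (fun j => RtoC (qb n j) * tterm q z j) N
     + RtoC (q ^ n) * / z * csum (fun j => RtoC (qb n (S (S j))) * tterm q z (S (S j))) N))%C.
    - f_equal; [unfold tterm; simpl; ring|].
      rewrite <- !csum_scal, <- !csum_plus. apply csum_ext. intros j Hj.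
      rewrite qb_rec.
      destruct (le_lt_dec j n) as [Hjn|Hjn].
      + assert (E1 : (RtoC (q ^ (n - j)) * RtoC (q ^ S j) = RtoC (q ^ S n))%C).
        { rewrite <- RtoC_mult, <- pow_add. do 2 f_equal. lia. }
        assert (E2 : (RtoC (q ^ n) * RtoC (q ^ S (S j)) = RtoC (q ^ (n + j + 2)))%C).
        { rewrite <- RtoC_mult, <- pow_add. do 2 f_equal. lia. }
        rewrite <- E1, !RtoC_plus, !RtoC_mult, !RtoC_plus, <- E2, (tterm_S z (S j)), (tterm_S z j).
        field. exact Hz.
      + rewrite (qb_out n j), (qb_out n (S j)), (qb_out n (S (S j))) by lia.
        rewrite !Rmult_0_r, !Rplus_0_r. ring.
    - unfold An.
      rewrite (csum_S_l (fun j => RtoC (qb n j) * tterm q z j)%C N).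
      rewrite (csum_S_l (fun j => RtoC (qb n j) * tterm q z j)%C (S N)).
      rewrite (csum_S_l (fun j => RtoC (qb n (S j)) * tterm q z (S j))%C N).
      assert (T0 : tterm q z 0 = RtoC 1) by (unfold tterm; simpl; ring).
      rewrite (tterm_S z 0), T0. simpl (q ^ 1). rewrite Rmult_1_r. ring. }
  assert (HB : (Bn (S n) (S N) z * / z = RtoC (1 + q ^ (2 * n + 1)) * (Bn n (S N) z * / z)
     + RtoC (q ^ n) * / z * (RtoC (qb n 0) + Bn n N z * / z)
     + RtoC (q ^ S n) * z * ((Bn n (S (S N)) z - RtoC (qb n 1)) * / z))%C).
  { unfold Bn at 1.
    (* In the middle sum the factor q^n / z sends the constant coefficient of [An] to index 0 and
       the index j - 1 of [Bn] to j; the [match] separates the two. *)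
    transitivity ((RtoC (1 + q ^ (2 * n + 1)) * csum (fun j => RtoC (qb n (S j)) * tterm q (/ z) j) (S N)
     + RtoC (q ^ n) * csum (fun j => RtoC (q ^ j) * / RtoC (q ^ j) * (RtoC (match j with O => qb n 0 | S i => qb n j end) * (match j with O => RtoC 1 | S i => tterm q (/ z) i * / z end))) (S N)
     + RtoC (q ^ S n) * z * csum (fun j => RtoC (qb n (S (S j))) * tterm q (/ z) (S j)) (S N)) * / z)%C.
    - f_equal. rewrite <- !csum_scal, <- !csum_plus. apply csum_ext. intros j Hj.
      rewrite qb_rec.
      assert (Hqj : RtoC (q ^ j) <> RtoC 0).
      { intros E. injection E as E. revert E. apply pow_nonzero.
        intros E0. rewrite E0, Rabs_R0 in Hq. lra. }
      assert (Hm : (RtoC (match j with O => qb n 0 | S i => qb n j end)) = RtoC (qb n j))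
        by (destruct j; reflexivity).
      rewrite Hm.
      assert (E2 : (RtoC (q ^ S n) * RtoC (q ^ S j) = RtoC (q ^ (n + j + 2)))%C).
      { rewrite <- RtoC_mult, <- pow_add. do 2 f_equal. lia. }
      destruct (le_lt_dec j n) as [Hjn|Hjn].
      + assert (E1 : (RtoC (q ^ (n - j)) * tterm q (/ z) j = RtoC (q ^ n) * (match j with O => RtoC 1 | S i => tterm q (/ z) i * / z end))%C).
        { destruct j as [|i].
          - rewrite Nat.sub_0_r. unfold tterm. simpl. ring.
          - rewrite tterm_S.
            replace (RtoC (q ^ n)) with (RtoC (q ^ (n - S i)) * RtoC (q ^ S i))%C.
            + ring.
            + rewrite <- RtoC_mult, <- pow_add. do 2 f_equal. lia. }
        rewrite !RtoC_plus, !RtoC_mult, <- E2, (tterm_S (/ z) j).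
        transitivity (RtoC (1 + q ^ (2 * n + 1)) * RtoC (qb n (S j)) * tterm q (/ z) j
          + RtoC (qb n j) * (RtoC (q ^ (n - j)) * tterm q (/ z) j)
          + RtoC (q ^ S n) * RtoC (q ^ S j) * RtoC (qb n (S (S j))) * tterm q (/ z) j)%C.
        * rewrite RtoC_plus. ring.
        * rewrite E1, RtoC_plus. field. split; auto.
      + rewrite (qb_out n j), (qb_out n (S j)), (qb_out n (S (S j))) by lia.
        rewrite !Rmult_0_r, !Rplus_0_r. ring.
    - unfold Bn.
      rewrite (csum_S_l (fun j => RtoC (qb n (S j)) * tterm q (/ z) j)%C (S N)).
      rewrite (csum_S_l (fun j => RtoC (q ^ j) * / RtoC (q ^ j) * _)%C N).
      rewrite (csum_ext (fun j => RtoC (q ^ S j) * / RtoC (q ^ S j) * (RtoC (qb n (S j)) * (tterm q (/ z) j * / z)))%C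
         (fun j => / z * (RtoC (qb n (S j)) * tterm q (/ z) j))%C N).
      + rewrite csum_scal.
        assert (T0 : tterm q (/ z) 0 = RtoC 1) by (unfold tterm; simpl; ring).
        rewrite T0. simpl (q ^ 0). field.
        exact Hz.
      + intros j _.
        assert (Hqj : RtoC (q ^ S j) <> RtoC 0).
        { intros E. injection E as E. revert E. apply (pow_nonzero q (S j)).
          intros E0. rewrite E0, Rabs_R0 in Hq. lra. }
        field. auto. }
  rewrite HA, HB, qb_rec0.
  rewrite !(An_S n (S N)), !(An_S n N), !(Bn_S n (S N)), !(Bn_S n N) by (unfold N; lia).
  rewrite !RtoC_plus, !RtoC_mult, !RtoC_plus.
  replace (RtoC (q ^ (2 * n + 1))) with (RtoC (q ^ S n) * RtoC (q ^ n))%C.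
  + rewrite !RtoC_pow, !Cpow_S. field. exact Hz.
  + rewrite <- RtoC_mult, <- pow_add. do 2 f_equal. lia.
Qed.

End QFactorial.

Lemma rsum_lim (c : nat -> nat -> R) (l : nat -> R) (N : nat) :
  (forall j, is_lim_seq (fun n => c n j) (l j)) ->
  is_lim_seq (fun n => rsum (c n) N) (rsum l N).
Proof.
intros H. induction N as [|N IH]; simpl.
- apply is_lim_seq_const.
- now apply is_lim_seq_plus'.
Qed.

(** Dominated convergence with a moving cutoff: beyond some J the tail of the summable majorant is
    small uniformly in n, and the first J terms tend to 0 one by one. *)
Lemma tannery (c : nat -> nat -> R) (a : nat -> R) (M : R) (N : nat -> nat) :
  (forall n j, Rabs (c n j) <= M) ->
  (forall j, is_lim_seq (fun n => c n j) 0) ->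
  (forall j, 0 <= a j) -> ex_series a ->
  is_lim_seq (fun n => rsum (fun j => Rabs (c n j) * a j) (N n)) 0.
Proof.
intros Hc Hl Ha Hs.
assert (HM : 0 <= M) by (eapply Rle_trans; [apply Rabs_pos|apply (Hc O O)]).
assert (Hbnd : forall n, rsum a n <= Series a).
{ intros n. apply (is_lim_seq_incr_compare (rsum a)).
  - now apply Series_lim.
  - intros k. simpl. specialize (Ha k). lra. }
apply is_lim_seq_spec. intros eps.
assert (He : 0 < eps / (2 * (M + 1))).
{ apply Rdiv_lt_0_compat; [apply cond_pos|lra]. }
pose proof (proj2 (is_lim_seq_spec _ _) (Series_lim a Hs)) as Hs'.
destruct (Hs' (mkposreal _ He)) as [J HJ]. simpl in HJ.
specialize (HJ J (le_n J)).
assert (Hf : is_lim_seq (fun n => rsum (fun j => Rabs (c n j) * a j) J) 0).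
{ replace (Finite 0) with (Finite (rsum (fun j => 0 * a j) J)).
  - apply rsum_lim. intros j. apply is_lim_seq_mult'; [|apply is_lim_seq_const].
    now apply (is_lim_seq_abs_0 (fun n => c n j)).
  - f_equal. rewrite rsum_scal. ring. }
apply is_lim_seq_spec in Hf.
assert (He2 : 0 < eps / 2) by (apply Rdiv_lt_0_compat; [apply cond_pos|lra]).
destruct (Hf (mkposreal _ He2)) as [n0 Hn0]. simpl in Hn0.
exists n0. intros n Hn. specialize (Hn0 n Hn).
rewrite Rminus_0_r in *.
assert (Hp : forall j, 0 <= Rabs (c n j) * a j).
{ intros j. apply Rmult_le_pos; [apply Rabs_pos|apply Ha]. }
rewrite Rabs_pos_eq in * by (apply rsum_ge0; auto).
apply Rle_lt_trans with (rsum (fun j => Rabs (c n j) * a j) (J + N n)).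
{ apply rsum_mono; [exact Hp|lia]. }
rewrite rsum_app.
assert (H2 : rsum (fun j => Rabs (c n (J + j)%nat) * a (J + j)%nat) (N n)
   <= M * (eps / (2 * (M + 1)))).
{ apply Rle_trans with (M * rsum (fun j => a (J + j)%nat) (N n)).
  - rewrite <- rsum_scal. apply rsum_le. intros j _.
    apply Rmult_le_compat_r; [apply Ha|apply Hc].
  - apply Rmult_le_compat_l; [exact HM|].
    pose proof (Hbnd (J + N n)%nat) as Hb. rewrite rsum_app in Hb.
    apply Rabs_def2 in HJ. lra. }
assert (H3 : M * (eps / (2 * (M + 1))) < eps / 2).
{ apply Rmult_lt_reg_r with (2 * (M + 1)); [lra|].
  replace (M * (eps / (2 * (M + 1))) * (2 * (M + 1))) with (M * eps) by (field; lra).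
  replace (eps / 2 * (2 * (M + 1))) with ((M + 1) * eps) by field.
  pose proof (cond_pos eps). nra. }
lra.
Qed.

Section Jacobi.

Variable q : R.
Hypothesis Hq : 0 < Rabs q < 1.

(** Normalised coefficients. For fixed j they tend to l^2 / l^2 = 1, where l is the limit of [qf],
    and they are bounded in both indices: the two inputs of [tannery]. *)
Let cf (n j : nat) : R := qf q n * qb q n j.

Lemma cf_bound : exists M, forall n j, Rabs (cf n j - 1) <= M.
Proof.
destruct (qf_upper q Hq) as [M [HM HM']]. destruct (qf_lower q Hq) as [m [Hm Hm']].
exists (M * M * / (m * m) + 1). intros n j. unfold cf.
assert (Hc : 0 <= qf q n * qb q n j <= M * M * / (m * m)).
{ unfold qb. destruct (Nat.leb j n).
  - assert (H1 : 0 < qf q (n + j) * qf q (n - j)) by (apply Rmult_lt_0_compat; now apply qf_gt0).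
    assert (H2 : 0 < qf q n) by now apply qf_gt0.
    assert (H3 : 0 < qf q (2 * n)) by now apply qf_gt0.
    replace (qf q n * (qf q (2 * n) / (qf q (n + j) * qf q (n - j))))
      with (qf q n * qf q (2 * n) * / (qf q (n + j) * qf q (n - j)))
      by (unfold Rdiv; ring).
    split.
    + apply Rmult_le_pos; [apply Rmult_le_pos; lra|].
      left; now apply Rinv_0_lt_compat.
    + apply Rmult_le_compat.
      * apply Rmult_le_pos; lra.
      * left; now apply Rinv_0_lt_compat.
      * apply Rmult_le_compat; auto; lra.
      * apply Rinv_le_contravar; [now apply Rmult_lt_0_compat|].
        apply Rmult_le_compat; auto; lra.
  - rewrite Rmult_0_r. split; [lra|].
    apply Rmult_le_pos; [nra|]. left. apply Rinv_0_lt_compat. nra. }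
apply Rabs_le. lra.
Qed.

Lemma cf_lim (j : nat) : is_lim_seq (fun n => cf n j - 1) 0.
Proof.
destruct (qf_cv q Hq) as [l [Hl HL]].
apply (is_lim_seq_incr_n _ j).
apply is_lim_seq_ext with
  (fun n => qf q (n + j) * (qf q (2 * (n + j)) / (qf q (n + j + j) * qf q n)) - 1).
{ intros n. unfold cf. rewrite (qb_in q (n + j) j n) by lia. reflexivity. }
assert (Hsub : forall phi : nat -> nat, (forall n, (n <= phi n)%nat) ->
  is_lim_seq (fun n => qf q (phi n)) l).
{ intros phi Hphi. apply (is_lim_seq_subseq (qf q)); [|exact HL].
  intros P [n0 Hn0]. exists n0. intros n Hn. apply Hn0. specialize (Hphi n). lia. }
replace (Finite 0) with (Finite (l * (l / (l * l)) - 1)) by (f_equal; field; lra).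
apply is_lim_seq_minus'; [|apply is_lim_seq_const].
apply is_lim_seq_mult'; [apply (Hsub (fun n => (n + j)%nat)); lia|].
apply is_lim_seq_div'.
- apply (Hsub (fun n => (2 * (n + j))%nat)). lia.
- apply is_lim_seq_mult'; [apply (Hsub (fun n => (n + j + j)%nat)); lia|exact HL].
- nra.
Qed.

(** The weights are split as (cf - 1) + 1; the first part vanishes by [tannery]. The shift k is 0
    for the nonnegative powers and 1 for the negative ones. *)
Lemma weighted_lim (z : C) (k : nat) (N : nat -> nat) :
  (forall n, (n <= N n)%nat) ->
  Clim (fun n => csum (fun j => RtoC (cf n (k + j)) * tterm q z j)%C (N n)) (theta q z).
Proof.
intros HN.
apply Clim_ext with (fun n => csum (fun j => RtoC (cf n (k + j) - 1) * tterm q z j) (N n)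
    + csum (tterm q z) (N n))%C.
{ intros n. rewrite <- csum_plus. apply csum_ext. intros j _.
  rewrite RtoC_minus. ring. }
replace (theta q z) with (RtoC 0 + theta q z)%C by ring.
apply Clim_plus.
- unfold Clim. destruct cf_bound as [M HM].
  apply is_lim_seq_squeeze0 with
    (fun n => rsum (fun j => Rabs (cf n (k + j) - 1) * (Rabs q ^ tri j * Cmod z ^ j)) (N n)).
  + intros n. split; [apply Cmod_ge_0|].
    replace (csum (fun j => RtoC (cf n (k + j) - 1) * tterm q z j) (N n) - 0)%C
      with (csum (fun j => RtoC (cf n (k + j) - 1) * tterm q z j) (N n))%C by ring.
    eapply Rle_trans; [apply Cmod_csum|]. apply rsum_le. intros j _.
    unfold tterm. rewrite !Cmod_mult, !Cmod_R, Cmod_pow, Rabs_pow_eq. lra.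
  + apply (tannery (fun n j => cf n (k + j) - 1) (fun j => Rabs q ^ tri j * Cmod z ^ j) M).
    * intros n j. apply HM.
    * intros j. apply cf_lim.
    * intros j. apply Rmult_le_pos; apply pow_le; [apply Rabs_pos|apply Cmod_ge_0].
    * apply ex_series_tri; [exact Hq|apply Cmod_ge_0].
- apply (Clim_subseq (csum (tterm q z))); [|now apply theta_lim].
  intros P [n0 Hn0]. exists n0. intros n Hn. apply Hn0. specialize (HN n). lia.
Qed.

Lemma jacobi_lim (z : C) :
  z <> RtoC 0 -> Clim (fun n => RtoC (qf q n) * Qn q n z)%C (Jc q z).
Proof.
intros Hz.
apply Clim_ext with (fun n =>
  csum (fun j => RtoC (cf n (0 + j)) * tterm q z j)%C (S (S n)) +
  csum (fun j => RtoC (cf n (1 + j)) * tterm q (/ z) j)%C (S (S n)) * / z)%C.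
- intros n. rewrite (finite_jacobi q Hq n z Hz). unfold An, Bn.
  rewrite Cmult_plus_distr_l, <- csum_scal, Cmult_assoc, <- csum_scal.
  f_equal; [|f_equal]; apply csum_ext; intros j _; unfold cf; simpl (_ + j)%nat;
    rewrite RtoC_mult; ring.
- unfold Jc, Cdiv. apply Clim_plus; [|apply Clim_mult; [|apply Clim_const]].
  + apply weighted_lim. lia.
  + apply weighted_lim. lia.
Qed.

Definition Qr (n : nat) (x : R) : R :=
  rprod (fun j => (1 + q ^ S j * x) * (1 + q ^ j * / x)) n.

Lemma Jc_RtoC (x : R) : x <> 0 -> Jc q (RtoC x) = RtoC (Jr q x).
Proof.
intros Hx. unfold Jc, Jr. rewrite RtoC_plus, RtoC_div.
rewrite <- RtoC_inv. rewrite !theta_real by assumption. reflexivity. all: assumption.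
Qed.

Lemma jacobi_lim_real (x : R) :
  x <> 0 -> is_lim_seq (fun n => qf q n * Qr n x) (Jr q x).
Proof.
intros Hx.
assert (Hx' : RtoC x <> RtoC 0) by (intros E; injection E; assumption).
pose proof (Clim_Re _ _ (jacobi_lim (RtoC x) Hx')) as H.
rewrite Jc_RtoC in H by assumption. simpl Re in H at 2.
eapply is_lim_seq_ext; [|exact H]. intros n. cbv beta.
assert (E : Qn q n (RtoC x) = RtoC (Qr n x)).
{ unfold Qn, Qr. rewrite <- cprod_RtoC. apply cprod_ext. intros j _.
  rewrite <- !RtoC_pow, <- RtoC_inv.
  rewrite <- !RtoC_mult, <- !RtoC_plus, <- RtoC_mult. reflexivity. all: assumption. }
rewrite E, <- RtoC_mult. reflexivity.
Qed.

End Jacobi.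

(** * Arguments and logarithmic derivatives *)

Definition cexp (l f : R) : C := (exp l * cos f, exp l * sin f).

Lemma cexp_plus (l l' f f' : R) :
  cexp (l + l') (f + f') = (cexp l f * cexp l' f')%C.
Proof.
unfold cexp, Cmult; simpl. rewrite exp_plus, cos_plus, sin_plus.
f_equal; ring.
Qed.

Lemma cexp_0 : cexp 0 0 = RtoC 1.
Proof. unfold cexp, RtoC. rewrite exp_0, cos_0, sin_0. f_equal; ring. Qed.

Lemma Cmod_cexp (l f : R) : Cmod (cexp l f) = exp l.
Proof.
unfold Cmod, cexp. simpl fst; simpl snd.
replace ((exp l * cos f) ^ 2 + (exp l * sin f) ^ 2)
  with ((exp l) ^ 2 * ((sin f)² + (cos f)²)) by (unfold Rsqr; ring).
rewrite sin2_cos2, Rmult_1_r. apply sqrt_pow2. left; apply exp_pos.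
Qed.

Lemma cexp_neq0 (l f : R) : cexp l f <> RtoC 0.
Proof.
intros E. pose proof (Cmod_cexp l f) as H. rewrite E, Cmod_0 in H.
pose proof (exp_pos l). lra.
Qed.

Lemma cexp_opp (l f : R) : cexp (- l) (- f) = (/ cexp l f)%C.
Proof.
pose proof (cexp_neq0 l f) as H.
assert (E : (cexp (- l) (- f) * cexp l f = RtoC 1)%C).
{ rewrite <- cexp_plus, !Rplus_opp_l. apply cexp_0. }
replace (cexp (- l) (- f)) with (cexp (- l) (- f) * cexp l f * / cexp l f)%C
  by (field; exact H).
rewrite E. ring.
Qed.

(* The argument, in [0, PI], of a nonzero point x + i y with 0 <= y. *)
Definition argu (x y : R) : R :=
  if Req_EM_T y 0 then (if Rlt_dec x 0 then PI else 0) else PI / 2 - atan (x / y).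
Definition lnm (x y : R) : R := ln (x ^ 2 + y ^ 2) / 2.

Lemma exp_half_ln (v : R) : 0 < v -> exp (ln v / 2) = sqrt v.
Proof.
intros Hv. symmetry. apply sqrt_lem_1; [lra|left; apply exp_pos|].
rewrite <- exp_plus. replace (ln v / 2 + ln v / 2) with (ln v) by field.
now apply exp_ln.
Qed.

Lemma polar_up (x y : R) :
  0 <= y -> (x <> 0 \/ y <> 0) -> cexp (lnm x y) (argu x y) = (x, y).
Proof.
intros Hy H. unfold cexp, lnm.
assert (Hpos : 0 < x ^ 2 + y ^ 2).
{ destruct H as [H|H].
  - assert (0 < x ^ 2) by (apply pow2_gt_0; exact H). pose proof (pow2_ge_0 y). lra.
  - assert (0 < y ^ 2) by (apply pow2_gt_0; exact H). pose proof (pow2_ge_0 x). lra. }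
rewrite exp_half_ln by assumption.
unfold argu. destruct (Req_EM_T y 0) as [E|E].
- subst y. replace (x ^ 2 + 0 ^ 2) with (x ^ 2) by ring.
  assert (Hx : x <> 0) by (destruct H; [assumption|lra]).
  destruct (Rlt_dec x 0) as [Hx0|Hx0].
  + rewrite cos_PI, sin_PI. replace (x ^ 2) with ((- x) ^ 2) by ring.
    rewrite sqrt_pow2 by lra. f_equal; ring.
  + rewrite cos_0, sin_0. rewrite sqrt_pow2 by lra. f_equal; ring.
- assert (Hy0 : 0 < y) by lra.
  rewrite cos_shift, sin_shift, cos_atan, sin_atan.
  assert (Hs : sqrt (x ^ 2 + y ^ 2) = y * sqrt (1 + (x / y)²)).
  { rewrite <- (sqrt_pow2 y) at 2 by lra. rewrite <- sqrt_mult.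
    - f_equal. unfold Rsqr. field. lra.
    - apply pow2_ge_0.
    - pose proof (Rle_0_sqr (x / y)). lra. }
  assert (Hs0 : sqrt (1 + (x / y)²) <> 0).
  { apply Rgt_not_eq, sqrt_lt_R0. pose proof (Rle_0_sqr (x / y)). lra. }
  rewrite Hs. f_equal; field; auto.
Qed.

Lemma argu_pos (x y : R) : 0 < y -> argu x y = PI / 2 - atan (x / y).
Proof. intros Hy. unfold argu. destruct (Req_EM_T y 0); [lra|reflexivity]. Qed.

(** With d = u + i t and w = x + s d this is - Im (conj d log w). As (log w)' = d / w, its
    derivative is |d|^2 Im w / |w|^2, positive for every linear factor whatever the direction of the
    segment. *)
Definition phi (x u t s : R) : R :=
  t * lnm (x + s * u) (s * t) - u * argu (x + s * u) (s * t).

Lemma phi_der (x u t s : R) : 0 < s -> 0 < t ->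
  is_derive (phi x u t) s ((u ^ 2 + t ^ 2) * (s * t) / ((x + s * u) ^ 2 + (s * t) ^ 2)).
Proof.
intros Hs Ht.
assert (H1 : 0 < s * t) by now apply Rmult_lt_0_compat.
assert (H2 : 0 < (x + s * u) ^ 2 + (s * t) ^ 2).
{ pose proof (pow2_ge_0 (x + s * u)). assert (0 < (s * t) ^ 2) by (apply pow2_gt_0; lra). lra. }
apply is_derive_ext_loc with
  (fun s => t * (ln ((x + s * u) ^ 2 + (s * t) ^ 2) / 2)
     - u * (PI / 2 - atan ((x + s * u) / (s * t)))).
{ exists (mkposreal _ Hs). intros y Hy.
  unfold ball in Hy; simpl in Hy; unfold AbsRing_ball, abs, minus, plus, opp in Hy; simpl in Hy.
  apply Rabs_def2 in Hy. unfold phi, lnm. rewrite argu_pos; [reflexivity|].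
  apply Rmult_lt_0_compat; lra. }
auto_derive.
- split; [simpl in *; lra|]. split; [lra|exact I].
- assert (1 + ((x + s * u) / (s * t)) ^ 2 <> 0).
  { apply Rgt_not_eq. pose proof (pow2_ge_0 ((x + s * u) / (s * t))). lra. }
  field. repeat split; lra.
Qed.

(** The formula in y / x stays continuous up to y = 0 when x <> 0, where the defining formula in x /
    y breaks off; the limit at the real end of a segment relies on it. *)
Lemma argu_atan (x y : R) : x <> 0 -> 0 <= y ->
  argu x y = (if Rlt_dec x 0 then PI else 0) + atan (y / x).
Proof.
intros Hx Hy. unfold argu. destruct (Req_EM_T y 0) as [E|E].
- subst y. unfold Rdiv. rewrite Rmult_0_l, atan_0. ring.
- assert (Hy0 : 0 < y) by lra.
  destruct (Rlt_dec x 0) as [H|H].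
  + replace (y / x) with (- (/ ((- x) / y))) by (field; lra).
    rewrite atan_opp, atan_inv by (apply Rdiv_lt_0_compat; lra).
    replace (x / y) with (- ((- x) / y)) by (field; lra).
    rewrite atan_opp. field.
  + replace (y / x) with (/ (x / y)) by (field; lra).
    rewrite atan_inv by (apply Rdiv_lt_0_compat; lra). field.
Qed.

Lemma at_right_le (x : R) : filter_le (at_right x) (locally x).
Proof. intros P [d Hd]. exists d. intros y Hy _. now apply Hd. Qed.

(** For small s the real part x + s u keeps the sign of x, so the constant 0 or PI is frozen and the
    remaining expression is differentiable at 0. *)
Lemma phi_lim0 (x u t : R) : x <> 0 -> 0 < t ->
  filterlim (phi x u t) (at_right 0) (locally (phi x u t 0)).
Proof.
intros Hx Ht.
set (c := if Rlt_dec x 0 then PI else 0).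
set (g := fun s => t * (ln ((x + s * u) ^ 2 + (s * t) ^ 2) / 2)
     - u * (c + atan ((s * t) / (x + s * u)))).
assert (Hg0 : g 0 = phi x u t 0).
{ unfold g, phi, lnm. rewrite argu_atan by lra.
  rewrite !Rmult_0_l, Rplus_0_r. reflexivity. }
rewrite <- Hg0.
assert (Hd : exists d, 0 < d /\ forall s, 0 <= s < d -> x + s * u <> 0
  /\ (if Rlt_dec (x + s * u) 0 then PI else 0) = c).
{ exists (Rabs x / (1 + Rabs u)). assert (0 < 1 + Rabs u) by (pose proof (Rabs_pos u); lra).
  split. { apply Rdiv_lt_0_compat; [now apply Rabs_pos_lt|assumption]. }
  intros s Hs.
  assert (Hsu : Rabs (s * u) < Rabs x).
  { rewrite Rabs_mult, (Rabs_pos_eq s) by lra.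
    assert (s * (1 + Rabs u) < Rabs x).
    { replace (Rabs x) with (Rabs x / (1 + Rabs u) * (1 + Rabs u)) by (field; lra).
      apply Rmult_lt_compat_r; lra. }
    lra. }
  unfold c.
  destruct (Rlt_dec x 0) as [H1|H1].
  - rewrite (Rabs_left x) in Hsu by lra. apply Rabs_def2 in Hsu.
    destruct (Rlt_dec (x + s * u) 0); [split; [lra|reflexivity]|lra].
  - rewrite (Rabs_pos_eq x) in Hsu by lra. apply Rabs_def2 in Hsu.
    destruct (Rlt_dec (x + s * u) 0); [lra|split; [lra|reflexivity]]. }
destruct Hd as [d [Hd0 Hd]].
apply filterlim_ext_loc with g.
- exists (mkposreal _ Hd0). intros s Hs Hs0.
  unfold ball in Hs; simpl in Hs; unfold AbsRing_ball, abs, minus, plus, opp in Hs; simpl in Hs.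
  apply Rabs_def2 in Hs.
  destruct (Hd s) as [H1 H2]; [lra|].
  unfold g, phi, lnm. rewrite argu_atan, H2; [reflexivity|exact H1|].
  apply Rmult_le_pos; lra.
- eapply filterlim_filter_le_1; [apply at_right_le|].
  assert (Hc : continuous (g : R_UniformSpace -> R_UniformSpace) 0).
  { apply (ex_derive_continuous (K := R_AbsRing) (V := R_NormedModule)). unfold g. auto_derive.
    assert (0 < x * x) by nra.
    rewrite !Rmult_0_l, !Rplus_0_r. split; [simpl; lra|].
    repeat split; auto. }
  exact Hc.
Qed.

Lemma Re_Cmult (x y : C) : Re (x * y)%C = Re x * Re y - Im x * Im y.
Proof. reflexivity. Qed.

Lemma Im_Cmult (x y : C) : Im (x * y)%C = Re x * Im y + Im x * Re y.
Proof. reflexivity. Qed.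

Lemma Im_RtoC_mult (r : R) (y : C) : Im (RtoC r * y)%C = r * Im y.
Proof. rewrite Im_Cmult. simpl. ring. Qed.

Definition cder (f : R -> C) (s : R) (d : C) : Prop :=
  is_derive (fun s => Re (f s)) s (Re d) /\ is_derive (fun s => Im (f s)) s (Im d).

Lemma cder_const (c : C) (s : R) : cder (fun _ => c) s (RtoC 0).
Proof. split; simpl; apply (is_derive_const (K := R_AbsRing) (V := R_NormedModule)). Qed.

Lemma cder_plus (f g : R -> C) (s : R) (d e : C) :
  cder f s d -> cder g s e -> cder (fun s => f s + g s)%C s (d + e)%C.
Proof.
intros [H1 H2] [H3 H4]. split; simpl.
- exact (is_derive_plus (K := R_AbsRing) (V := R_NormedModule) _ _ s _ _ H1 H3).
- exact (is_derive_plus (K := R_AbsRing) (V := R_NormedModule) _ _ s _ _ H2 H4).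
Qed.

Lemma is_derive_Rmult (f g : R -> R) (s d e : R) :
  is_derive f s d -> is_derive g s e -> is_derive (fun s => f s * g s) s (d * g s + f s * e).
Proof.
intros H1 H2. apply (is_derive_mult f g s d e H1 H2). intros; apply Rmult_comm.
Qed.

Lemma cder_mult (f g : R -> C) (s : R) (d e : C) :
  cder f s d -> cder g s e -> cder (fun s => f s * g s)%C s (d * g s + f s * e)%C.
Proof.
intros [H1 H2] [H3 H4].
pose proof (is_derive_Rmult _ _ _ _ _ H1 H3) as A.
pose proof (is_derive_Rmult _ _ _ _ _ H2 H4) as B.
pose proof (is_derive_Rmult _ _ _ _ _ H1 H4) as D.
pose proof (is_derive_Rmult _ _ _ _ _ H2 H3) as E.
split.
- pose proof (is_derive_minus (K := R_AbsRing) (V := R_NormedModule) _ _ s _ _ A B) as L.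
  replace (Re (d * g s + f s * e)%C) with
    (minus (G := R_AbelianGroup) (Re d * Re (g s) + Re (f s) * Re e) (Im d * Im (g s) + Im (f s) * Im e)).
  + eapply is_derive_ext; [|exact L]. intros r. reflexivity.
  + unfold minus, plus, opp; simpl; unfold Re, Im; simpl; ring.
- pose proof (is_derive_plus (K := R_AbsRing) (V := R_NormedModule) _ _ s _ _ D E) as L.
  replace (Im (d * g s + f s * e)%C) with
    (plus (G := R_AbelianGroup) (Re d * Im (g s) + Re (f s) * Im e) (Im d * Re (g s) + Im (f s) * Re e)).
  + eapply is_derive_ext; [|exact L]. intros r. reflexivity.
  + unfold plus; simpl; unfold Re, Im; simpl; ring.
Qed.

Lemma cder_eq (f : R -> C) (s : R) (d e : C) : cder f s d -> d = e -> cder f s e.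
Proof. now intros H <-. Qed.

Lemma cder_csum (f : nat -> R -> C) (d : nat -> C) (s : R) (n : nat) :
  (forall j, cder (f j) s (d j)) -> cder (fun s => csum (fun j => f j s) n) s (csum d n).
Proof.
intros H. induction n as [|n IH]; simpl; [apply cder_const|].
now apply cder_plus.
Qed.

Lemma cder_pow (f : R -> C) (s : R) (d : C) (n : nat) :
  cder f s d -> cder (fun s => f s ^ n)%C s (RtoC (INR n) * f s ^ pred n * d)%C.
Proof.
intros H. induction n as [|n IH].
- simpl. eapply cder_eq; [apply cder_const|]. ring.
- eapply cder_eq; [apply (cder_mult _ _ _ _ _ H IH)|].
  rewrite S_INR, RtoC_plus. destruct n as [|n]; simpl; ring.
Qed.

Lemma log_der (f : R -> C) (d : C) (t u s : R) :
  cder f s d -> 0 < Re (f s) ->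
  is_derive (fun s => t * lnm (Re (f s)) (Im (f s)) - u * atan (Im (f s) / Re (f s))) s
   ((t * (Re (f s) * Re d + Im (f s) * Im d) - u * (Im d * Re (f s) - Im (f s) * Re d))
     / (Re (f s) ^ 2 + Im (f s) ^ 2)).
Proof.
intros [H1 H2] Hpos. unfold lnm.
set (a := fun s => Re (f s)) in *. set (b := fun s => Im (f s)) in *.
change (is_derive (fun s => t * (ln (a s ^ 2 + b s ^ 2) / 2) - u * atan (b s / a s)) s
   ((t * (a s * Re d + b s * Im d) - u * (Im d * a s - b s * Re d))
     / (a s ^ 2 + b s ^ 2))).
assert (Ha : 0 < a s) by exact Hpos.
assert (Hab : 0 < a s ^ 2 + b s ^ 2).
{ pose proof (pow2_ge_0 (b s)). assert (0 < a s ^ 2) by (apply pow2_gt_0; lra). lra. }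
assert (E1 : Derive (fun x => a x) s = Re d) by (now apply is_derive_unique).
assert (E2 : Derive (fun x => b x) s = Im d) by (now apply is_derive_unique).
auto_derive.
- split; [now exists (Re d)|]. split; [now exists (Im d)|].
  split; [simpl in *; lra|]. split; [now exists (Im d)|]. split; [now exists (Re d)|].
  split; [lra|exact I].
- rewrite E1, E2.
  assert (1 + (b s / a s) ^ 2 <> 0).
  { apply Rgt_not_eq. pose proof (pow2_ge_0 (b s / a s)). lra. }
  field. repeat split; lra.
Qed.

Definition zpath (x u t s : R) : C := (x + s * u, s * t).

Lemma zpath_der (x u t s : R) : cder (zpath x u t) s (u, t).
Proof.
unfold cder, zpath; simpl. split; auto_derive; auto; ring.
Qed.

Lemma cder_inv (f : R -> C) (d : C) (s : R) :
  cder f s d -> f s <> RtoC 0 -> cder (fun s => / f s)%C s (- d * / f s * / f s)%C.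
Proof.
intros [H1 H2] Hf.
set (a := fun s => Re (f s)) in *. set (b := fun s => Im (f s)) in *.
assert (Hab : 0 < a s ^ 2 + b s ^ 2).
{ apply Cmod_gt_0 in Hf. unfold Cmod in Hf.
  destruct (Rle_lt_dec (a s ^ 2 + b s ^ 2) 0) as [H|H]; [|exact H].
  change (0 < sqrt (a s ^ 2 + b s ^ 2)) in Hf. rewrite sqrt_neg_0 in Hf by exact H. lra. }
assert (E1 : Derive (fun x => a x) s = Re d) by (now apply is_derive_unique).
assert (E2 : Derive (fun x => b x) s = Im d) by (now apply is_derive_unique).
split.
- change (is_derive (fun s => a s / (a s ^ 2 + b s ^ 2)) s (Re (- d * / f s * / f s)%C)).
  auto_derive.
  + repeat split; try (now exists (Re d)); try (now exists (Im d)).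
    simpl in Hab; lra.
  + rewrite E1, E2. destruct d as [d1 d2]. unfold Re, Im, Cmult, Cinv, Copp. simpl fst; simpl snd.
    change (fst (f s)) with (a s). change (snd (f s)) with (b s).
    field. simpl in Hab. lra.
- change (is_derive (fun s => - b s / (a s ^ 2 + b s ^ 2)) s (Im (- d * / f s * / f s)%C)).
  auto_derive.
  + repeat split; try (now exists (Re d)); try (now exists (Im d)).
    simpl in Hab; lra.
  + rewrite E1, E2. destruct d as [d1 d2]. unfold Re, Im, Cmult, Cinv, Copp. simpl fst; simpl snd.
    change (fst (f s)) with (a s). change (snd (f s)) with (b s).
    field. simpl in Hab. lra.
Qed.

(** * The logarithmic derivative of the partial sums of theta *)

Section PartialSums.

Variables (q P om : R).
Hypothesis Hq : Rabs q <= P.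
Hypothesis Hom : 0 <= om.
(** Since tri (j + 1) >= 2 j + 1, the term of index j + 1 is at most a c^j with c = P^2 om; all
    bounds below are sums of a geometric series and of its first two derivatives. *)
Let a := P * om.
Let c := P * P * om.
Hypothesis HP : 0 < P <= 1.
Hypothesis Hc : a + c < 1.

Lemma c_lt1 : 0 <= c < 1 /\ 0 <= a.
Proof.
assert (0 <= a) by (apply Rmult_le_pos; lra).
assert (0 <= c) by (unfold c; apply Rmult_le_pos; [nra|lra]).
lra.
Qed.

Lemma tri_pow_le (j : nat) : Rabs q ^ tri (S j) <= P * (P * P) ^ j.
Proof.
assert (H : Rabs q ^ tri (S j) <= P ^ (2 * j + 1)).
{ apply Rle_trans with (P ^ tri (S j)).
  - apply pow_incr. split; [apply Rabs_pos|exact Hq].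
  - pose proof (tri_double (S j)).
    assert (L : (2 * j + 1 <= tri (S j))%nat) by nia.
    replace (tri (S j)) with ((2 * j + 1) + (tri (S j) - (2 * j + 1)))%nat by lia.
    rewrite pow_add.
    assert (P ^ (tri (S j) - (2 * j + 1)) <= 1).
    { rewrite <- (pow1 (tri (S j) - (2 * j + 1))). apply pow_incr. lra. }
    assert (0 < P ^ (2 * j + 1)) by (apply pow_lt; lra). nra. }
replace (P * (P * P) ^ j) with (P ^ (2 * j + 1)); [exact H|].
rewrite pow_add, pow_mult. simpl. rewrite !Rmult_1_r. ring.
Qed.

Lemma sum_S1 (n : nat) : rsum (fun j => (INR j + 1) * c ^ j) n <= / (1 - c) ^ 2.
Proof.
pose proof c_lt1 as Hc1.
assert (H : rsum (fun j => (INR j + 1) * c ^ j) n * (1 - c)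
   = rsum (fun j => c ^ j) n - INR n * c ^ n).
{ induction n as [|n IH]; [simpl; ring|].
  cbn [rsum]. rewrite Rmult_plus_distr_r, IH, S_INR. simpl. ring. }
assert (H2 : rsum (fun j => c ^ j) n <= / (1 - c)) by (apply rsum_geom; lra).
assert (0 <= INR n * c ^ n) by (apply Rmult_le_pos; [apply pos_INR|apply pow_le; lra]).
replace (/ (1 - c) ^ 2) with (/ (1 - c) * / (1 - c)) by (field; lra).
apply Rmult_le_reg_r with (1 - c); [lra|].
rewrite H. rewrite Rmult_assoc, Rinv_l, Rmult_1_r by lra. lra.
Qed.

Lemma sum_S2 (n : nat) :
  rsum (fun j => (INR j + 1) * (INR j + 2) * c ^ j) n <= 2 * / (1 - c) ^ 3.
Proof.
pose proof c_lt1 as Hc1.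
assert (H : rsum (fun j => (INR j + 1) * (INR j + 2) * c ^ j) n * (1 - c)
   = 2 * rsum (fun j => (INR j + 1) * c ^ j) n - INR n * (INR n + 1) * c ^ n).
{ induction n as [|n IH]; [simpl; ring|].
  cbn [rsum]. rewrite Rmult_plus_distr_r, IH, S_INR. simpl. ring. }
pose proof (sum_S1 n) as H2.
assert (0 <= INR n * (INR n + 1) * c ^ n).
{ pose proof (pos_INR n). apply Rmult_le_pos; [nra|apply pow_le; lra]. }
replace (/ (1 - c) ^ 3) with (/ (1 - c) ^ 2 * / (1 - c)) by (field; lra).
apply Rmult_le_reg_r with (1 - c); [lra|].
rewrite H. replace (2 * (/ (1 - c) ^ 2 * / (1 - c)) * (1 - c)) with (2 * / (1 - c) ^ 2)
  by (field; lra). lra.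
Qed.

(** The factor |Im w| is extracted so that the bounds on imaginary parts vanish linearly at the real
    axis, as the contribution of the zeros of J does. *)
Lemma Im_pow (w : C) (j : nat) :
  Rabs (Im (w ^ j)%C) <= INR j * Rabs (Im w) * Cmod w ^ pred j.
Proof.
induction j as [|j IH].
- simpl. rewrite Rabs_R0. lra.
- simpl (w ^ S j)%C.
  rewrite Im_Cmult.
  eapply Rle_trans; [apply Rabs_triang|]. rewrite !Rabs_mult.
  pose proof (re_le_Cmod w) as H1. pose proof (re_le_Cmod (w ^ j)%C) as H2.
  rewrite Cmod_pow in H2. rewrite S_INR. simpl pred.
  assert (H3 : Rabs (Re w) * Rabs (Im (w ^ j)%C) <= INR j * Rabs (Im w) * Cmod w ^ j).
  { destruct j as [|j].
    - simpl in *. rewrite Rabs_R0. rewrite Rmult_0_r. nra.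
    - simpl pred in IH.
      apply Rle_trans with (Cmod w * (INR (S j) * Rabs (Im w) * Cmod w ^ j)).
      + apply Rmult_le_compat; auto using Rabs_pos.
      + simpl (Cmod w ^ S j). right. ring. }
  assert (H4 : Rabs (Im w) * Rabs (Re (w ^ j)%C) <= Rabs (Im w) * Cmod w ^ j).
  { apply Rmult_le_compat_l; [apply Rabs_pos|exact H2]. }
  lra.
Qed.

Variable w : C.
Hypothesis Hw : Cmod w <= om.

(** For B = [tB] and A = [tA]: m bounds Re B from below, [be] and [al] bound |Im B| and |Im A| per
    unit of |Im w|. *)
Let m := 1 - a / (1 - c).
Let be := P / (1 - c) ^ 2.
Let al := 2 * a / (1 - c) ^ 3.

(** This is w^2 B'(w) for B = [tB]. With w = eps / z and eps^2 = 1 one has dw = - eps w^2 dz, so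
    differentiation in z produces exactly this quantity. *)
Definition tA (n : nat) : C := csum (fun j => RtoC (INR j) * w * tterm q w j)%C n.
Definition tB (n : nat) : C := csum (tterm q w) n.

Lemma m_pos : 0 < m.
Proof.
pose proof c_lt1 as Hc1. unfold m.
assert (a / (1 - c) < 1).
{ apply Rmult_lt_reg_r with (1 - c); [lra|].
  unfold Rdiv. rewrite Rmult_assoc, Rinv_l by lra. lra. }
lra.
Qed.

Lemma pow_w_le (j : nat) : Cmod w ^ j <= om ^ j.
Proof. apply pow_incr. split; [apply Cmod_ge_0|exact Hw]. Qed.

Lemma tB_near1 (n : nat) : Cmod (tB (S n) - 1)%C <= a / (1 - c).
Proof.
pose proof c_lt1 as Hc1.
unfold tB. rewrite csum_S_l.
replace (tterm q w 0 + csum (fun j => tterm q w (S j)) n - 1)%C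
  with (csum (fun j => tterm q w (S j)) n) by (unfold tterm; simpl; ring).
eapply Rle_trans; [apply Cmod_csum|].
apply Rle_trans with (rsum (fun j => a * c ^ j) n).
- apply rsum_le. intros j _. unfold tterm.
  rewrite Cmod_mult, Cmod_R, Cmod_pow, Rabs_pow_eq.
  replace (a * c ^ j) with ((P * (P * P) ^ j) * om ^ S j).
  + apply Rmult_le_compat; [apply pow_le, Rabs_pos|apply pow_le, Cmod_ge_0|
      apply tri_pow_le|apply pow_w_le].
  + unfold a, c. rewrite !Rpow_mult_distr. simpl. ring.
- rewrite rsum_scal. unfold Rdiv. apply Rmult_le_compat_l; [lra|].
  apply rsum_geom. lra.
Qed.

Lemma tB_Re (n : nat) : m <= Re (tB (S n)).
Proof.
pose proof (tB_near1 n) as H. pose proof (re_le_Cmod (tB (S n) - 1)%C) as H1.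
assert (H2 : Re (tB (S n) - 1)%C = Re (tB (S n)) - 1) by (simpl; ring).
rewrite H2 in H1. unfold m.
assert (H3 : Rabs (Re (tB (S n)) - 1) <= a / (1 - c)) by lra.
apply Rabs_le_between in H3. lra.
Qed.

Lemma tB_Im (n : nat) : Rabs (Im (tB n)) <= Rabs (Im w) * be.
Proof.
pose proof c_lt1 as Hc1.
assert (Hbe : 0 <= be).
{ unfold be. apply Rmult_le_pos; [lra|left; apply Rinv_0_lt_compat, pow_lt; lra]. }
destruct n as [|n].
{ simpl. rewrite Rabs_R0. apply Rmult_le_pos; [apply Rabs_pos|exact Hbe]. }
apply Rle_trans with (rsum (fun j => Rabs (Im (tterm q w j))) (S n)).
{ unfold tB. generalize (S n). intros k. induction k as [|k IH]; simpl; [rewrite Rabs_R0; lra|].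
  eapply Rle_trans; [apply Rabs_triang|]. apply Rplus_le_compat_r, IH. }
rewrite rsum_S_l.
replace (Im (tterm q w 0)) with 0 by (unfold tterm; simpl; ring).
rewrite Rabs_R0, Rplus_0_l.
apply Rle_trans with (rsum (fun j => Rabs (Im w) * P * ((INR j + 1) * c ^ j)) n).
- apply rsum_le. intros j _.
  replace (Im (tterm q w (S j))) with (q ^ tri (S j) * Im (w ^ S j)%C)
    by (unfold tterm; now rewrite Im_RtoC_mult).
  rewrite Rabs_mult, Rabs_pow_eq.
  pose proof (Im_pow w (S j)) as H. simpl pred in H. rewrite S_INR in H.
  apply Rle_trans with ((P * (P * P) ^ j) * ((INR j + 1) * Rabs (Im w) * om ^ j)).
  + apply Rmult_le_compat; [apply pow_le, Rabs_pos|apply Rabs_pos|apply tri_pow_le|].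
    eapply Rle_trans; [exact H|]. apply Rmult_le_compat_l; [|apply pow_w_le].
    apply Rmult_le_pos; [pose proof (pos_INR j); lra|apply Rabs_pos].
  + unfold c. rewrite !Rpow_mult_distr. right. ring.
- rewrite rsum_scal. unfold be, Rdiv. rewrite Rmult_assoc.
  apply Rmult_le_compat_l; [apply Rabs_pos|].
  apply Rmult_le_compat_l; [lra|apply sum_S1].
Qed.

Lemma tA_Im (n : nat) : Rabs (Im (tA n)) <= Rabs (Im w) * al.
Proof.
pose proof c_lt1 as Hc1.
assert (Hal : 0 <= al).
{ unfold al. apply Rmult_le_pos; [lra|left; apply Rinv_0_lt_compat, pow_lt; lra]. }
destruct n as [|n].
{ simpl. rewrite Rabs_R0. apply Rmult_le_pos; [apply Rabs_pos|exact Hal]. }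
apply Rle_trans with (rsum (fun j => Rabs (Im (RtoC (INR j) * w * tterm q w j)%C)) (S n)).
{ unfold tA. generalize (S n). intros k. induction k as [|k IH]; simpl; [rewrite Rabs_R0; lra|].
  eapply Rle_trans; [apply Rabs_triang|]. apply Rplus_le_compat_r, IH. }
rewrite rsum_S_l.
replace (Im (RtoC (INR 0) * w * tterm q w 0)%C) with 0 by (simpl; ring).
rewrite Rabs_R0, Rplus_0_l.
apply Rle_trans with (rsum (fun j => Rabs (Im w) * a * ((INR j + 1) * (INR j + 2) * c ^ j)) n).
- apply rsum_le. intros j _.
  replace (Im (RtoC (INR (S j)) * w * tterm q w (S j))%C)
    with (INR (S j) * q ^ tri (S j) * Im (w ^ S (S j))%C)
    by (unfold tterm; rewrite !Cpow_S; generalize (w ^ j)%C; intros v;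
        rewrite <- Im_RtoC_mult, RtoC_mult; f_equal; ring).
  rewrite !Rabs_mult, Rabs_pow_eq, (Rabs_pos_eq (INR (S j))) by apply pos_INR.
  pose proof (Im_pow w (S (S j))) as H. simpl pred in H. rewrite !S_INR in *.
  pose proof (pos_INR j).
  apply Rle_trans with ((INR j + 1) * (P * (P * P) ^ j) * ((INR j + 1 + 1) * Rabs (Im w) * om ^ S j)).
  + apply Rmult_le_compat.
    * apply Rmult_le_pos; [lra|apply pow_le, Rabs_pos].
    * apply Rabs_pos.
    * apply Rmult_le_compat_l; [lra|apply tri_pow_le].
    * eapply Rle_trans; [exact H|]. apply Rmult_le_compat_l; [|apply pow_w_le].
      apply Rmult_le_pos; [lra|apply Rabs_pos].
  + unfold a, c. rewrite !Rpow_mult_distr. simpl. right. ring.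
- rewrite rsum_scal.
  replace (Rabs (Im w) * al) with (Rabs (Im w) * a * (2 * / (1 - c) ^ 3))
    by (unfold al; field; lra).
  apply Rmult_le_compat_l; [apply Rmult_le_pos; [apply Rabs_pos|lra]|apply sum_S2].
Qed.

Lemma tA_mod (n : nat) : Cmod (tA n) <= om ^ 2 * be.
Proof.
pose proof c_lt1 as Hc1.
assert (Hbe : 0 <= om ^ 2 * be).
{ unfold be. apply Rmult_le_pos; [apply pow2_ge_0|].
  apply Rmult_le_pos; [lra|left; apply Rinv_0_lt_compat, pow_lt; lra]. }
destruct n as [|n]; [change (tA 0) with (RtoC 0); rewrite Cmod_0; exact Hbe|].
eapply Rle_trans; [apply Cmod_csum|]. rewrite rsum_S_l.
replace (RtoC (INR 0) * w * tterm q w 0)%C with (RtoC 0) by (simpl; ring).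
rewrite Cmod_0, Rplus_0_l.
apply Rle_trans with (rsum (fun j => om ^ 2 * P * ((INR j + 1) * c ^ j)) n).
- apply rsum_le. intros j _. unfold tterm.
  rewrite !Cmod_mult, !Cmod_R, Cmod_pow, Rabs_pow_eq, Rabs_pos_eq by apply pos_INR.
  rewrite S_INR. pose proof (pos_INR j).
  apply Rle_trans with ((INR j + 1) * om * ((P * (P * P) ^ j) * om ^ S j)).
  + apply Rmult_le_compat.
    * apply Rmult_le_pos; [lra|apply Cmod_ge_0].
    * apply Rmult_le_pos; [apply pow_le, Rabs_pos|apply pow_le, Cmod_ge_0].
    * apply Rmult_le_compat_l; [lra|exact Hw].
    * apply Rmult_le_compat; [apply pow_le, Rabs_pos|apply pow_le, Cmod_ge_0|
        apply tri_pow_le|apply pow_w_le].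
  + unfold c. rewrite !Rpow_mult_distr. simpl. right. ring.
- rewrite rsum_scal. unfold be, Rdiv. rewrite Rmult_assoc.
  apply Rmult_le_compat_l; [apply pow2_ge_0|].
  apply Rmult_le_compat_l; [lra|apply sum_S1].
Qed.

(** |Im (A conj B)| / |B|^2 is at most |Im w| (al / m + om^2 be^2 / m^2). With m = (1 - a - c) / (1
    - c) the bracket collapses to a difference of two inverse squares. *)
Lemma theta_logder_bound (n : nat) :
  Rabs (Im (tA (S n) * Cconj (tB (S n)))%C / (Re (tB (S n)) ^ 2 + Im (tB (S n)) ^ 2))
   <= Rabs (Im w) * (/ (1 - (a + c)) ^ 2 - / (1 - c) ^ 2).
Proof.
pose proof c_lt1 as Hc1. pose proof m_pos as Hm.
set (A := tA (S n)). set (B := tB (S n)).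
assert (HB : m <= Re B) by apply tB_Re.
set (N := Re B ^ 2 + Im B ^ 2).
assert (HN : 0 < N).
{ unfold N. pose proof (pow2_ge_0 (Im B)). assert (0 < Re B ^ 2) by (apply pow2_gt_0; lra). lra. }
assert (HMB : Cmod B ^ 2 = N) by apply Cmod2_alt.
assert (HMm : m <= Cmod B).
{ pose proof (re_le_Cmod B). rewrite Rabs_pos_eq in H; lra. }
assert (E : / (1 - (a + c)) ^ 2 - / (1 - c) ^ 2 = al / m + om ^ 2 * be ^ 2 / m ^ 2).
{ unfold al, be, m. replace (P * P * om) with c by reflexivity.
  replace (om ^ 2 * (P / (1 - c) ^ 2) ^ 2) with (a ^ 2 / (1 - c) ^ 4) by (unfold a; field; lra).
  field. repeat split; lra. }
rewrite E. unfold Rdiv at 1. rewrite Rabs_mult, (Rabs_pos_eq (/ N)) by (left; now apply Rinv_0_lt_compat).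
assert (HIm : Rabs (Im (A * Cconj B)%C) <= Rabs (Im w) * (al * Cmod B + om ^ 2 * be * be)).
{ replace (Im (A * Cconj B)%C) with (Im A * Re B + - (Re A * Im B))
    by (rewrite Im_Cmult; unfold Cconj; simpl; unfold Re, Im; ring).
  eapply Rle_trans; [apply Rabs_triang|]. rewrite Rabs_Ropp, !Rabs_mult.
  assert (H1 : Rabs (Im A) * Rabs (Re B) <= (Rabs (Im w) * al) * Cmod B).
  { apply Rmult_le_compat; try apply Rabs_pos; [apply tA_Im|apply re_le_Cmod]. }
  assert (H2 : Rabs (Re A) * Rabs (Im B) <= (om ^ 2 * be) * (Rabs (Im w) * be)).
  { apply Rmult_le_compat; try apply Rabs_pos; [|apply tB_Im].
    eapply Rle_trans; [apply re_le_Cmod|apply tA_mod]. }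
  lra. }
assert (Hal : 0 <= al).
{ unfold al. apply Rmult_le_pos; [lra|left; apply Rinv_0_lt_compat, pow_lt; lra]. }
assert (Hbe : 0 <= om ^ 2 * be * be).
{ rewrite Rmult_assoc. apply Rmult_le_pos; [apply pow2_ge_0|apply Rle_0_sqr]. }
apply Rle_trans with (Rabs (Im w) * (al * Cmod B + om ^ 2 * be * be) * / N).
{ apply Rmult_le_compat_r; [left; now apply Rinv_0_lt_compat|exact HIm]. }
rewrite Rmult_assoc. apply Rmult_le_compat_l; [apply Rabs_pos|].
rewrite <- HMB.
assert (HMp : 0 < Cmod B) by lra.
replace ((al * Cmod B + om ^ 2 * be * be) * / Cmod B ^ 2)
  with (al * / Cmod B + om ^ 2 * be * be * / Cmod B ^ 2) by (field; lra).
apply Rplus_le_compat.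
- apply Rmult_le_compat_l; [exact Hal|]. now apply Rinv_le_contravar.
- replace (om ^ 2 * be ^ 2 / m ^ 2) with (om ^ 2 * be * be * / m ^ 2) by (field; lra).
  apply Rmult_le_compat_l; [exact Hbe|]. apply Rinv_le_contravar; [apply pow_lt; lra|].
  apply pow_incr. lra.
Qed.

End PartialSums.

Lemma Clim_inv (u : nat -> C) (l : C) :
  (forall n, u n <> RtoC 0) -> l <> RtoC 0 -> Clim u l -> Clim (fun n => / u n)%C (/ l)%C.
Proof.
intros Hu Hl H. unfold Clim.
apply is_lim_seq_ext with (fun n => Cmod (u n - l)%C * (/ Cmod (u n) * / Cmod l)).
- intros n. rewrite <- !Cmod_inv by auto. rewrite <- !Cmod_mult.
  rewrite <- Cmod_opp. f_equal. field. auto.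
- replace (Finite 0) with (Finite (0 * (/ Cmod l * / Cmod l))) by (f_equal; ring).
  apply is_lim_seq_mult'; [exact H|].
  assert (Hl' : Cmod l <> 0) by (intros E; now apply Hl, Cmod_eq_0).
  apply is_lim_seq_mult'; [|apply is_lim_seq_const].
  apply (is_lim_seq_inv (fun n => Cmod (u n)) (Cmod l)); [now apply Clim_Cmod|].
  intros E. injection E. assumption.
Qed.

(** The derivative is available only for s > 0, because a segment starts on the real axis, where the
    branch of the argument ends. The mean value theorem is applied on [e, 1] to g - k s^2 / 2, which
    is nondecreasing, and e tends to 0 by one-sided continuity. *)
Lemma increment_bound (g g' : R -> R) (k : R) :
  (forall s, 0 < s <= 1 -> is_derive g s (g' s)) ->
  (forall s, 0 < s <= 1 -> k * s <= g' s) ->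
  filterlim g (at_right 0) (locally (g 0)) ->
  k / 2 <= g 1 - g 0.
Proof.
intros Hd Hk Hl.
assert (H1 : forall e, 0 < e < 1 -> g e <= g 1 - k / 2 + k / 2 * e ^ 2).
{ intros e He.
  destruct (MVT_gen (fun s => g s - k / 2 * s ^ 2) e 1 (fun s => g' s - k * s)) as [c [Hc Hm]].
  - intros s Hs. rewrite Rmin_left, Rmax_right in Hs by lra.
    apply (is_derive_minus (K := R_AbsRing) (V := R_NormedModule) g (fun s => k / 2 * s ^ 2)).
    + apply Hd. lra.
    + auto_derive; [exact I|]. field.
  - intros s Hs. rewrite Rmin_left, Rmax_right in Hs by lra.
    apply continuity_pt_minus.
    + apply continuity_pt_filterlim.
      apply (ex_derive_continuous (K := R_AbsRing) (V := R_NormedModule)).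
      exists (g' s). apply Hd. lra.
    + apply continuity_pt_filterlim.
      apply (ex_derive_continuous (K := R_AbsRing) (V := R_NormedModule)
        (fun s => k / 2 * s ^ 2)). auto_derive. exact I.
  - rewrite Rmin_left, Rmax_right in Hc by lra.
    assert (0 <= g' c - k * c) by (specialize (Hk c); lra).
    assert (0 <= (g' c - k * c) * (1 - e)) by (apply Rmult_le_pos; lra). lra. }
apply Rnot_lt_le. intros Hlt.
set (d := k / 2 - (g 1 - g 0)) in *. assert (Hd0 : 0 < d) by (unfold d; lra).
assert (Hd4 : 0 < d / 4) by lra.
pose proof (proj1 (filterlim_locally (g : R -> R_UniformSpace) (g 0)) Hl (mkposreal _ Hd4)) as [r Hr].
assert (Hmx : 0 < 1 + Rabs k) by (pose proof (Rabs_pos k); lra).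
set (e := Rmin (Rmin (r / 2) (1 / 2)) (d / (1 + Rabs k))).
assert (He0 : 0 < e).
{ unfold e. repeat apply Rmin_glb_lt; try lra.
  - pose proof (cond_pos r). lra.
  - now apply Rdiv_lt_0_compat. }
assert (He1 : e <= r / 2) by (unfold e; eapply Rle_trans; [apply Rmin_l|apply Rmin_l]).
assert (He2 : e <= 1 / 2) by (unfold e; eapply Rle_trans; [apply Rmin_l|apply Rmin_r]).
assert (He3 : e * (1 + Rabs k) <= d).
{ apply Rle_trans with (d / (1 + Rabs k) * (1 + Rabs k)).
  - apply Rmult_le_compat_r; [lra|]. unfold e; apply Rmin_r.
  - right. field. lra. }
pose proof (cond_pos r) as Hrp.
specialize (Hr e). specialize (H1 e).
assert (Hb : ball (0 : R_UniformSpace) r e).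
{ unfold ball; simpl; unfold AbsRing_ball, abs, minus, plus, opp; simpl.
  rewrite Ropp_0, Rplus_0_r, Rabs_pos_eq; lra. }
specialize (Hr Hb He0).
unfold ball in Hr; simpl in Hr; unfold AbsRing_ball, abs, minus, plus, opp in Hr; simpl in Hr.
apply Rabs_def2 in Hr.
assert (H2 : k / 2 * e ^ 2 <= d / 4).
{ apply Rle_trans with (Rabs k / 2 * e ^ 2).
  - apply Rmult_le_compat_r; [apply pow2_ge_0|]. pose proof (Rle_abs k). lra.
  - assert (Rabs k * e <= d) by lra. pose proof (Rabs_pos k). nra. }
unfold d in *. lra.
Qed.

Lemma rsum_lin (t u : R) (f g : nat -> R) (n : nat) :
  rsum (fun j => t * f j - u * g j) n = t * rsum f n - u * rsum g n.
Proof. induction n as [|n IH]; simpl; [|rewrite IH]; ring. Qed.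

(** * Noshiro's inequality for F *)

Section Noshiro.

Variables (q eps P om eta B : R).
Hypothesis Hq : 0 < Rabs q < 1.
Hypothesis HqP : Rabs q <= P.
Hypothesis HP : 0 < P <= 1.
Hypothesis Heps : eps = 1 \/ eps = - 1.
Hypothesis HB : 1 < B.
Hypothesis Hom : / B <= om.
Hypothesis Hc : P * om + P * P * om < 1.
Hypothesis Heta : 0 < eta.

(* In the variable z = eps x the function J vanishes at the points -cc j and -dd j. Up to additive
   constants, Lam n and Ang n are ln |F| and arg F with J and theta(1/x) replaced by partial
   products and partial sums, and - Im (log F)' >= (Sfun - Eb) Im z / |z|^2. *)
Definition cc (j : nat) : R := eps / q ^ S j.
Definition dd (j : nat) : R := eps * q ^ j.

(** The leading 1 comes from the factor z of F. The factors belonging to [dd] are (z + dd j) / z,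
    normalised to tend to 1, whence the - 1 in the last sum. *)
Definition Sfun (n : nat) (X Y : R) : R :=
  1 + rsum (fun j => (X ^ 2 + Y ^ 2) / ((X + cc j) ^ 2 + Y ^ 2)) n
    + rsum (fun j => (X ^ 2 + Y ^ 2) / ((X + dd j) ^ 2 + Y ^ 2) - 1) n.

Definition Eb : R := / (1 - (P * om + P * P * om)) ^ 2 - / (1 - P * P * om) ^ 2.

Definition inv_arg (x y : R) : C := (RtoC eps * / (x, y))%C.
Definition Bz (n : nat) (x y : R) : C := tB q (inv_arg x y) (S n).

Definition Lam (n : nat) (x y : R) : R :=
  lnm x y + rsum (fun j => lnm (x + cc j) y) n
   + rsum (fun j => lnm (x + dd j) y - lnm x y) n - lnm (Re (Bz n x y)) (Im (Bz n x y)).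
Definition Ang (n : nat) (x y : R) : R :=
  argu x y + rsum (fun j => argu (x + cc j) y) n
   + rsum (fun j => argu (x + dd j) y - argu x y) n - atan (Im (Bz n x y) / Re (Bz n x y)).

Definition Psi (n : nat) (x u t s : R) : R :=
  t * Lam n (x + s * u) (s * t) - u * Ang n (x + s * u) (s * t).

Lemma q_neq0 : q <> 0.
Proof. intros E. rewrite E, Rabs_R0 in Hq. lra. Qed.

Lemma eps_sq : eps * eps = 1.
Proof. destruct Heps as [E|E]; rewrite E; ring. Qed.

Lemma eps_neq0 : eps <> 0.
Proof. destruct Heps as [E|E]; rewrite E; lra. Qed.

Lemma eps_abs : Rabs eps = 1.
Proof.
destruct Heps as [E|E]; rewrite E; [apply Rabs_R1|].
rewrite Rabs_left; lra.
Qed.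

Lemma xy_neq0 (x y : R) : x <> 0 -> (x, y) <> RtoC 0.
Proof. intros Hx E. injection E. intros. contradiction. Qed.

Lemma inv_arg_mod (x y : R) : x <= - B -> Cmod (inv_arg x y) <= om.
Proof.
intros Hx. unfold inv_arg. rewrite Cmod_mult, Cmod_R, eps_abs, Rmult_1_l.
rewrite Cmod_inv by (apply xy_neq0; lra). eapply Rle_trans; [|exact Hom].
apply Rinv_le_contravar; [lra|].
pose proof (re_le_Cmod (x, y)) as H. simpl in H. rewrite Rabs_left in H; lra.
Qed.

Lemma inv_arg_Im (x y : R) : x <> 0 ->
  Rabs (Im (inv_arg x y)) = Rabs y / (x ^ 2 + y ^ 2).
Proof.
intros Hx. unfold inv_arg. rewrite Im_RtoC_mult, Rabs_mult, eps_abs, Rmult_1_l.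
assert (0 < x ^ 2 + y ^ 2).
{ pose proof (pow2_ge_0 y). assert (0 < x ^ 2) by (now apply pow2_gt_0). lra. }
unfold Cinv, Im. simpl snd. change (x * (x * 1) + y * (y * 1)) with (x ^ 2 + y ^ 2).
unfold Rdiv. rewrite Rabs_mult, Rabs_Ropp. f_equal.
rewrite Rabs_pos_eq; [reflexivity|]. left. now apply Rinv_0_lt_compat.
Qed.

Lemma om_pos : 0 < om.
Proof. eapply Rlt_le_trans; [|exact Hom]. apply Rinv_0_lt_compat. lra. Qed.

Lemma Bz_Re (n : nat) (x y : R) : x <= - B -> 0 < Re (Bz n x y).
Proof.
intros Hx. pose proof om_pos.
eapply Rlt_le_trans; [apply (m_pos P om)|apply (tB_Re q P om)]; auto; try lra.
now apply inv_arg_mod.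
Qed.

Lemma is_derive_rsum (f : nat -> R -> R) (d : nat -> R) (s : R) (n : nat) :
  (forall j, is_derive (f j) s (d j)) ->
  is_derive (fun s => rsum (fun j => f j s) n) s (rsum d n).
Proof.
intros H. induction n as [|n IH]; simpl.
- apply (is_derive_const (K := R_AbsRing) (V := R_NormedModule)).
- exact (is_derive_plus (K := R_AbsRing) (V := R_NormedModule) _ _ s _ _ IH (H n)).
Qed.

Definition phiB (n : nat) (x u t s : R) : R :=
  t * lnm (Re (Bz n (x + s * u) (s * t))) (Im (Bz n (x + s * u) (s * t)))
  - u * atan (Im (Bz n (x + s * u) (s * t)) / Re (Bz n (x + s * u) (s * t))).

Lemma Psi_eq (n : nat) (x u t s : R) :
  Psi n x u t s = phi x u t s + rsum (fun j => phi (x + cc j) u t s) n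
   + rsum (fun j => phi (x + dd j) u t s - phi x u t s) n - phiB n x u t s.
Proof.
unfold Psi, Lam, Ang, phiB, phi.
assert (H1 : rsum (fun j => t * lnm (x + cc j + s * u) (s * t) - u * argu (x + cc j + s * u) (s * t)) n
  = t * rsum (fun j => lnm (x + s * u + cc j) (s * t)) n - u * rsum (fun j => argu (x + s * u + cc j) (s * t)) n).
{ rewrite <- rsum_lin. apply rsum_ext. intros j _.
  replace (x + cc j + s * u) with (x + s * u + cc j) by ring. ring. }
assert (H2 : rsum (fun j => t * lnm (x + dd j + s * u) (s * t) - u * argu (x + dd j + s * u) (s * t)
     - (t * lnm (x + s * u) (s * t) - u * argu (x + s * u) (s * t))) n
  = t * rsum (fun j => lnm (x + s * u + dd j) (s * t) - lnm (x + s * u) (s * t)) n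
    - u * rsum (fun j => argu (x + s * u + dd j) (s * t) - argu (x + s * u) (s * t)) n).
{ rewrite <- rsum_lin. apply rsum_ext. intros j _.
  replace (x + dd j + s * u) with (x + s * u + dd j) by ring. ring. }
rewrite H1, H2. ring.
Qed.

Definition zpt (x y : R) : C := (x, y).

Lemma Bz_der (n : nat) (x u t s : R) : x + s * u <> 0 ->
  cder (fun s => Bz n (x + s * u) (s * t)) s
   (- RtoC eps * (u, t) * tA q (inv_arg (x + s * u) (s * t)) (S n))%C.
Proof.
intros Hx.
assert (Hz : zpt (x + s * u) (s * t) <> RtoC 0) by now apply xy_neq0.
assert (Hw : cder (fun s => inv_arg (x + s * u) (s * t)) s
   (RtoC eps * (- (u, t) * / zpt (x + s * u) (s * t) * / zpt (x + s * u) (s * t)))%C).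
{ eapply cder_eq.
  - unfold inv_arg. apply (cder_mult (fun _ => RtoC eps)); [apply cder_const|].
    apply (cder_inv (zpath x u t)); [apply zpath_der|exact Hz].
  - unfold zpath, zpt. ring. }
unfold Bz, tB, tA.
rewrite <- csum_scal. eapply cder_eq.
- apply (cder_csum (fun j s => tterm q (inv_arg (x + s * u) (s * t)) j)).
  intros j. unfold tterm. apply (cder_mult (fun _ => RtoC (q ^ tri j))); [apply cder_const|].
  apply (cder_pow (fun s => inv_arg (x + s * u) (s * t))). exact Hw.
- apply csum_ext. intros j _. unfold tterm.
  assert (E : (RtoC eps * (/ zpt (x + s * u) (s * t) * / zpt (x + s * u) (s * t)) =
     RtoC eps * inv_arg (x + s * u) (s * t) * inv_arg (x + s * u) (s * t))%C).
  { unfold inv_arg. fold (zpt (x + s * u) (s * t)).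
    replace (RtoC eps * (RtoC eps * / zpt (x + s * u) (s * t)) * (RtoC eps * / zpt (x + s * u) (s * t)))%C
     with (RtoC eps * (RtoC eps * RtoC eps) * (/ zpt (x + s * u) (s * t) * / zpt (x + s * u) (s * t)))%C by ring.
    rewrite <- (RtoC_mult eps eps), eps_sq. ring. }
  replace (RtoC eps * (- (u, t) * / zpt (x + s * u) (s * t) * / zpt (x + s * u) (s * t)))%C
    with (- (u, t) * (RtoC eps * (/ zpt (x + s * u) (s * t) * / zpt (x + s * u) (s * t))))%C by ring.
  rewrite E. destruct j as [|j].
  + simpl. ring.
  + simpl pred. rewrite (Cpow_S _ j). ring.
Qed.

Definition Vb (n : nat) (x y : R) : R :=
  Im (tA q (inv_arg x y) (S n) * Cconj (Bz n x y))%C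
  / (Re (Bz n x y) ^ 2 + Im (Bz n x y) ^ 2).

Lemma phiB_der (n : nat) (x u t s : R) : x + s * u <= - B ->
  is_derive (phiB n x u t) s ((u ^ 2 + t ^ 2) * (eps * Vb n (x + s * u) (s * t))).
Proof.
intros Hx. unfold Vb.
pose proof (log_der _ _ t u s (Bz_der n x u t s ltac:(lra)) (Bz_Re n _ _ Hx)) as H.
set (A := tA q (inv_arg (x + s * u) (s * t)) (S n)) in *.
set (Bv := Bz n (x + s * u) (s * t)) in *.
pose proof (Bz_Re n (x + s * u) (s * t) Hx) as HR. fold Bv in HR.
match type of H with is_derive _ _ ?v => replace ((u ^ 2 + t ^ 2) * (eps *
    (Im (A * Cconj Bv)%C / (Re Bv ^ 2 + Im Bv ^ 2)))) with v end; [exact H|].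
rewrite !Re_Cmult, !Im_Cmult. destruct A as [a1 a2]. destruct Bv as [b1 b2].
unfold Re, Im, Cconj, Copp, RtoC. simpl. simpl in HR.
field. nra.
Qed.

Lemma Psi_der (n : nat) (x u t s : R) : 0 < s -> 0 < t -> x + s * u <= - B ->
  is_derive (Psi n x u t) s ((u ^ 2 + t ^ 2) *
    ((s * t) / ((x + s * u) ^ 2 + (s * t) ^ 2) * Sfun n (x + s * u) (s * t)
     - eps * Vb n (x + s * u) (s * t))).
Proof.
intros Hs Ht Hx.
apply is_derive_ext with (fun s => phi x u t s + rsum (fun j => phi (x + cc j) u t s) n
   + rsum (fun j => phi (x + dd j) u t s - phi x u t s) n - phiB n x u t s).
{ intros r. symmetry. apply Psi_eq. }
pose proof (phi_der x u t s Hs Ht) as D0.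
pose proof (is_derive_rsum (fun j => phi (x + cc j) u t) _ s n
  (fun j => phi_der (x + cc j) u t s Hs Ht)) as D1.
pose proof (is_derive_rsum (fun j s => phi (x + dd j) u t s - phi x u t s) _ s n
  (fun j => is_derive_minus (K := R_AbsRing) (V := R_NormedModule) _ _ s _ _
     (phi_der (x + dd j) u t s Hs Ht) D0)) as D2.
pose proof (phiB_der n x u t s Hx) as D3.
pose proof (is_derive_minus (K := R_AbsRing) (V := R_NormedModule) _ _ s _ _
  (is_derive_plus (K := R_AbsRing) (V := R_NormedModule) _ _ s _ _
    (is_derive_plus (K := R_AbsRing) (V := R_NormedModule) _ _ s _ _ D0 D1) D2) D3) as D.
match type of D with is_derive _ _ ?v => match goal with |- is_derive _ _ ?w =>
  replace w with v; [exact D|] end end.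
unfold minus, plus, opp; simpl.
set (X := x + s * u). set (Y := s * t).
assert (HN : 0 < X ^ 2 + Y ^ 2).
{ pose proof (pow2_ge_0 Y). assert (0 < X ^ 2) by (apply pow2_gt_0; unfold X; lra). lra. }
unfold Sfun.
assert (E1 : rsum (fun j => (u ^ 2 + t ^ 2) * Y / ((x + cc j + s * u) ^ 2 + Y ^ 2)) n
  = (u ^ 2 + t ^ 2) * (Y / (X ^ 2 + Y ^ 2)) * rsum (fun j => (X ^ 2 + Y ^ 2) / ((X + cc j) ^ 2 + Y ^ 2)) n).
{ rewrite <- rsum_scal. apply rsum_ext. intros j _.
  replace (x + cc j + s * u) with (X + cc j) by (unfold X; ring).
  field. split; [|lra]. apply Rgt_not_eq.
  assert (0 < Y ^ 2) by (apply pow2_gt_0; unfold Y; nra).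
  pose proof (pow2_ge_0 (X + cc j)). lra. }
assert (E2 : rsum (fun j => (u ^ 2 + t ^ 2) * Y / ((x + dd j + s * u) ^ 2 + Y ^ 2)
     + - ((u ^ 2 + t ^ 2) * Y / (X ^ 2 + Y ^ 2))) n
  = (u ^ 2 + t ^ 2) * (Y / (X ^ 2 + Y ^ 2)) * rsum (fun j => (X ^ 2 + Y ^ 2) / ((X + dd j) ^ 2 + Y ^ 2) - 1) n).
{ rewrite <- rsum_scal. apply rsum_ext. intros j _.
  replace (x + dd j + s * u) with (X + dd j) by (unfold X; ring).
  field. split; [|lra]. apply Rgt_not_eq.
  assert (0 < Y ^ 2) by (apply pow2_gt_0; unfold Y; nra).
  pose proof (pow2_ge_0 (X + dd j)). simpl in *. lra. }
simpl pow in *. rewrite E1, E2. field. lra.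
Qed.

(** Even truncations, because for negative q the terms are estimated in pairs; eta is a uniform
    margin that survives the limit. *)
Hypothesis HS : exists n0 : nat, forall m X Y, (n0 <= m)%nat -> X <= - B -> 0 < Y ->
  Eb + eta <= Sfun (2 * m) X Y.

Lemma filterlim_Rplus (f g : R -> R) (a b : R) :
  filterlim f (at_right 0) (locally a) -> filterlim g (at_right 0) (locally b) ->
  filterlim (fun s => f s + g s) (at_right 0) (locally (a + b)).
Proof.
intros Hf Hg. eapply filterlim_comp_2; [exact Hf|exact Hg|].
apply (filterlim_plus (K := R_AbsRing) (V := R_NormedModule)).
Qed.

Lemma filterlim_Ropp (f : R -> R) (a : R) :
  filterlim f (at_right 0) (locally a) ->
  filterlim (fun s => - f s) (at_right 0) (locally (- a)).
Proof.
intros Hf. eapply filterlim_comp; [exact Hf|].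
apply (filterlim_opp (K := R_AbsRing) (V := R_NormedModule)).
Qed.

Lemma filterlim_rsum (f : nat -> R -> R) (l : nat -> R) (n : nat) :
  (forall j, filterlim (f j) (at_right 0) (locally (l j))) ->
  filterlim (fun s => rsum (fun j => f j s) n) (at_right 0) (locally (rsum l n)).
Proof.
intros H. induction n as [|n IH]; simpl; [apply filterlim_const|].
now apply filterlim_Rplus.
Qed.

Lemma Psi_lim0 (n : nat) (x u t : R) :
  x <= - B -> 0 < t -> (forall j, x + cc j <> 0) ->
  filterlim (Psi n x u t) (at_right 0) (locally (Psi n x u t 0)).
Proof.
intros Hx Ht Hcc.
assert (Hdd : forall j, x + dd j <> 0).
{ intros j. unfold dd.
  assert (Rabs (eps * q ^ j) <= 1).
  { rewrite Rabs_mult, eps_abs, Rabs_pow_eq, Rmult_1_l.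
    rewrite <- (pow1 j). apply pow_incr. lra. }
  apply Rabs_le_between in H. lra. }
apply filterlim_ext with (fun s => phi x u t s + rsum (fun j => phi (x + cc j) u t s) n
   + rsum (fun j => phi (x + dd j) u t s + - phi x u t s) n + - phiB n x u t s).
{ intros s. rewrite Psi_eq. reflexivity. }
rewrite Psi_eq. apply filterlim_Rplus; [apply filterlim_Rplus; [apply filterlim_Rplus|]|].
- apply phi_lim0; [lra|exact Ht].
- apply filterlim_rsum. intros j. apply phi_lim0; [apply Hcc|exact Ht].
- apply filterlim_rsum. intros j. apply filterlim_Rplus; [|apply filterlim_Ropp].
  + apply phi_lim0; [apply Hdd|exact Ht].
  + apply phi_lim0; [lra|exact Ht].
- apply filterlim_Ropp. eapply filterlim_filter_le_1; [apply at_right_le|].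
  assert (Hc0 : continuous (phiB n x u t : R_UniformSpace -> R_UniformSpace) 0).
  { apply (ex_derive_continuous (K := R_AbsRing) (V := R_NormedModule)).
    eexists. apply phiB_der. lra. }
  exact Hc0.
Qed.

(** The left side does not depend on m, so positivity stays strict when m tends to infinity. R2
    bounds |z|^2 at both ends of the segment, hence on all of it by convexity. *)
Lemma noshiro : exists n0 : nat, forall m x u t R2,
  (n0 <= m)%nat -> x <= - B -> x + u <= - B -> 0 < t -> (forall j, x + cc j <> 0) ->
  x ^ 2 <= R2 -> (x + u) ^ 2 + t ^ 2 <= R2 ->
  (u ^ 2 + t ^ 2) * t * eta / R2 / 2 <=
  t * (Lam (2 * m) (x + u) t - Lam (2 * m) x 0) - u * (Ang (2 * m) (x + u) t - Ang (2 * m) x 0).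
Proof.
destruct HS as [n0 Hn0]. exists n0. intros m x u t R2 Hm Hx Hxu Ht Hcc HR1 HR2.
assert (HX : forall s, 0 < s <= 1 -> x + s * u <= - B).
{ intros s Hs. replace (x + s * u) with ((1 - s) * x + s * (x + u)) by ring.
  apply Rle_trans with ((1 - s) * - B + s * - B); [|right; ring].
  apply Rplus_le_compat; apply Rmult_le_compat_l; lra. }
pose proof (increment_bound (Psi (2 * m) x u t) _ ((u ^ 2 + t ^ 2) * t * eta / R2)
  (fun s Hs => Psi_der (2 * m) x u t s (proj1 Hs) Ht (HX s Hs))) as HI.
cbv beta in HI.
replace (t * (Lam (2 * m) (x + u) t - Lam (2 * m) x 0) - u * (Ang (2 * m) (x + u) t - Ang (2 * m) x 0))
  with (Psi (2 * m) x u t 1 - Psi (2 * m) x u t 0)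
  by (unfold Psi; rewrite !Rmult_1_l, !Rmult_0_l, Rplus_0_r; ring).
apply HI; [|now apply Psi_lim0].
intros s Hs. specialize (HX s Hs).
assert (HY : 0 < s * t) by (apply Rmult_lt_0_compat; lra).
specialize (Hn0 m _ _ Hm HX HY).
pose proof om_pos as Hom0.
assert (HEb := theta_logder_bound q P om HqP (Rlt_le _ _ Hom0) HP Hc _
  (inv_arg_mod (x + s * u) (s * t) HX) (2 * m)).
change (tB q (inv_arg (x + s * u) (s * t)) (S (2 * m))) with (Bz (2 * m) (x + s * u) (s * t)) in HEb.
fold Eb in HEb.
fold (Vb (2 * m) (x + s * u) (s * t)) in HEb.
set (V := Vb (2 * m) (x + s * u) (s * t)) in *.
rewrite inv_arg_Im in HEb by lra.
set (X := x + s * u) in *. set (Y := s * t) in *.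
rewrite (Rabs_pos_eq Y) in HEb by lra.
assert (HN : 0 < X ^ 2 + Y ^ 2).
{ pose proof (pow2_ge_0 Y). assert (0 < X ^ 2) by (apply pow2_gt_0; lra). lra. }
assert (HNR : X ^ 2 + Y ^ 2 <= R2).
{ assert (E : X ^ 2 + Y ^ 2 = (1 - s) * x ^ 2 + s * ((x + u) ^ 2 + t ^ 2) - s * (1 - s) * (u ^ 2 + t ^ 2))
    by (unfold X, Y; ring).
  rewrite E.
  assert (0 <= s * (1 - s) * (u ^ 2 + t ^ 2)).
  { apply Rmult_le_pos; [apply Rmult_le_pos; lra|]. pose proof (pow2_ge_0 u). pose proof (pow2_ge_0 t). lra. }
  assert ((1 - s) * x ^ 2 <= (1 - s) * R2) by (apply Rmult_le_compat_l; lra).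
  assert (s * ((x + u) ^ 2 + t ^ 2) <= s * R2) by (apply Rmult_le_compat_l; lra). lra. }
assert (HeV : eps * V <= Y / (X ^ 2 + Y ^ 2) * Eb).
{ eapply Rle_trans; [apply Rle_abs|]. rewrite Rabs_mult, eps_abs, Rmult_1_l. exact HEb. }
assert (HYN : 0 < Y / (X ^ 2 + Y ^ 2)) by now apply Rdiv_lt_0_compat.
assert (H1 : Y / (X ^ 2 + Y ^ 2) * eta <= Y / (X ^ 2 + Y ^ 2) * Sfun (2 * m) X Y - eps * V).
{ apply Rle_trans with (Y / (X ^ 2 + Y ^ 2) * (Eb + eta) - Y / (X ^ 2 + Y ^ 2) * Eb); [right; ring|].
  apply Rplus_le_compat; [|now apply Ropp_le_contravar].
  apply Rmult_le_compat_l; lra. }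
assert (H2 : Y / R2 <= Y / (X ^ 2 + Y ^ 2)).
{ unfold Rdiv. apply Rmult_le_compat_l; [lra|]. now apply Rinv_le_contravar. }
replace ((u ^ 2 + t ^ 2) * t * eta / R2 * s) with ((u ^ 2 + t ^ 2) * (Y / R2 * eta))
  by (unfold Y; field; lra).
apply Rmult_le_compat_l.
{ pose proof (pow2_ge_0 u). pose proof (pow2_ge_0 t). lra. }
eapply Rle_trans; [|exact H1]. apply Rmult_le_compat_r; lra.
Qed.

Definition Gc (n : nat) (x y : R) : C :=
  (zpt x y * cprod (fun j => zpt (x + cc j) y) n
   * cprod (fun j => zpt (x + dd j) y * / zpt x y) n * / Bz n x y)%C.

Lemma polar_right (z : C) : 0 < Re z -> cexp (lnm (Re z) (Im z)) (atan (Im z / Re z)) = z.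
Proof.
intros Hz. destruct z as [a b]. simpl in *. unfold cexp, lnm.
assert (Hpos : 0 < a ^ 2 + b ^ 2).
{ assert (0 < a ^ 2) by (apply pow2_gt_0; lra). pose proof (pow2_ge_0 b). lra. }
rewrite exp_half_ln by assumption. rewrite cos_atan, sin_atan.
assert (Hs : sqrt (a ^ 2 + b ^ 2) = a * sqrt (1 + (b / a)²)).
{ rewrite <- (sqrt_pow2 a) at 2 by lra. rewrite <- sqrt_mult.
  - f_equal. unfold Rsqr. field. lra.
  - apply pow2_ge_0.
  - pose proof (Rle_0_sqr (b / a)). lra. }
assert (Hs0 : sqrt (1 + (b / a)²) <> 0).
{ apply Rgt_not_eq, sqrt_lt_R0. pose proof (Rle_0_sqr (b / a)). lra. }
rewrite Hs. f_equal; field; repeat split; auto; lra.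
Qed.

Lemma cexp_rsum (l f : nat -> R) (z : nat -> C) (n : nat) :
  (forall j, cexp (l j) (f j) = z j) -> cexp (rsum l n) (rsum f n) = cprod z n.
Proof.
intros H. induction n as [|n IH]; simpl; [apply cexp_0|].
rewrite cexp_plus, IH, H. reflexivity.
Qed.

Lemma dd_abs (j : nat) : Rabs (dd j) <= 1.
Proof.
unfold dd. rewrite Rabs_mult, eps_abs, Rabs_pow_eq, Rmult_1_l.
rewrite <- (pow1 j). apply pow_incr. lra.
Qed.

Lemma x_dd (x : R) (j : nat) : x <= - B -> x + dd j <= 1 - B.
Proof. intros Hx. pose proof (dd_abs j) as H. apply Rabs_le_between in H. lra. Qed.

Lemma cexp_minus (l l' f f' : R) :
  cexp (l - l') (f - f') = (cexp l f * / cexp l' f')%C.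
Proof. unfold Rminus. now rewrite cexp_plus, cexp_opp. Qed.

Lemma polar_G (n : nat) (x y : R) :
  0 <= y -> x <= - B -> (forall j, x + cc j <> 0 \/ y <> 0) ->
  cexp (Lam n x y) (Ang n x y) = Gc n x y.
Proof.
intros Hy Hx Hcc. unfold Lam, Ang, Gc.
rewrite cexp_minus, !cexp_plus, polar_right by now apply Bz_Re.
f_equal. f_equal; [f_equal|].
- apply polar_up; [exact Hy|left; lra].
- apply cexp_rsum. intros j. now apply polar_up.
- apply cexp_rsum. intros j. rewrite cexp_minus.
  pose proof (x_dd x j Hx).
  rewrite !polar_up; auto; left; lra.
Qed.

(** The factor that turns [Gc] into eps z times the partial triple product divided by [Bz]. It does
    not depend on z and cancels in the ratio of two values. *)
Definition Kn (n : nat) : R := eps * qf q n * rprod (fun j => eps * q ^ S j) n.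

Lemma Kn_neq0 (n : nat) : Kn n <> 0.
Proof.
unfold Kn. repeat apply Rmult_integral_contrapositive_currified.
- apply eps_neq0.
- now apply qf_neq0.
- apply rprod_neq0. intros j _. apply Rmult_integral_contrapositive_currified;
    [apply eps_neq0|apply pow_nonzero, q_neq0].
Qed.

Lemma RtoC_neq0 (x : R) : x <> 0 -> RtoC x <> RtoC 0.
Proof. intros H E. injection E. exact H. Qed.

Lemma zpt_plus (x c y : R) : zpt (x + c) y = (zpt x y + RtoC c)%C.
Proof. unfold zpt, RtoC, Cplus. simpl. f_equal. ring. Qed.

Lemma KG_eq (n : nat) (x y : R) : x <= - B ->
  (RtoC (Kn n) * Gc n x y =
   RtoC eps * zpt x y * (RtoC (qf q n) * Qn q n (RtoC eps * zpt x y)) * / Bz n x y)%C.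
Proof.
intros Hx. unfold Kn, Gc.
assert (Hz : zpt x y <> RtoC 0) by (apply xy_neq0; lra).
assert (E : (RtoC (rprod (fun j => (eps * q ^ S j)%R) n) * cprod (fun j => zpt (x + cc j) y) n
   * cprod (fun j => zpt (x + dd j) y * / zpt x y) n)%C = Qn q n (RtoC eps * zpt x y)%C).
{ unfold Qn. rewrite <- cprod_RtoC. induction n as [|n IH]; [simpl; ring|].
  cbn [cprod]. rewrite <- IH.
  match goal with |- (?a * ?a' * (?b * ?b') * (?c * ?c'))%C = _ =>
    replace (a * a' * (b * b') * (c * c'))%C with (a * b * c * (a' * b' * c'))%C by ring end.
  f_equal. rewrite !zpt_plus. unfold cc, dd.
  assert (Hqn : RtoC (q ^ S n) <> RtoC 0) by (apply RtoC_neq0, pow_nonzero, q_neq0).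
  assert (He : RtoC eps <> RtoC 0) by (apply RtoC_neq0, eps_neq0).
  assert (He2 : (RtoC eps * RtoC eps)%C = RtoC 1) by (rewrite <- RtoC_mult, eps_sq; reflexivity).
  rewrite <- !RtoC_pow, !RtoC_mult, RtoC_div by (apply pow_nonzero, q_neq0).
  replace (RtoC eps * RtoC (q ^ S n) * (zpt x y + RtoC eps / RtoC (q ^ S n)))%C
    with (RtoC eps * RtoC (q ^ S n) * zpt x y + RtoC eps * RtoC eps)%C by (field; exact Hqn).
  rewrite He2.
  replace (/ (RtoC eps * zpt x y))%C with (RtoC eps * / zpt x y)%C.
  - field. exact Hz.
  - replace (/ (RtoC eps * zpt x y))%C with (RtoC 1 * / (RtoC eps * zpt x y))%C by ring.
    rewrite <- He2. field. auto. }
rewrite <- E, !RtoC_mult. ring.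
Qed.

Lemma inv_arg_eq (x y : R) : x <> 0 -> inv_arg x y = (/ (RtoC eps * zpt x y))%C.
Proof.
intros Hx. assert (Hz : zpt x y <> RtoC 0) by now apply xy_neq0.
assert (He : RtoC eps <> RtoC 0) by (apply RtoC_neq0, eps_neq0).
assert (He2 : (RtoC eps * RtoC eps)%C = RtoC 1) by (rewrite <- RtoC_mult, eps_sq; reflexivity).
unfold inv_arg. fold (zpt x y).
replace (/ (RtoC eps * zpt x y))%C with (RtoC 1 * / (RtoC eps * zpt x y))%C by ring.
rewrite <- He2. field. auto.
Qed.

Lemma Bz_lim (x y : R) : Clim (fun n => Bz n x y) (theta q (inv_arg x y)).
Proof.
unfold Bz, tB. apply (Clim_subseq (csum (tterm q (inv_arg x y))) _ S).
- intros Q [n0 H]. exists n0. intros n Hn. apply H. lia.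
- now apply theta_lim.
Qed.

Lemma theta_inv_Re (x y : R) : x <= - B -> 0 < Re (theta q (inv_arg x y)).
Proof.
intros Hx. pose proof om_pos as Hom0.
apply Rlt_le_trans with (1 - P * om / (1 - P * P * om)).
- apply (m_pos P om); auto; lra.
- apply (is_lim_seq_le (fun _ => 1 - P * om / (1 - P * P * om)) (fun n => Re (Bz n x y))
    (1 - P * om / (1 - P * P * om)) (Re (theta q (inv_arg x y)))).
  + intros n. apply (tB_Re q P om); auto; try lra. now apply inv_arg_mod.
  + apply is_lim_seq_const.
  + apply Clim_Re, Bz_lim.
Qed.

Lemma Re0_neq (z : C) : 0 < Re z -> z <> RtoC 0.
Proof. intros H E. rewrite E in H. simpl in H. lra. Qed.

Lemma KG_lim (x y : R) : x <= - B ->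
  Clim (fun n => RtoC (Kn n) * Gc n x y)%C
   (RtoC eps * zpt x y * Jc q (RtoC eps * zpt x y) * / theta q (inv_arg x y))%C.
Proof.
intros Hx.
assert (Hz : zpt x y <> RtoC 0) by (apply xy_neq0; lra).
assert (He : RtoC eps <> RtoC 0) by (apply RtoC_neq0, eps_neq0).
apply Clim_ext with (fun n => RtoC eps * zpt x y * (RtoC (qf q n) * Qn q n (RtoC eps * zpt x y)) * / Bz n x y)%C.
{ intros n. symmetry. now apply KG_eq. }
apply Clim_mult.
- apply Clim_mult; [apply Clim_const|]. apply jacobi_lim; [exact Hq|]. now apply Cmult_neq_0.
- apply Clim_inv; [|apply Re0_neq; now apply theta_inv_Re|apply Bz_lim].
  intros n. apply Re0_neq. now apply Bz_Re.
Qed.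

(** At a zero x of theta only theta(1/x)/x is left of J(x), so F(x) = 1. *)
Lemma KG_lim_zero (x y : R) : x <= - B -> theta q (RtoC eps * zpt x y)%C = RtoC 0 ->
  Clim (fun n => RtoC (Kn n) * Gc n x y)%C (RtoC 1).
Proof.
intros Hx H0. pose proof (KG_lim x y Hx) as H.
match type of H with Clim _ ?l => replace l with (RtoC 1) in H; [exact H|] end.
assert (Hz : zpt x y <> RtoC 0) by (apply xy_neq0; lra).
assert (He : RtoC eps <> RtoC 0) by (apply RtoC_neq0, eps_neq0).
pose proof (Re0_neq _ (theta_inv_Re x y Hx)) as Ht.
unfold Jc. rewrite H0. rewrite inv_arg_eq in * by lra.
field. auto.
Qed.

Definition Fr (v : R) : R := v * Jr q v / thr q (/ v).

Lemma inv_arg_real (x : R) : x <> 0 -> inv_arg x 0 = RtoC (/ (eps * x)).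
Proof.
intros Hx. rewrite inv_arg_eq by exact Hx.
replace (zpt x 0) with (RtoC x) by reflexivity.
rewrite <- RtoC_mult, <- RtoC_inv; [reflexivity|].
apply Rmult_integral_contrapositive_currified; [apply eps_neq0|exact Hx].
Qed.

Lemma thr_inv_pos (x : R) : x <= - B -> 0 < thr q (/ (eps * x)).
Proof.
intros Hx. pose proof (theta_inv_Re x 0 Hx) as H.
rewrite inv_arg_real in H by lra. rewrite theta_real in H by exact Hq. exact H.
Qed.

Lemma KG_lim_real (x : R) : x <= - B ->
  Clim (fun n => RtoC (Kn n) * Gc n x 0)%C (RtoC (Fr (eps * x))).
Proof.
intros Hx. pose proof (KG_lim x 0 Hx) as H.
match type of H with Clim _ ?l => replace l with (RtoC (Fr (eps * x))) in H; [exact H|] end.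
pose proof (thr_inv_pos x Hx) as Ht.
replace (zpt x 0) with (RtoC x) by reflexivity.
assert (Hex : eps * x <> 0).
{ apply Rmult_integral_contrapositive_currified; [apply eps_neq0|lra]. }
rewrite <- RtoC_mult, Jc_RtoC by auto. rewrite inv_arg_real by lra.
rewrite theta_real by exact Hq. unfold Fr.
rewrite <- RtoC_inv, <- !RtoC_mult by lra. reflexivity.
Qed.

(** If x + cc j = 0, all partial products for J at eps x beyond index j contain the same vanishing
    factor, so J and F vanish there. Base points with F >= 1 thus avoid the jumps of the
    argument. *)
Lemma noncritical (x : R) : x <= - B -> Fr (eps * x) <> 0 -> forall j, x + cc j <> 0.
Proof.
intros Hx HF j E. apply HF.
assert (Hex : eps * x <> 0).
{ apply Rmult_integral_contrapositive_currified; [apply eps_neq0|lra]. }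
assert (HJ : Jr q (eps * x) = 0).
{ pose proof (jacobi_lim_real q Hq (eps * x) Hex) as HL.
  apply (is_lim_seq_incr_n _ (S j)) in HL.
  apply is_lim_seq_unique in HL.
  assert (E0 : Lim_seq (fun n => qf q (n + S j) * Qr q (n + S j) (eps * x)) = 0).
  { rewrite <- (Lim_seq_const 0). apply Lim_seq_ext. intros n.
    replace (n + S j)%nat with (S j + n)%nat by lia.
    unfold Qr at 1. rewrite rprod_app. simpl (rprod _ (S j)).
    assert (E2 : 1 + q ^ S j * (eps * x) = 0).
    { replace x with (- cc j) by lra. unfold cc.
      replace (q ^ S j * (eps * - (eps / q ^ S j))) with (- (eps * eps)).
      - rewrite eps_sq. ring.
      - field. apply pow_nonzero, q_neq0. }
    simpl in E2. rewrite E2. ring. }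
  rewrite E0 in HL. now injection HL. }
unfold Fr. rewrite HJ. unfold Rdiv. ring.
Qed.

Section OneZero.

Variables x' t : R.
Hypothesis Hx' : x' <= - B.
Hypothesis Ht : 0 < t.
Hypothesis Hzero : theta q (RtoC eps * zpt x' t)%C = RtoC 0.

Lemma ratio_lim (x : R) : x <= - B -> 0 < Fr (eps * x) ->
  Clim (fun n => cexp (Lam n x' t - Lam n x 0) (Ang n x' t - Ang n x 0))
    (RtoC (/ Fr (eps * x))).
Proof.
intros Hx HF.
assert (Hnc : forall j, x + cc j <> 0) by (apply noncritical; [exact Hx|lra]).
apply Clim_ext with (fun n => (RtoC (Kn n) * Gc n x' t) * / (RtoC (Kn n) * Gc n x 0))%C.
- intros n. rewrite cexp_minus, !polar_G; auto; try lra; [|intros j; right; lra].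
  assert (RtoC (Kn n) <> RtoC 0) by (apply RtoC_neq0, Kn_neq0).
  assert (Gc n x 0 <> RtoC 0).
  { rewrite <- polar_G; auto; [apply cexp_neq0|lra]. }
  field. auto.
- rewrite RtoC_inv by lra.
  replace (/ RtoC (Fr (eps * x)))%C with (RtoC 1 * / RtoC (Fr (eps * x)))%C by ring.
  apply Clim_mult; [now apply KG_lim_zero|].
  apply Clim_inv; [|apply RtoC_neq0; lra|now apply KG_lim_real].
  intros n. apply Cmult_neq_0; [apply RtoC_neq0, Kn_neq0|].
  rewrite <- polar_G; auto; [apply cexp_neq0|lra].
Qed.

Lemma Lam_lim (x : R) : x <= - B -> 0 < Fr (eps * x) ->
  is_lim_seq (fun n => Lam n x' t - Lam n x 0) (- ln (Fr (eps * x))).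
Proof.
intros Hx HF. pose proof (Clim_Cmod _ _ (ratio_lim x Hx HF)) as H.
assert (HFi : 0 < / Fr (eps * x)) by now apply Rinv_0_lt_compat.
rewrite Cmod_R, Rabs_pos_eq in H by lra.
apply is_lim_seq_ext with (fun n => ln (exp (Lam n x' t - Lam n x 0))).
{ intros n. apply ln_exp. }
rewrite <- ln_Rinv by exact HF.
apply is_lim_seq_continuous; [|apply is_lim_seq_ext with (2 := H)].
- apply continuity_pt_filterlim.
  apply (ex_derive_continuous (K := R_AbsRing) (V := R_NormedModule)).
  auto_derive. exact HFi.
- intros n. apply Cmod_cexp.
Qed.

(** The ratio of the values of F tends to a positive real number; this fixes the argument only
    modulo 2 PI, hence the cosine. *)
Lemma Ang_cos_lim (x : R) : x <= - B -> 0 < Fr (eps * x) ->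
  is_lim_seq (fun n => cos (Ang n x' t - Ang n x 0)) 1.
Proof.
intros Hx HF. pose proof (ratio_lim x Hx HF) as H0.
pose proof (Clim_Cmod _ _ H0) as H. pose proof (Clim_Re _ _ H0) as H1.
assert (HFi : 0 < / Fr (eps * x)) by now apply Rinv_0_lt_compat.
rewrite Cmod_R, Rabs_pos_eq in H by lra. simpl (Re (RtoC _)) in H1.
apply is_lim_seq_ext with (fun n => Re (cexp (Lam n x' t - Lam n x 0) (Ang n x' t - Ang n x 0))
  / Cmod (cexp (Lam n x' t - Lam n x 0) (Ang n x' t - Ang n x 0))).
- intros n. rewrite Cmod_cexp. unfold cexp. simpl.
  field. apply Rgt_not_eq, exp_pos.
- replace (Finite 1) with (Finite (/ Fr (eps * x) / / Fr (eps * x))) by (f_equal; field; lra).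
  apply is_lim_seq_div'; auto. lra.
Qed.

End OneZero.

Lemma pos_seq_lower (v : nat -> R) :
  (forall n, 0 < v n) -> is_lim_seq v 1 -> exists k, 0 < k <= 1 /\ forall n, k <= v n.
Proof.
intros Hv Hl. apply is_lim_seq_spec in Hl.
assert (H2 : 0 < / 2) by lra.
destruct (Hl (mkposreal _ H2)) as [N HN]. simpl in HN.
assert (Hfin : exists k, 0 < k <= / 2 /\ forall n, (n < N)%nat -> k <= v n).
{ clear HN. induction N as [|N [k [Hk IH]]].
  - exists (/ 2). split; [lra|]. intros n Hn. lia.
  - exists (Rmin k (v N)). split.
    + split; [apply Rmin_glb_lt; [lra|apply Hv]|]. eapply Rle_trans; [apply Rmin_l|lra].
    + intros n Hn. destruct (Nat.eq_dec n N) as [E|E].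
      * subst n. apply Rmin_r.
      * eapply Rle_trans; [apply Rmin_l|]. apply IH. lia. }
destruct Hfin as [k [Hk Hkn]]. exists k. split; [lra|].
intros n. destruct (le_lt_dec N n) as [H|H]; [|now apply Hkn].
specialize (HN n H). apply Rabs_def2 in HN. lra.
Qed.

Lemma geom_lim0 : is_lim_seq (fun n => Rabs q ^ n) 0.
Proof. apply is_lim_seq_geom. rewrite Rabs_Rabsolu. lra. Qed.

(** The products |x + cc j| |q|^(j+1) = |1 + eps x q^(j+1)| are nonzero and tend to 1. The resulting
    geometric bound makes the perturbations of the arguments summable in j. *)
Lemma cc_lower (x : R) : (forall j, x + cc j <> 0) ->
  exists k, 0 < k <= 1 /\ forall j, k * / Rabs q ^ S j <= Rabs (x + cc j).
Proof.
intros Hx.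
destruct (pos_seq_lower (fun j => Rabs (1 + eps * x * q ^ S j))) as [k [Hk Hkj]].
- intros j. apply Rabs_pos_lt. intros E. apply (Hx j). unfold cc.
  assert (Hq0 : q ^ S j <> 0) by apply pow_nonzero, q_neq0.
  replace (x + eps / q ^ S j) with (eps * (1 + eps * x * q ^ S j) / q ^ S j - (eps * eps - 1) * x)
    by (field; auto).
  rewrite E, eps_sq. field. exact Hq0.
- replace (Finite 1) with (Finite (Rabs (1 + eps * x * 0)))
    by (f_equal; rewrite Rmult_0_r, Rplus_0_r; apply Rabs_R1).
  apply (is_lim_seq_abs (fun n => 1 + eps * x * q ^ S n) (1 + eps * x * 0)).
  apply is_lim_seq_plus'; [apply is_lim_seq_const|].
  apply is_lim_seq_mult'; [apply is_lim_seq_const|].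
  apply (is_lim_seq_incr_1 (fun n => q ^ n)). apply is_lim_seq_geom. lra.
- exists k. split; [exact Hk|]. intros j. specialize (Hkj j).
  assert (Hq0 : q ^ S j <> 0) by apply pow_nonzero, q_neq0.
  replace (x + cc j) with (eps * (1 + eps * x * q ^ S j) * / q ^ S j).
  + rewrite !Rabs_mult, eps_abs, Rmult_1_l, Rabs_inv, Rabs_pow_eq.
    apply Rmult_le_compat_r; [|exact Hkj].
    left. apply Rinv_0_lt_compat, pow_lt. lra.
  + unfold cc. pose proof eps_sq as He.
    replace (eps * (1 + eps * x * q ^ S j) * / q ^ S j) with (eps / q ^ S j + (eps * eps) * x)
      by (field; exact Hq0).
    rewrite He. ring.
Qed.

Lemma atan_abs_le (v : R) : Rabs (atan v) <= Rabs v.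
Proof.
assert (Hpos : forall w, 0 <= w -> 0 <= atan w <= w).
{ intros w Hw. destruct (Req_dec w 0) as [E|E]; [rewrite E, atan_0; lra|].
  assert (Hw0 : 0 < w) by lra.
  split; [rewrite <- atan_0; left; apply atan_increasing; exact Hw0|].
  destruct (MVT_gen atan 0 w (fun z => / (1 + z ^ 2))) as [c [Hcin Hm]].
  - intros z _. apply is_derive_Reals, derivable_pt_lim_atan.
  - intros z _. apply derivable_continuous_pt. exists (/ (1 + z ^ 2)). apply derivable_pt_lim_atan.
  - rewrite atan_0, !Rminus_0_r in Hm. rewrite Hm.
    assert (/ (1 + c ^ 2) <= 1).
    { rewrite <- Rinv_1. apply Rinv_le_contravar; [lra|]. pose proof (pow2_ge_0 c). lra. }
    nra. }
destruct (Rle_lt_dec 0 v) as [H|H].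
- specialize (Hpos v H). rewrite !Rabs_pos_eq; lra.
- specialize (Hpos (- v)). rewrite atan_opp in Hpos. rewrite !Rabs_left1; lra.
Qed.

Lemma atan_lip (v w : R) : Rabs (atan v - atan w) <= Rabs (v - w).
Proof.
destruct (MVT_gen atan w v (fun z => / (1 + z ^ 2))) as [c [Hcin Hm]].
- intros z _. apply is_derive_Reals, derivable_pt_lim_atan.
- intros z _. apply derivable_continuous_pt. exists (/ (1 + z ^ 2)). apply derivable_pt_lim_atan.
- rewrite Hm, Rabs_mult.
  assert (H1 : 0 < / (1 + c ^ 2) <= 1).
  { pose proof (pow2_ge_0 c). split; [apply Rinv_0_lt_compat; lra|].
    rewrite <- Rinv_1. apply Rinv_le_contravar; lra. }
  rewrite (Rabs_pos_eq (/ (1 + c ^ 2))) by lra.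
  pose proof (Rabs_pos (v - w)). nra.
Qed.

Lemma argu_close (v v' y : R) : v <> 0 -> Rabs (v' - v) <= Rabs v / 2 -> 0 <= y ->
  Rabs (argu v' y - argu v 0) <= 2 * y / Rabs v.
Proof.
intros Hv Hd Hy. pose proof (Rabs_pos_lt v Hv) as Hp.
assert (Hs : v' <> 0 /\ (if Rlt_dec v' 0 then PI else 0) = (if Rlt_dec v 0 then PI else 0)
   /\ Rabs v / 2 <= Rabs v').
{ apply Rabs_le_between in Hd.
  destruct (Rlt_dec v 0) as [H|H].
  - rewrite (Rabs_left v) in * by lra. destruct (Rlt_dec v' 0); [|lra].
    rewrite (Rabs_left v') by lra. repeat split; lra.
  - rewrite (Rabs_pos_eq v) in * by lra. destruct (Rlt_dec v' 0); [lra|].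
    rewrite (Rabs_pos_eq v') by lra. repeat split; lra. }
destruct Hs as [Hv' [Hif Hlow]].
rewrite !argu_atan by (auto; lra). rewrite Hif.
replace (0 / v) with 0 by (field; exact Hv). rewrite atan_0.
match goal with |- Rabs ?a <= _ => replace a with (atan (y / v')) by ring end.
eapply Rle_trans; [apply atan_abs_le|].
unfold Rdiv. rewrite Rabs_mult, Rabs_inv, (Rabs_pos_eq y) by exact Hy.
replace (2 * y * / Rabs v) with (y * / (Rabs v / 2)) by (field; lra).
apply Rmult_le_compat_l; [exact Hy|]. apply Rinv_le_contravar; lra.
Qed.

Lemma argu_dd (x y : R) (j : nat) : x <= - B -> 0 <= y ->
  Rabs (argu (x + dd j) y - argu x y) <= y * / (B - 1) * Rabs q ^ j.
Proof.
intros Hx Hy. pose proof (x_dd x j Hx) as Hd.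
rewrite !argu_atan by lra.
destruct (Rlt_dec (x + dd j) 0) as [H1|H1]; [|lra].
destruct (Rlt_dec x 0) as [H2|H2]; [|lra].
match goal with |- Rabs ?a <= _ =>
  replace a with (atan (y / (x + dd j)) - atan (y / x)) by ring end.
eapply Rle_trans; [apply atan_lip|].
replace (y / (x + dd j) - y / x) with (y * (- dd j * (/ (x + dd j) * / x))) by (field; lra).
rewrite !Rabs_mult, (Rabs_pos_eq y), Rabs_Ropp by exact Hy.
rewrite Rmult_assoc. apply Rmult_le_compat_l; [exact Hy|].
assert (E : Rabs (dd j) = Rabs q ^ j).
{ unfold dd. rewrite Rabs_mult, eps_abs, Rabs_pow_eq. ring. }
rewrite E, Rmult_comm. apply Rmult_le_compat_r; [apply pow_le; lra|].
rewrite !Rabs_inv, !Rabs_left by lra.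
rewrite <- (Rmult_1_r (/ (B - 1))). apply Rmult_le_compat.
- left; apply Rinv_0_lt_compat; lra.
- left; apply Rinv_0_lt_compat; lra.
- apply Rinv_le_contravar; lra.
- rewrite <- Rinv_1. apply Rinv_le_contravar; lra.
Qed.

Lemma Bz_arg_lim (x y : R) : x <= - B ->
  is_lim_seq (fun n => atan (Im (Bz n x y) / Re (Bz n x y)))
   (atan (Im (theta q (inv_arg x y)) / Re (theta q (inv_arg x y)))).
Proof.
intros Hx. pose proof (Bz_lim x y) as H.
apply (is_lim_seq_continuous atan (fun n => Im (Bz n x y) / Re (Bz n x y))).
- apply derivable_continuous_pt. eexists. apply derivable_pt_lim_atan.
- apply is_lim_seq_div'; [now apply Clim_Im|now apply Clim_Re|].
  apply Rgt_not_eq. now apply theta_inv_Re.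
Qed.

Lemma lim_seq_diff0 (v : nat -> R) (l : R) :
  is_lim_seq v l -> is_lim_seq (fun n => v (S n) - v n) 0.
Proof.
intros H. replace (Finite 0) with (Finite (l - l)) by (f_equal; ring).
apply is_lim_seq_minus'; [|exact H]. now apply (is_lim_seq_incr_1 v).
Qed.

(** The two new factors and the new term of the partial sum each change the argument difference by a
    quantity tending to 0. Together with the cosine limit this excludes jumps by multiples of 2
    PI. *)
Lemma Ang_step (x' t x : R) :
  x' <= - B -> 0 < t -> x <= - B -> (forall j, x + cc j <> 0) ->
  is_lim_seq (fun n => (Ang (S n) x' t - Ang (S n) x 0) - (Ang n x' t - Ang n x 0)) 0.
Proof.
intros Hx' Ht Hx Hnc.
apply is_lim_seq_ext with (fun n =>
  (argu (x' + cc n) t - argu (x + cc n) 0) + (argu (x' + dd n) t - argu x' t)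
  - (argu (x + dd n) 0 - argu x 0)
  - (atan (Im (Bz (S n) x' t) / Re (Bz (S n) x' t)) - atan (Im (Bz n x' t) / Re (Bz n x' t)))
  + (atan (Im (Bz (S n) x 0) / Re (Bz (S n) x 0)) - atan (Im (Bz n x 0) / Re (Bz n x 0)))).
{ intros n. unfold Ang. cbn [rsum]. ring. }
assert (Hddlim : forall z y, z <= - B -> 0 <= y ->
  is_lim_seq (fun n => argu (z + dd n) y - argu z y) 0).
{ intros z y Hz Hy. apply is_lim_seq_abs_0.
  apply is_lim_seq_squeeze0 with (fun n => y * / (B - 1) * Rabs q ^ n).
  - intros n. split; [apply Rabs_pos|]. now apply argu_dd.
  - replace (Finite 0) with (Finite (y * / (B - 1) * 0)) by (f_equal; ring).
    apply is_lim_seq_mult'; [apply is_lim_seq_const|apply geom_lim0]. }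
replace (Finite 0) with (Finite (0 + 0 - 0 - 0 + 0)) by (f_equal; ring).
apply is_lim_seq_plus'; [apply is_lim_seq_minus'; [apply is_lim_seq_minus';
  [apply is_lim_seq_plus'|]|]|].
- destruct (cc_lower x Hnc) as [k [Hk Hkj]].
  assert (Hlim : is_lim_seq (fun n => 2 * t * / k * Rabs q ^ S n) 0).
  { replace (Finite 0) with (Finite (2 * t * / k * 0)) by (f_equal; ring).
    apply is_lim_seq_mult'; [apply is_lim_seq_const|].
    apply (is_lim_seq_incr_1 (fun n => Rabs q ^ n)), geom_lim0. }
  apply is_lim_seq_abs_0.
  assert (Hev : exists N, forall n, (N <= n)%nat -> Rabs (x' - x) * Rabs q ^ S n <= k / 2).
  { assert (Hl2 : is_lim_seq (fun n => Rabs (x' - x) * Rabs q ^ S n) 0).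
    { replace (Finite 0) with (Finite (Rabs (x' - x) * 0)) by (f_equal; ring).
      apply is_lim_seq_mult'; [apply is_lim_seq_const|].
      apply (is_lim_seq_incr_1 (fun n => Rabs q ^ n)), geom_lim0. }
    apply is_lim_seq_spec in Hl2. assert (Hk2 : 0 < k / 2) by lra.
    destruct (Hl2 (mkposreal _ Hk2)) as [N HN]. exists N. intros n Hn. specialize (HN n Hn).
    simpl pos in HN. rewrite Rminus_0_r in HN. apply Rabs_def2 in HN. lra. }
  destruct Hev as [N HN].
  apply (is_lim_seq_incr_n _ N). apply (is_lim_seq_incr_n _ N) in Hlim.
  apply is_lim_seq_squeeze0 with (2 := Hlim).
  intros n. split; [apply Rabs_pos|].
  specialize (HN (n + N)%nat ltac:(lia)). specialize (Hkj (n + N)%nat).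
  set (Q := Rabs q ^ S (n + N)) in *.
  assert (HQ : 0 < Q) by (apply pow_lt; lra).
  assert (Hp : 0 < k * / Q) by (apply Rmult_lt_0_compat; [lra|now apply Rinv_0_lt_compat]).
  eapply Rle_trans.
  + apply argu_close; [apply Hnc| |lra].
    replace (x' + cc (n + N) - (x + cc (n + N))) with (x' - x) by ring.
    apply Rle_trans with (k * / Q / 2); [|lra].
    apply Rmult_le_reg_r with Q; [exact HQ|].
    replace (k * / Q / 2 * Q) with (k / 2) by (field; lra). exact HN.
  + replace (2 * t * / k * Q) with (2 * t * / (k * / Q)) by (field; lra).
    unfold Rdiv. apply Rmult_le_compat_l; [lra|]. apply Rinv_le_contravar; lra.
- apply Hddlim; lra.
- apply Hddlim; lra.
- exact (lim_seq_diff0 _ _ (Bz_arg_lim x' t Hx')).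
- exact (lim_seq_diff0 _ _ (Bz_arg_lim x 0 Hx)).
Qed.

Lemma cos_lim_int (f : nat -> R) :
  is_lim_seq (fun n => cos (f n)) 1 -> is_lim_seq (fun n => f (S n) - f n) 0 ->
  exists k : Z, is_lim_seq f (2 * PI * IZR k).
Proof.
intros Hco Hd. pose proof PI_RGT_0 as HPI.
(* [kk] is an integer nearest to f / (2 PI), so d lies in [- PI, PI], where cos d near 1 forces d
   near 0; small increments of f then make [kk] eventually constant. *)
set (kk := fun n => up (f n / (2 * PI) - 1 / 2)).
set (d := fun n => f n - 2 * PI * IZR (kk n)).
assert (Hd1 : forall n, Rabs (d n) <= PI).
{ intros n. unfold d, kk. pose proof (archimed (f n / (2 * PI) - 1 / 2)) as [H1 H2].
  set (z := IZR (up (f n / (2 * PI) - 1 / 2))) in *.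
  assert (E : f n = 2 * PI * (f n / (2 * PI))) by (field; lra).
  apply Rabs_le. rewrite E. split; nra. }
assert (Hcd : forall n, cos (Rabs (d n)) = cos (f n)).
{ intros n.
  assert (E : cos (Rabs (d n)) = cos (d n)).
  { unfold Rabs. destruct (Rcase_abs (d n)); [apply cos_neg|reflexivity]. }
  rewrite E. unfold d.
  destruct (Z_le_dec 0 (kk n)) as [Hz|Hz].
  - rewrite <- (cos_period (f n - 2 * PI * IZR (kk n)) (Z.to_nat (kk n))).
    f_equal. rewrite INR_IZR_INZ, Z2Nat.id by lia. ring.
  - rewrite <- (cos_period (f n) (Z.to_nat (- kk n))).
    f_equal. rewrite INR_IZR_INZ, Z2Nat.id by lia. rewrite opp_IZR. ring. }
assert (Hd0 : is_lim_seq d 0).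
{ apply is_lim_seq_spec. intros e. apply is_lim_seq_spec in Hco.
  set (e' := Rmin e (PI / 2)).
  assert (He' : 0 < e' <= PI / 2).
  { unfold e'. split; [apply Rmin_glb_lt; [apply cond_pos|lra]|apply Rmin_r]. }
  assert (Hce : 0 < 1 - cos e').
  { pose proof (cos_decreasing_1 0 e') as H. rewrite cos_0 in H. lra. }
  destruct (Hco (mkposreal _ Hce)) as [N HN]. exists N. intros n Hn. specialize (HN n Hn).
  simpl in HN. apply Rabs_def2 in HN. rewrite Rminus_0_r.
  apply Rnot_le_lt. intros Hle. specialize (Hd1 n). specialize (Hcd n).
  assert (e' <= Rabs (d n)) by (eapply Rle_trans; [apply Rmin_l|exact Hle]).
  destruct (Req_dec e' (Rabs (d n))) as [E|E].
  - rewrite <- E in Hcd. lra.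
  - pose proof (cos_decreasing_1 e' (Rabs (d n))) as H'. lra. }
assert (Hk : is_lim_seq (fun n => 2 * PI * (IZR (kk (S n)) - IZR (kk n))) 0).
{ apply is_lim_seq_ext with (fun n => (f (S n) - f n) - (d (S n) - d n)).
  - intros n. unfold d. ring.
  - replace (Finite 0) with (Finite (0 - 0)) by (f_equal; ring).
    apply is_lim_seq_minus'; [exact Hd|]. exact (lim_seq_diff0 _ _ Hd0). }
apply is_lim_seq_spec in Hk.
destruct (Hk (mkposreal _ HPI)) as [N HN]. simpl in HN.
assert (Hconst : forall n, kk (N + n)%nat = kk N).
{ intros n. induction n as [|n IH]; [now rewrite Nat.add_0_r|].
  rewrite Nat.add_succ_r. specialize (HN (N + n)%nat ltac:(lia)).
  rewrite Rminus_0_r in HN. apply Rabs_def2 in HN. rewrite IH in HN.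
  rewrite <- minus_IZR in HN.
  assert (H1 : (kk (S (N + n)) - kk N < 1)%Z) by (apply lt_IZR; nra).
  assert (H2 : (-1 < kk (S (N + n)) - kk N)%Z) by (apply lt_IZR; nra).
  lia. }
exists (kk N). apply (is_lim_seq_incr_n _ N).
apply is_lim_seq_ext with (fun n => d (n + N)%nat + 2 * PI * IZR (kk N)).
- intros n. unfold d. rewrite (Nat.add_comm n N), Hconst. ring.
- replace (Finite (2 * PI * IZR (kk N))) with (Finite (0 + 2 * PI * IZR (kk N))) by (f_equal; ring).
  apply is_lim_seq_plus'; [|apply is_lim_seq_const].
  now apply (is_lim_seq_incr_n d N).
Qed.

(** Uniform in n and linear in t: for zeros low above the axis near x this keeps the argument
    difference away from - 2 PI. *)
Lemma Ang_close (x : R) : x <= - B -> (forall j, x + cc j <> 0) ->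
  exists C r, 0 < C /\ 0 < r /\ forall x' t n, x' <= - B -> Rabs (x' - x) <= r -> 0 < t ->
    Rabs (Ang n x' t - Ang n x 0) <= C * t.
Proof.
intros Hx Hnc. destruct (cc_lower x Hnc) as [k [Hk Hkj]].
pose proof om_pos as Hom0.
destruct (c_lt1 P om (Rlt_le _ _ Hom0) HP Hc) as [Hc1 Hc2].
pose proof (m_pos P om (Rlt_le _ _ Hom0) HP Hc) as Hm.
set (m := 1 - P * om / (1 - P * P * om)) in *.
set (be := P / (1 - P * P * om) ^ 2).
assert (Hbe : 0 < be).
{ unfold be. apply Rdiv_lt_0_compat; [lra|]. apply pow_lt. lra. }
set (S1 := / (1 - Rabs q)).
assert (HS1 : 0 < S1) by (apply Rinv_0_lt_compat; lra).
assert (HBi : 0 < / (B - 1)) by (apply Rinv_0_lt_compat; lra).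
assert (Hki : 0 < / k) by (apply Rinv_0_lt_compat; lra).
assert (Hmi : 0 < / m) by (apply Rinv_0_lt_compat; lra).
exists (2 + 2 * / k * S1 + / (B - 1) * S1 + be * / m), (k / 2).
split; [|split; [lra|]].
{ assert (0 < 2 * / k * S1) by (repeat apply Rmult_lt_0_compat; lra).
  assert (0 < / (B - 1) * S1) by (apply Rmult_lt_0_compat; lra).
  assert (0 < be * / m) by (apply Rmult_lt_0_compat; lra). lra. }
intros x' t n Hx' Hr Ht.
assert (Hx0 : 1 <= Rabs x) by (rewrite Rabs_left; lra).
assert (T1 : Rabs (argu x' t - argu x 0) <= 2 * t).
{ eapply Rle_trans; [apply argu_close; lra|].
  unfold Rdiv. rewrite <- (Rmult_1_r (2 * t)) at 2. apply Rmult_le_compat_l; [lra|].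
  rewrite <- Rinv_1. apply Rinv_le_contravar; lra. }
assert (T2 : Rabs (rsum (fun j => argu (x' + cc j) t) n - rsum (fun j => argu (x + cc j) 0) n)
   <= 2 * / k * S1 * t).
{ replace (rsum (fun j => argu (x' + cc j) t) n - rsum (fun j => argu (x + cc j) 0) n)
    with (rsum (fun j => argu (x' + cc j) t - argu (x + cc j) 0) n)
    by (clear; induction n as [|n IH]; simpl; [|rewrite IH]; ring).
  eapply Rle_trans; [apply rsum_abs|].
  apply Rle_trans with (rsum (fun j => 2 * / k * t * Rabs q ^ j) n).
  - apply rsum_le. intros j _. specialize (Hkj j).
    assert (HQ : 0 < Rabs q ^ S j) by (apply pow_lt; lra).
    assert (HQ1 : Rabs q ^ S j <= 1) by (rewrite <- (pow1 (S j)); apply pow_incr; lra).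
    assert (Hp : k <= k * / Rabs q ^ S j).
    { rewrite <- (Rmult_1_r k) at 1. apply Rmult_le_compat_l; [lra|].
      rewrite <- Rinv_1. apply Rinv_le_contravar; lra. }
    eapply Rle_trans; [apply argu_close; [apply Hnc| |lra]|].
    + replace (x' + cc j - (x + cc j)) with (x' - x) by ring. lra.
    + replace (2 * / k * t * Rabs q ^ j) with (2 * t * (/ k * Rabs q ^ j)) by ring.
      unfold Rdiv. apply Rmult_le_compat_l; [lra|].
      apply Rle_trans with (/ (k * / Rabs q ^ S j)).
      * apply Rinv_le_contravar; lra.
      * rewrite Rinv_mult, Rinv_inv. apply Rmult_le_compat_l; [lra|].
        simpl. assert (0 < Rabs q ^ j) by (apply pow_lt; lra). nra.
  - rewrite rsum_scal. replace (2 * / k * S1 * t) with (2 * / k * t * S1) by ring.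
    apply Rmult_le_compat_l; [|apply rsum_geom; lra].
    apply Rmult_le_pos; lra. }
assert (T3 : forall z y, z <= - B -> 0 <= y ->
   Rabs (rsum (fun j => argu (z + dd j) y - argu z y) n) <= / (B - 1) * S1 * y).
{ intros z y Hz Hy. eapply Rle_trans; [apply rsum_abs|].
  apply Rle_trans with (rsum (fun j => y * / (B - 1) * Rabs q ^ j) n).
  - apply rsum_le. intros j _. now apply argu_dd.
  - rewrite rsum_scal. replace (/ (B - 1) * S1 * y) with (y * / (B - 1) * S1) by ring.
    apply Rmult_le_compat_l; [|apply rsum_geom; lra].
    apply Rmult_le_pos; lra. }
assert (T4 : forall z y, z <= - B -> 0 <= y ->
   Rabs (atan (Im (Bz n z y) / Re (Bz n z y))) <= be * / m * y).
{ intros z y Hz Hy. eapply Rle_trans; [apply atan_abs_le|].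
  pose proof (tB_Re q P om HqP (Rlt_le _ _ Hom0) HP Hc _ (inv_arg_mod z y Hz) n) as HR.
  pose proof (tB_Im q P om HqP (Rlt_le _ _ Hom0) HP Hc _ (inv_arg_mod z y Hz) (S n)) as HI.
  fold (Bz n z y) in HR, HI. fold m in HR. fold be in HI.
  unfold Rdiv. rewrite Rabs_mult, Rabs_inv, (Rabs_pos_eq (Re _)) by lra.
  replace (be * / m * y) with (y * be * / m) by ring.
  apply Rmult_le_compat; [apply Rabs_pos|left; apply Rinv_0_lt_compat; lra| |apply Rinv_le_contravar; lra].
  eapply Rle_trans; [exact HI|]. apply Rmult_le_compat_r; [lra|].
  rewrite inv_arg_Im by lra. rewrite (Rabs_pos_eq y) by lra.
  unfold Rdiv. apply Rle_trans with (y * 1); [|lra]. apply Rmult_le_compat_l; [exact Hy|].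
  rewrite <- Rinv_1. apply Rinv_le_contravar; [lra|].
  pose proof (pow2_ge_0 y). nra. }
unfold Ang.
pose proof (T3 x' t Hx' (Rlt_le _ _ Ht)) as T3a. pose proof (T3 x 0 Hx (Rle_refl 0)) as T3b.
pose proof (T4 x' t Hx' (Rlt_le _ _ Ht)) as T4a. pose proof (T4 x 0 Hx (Rle_refl 0)) as T4b.
rewrite Rmult_0_r in T3b, T4b.
apply Rabs_le_between in T1. apply Rabs_le_between in T2.
apply Rabs_le_between in T3a. apply Rabs_le_between in T3b.
apply Rabs_le_between in T4a. apply Rabs_le_between in T4b.
apply Rabs_le. split; nra.
Qed.

Lemma thr_continuity (x : R) : continuity_pt (thr q) x.
Proof.
apply (PSeries_continuity (fun j => q ^ tri j)).
rewrite CV_radius_infinite_DAlembert; [exact I| |].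
- intros n. apply pow_nonzero, q_neq0.
- apply is_lim_seq_ext with (fun n => Rabs q ^ S n).
  + intros n. rewrite tri_S, pow_add. rewrite <- Rabs_pow_eq. f_equal.
    field. apply pow_nonzero, q_neq0.
  + apply (is_lim_seq_incr_1 (fun n => Rabs q ^ n)), geom_lim0.
Qed.

Lemma Fr_continuity (x : R) : x <= - B -> continuity_pt (fun x => Fr (eps * x)) x.
Proof.
intros Hx.
assert (Hex : eps * x <> 0).
{ apply Rmult_integral_contrapositive_currified; [apply eps_neq0|lra]. }
assert (Hl : continuity_pt (fun x => eps * x) x) by (apply continuity_pt_mult; [apply continuity_pt_const; intros ? ?; reflexivity|apply continuity_pt_id]).
assert (Hi : continuity_pt (fun x => / (eps * x)) x) by (apply (continuity_pt_inv (fun x => eps * x)); assumption).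
assert (Ht : continuity_pt (fun x => thr q (/ (eps * x))) x).
{ apply (continuity_pt_comp (fun x => / (eps * x)) (thr q)); [exact Hi|apply thr_continuity]. }
unfold Fr, Jr.
apply (continuity_pt_div (fun x => eps * x * (thr q (eps * x) + thr q (/ (eps * x)) / (eps * x)))
  (fun x => thr q (/ (eps * x)))); [|exact Ht|].
- apply (continuity_pt_mult (fun x => eps * x)); [exact Hl|].
  apply (continuity_pt_plus (fun x => thr q (eps * x))).
  + apply (continuity_pt_comp (fun x => eps * x) (thr q)); [exact Hl|apply thr_continuity].
  + apply (continuity_pt_div (fun x => thr q (/ (eps * x))) (fun x => eps * x)); assumption.
- apply Rgt_not_eq. now apply thr_inv_pos.
Qed.

Lemma Fr_zero (x : R) : x <= - B -> thr q (eps * x) = 0 -> Fr (eps * x) = 1.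
Proof.
intros Hx H0. unfold Fr, Jr. rewrite H0.
pose proof (thr_inv_pos x Hx).
assert (Hex : eps * x <> 0).
{ apply Rmult_integral_contrapositive_currified; [apply eps_neq0|lra]. }
field. repeat split; try apply eps_neq0; lra.
Qed.

(** Let 2 PI k be the limit of the argument difference between the zero and x0. For k >= 0 the far
    point r of rank k has the argument of the zero, and Noshiro's inequality reads 0 < - t ln F(r)
    <= 0. For k < 0 and x <= x0 the base x0, where ln F = 0, gives 0 < - 2 PI k (x - x0) <= 0.
    Continuity is called upon for k < 0 and x slightly to the right of x0. *)
Lemma no_zero_left_of (x0 : R) :
  x0 < - B -> thr q (eps * x0) = 0 ->
  (forall k : nat, exists r, r <= x0 /\ 1 <= Fr (eps * r) /\
     exists N, forall m, (N <= m)%nat ->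
       Ang (2 * m) r 0 = Ang (2 * m) x0 0 + 2 * PI * INR k) ->
  exists d, 0 < d /\ forall x t, 0 < t -> theta q (RtoC eps * zpt x t)%C = RtoC 0 -> x0 + d < x.
Proof.
intros Hx0 Hz0 Hk. pose proof PI_RGT_0 as HPI.
pose proof (Fr_zero x0 (Rlt_le _ _ Hx0) Hz0) as HF0.
assert (Hnc0 : forall j, x0 + cc j <> 0) by (apply noncritical; lra).
destruct noshiro as [n0 Hno].
destruct (Ang_close x0 (Rlt_le _ _ Hx0) Hnc0) as [C [r [HC [Hr HAC]]]].
(* Heights below t1 keep the argument difference above - PI. [tau] is the value of t^2 / (x0^2 +
   t^2) at t1, which measures the gain of Noshiro's inequality on a vertical segment of height at
   least t1. *)
set (t1 := PI / C). assert (Ht1 : 0 < t1) by now apply Rdiv_lt_0_compat.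
set (tau := t1 ^ 2 / (x0 ^ 2 + t1 ^ 2)).
assert (Hx2 : 0 < x0 ^ 2) by (apply pow2_gt_0; lra).
assert (Ht2 : 0 < t1 ^ 2) by (apply pow2_gt_0; lra).
assert (Htau : 0 < tau) by (apply Rdiv_lt_0_compat; lra).
assert (Hgap : 0 < 1 - exp (- (eta * tau / 2))).
{ assert (0 < eta * tau) by now apply Rmult_lt_0_compat.
  assert (exp (- (eta * tau / 2)) < exp 0) by (apply exp_increasing; lra).
  rewrite exp_0 in H0. lra. }
destruct (proj1 (continuity_pt_locally (fun x => Fr (eps * x)) x0) (Fr_continuity x0 (Rlt_le _ _ Hx0))
   (mkposreal _ Hgap)) as [rho Hrho]. simpl in Hrho.
set (d := Rmin (Rmin r (rho / 2)) (Rmin (- B - x0) 1)).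
assert (Hd : 0 < d).
{ unfold d. pose proof (cond_pos rho). repeat apply Rmin_glb_lt; lra. }
assert (Hdr : d <= r) by (unfold d; eapply Rle_trans; [apply Rmin_l|apply Rmin_l]).
assert (Hdrho : d <= rho / 2) by (unfold d; eapply Rle_trans; [apply Rmin_l|apply Rmin_r]).
assert (HdB : d <= - B - x0) by (unfold d; eapply Rle_trans; [apply Rmin_r|apply Rmin_l]).
exists d. split; [exact Hd|]. intros x t Ht Hz. apply Rnot_le_lt. intros Hxd.
assert (HxB : x <= - B) by lra.
assert (Hev : forall s : nat, filterlim (fun m => (2 * m)%nat) Hierarchy.eventually Hierarchy.eventually).
{ intros _ Q [N HN]. exists N. intros n Hn. apply HN. lia. }
assert (Hlim : forall y f : R, y <= - B -> 0 < Fr (eps * y) ->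
   is_lim_seq (fun m => Ang (2 * m) x t - Ang (2 * m) y 0) f ->
   0 < t * - ln (Fr (eps * y)) - (x - y) * f).
{ intros y f Hy HF Hf.
  assert (Hnc : forall j, y + cc j <> 0) by (apply noncritical; lra).
  set (R2 := y ^ 2 + (x ^ 2 + t ^ 2)).
  pose proof (pow2_ge_0 x) as Hx'. pose proof (pow2_ge_0 y) as Hy'. pose proof (pow2_ge_0 t) as Ht'.
  assert (Ht0 : 0 < t ^ 2) by (apply pow2_gt_0; lra).
  assert (HR2 : 0 < R2) by (unfold R2; lra).
  apply Rlt_le_trans with (((x - y) ^ 2 + t ^ 2) * t * eta / R2 / 2).
  { pose proof (pow2_ge_0 (x - y)). unfold Rdiv.
    repeat apply Rmult_lt_0_compat; try lra. now apply Rinv_0_lt_compat. }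
  assert (HL : is_lim_seq (fun m => t * (Lam (2 * m) x t - Lam (2 * m) y 0)
     - (x - y) * (Ang (2 * m) x t - Ang (2 * m) y 0))
     (t * - ln (Fr (eps * y)) - (x - y) * f)).
  { apply is_lim_seq_minus'.
    - apply is_lim_seq_mult'; [apply is_lim_seq_const|].
      apply (is_lim_seq_subseq (fun n => Lam n x t - Lam n y 0)); [exact (Hev O)|].
      now apply Lam_lim.
    - apply is_lim_seq_mult'; [apply is_lim_seq_const|exact Hf]. }
  apply (is_lim_seq_incr_n _ n0) in HL.
  apply (is_lim_seq_le (fun _ => ((x - y) ^ 2 + t ^ 2) * t * eta / R2 / 2)
    _ (((x - y) ^ 2 + t ^ 2) * t * eta / R2 / 2) (t * - ln (Fr (eps * y)) - (x - y) * f))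
    with (3 := HL); [|apply is_lim_seq_const].
  intros n. replace x with (y + (x - y)) at 2 4 by ring.
  apply Hno; auto; try lia; unfold R2; lra. }
assert (Hnn : 0 < Fr (eps * x0)) by lra.
assert (Hstep2 : is_lim_seq (fun n => (Ang (S n) x t - Ang (S n) x0 0) - (Ang n x t - Ang n x0 0)) 0)
  by (apply Ang_step; auto; lra).
destruct (cos_lim_int (fun n => Ang n x t - Ang n x0 0)) as [k Hkl].
{ now apply Ang_cos_lim; try lra. }
{ exact Hstep2. }
assert (Hkl2 : is_lim_seq (fun m => Ang (2 * m) x t - Ang (2 * m) x0 0) (2 * PI * IZR k)).
{ exact (is_lim_seq_subseq (fun n => Ang n x t - Ang n x0 0) _ _ (Hev O) Hkl). }
destruct (Z_le_dec 0 k) as [Hk0|Hk0].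
- destruct (Hk (Z.to_nat k)) as [y [Hy [HFy [N HN]]]].
  assert (Hyl : is_lim_seq (fun m => Ang (2 * m) x t - Ang (2 * m) y 0) 0).
  { apply (is_lim_seq_incr_n _ N).
    apply is_lim_seq_ext with (fun m => (Ang (2 * (m + N)) x t - Ang (2 * (m + N)) x0 0) - 2 * PI * IZR k).
    - intros m. rewrite (HN (m + N)%nat) by lia. rewrite INR_IZR_INZ, Z2Nat.id by lia. ring.
    - replace (Finite 0) with (Finite (2 * PI * IZR k - 2 * PI * IZR k)) by (f_equal; ring).
      apply is_lim_seq_minus'; [|apply is_lim_seq_const].
      now apply (is_lim_seq_incr_n (fun m => Ang (2 * m) x t - Ang (2 * m) x0 0) N). }
  specialize (Hlim y 0 ltac:(lra) ltac:(lra) Hyl).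
  assert (0 <= ln (Fr (eps * y))).
  { rewrite <- ln_1. destruct HFy as [HFy|HFy]; [left; apply ln_increasing; lra|rewrite <- HFy; lra]. }
  nra.
- assert (Hkn : IZR k <= -1) by (apply IZR_le; lia).
  destruct (Rle_lt_dec x x0) as [Hxx|Hxx].
  + specialize (Hlim x0 _ ltac:(lra) Hnn Hkl2). rewrite HF0, ln_1 in Hlim.
    assert (0 <= (x0 - x) * (2 * PI * - IZR k)).
    { apply Rmult_le_pos; [lra|]. apply Rmult_le_pos; lra. }
    lra.
  + assert (Hball : ball (x0 : R_UniformSpace) rho x).
    { unfold ball; simpl; unfold AbsRing_ball, abs, minus, plus, opp; simpl.
      pose proof (cond_pos rho). apply Rabs_def1; lra. }
    specialize (Hrho x Hball). rewrite HF0 in Hrho. apply Rabs_def2 in Hrho.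
    assert (HFx : exp (- (eta * tau / 2)) < Fr (eps * x)) by lra.
    assert (HFx0 : 0 < Fr (eps * x)) by (pose proof (exp_pos (- (eta * tau / 2))); lra).
    assert (Hnc : forall j, x + cc j <> 0) by (apply noncritical; lra).
    (* Vertical segment above x itself: for t >= t1 Noshiro's inequality would make - ln F (eps x)
       at least eta tau / 2, against the choice of [rho]. *)
    assert (Htt : t < t1).
    { apply Rnot_le_lt. intros Hle.
      assert (HL : is_lim_seq (fun m => t * (Lam (2 * m) x t - Lam (2 * m) x 0)) (t * - ln (Fr (eps * x)))).
      { apply is_lim_seq_mult'; [apply is_lim_seq_const|].
        apply (is_lim_seq_subseq (fun n => Lam n x t - Lam n x 0)); [exact (Hev O)|].
        now apply Lam_lim. }
      apply (is_lim_seq_incr_n _ n0) in HL.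
      assert (Hge : t ^ 2 * t * eta / (x ^ 2 + t ^ 2) / 2 <= t * - ln (Fr (eps * x))).
      { apply (is_lim_seq_le (fun _ => t ^ 2 * t * eta / (x ^ 2 + t ^ 2) / 2)
          _ (t ^ 2 * t * eta / (x ^ 2 + t ^ 2) / 2) (t * - ln (Fr (eps * x))))
          with (3 := HL); [|apply is_lim_seq_const].
        intros n. pose proof (pow2_ge_0 x). pose proof (pow2_ge_0 t).
        pose proof (Hno (n + n0)%nat x 0 t (x ^ 2 + t ^ 2)) as H2.
        rewrite !Rplus_0_r, Rmult_0_l, Rminus_0_r in H2.
        replace (0 ^ 2 + t ^ 2) with (t ^ 2) in H2 by ring.
        apply H2; auto; try lia; lra. }
      assert (Hln : - ln (Fr (eps * x)) < eta * tau / 2).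
      { apply Ropp_lt_cancel. rewrite Ropp_involutive.
        rewrite <- (ln_exp (- (eta * tau / 2))). apply ln_increasing; [apply exp_pos|exact HFx]. }
      assert (Hx2' : 0 < x ^ 2) by (apply pow2_gt_0; lra).
      assert (Ht2' : t1 ^ 2 <= t ^ 2) by (apply pow_incr; lra).
      assert (Hxx2 : x ^ 2 <= x0 ^ 2) by nra.
      assert (Htau' : tau <= t ^ 2 / (x ^ 2 + t ^ 2)).
      { unfold tau. apply Rmult_le_reg_r with ((x0 ^ 2 + t1 ^ 2) * (x ^ 2 + t ^ 2)); [nra|].
        replace (t1 ^ 2 / (x0 ^ 2 + t1 ^ 2) * ((x0 ^ 2 + t1 ^ 2) * (x ^ 2 + t ^ 2)))
          with (t1 ^ 2 * (x ^ 2 + t ^ 2)) by (field; lra).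
        replace (t ^ 2 / (x ^ 2 + t ^ 2) * ((x0 ^ 2 + t1 ^ 2) * (x ^ 2 + t ^ 2)))
          with (t ^ 2 * (x0 ^ 2 + t1 ^ 2)) by (field; lra).
        nra. }
      replace (t ^ 2 * t * eta / (x ^ 2 + t ^ 2) / 2) with (t * (eta * (t ^ 2 / (x ^ 2 + t ^ 2)) / 2)) in Hge
        by (field; lra).
      apply Rmult_le_reg_l in Hge; [|exact Ht].
      assert (eta * tau <= eta * (t ^ 2 / (x ^ 2 + t ^ 2))) by (apply Rmult_le_compat_l; lra).
      lra. }
    assert (HA : forall n, - (C * t) <= Ang n x t - Ang n x0 0).
    { intros n. pose proof (HAC x t n HxB ltac:(apply Rabs_le; lra) Ht) as H.
      apply Rabs_le_between in H. lra. }
    assert (HCt : C * t < PI).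
    { apply Rlt_le_trans with (C * t1); [apply Rmult_lt_compat_l; lra|].
      right. unfold t1. field. lra. }
    assert (Hcontra : - (C * t) <= 2 * PI * IZR k).
    { apply (is_lim_seq_le (fun _ => - (C * t)) (fun n => Ang n x t - Ang n x0 0)
        (- (C * t)) (2 * PI * IZR k)); auto. apply is_lim_seq_const. }
    nra.
Qed.

End Noshiro.

(** * Arguments on the real axis *)

Section RealAngle.

Variables (q eps : R).
Hypothesis Hq : 0 < Rabs q < 1.
Hypothesis Heps : eps = 1 \/ eps = - 1.

Lemma csum_Im0 (f : nat -> C) (n : nat) : (forall j, Im (f j) = 0) -> Im (csum f n) = 0.
Proof.
intros H. induction n as [|n IH]; [reflexivity|].
change (Im (csum f n) + Im (f n) = 0). rewrite IH, H. ring.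
Qed.

Lemma Bz_real (n : nat) (x : R) : x <> 0 -> Im (Bz q eps n x 0) = 0.
Proof.
intros Hx. unfold Bz, tB. apply csum_Im0. intros j.
rewrite inv_arg_real by auto. unfold tterm. rewrite <- RtoC_pow, <- RtoC_mult. reflexivity.
Qed.

Lemma argu_neg (x : R) : x < 0 -> argu x 0 = PI.
Proof.
intros H. unfold argu. destruct (Req_EM_T 0 0); [|lra].
destruct (Rlt_dec x 0); [reflexivity|lra].
Qed.

Lemma argu_nonneg (x : R) : 0 <= x -> argu x 0 = 0.
Proof.
intros H. unfold argu. destruct (Req_EM_T 0 0); [|lra].
destruct (Rlt_dec x 0); [lra|reflexivity].
Qed.

Lemma dd_le1 (j : nat) : Rabs (dd q eps j) <= 1.
Proof.
unfold dd. rewrite Rabs_mult, (eps_abs eps Heps), Rabs_pow_eq, Rmult_1_l.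
rewrite <- (pow1 j). apply pow_incr. lra.
Qed.

(** On the real axis the partial sum of theta(1/x) is real, so its [atan] vanishes, and |dd j| <= 1
    < |x| gives x + dd j the sign of x. What remains counts the zeros of J that have been passed, PI
    for each. *)
Lemma Ang_real (n : nat) (x : R) : x < - 1 ->
  Ang q eps n x 0 = PI + rsum (fun j => argu (x + cc q eps j) 0) n.
Proof.
intros Hx. unfold Ang. rewrite Bz_real by lra.
replace (0 / _) with 0 by (unfold Rdiv; ring). rewrite atan_0, argu_neg by lra.
rewrite (rsum_ext (fun j => argu (x + dd q eps j) 0 - PI) (fun j => 0 * 0)).
- rewrite (rsum_scal 0 (fun _ => 0)). ring.
- intros j _. pose proof (dd_le1 j) as H. apply Rabs_le_between in H.
  rewrite argu_neg by lra. ring.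
Qed.

Lemma cc_abs (j : nat) : Rabs (cc q eps j) = / Rabs q ^ S j.
Proof.
unfold cc, Rdiv. rewrite Rabs_mult, (eps_abs eps Heps), Rabs_inv, Rabs_pow_eq. ring.
Qed.

Lemma cc_large (x : R) : exists N, forall j, (N <= j)%nat -> Rabs x < Rabs (cc q eps j).
Proof.
assert (Hl : is_lim_seq (fun n => Rabs x * Rabs q ^ S n) 0).
{ replace (Finite 0) with (Finite (Rabs x * 0)) by (f_equal; ring).
  apply is_lim_seq_mult'; [apply is_lim_seq_const|].
  apply (is_lim_seq_incr_1 (fun n => Rabs q ^ n)).
  apply is_lim_seq_geom. rewrite Rabs_Rabsolu. lra. }
apply is_lim_seq_spec in Hl. destruct (Hl (mkposreal 1 Rlt_0_1)) as [N HN].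
exists N. intros j Hj. specialize (HN j Hj). simpl pos in HN.
rewrite Rminus_0_r in HN. apply Rabs_def2 in HN. rewrite cc_abs.
assert (HQ : 0 < Rabs q ^ S j) by (apply pow_lt; lra).
apply Rmult_lt_reg_r with (Rabs q ^ S j); [exact HQ|].
rewrite Rinv_l by lra. lra.
Qed.

(* Moving from x to x / q^M passes M more of the points -cc j, of which the
   last M, when negative, already counted PI. *)
Lemma Ang_shift (M : nat) (x T : R) :
  0 < q ^ M -> x < - 1 ->
  (exists N, forall m, (N <= m)%nat ->
     rsum (fun i => argu (x + cc q eps (2 * m + i)) 0) M = INR M * PI - T) ->
  exists N, forall m, (N <= m)%nat ->
     Ang q eps (2 * m + M) (x / q ^ M) 0 = Ang q eps (2 * m + M) x 0 + T.
Proof.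
intros HM Hx [N HN]. exists N. intros m Hm. specialize (HN m Hm).
assert (HM1 : q ^ M <= 1).
{ eapply Rle_trans; [apply Rle_abs|]. rewrite Rabs_pow_eq.
  rewrite <- (pow1 M). apply pow_incr. lra. }
assert (Hq0 : q <> 0) by (intros E; rewrite E, Rabs_R0 in Hq; lra).
assert (Hx' : x / q ^ M <= x).
{ apply Rmult_le_reg_r with (q ^ M); [exact HM|].
  unfold Rdiv. rewrite Rmult_assoc, Rinv_l by lra. nra. }
rewrite !Ang_real by lra.
rewrite (rsum_app (fun j => argu (x + cc q eps j) 0)), HN.
rewrite (Nat.add_comm (2 * m) M), (rsum_app (fun j => argu (x / q ^ M + cc q eps j) 0)).
rewrite (rsum_ext _ (fun _ => PI) M).
- rewrite (rsum_ext (fun j => argu (x / q ^ M + cc q eps (M + j)) 0)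
    (fun j => argu (x + cc q eps j) 0)).
  + assert (Hc : forall k, rsum (fun _ => PI) k = INR k * PI).
    { intros k. induction k as [|k IH]; [simpl; ring|]. cbn [rsum].
      rewrite IH, S_INR. ring. }
    rewrite Hc. ring.
  + intros j _.
    assert (E : x / q ^ M + cc q eps (M + j) = (x + cc q eps j) / q ^ M).
    { unfold cc. replace (S (M + j)) with (M + S j)%nat by lia.
      rewrite pow_add. field. split; [apply (pow_nonzero q (S j) Hq0)|lra]. }
    rewrite E. unfold argu. destruct (Req_EM_T 0 0) as [_|]; [|lra].
    assert (Hi : 0 < / q ^ M) by now apply Rinv_0_lt_compat.
    unfold Rdiv.
    destruct (Rlt_dec (x + cc q eps j) 0) as [H|H];
      destruct (Rlt_dec ((x + cc q eps j) * / q ^ M) 0) as [H'|H']; try reflexivity; nra.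
- intros j Hj. apply argu_neg.
  assert (Hcc : cc q eps j <= / q ^ M).
  { eapply Rle_trans; [apply Rle_abs|]. rewrite cc_abs.
    apply Rinv_le_contravar; [exact HM|].
    rewrite <- (Rabs_pos_eq (q ^ M)) by lra. rewrite Rabs_pow_eq.
    replace M with (S j + (M - S j))%nat by lia. rewrite pow_add.
    assert (0 < Rabs q ^ S j) by (apply pow_lt; lra).
    assert (Rabs q ^ (M - S j) <= 1) by (rewrite <- (pow1 (M - S j)); apply pow_incr; lra).
    nra. }
  assert (Hi : 0 < / q ^ M) by now apply Rinv_0_lt_compat.
  unfold Rdiv. nra.
Qed.

End RealAngle.

(** For q > 0 all [cc j] are positive, so the far indices count 0 at x, and two powers of q pass two
    zeros: a full turn. *)
Lemma Ang_shift_pos (q x : R) : 0 < q < 1 -> x < - 1 ->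
  exists N, forall m, (N <= m)%nat ->
    Ang q 1 (2 * m) (x / q ^ 2) 0 = Ang q 1 (2 * m) x 0 + 2 * PI.
Proof.
intros Hq Hx. assert (Hq' : 0 < Rabs q < 1) by (rewrite Rabs_pos_eq; lra).
assert (He : 1 = 1 \/ 1 = - 1) by now left.
destruct (Ang_shift q 1 Hq' He 2 x (2 * PI)) as [N HN].
- apply pow_lt; lra.
- exact Hx.
- destruct (cc_large q 1 Hq' He x) as [N HN]. exists N. intros m Hm. simpl rsum.
  assert (Hj : forall j, (N <= j)%nat -> argu (x + cc q 1 j) 0 = 0).
  { intros j Hj. apply argu_nonneg. specialize (HN j Hj).
    assert (0 < cc q 1 j).
    { unfold cc. apply Rdiv_lt_0_compat; [lra|]. apply pow_lt. lra. }
    rewrite (Rabs_pos_eq (cc _ _ _)) in HN by lra. rewrite Rabs_left in HN by lra. lra. }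
  rewrite !Hj by lia. simpl. ring.
- exists (S N). intros m Hm. replace (2 * m)%nat with (2 * (m - 1) + 2)%nat by lia.
  apply HN. lia.
Qed.

(** For q < 0 the signs of [cc j] alternate and only every second zero is passed, so a full turn
    takes four powers of q. Of four consecutive far indices two already counted PI each, leaving 4
    PI - 2 PI. *)
Lemma Ang_shift_neg (q eps x : R) : -1 < q < 0 -> eps = 1 \/ eps = - 1 -> x < - 1 ->
  exists N, forall m, (N <= m)%nat ->
    Ang q eps (2 * m) (x / q ^ 4) 0 = Ang q eps (2 * m) x 0 + 2 * PI.
Proof.
intros Hq He Hx. assert (Hq' : 0 < Rabs q < 1) by (rewrite Rabs_left; lra).
destruct (Ang_shift q eps Hq' He 4 x (2 * PI)) as [N HN].
- replace (q ^ 4) with ((q ^ 2) ^ 2) by ring. apply pow_lt. nra.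
- exact Hx.
- destruct (cc_large q eps Hq' He x) as [N HN]. exists N. intros m Hm.
  assert (Hj : forall j, (N <= j)%nat ->
     argu (x + cc q eps j) 0 + argu (x + cc q eps (S j)) 0 = PI).
  { intros j Hj. pose proof (HN j Hj) as H1. pose proof (HN (S j) ltac:(lia)) as H2.
    assert (Hs : cc q eps (S j) = cc q eps j * / q).
    { unfold cc. simpl. field. split; [lra|apply pow_nonzero; lra]. }
    assert (Hqi : / q < 0) by now apply Rinv_lt_0_compat.
    rewrite (Rabs_left x) in * by lra.
    destruct (Rle_lt_dec 0 (cc q eps j)) as [H|H].
    - rewrite (Rabs_pos_eq (cc q eps j)) in H1 by lra.
      assert (cc q eps (S j) < 0) by (rewrite Hs; nra).
      rewrite argu_nonneg, argu_neg by lra. ring.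
    - rewrite (Rabs_left (cc q eps j)) in H1 by lra.
      assert (0 < cc q eps (S j)) by (rewrite Hs; nra).
      rewrite (Rabs_pos_eq (cc q eps (S j))) in H2 by lra.
      rewrite argu_neg, argu_nonneg by lra. ring. }
  pose proof (Hj (2 * m + 0)%nat ltac:(lia)) as A. pose proof (Hj (2 * m + 2)%nat ltac:(lia)) as D.
  replace (S (2 * m + 0)) with (2 * m + 1)%nat in A by lia.
  replace (S (2 * m + 2)) with (2 * m + 3)%nat in D by lia.
  cbn [rsum]. replace (INR 4) with 4 by (simpl; ring). lra.
- exists (S (S N)). intros m Hm. replace (2 * m)%nat with (2 * (m - 2) + 4)%nat by lia.
  apply HN. lia.
Qed.

(** * Growth of F along the base points *)

Lemma thr_near1 (q P om w : R) : 0 < Rabs q < 1 -> Rabs q <= P -> 0 < P <= 1 -> 0 <= om ->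
  P * om + P * P * om < 1 -> Rabs w <= om ->
  Rabs (thr q w - 1) <= P * om / (1 - P * P * om).
Proof.
intros Hq HqP HP Hom Hc Hw.
assert (HL : is_lim_seq (fun n => Cmod (tB q (RtoC w) (S n) - 1)%C) (Rabs (thr q w - 1))).
{ replace (Rabs (thr q w - 1)) with (Cmod (theta q (RtoC w) - RtoC 1)%C).
  - apply (Clim_Cmod (fun n => tB q (RtoC w) (S n) - 1)%C).
    unfold Cminus. apply Clim_plus; [|apply Clim_const].
    apply (Clim_subseq (csum (tterm q (RtoC w))) _ S); [|now apply theta_lim].
    intros Q [n0 H]. exists n0. intros n Hn. apply H. lia.
  - rewrite theta_real by exact Hq. rewrite <- RtoC_minus. apply Cmod_R. }
apply (is_lim_seq_le (fun n => Cmod (tB q (RtoC w) (S n) - 1)%C) (fun _ => P * om / (1 - P * P * om))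
  (Rabs (thr q w - 1)) (P * om / (1 - P * P * om))); [|exact HL|apply is_lim_seq_const].
intros n. apply tB_near1; auto. now rewrite Cmod_R.
Qed.

Lemma Jr_div (q v : R) : 0 < Rabs q < 1 -> v <> 0 -> Jr q (v / q) = v * Jr q v.
Proof.
intros Hq Hv. assert (Hq0 : q <> 0) by (intros E; rewrite E, Rabs_R0 in Hq; lra).
rewrite Jr_scale; [|exact Hq|].
- replace (q * (v / q)) with v by (field; exact Hq0). reflexivity.
- unfold Rdiv. apply Rmult_integral_contrapositive_currified; [exact Hv|now apply Rinv_neq_0_compat].
Qed.

(** F(v') = g F(v) theta(1/v) / theta(1/v'), and both thetas lie within delta = om / (1 - om) of 1,
    so 1 + delta <= g (1 - delta) suffices. *)
Lemma Fr_grow (q v g v' : R) : 0 < Rabs q < 1 -> v <> 0 -> 1 <= Fr q v ->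
  v' * Jr q v' = g * (v * Jr q v) ->
  (exists om, 0 <= om /\ om + om < 1 /\ Rabs (/ v) <= om /\ Rabs (/ v') <= om /\
     1 + om / (1 - om) <= g * (1 - om / (1 - om))) ->
  1 <= Fr q v'.
Proof.
intros Hq Hv HF Hg [om [H0 [H1 [H2 [H3 H4]]]]].
assert (T : forall w, Rabs w <= om -> Rabs (thr q w - 1) <= om / (1 - om)).
{ intros w Hw. replace (om / (1 - om)) with (1 * om / (1 - 1 * 1 * om)) by (field; lra).
  apply thr_near1; auto; lra. }
pose proof (T _ H2) as T1. pose proof (T _ H3) as T2.
apply Rabs_le_between in T1. apply Rabs_le_between in T2.
assert (Hom : om / (1 - om) < 1).
{ apply Rmult_lt_reg_r with (1 - om); [lra|]. unfold Rdiv. rewrite Rmult_assoc, Rinv_l; lra. }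
assert (Hom0 : 0 <= om / (1 - om)).
{ apply Rmult_le_pos; [lra|]. left. apply Rinv_0_lt_compat. lra. }
unfold Fr in *. rewrite Hg.
set (N := v * Jr q v) in *. set (d := thr q (/ v)) in *. set (d' := thr q (/ v')) in *.
assert (Hd : 0 < d) by lra. assert (Hd' : 0 < d') by lra.
assert (HN : d <= N).
{ apply Rmult_le_reg_r with (/ d); [now apply Rinv_0_lt_compat|]. rewrite Rinv_r; lra. }
apply Rmult_le_reg_r with d'; [exact Hd'|].
unfold Rdiv. rewrite Rmult_assoc, Rinv_l, Rmult_1_l, Rmult_1_r by lra.
assert (Hgp : 0 < g).
{ apply Rnot_le_lt. intros Hg0. nra. }
assert (g * (1 - om / (1 - om)) <= g * N) by (apply Rmult_le_compat_l; lra).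
lra.
Qed.

Lemma Rabs_inv_le (v b : R) : 0 < b -> b <= Rabs v -> Rabs (/ v) <= / b.
Proof. intros Hb Hv. rewrite Rabs_inv. now apply Rinv_le_contravar. Qed.

Lemma Fr_grow_pos (q x : R) : 0 < q < 1 -> x <= - 5 -> 1 <= Fr q (1 * x) ->
  1 <= Fr q (1 * (x / q ^ 2)).
Proof.
intros Hq Hx HF. rewrite Rmult_1_l in *.
assert (Hq' : 0 < Rabs q < 1) by (rewrite Rabs_pos_eq; lra).
assert (Hq2 : 0 < q ^ 2 <= 1) by nra.
assert (Hx' : x / q ^ 2 <= x).
{ apply Rmult_le_reg_r with (q ^ 2); [lra|]. unfold Rdiv. rewrite Rmult_assoc, Rinv_l by lra. nra. }
apply (Fr_grow q x (x ^ 2 / q ^ 3)); auto; [lra| |].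
- replace (x / q ^ 2) with (x / q / q) by (field; lra).
  rewrite !Jr_div; auto; try lra.
  + field. lra.
  + apply Rlt_not_eq. unfold Rdiv. assert (0 < / q) by (apply Rinv_0_lt_compat; lra). nra.
(* Here delta = 1/4 and g = x^2 / q^3 >= 25. *)
- exists (/ 5). split; [lra|]. split; [lra|].
  split; [apply Rabs_inv_le; [lra|rewrite Rabs_left; lra]|].
  split; [apply Rabs_inv_le; [lra|rewrite Rabs_left; lra]|].
  assert (25 <= x ^ 2 / q ^ 3).
  { assert (0 < q ^ 3 <= 1).
    { split; [apply pow_lt; lra|]. rewrite <- (pow1 3). apply pow_incr. lra. }
    apply Rmult_le_reg_r with (q ^ 3); [lra|]. unfold Rdiv. rewrite Rmult_assoc, Rinv_l by lra. nra. }
  lra.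
Qed.

Lemma Fr_grow_neg (q eps x : R) : -1 < q < 0 -> eps = 1 \/ eps = - 1 -> x <= - (24 / 10) ->
  1 <= Fr q (eps * x) -> 1 <= Fr q (eps * (x / q ^ 4)).
Proof.
intros Hq He Hx HF.
assert (Hq' : 0 < Rabs q < 1) by (rewrite Rabs_left; lra).
assert (Hq4 : 0 < q ^ 4 <= 1).
{ replace (q ^ 4) with ((q ^ 2) ^ 2) by ring. split; [apply pow_lt; nra|].
  rewrite <- (pow1 2). apply pow_incr. nra. }
assert (Hx' : x / q ^ 4 <= x).
{ apply Rmult_le_reg_r with (q ^ 4); [lra|]. unfold Rdiv. rewrite Rmult_assoc, Rinv_l by lra. nra. }
set (v := eps * x) in *.
assert (Hv : Rabs v = - x).
{ unfold v. rewrite Rabs_mult, (eps_abs eps He), Rabs_left; lra. }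
assert (Hv0 : v <> 0) by (intros E; rewrite E, Rabs_R0 in Hv; lra).
assert (Hv' : eps * (x / q ^ 4) = v / q ^ 4) by (unfold v; field; lra).
assert (Hvv : Rabs (v / q ^ 4) = - (x / q ^ 4)).
{ rewrite <- Hv', Rabs_mult, (eps_abs eps He), Rabs_left; lra. }
rewrite Hv'.
assert (Hqi : / q <> 0) by (apply Rinv_neq_0_compat; lra).
apply (Fr_grow q v (v ^ 4 / q ^ 10)); auto.
- replace (v / q ^ 4) with (v / q / q / q / q) by (field; lra).
  assert (N1 : v / q <> 0) by (apply Rmult_integral_contrapositive_currified; auto).
  assert (N2 : v / q / q <> 0) by (apply Rmult_integral_contrapositive_currified; auto).
  assert (N3 : v / q / q / q <> 0) by (apply Rmult_integral_contrapositive_currified; auto).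
  rewrite !Jr_div; auto. field. lra.
(* Here delta = 5/7 and g = v^4 / q^10 >= 2.4^4 > 33. *)
- exists (/ (24 / 10)). split; [lra|]. split; [lra|].
  split; [apply Rabs_inv_le; lra|]. split; [apply Rabs_inv_le; lra|].
  assert (33 <= v ^ 4 / q ^ 10).
  { assert (0 < q ^ 10 <= 1).
    { replace (q ^ 10) with ((q ^ 2) ^ 5) by ring. split; [apply pow_lt; nra|].
      rewrite <- (pow1 5). apply pow_incr. nra. }
    assert (33 <= v ^ 4).
    { replace (v ^ 4) with ((Rabs v) ^ 4) by (rewrite <- Rabs_pow_eq; apply Rabs_pos_eq;
        replace (v ^ 4) with ((v ^ 2) ^ 2) by ring; apply pow2_ge_0).
      rewrite Hv. apply Rle_trans with ((24 / 10) ^ 4); [lra|]. apply pow_incr. lra. }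
    apply Rmult_le_reg_r with (q ^ 10); [lra|]. unfold Rdiv. rewrite Rmult_assoc, Rinv_l by lra. nra. }
  lra.
Qed.

(** * Lower bounds for the sum over the zeros of J *)

Section Terms.

Variables (X Y b : R).
Hypothesis HX : X <= - b.
Hypothesis Hb : 1 < b.
Hypothesis HY : 0 < Y.

Definition qt (c : R) : R := (X ^ 2 + Y ^ 2) / ((X + c) ^ 2 + Y ^ 2).

Lemma qden_pos (c : R) : 0 < (X + c) ^ 2 + Y ^ 2.
Proof. assert (0 < Y ^ 2) by (apply pow2_gt_0; lra). pose proof (pow2_ge_0 (X + c)). lra. Qed.

Lemma N_ge : b ^ 2 <= X ^ 2 + Y ^ 2.
Proof. pose proof (pow2_ge_0 Y). nra. Qed.

Lemma qt_ge0 (c : R) : 0 <= qt c.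
Proof.
unfold qt. pose proof N_ge. pose proof (pow2_ge_0 b). pose proof (qden_pos c).
apply Rmult_le_pos; [lra|]. left. now apply Rinv_0_lt_compat.
Qed.

Lemma qt_lower (c v : R) : v * ((X + c) ^ 2 + Y ^ 2) <= X ^ 2 + Y ^ 2 -> v <= qt c.
Proof.
intros H. unfold qt. pose proof (qden_pos c) as Hd.
apply Rmult_le_reg_r with ((X + c) ^ 2 + Y ^ 2); [exact Hd|].
unfold Rdiv. rewrite Rmult_assoc, Rinv_l, Rmult_1_r by lra. exact H.
Qed.

(** For 0 <= c <= - 2 X the point X + c is no farther from 0 than X. Such c belong to the zeros of J
    at most twice as far out as the boundary of the half-plane. *)
Lemma qt_good (c : R) : 0 <= c <= 2 * b -> 1 <= qt c.
Proof. intros Hc. apply qt_lower. nra. Qed.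

(** The term of s is positive, that of - p s negative. Putting both over the larger denominator
    lowers the sum; the joint numerator is then linear in X and worst at X = - b, and the common
    denominator is at least |z|^2. *)
Lemma qt_pair (s p : R) : 0 < s <= 1 -> 0 < p < 1 ->
  - (Rmax 0 (s * (s * (1 + p ^ 2) - 2 * b * (1 - p))) / (X ^ 2 + Y ^ 2))
  <= (qt s - 1) + (qt (- (p * s)) - 1).
Proof.
intros Hs Hp. unfold qt.
set (D1 := (X + s) ^ 2 + Y ^ 2). set (D2 := (X + - (p * s)) ^ 2 + Y ^ 2). set (N := X ^ 2 + Y ^ 2).
assert (HD1 : 0 < D1) by apply qden_pos. assert (HD2 : 0 < D2) by apply qden_pos.
assert (HN : 0 < N) by (pose proof N_ge; fold N in H; nra).
assert (Hps : 0 < p * s) by nra.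
assert (HD12 : D1 <= D2) by (unfold D1, D2; nra).
assert (HND : N <= D2) by (unfold N, D2; nra).
assert (E : N / D1 - 1 + (N / D2 - 1) = (- 2 * X * s - s ^ 2) / D1 + (2 * X * p * s - p ^ 2 * s ^ 2) / D2).
{ replace (N / D1 - 1) with ((N - D1) / D1) by (field; lra).
  replace (N / D2 - 1) with ((N - D2) / D2) by (field; lra).
  f_equal; f_equal; unfold N, D1, D2; ring. }
rewrite E.
assert (H1 : (- 2 * X * s - s ^ 2) / D2 <= (- 2 * X * s - s ^ 2) / D1).
{ unfold Rdiv. apply Rmult_le_compat_l; [nra|]. now apply Rinv_le_contravar. }
set (L := s * (s * (1 + p ^ 2) - 2 * b * (1 - p))) in *.
assert (H2 : - L <= - 2 * X * s - s ^ 2 + (2 * X * p * s - p ^ 2 * s ^ 2)).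
{ unfold L. assert (0 <= (1 - p) * s * (- X - b)).
  { apply Rmult_le_pos; [nra|lra]. } nra. }
assert (H3 : - Rmax 0 L <= - L) by (pose proof (Rmax_r 0 L); lra).
apply Rle_trans with (- Rmax 0 L / D2).
- unfold Rdiv. rewrite <- Ropp_mult_distr_l. apply Ropp_le_contravar.
  apply Rmult_le_compat_l; [apply Rmax_l|]. now apply Rinv_le_contravar.
- apply Rle_trans with ((- 2 * X * s - s ^ 2) / D2 + (2 * X * p * s - p ^ 2 * s ^ 2) / D2); [|lra].
  replace ((- 2 * X * s - s ^ 2) / D2 + (2 * X * p * s - p ^ 2 * s ^ 2) / D2)
    with ((- 2 * X * s - s ^ 2 + (2 * X * p * s - p ^ 2 * s ^ 2)) / D2) by (unfold Rdiv; ring).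
  unfold Rdiv. apply Rmult_le_compat_r; [left; now apply Rinv_0_lt_compat|lra].
Qed.

Lemma qt_pair2 (s p : R) : 0 < s <= 1 -> 0 < p < 1 ->
  - (2 * s ^ 2 / (X ^ 2 + Y ^ 2)) <= (qt s - 1) + (qt (- (p * s)) - 1).
Proof.
intros Hs Hp. eapply Rle_trans; [|apply qt_pair; assumption].
apply Ropp_le_contravar. unfold Rdiv.
apply Rmult_le_compat_r.
- left. apply Rinv_0_lt_compat. pose proof N_ge. nra.
- apply Rmax_lub; [nra|].
  assert (0 <= s * (2 * b * (1 - p))) by (apply Rmult_le_pos; nra).
  assert (0 <= s ^ 2 * (1 - p ^ 2)) by (apply Rmult_le_pos; nra). lra.
Qed.

Lemma qt_pair0 (s p : R) : 0 < s <= 1 -> 0 < p < 1 -> s * (1 + p ^ 2) <= 2 * b * (1 - p) ->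
  0 <= (qt s - 1) + (qt (- (p * s)) - 1).
Proof.
intros Hs Hp H. eapply Rle_trans; [|apply qt_pair; assumption].
rewrite Rmax_left by nra. unfold Rdiv. rewrite Rmult_0_l. lra.
Qed.

(* Grouping that keeps each summand of Sfun nonnegative: the zero -1/s of J with the pair -s, ps. *)
Definition qgroup (s p : R) : R := qt (/ s) + ((qt s - 1) + (qt (- (p * s)) - 1)).

(** The loss of the pair, at most 2 s^2 / |z|^2, is covered by the zero at - 1/s: since X < 0, its
    denominator is at most |z|^2 + 1/s^2. *)
Lemma qgroup_ge0 (s p : R) : 0 < s <= 1 -> 0 < p < 1 -> 2 <= b -> 0 <= qgroup s p.
Proof.
intros Hs Hp Hb2. unfold qgroup. pose proof (qt_pair2 s p Hs Hp) as H.
assert (HN : 4 <= X ^ 2 + Y ^ 2) by (pose proof N_ge; nra).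
set (N := X ^ 2 + Y ^ 2) in *.
assert (H1 : 2 * s ^ 2 / N <= qt (/ s)).
{ apply qt_lower. fold N. set (i := / s).
  assert (Hi : 0 < i) by (apply Rinv_0_lt_compat; lra).
  assert (His : s * i = 1) by (unfold i; apply Rinv_r; lra).
  apply Rle_trans with (2 * s ^ 2 / N * (N + i ^ 2)).
  - apply Rmult_le_compat_l; [|unfold N; nra].
    apply Rmult_le_pos; [nra|left; apply Rinv_0_lt_compat; lra].
  - replace (2 * s ^ 2 / N * (N + i ^ 2)) with (2 * s ^ 2 + 2 * (s * i) ^ 2 / N) by (field; lra).
    rewrite His. assert (2 * 1 ^ 2 / N <= 1 / 2).
    { apply Rmult_le_reg_r with N; [lra|]. unfold Rdiv. rewrite Rmult_assoc, Rinv_l by lra. lra. }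
    nra. }
lra.
Qed.

(** The zero at - 1/s now contributes at least 1, and the pair loses at most 2 / 3.2^2 < 0.196. *)
Lemma qgroup_good (s p : R) : 0 < s <= 1 -> 0 < p < 1 -> 32 / 10 <= b -> / s <= 2 * b ->
  804 / 1000 <= qgroup s p.
Proof.
intros Hs Hp Hb2 Hsb. unfold qgroup. pose proof (qt_pair2 s p Hs Hp) as H.
assert (HN : (32 / 10) ^ 2 <= X ^ 2 + Y ^ 2) by (pose proof N_ge; nra).
set (N := X ^ 2 + Y ^ 2) in *.
assert (H1 : 1 <= qt (/ s)).
{ apply qt_good. split; [left; apply Rinv_0_lt_compat; lra|exact Hsb]. }
assert (H2 : 2 * s ^ 2 / N <= 196 / 1000).
{ apply Rmult_le_reg_r with N; [lra|]. unfold Rdiv at 1. rewrite Rmult_assoc, Rinv_l by lra. nra. }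
lra.
Qed.

(** A zero of J on the opposite side: |z| / |z - c| is smallest at the corner z = - b, where it
    equals b / (b + c). *)
Lemma qt_back (c v : R) : 0 <= c -> 0 <= v <= 1 -> v * (b + c) <= b -> v ^ 2 <= qt (- c).
Proof.
intros Hc Hv H. apply qt_lower.
assert (H1 : v * (- X + c) <= - X).
{ replace (v * (- X + c)) with (v * (b + c) + v * (- X - b)) by ring. nra. }
assert (H2 : (v * (- X + c)) ^ 2 <= (- X) ^ 2).
{ apply pow_incr. split; [apply Rmult_le_pos; lra|exact H1]. }
assert (H3 : v ^ 2 * Y ^ 2 <= Y ^ 2).
{ assert (v ^ 2 <= 1) by nra. pose proof (pow2_ge_0 Y). nra. }
nra.
Qed.

End Terms.

Lemma rsum_first (f : nat -> R) (k m : nat) (g : R) :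
  (forall j, 0 <= f j) -> (forall j, (j < k)%nat -> g <= f j) -> (k <= m)%nat ->
  INR k * g <= rsum f m.
Proof.
intros H0 Hg Hk. eapply Rle_trans; [|apply rsum_mono; [exact H0|exact Hk]].
clear Hk. induction k as [|k IH]; [simpl; lra|].
cbn [rsum]. rewrite S_INR.
assert (INR k * g <= rsum f k) by (apply IH; intros; apply Hg; lia).
specialize (Hg k ltac:(lia)). lra.
Qed.

Lemma Sfun_qt (q eps X Y : R) (n : nat) :
  Sfun q eps n X Y = 1 + rsum (fun j => qt X Y (cc q eps j)) n
    + rsum (fun j => qt X Y (dd q eps j) - 1) n.
Proof. reflexivity. Qed.

Lemma neg_pow_even (p : R) (i : nat) : (- p) ^ (2 * i) = p ^ (2 * i).
Proof. rewrite !pow_mult. f_equal. ring. Qed.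

Lemma neg_pow_odd (p : R) (i : nat) : (- p) ^ (2 * i + 1) = - p ^ (2 * i + 1).
Proof. rewrite !pow_add, neg_pow_even. simpl. ring. Qed.

Lemma pow_pos_le1 (p : R) (n : nat) : 0 < p < 1 -> 0 < p ^ n <= 1.
Proof.
intros Hp. split; [apply pow_lt; lra|]. rewrite <- (pow1 n). apply pow_incr. lra.
Qed.

(** For q = - p and eps = 1 the values of [cc] are - 1/p, 1/p^2, - 1/p^3, ... and those of [dd] are
    1, - p, p^2, ... . The pair (1, - p) and the value - 1/p are kept apart, the groups start at s =
    p^2, and the other terms, all nonnegative, are dropped. *)
Lemma Sfun_left (p X Y b : R) (m : nat) :
  0 < p < 1 -> X <= - b -> 2 <= b -> 0 < Y ->
  1 + ((qt X Y 1 - 1) + (qt X Y (- (p * 1)) - 1)) + qt X Y (- / p)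
   + rsum (fun i => qgroup X Y (p ^ (2 * i + 2)) p) m
  <= Sfun (- p) 1 (2 * S m) X Y.
Proof.
intros Hp HX Hb HY.
rewrite Sfun_qt, !rsum_pairs.
assert (Hc0 : forall i, cc (- p) 1 (2 * i) = - / p ^ (2 * i + 1)).
{ intros i. unfold cc. replace (S (2 * i)) with (2 * i + 1)%nat by lia.
  rewrite neg_pow_odd. field. apply pow_nonzero; lra. }
assert (Hc1 : forall i, cc (- p) 1 (2 * i + 1) = / p ^ (2 * i + 2)).
{ intros i. unfold cc. replace (S (2 * i + 1)) with (2 * (i + 1))%nat by lia.
  rewrite neg_pow_even. replace (2 * (i + 1))%nat with (2 * i + 2)%nat by lia.
  field. apply pow_nonzero; lra. }
assert (Hd0 : forall i, dd (- p) 1 (2 * i) = p ^ (2 * i)).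
{ intros i. unfold dd. rewrite neg_pow_even. ring. }
assert (Hd1 : forall i, dd (- p) 1 (2 * i + 1) = - (p * p ^ (2 * i))).
{ intros i. unfold dd. rewrite neg_pow_odd, pow_add. simpl (p ^ 1). ring. }
assert (A : qt X Y (- / p) + rsum (fun i => qt X Y (/ p ^ (2 * i + 2))) m
   <= rsum (fun i => qt X Y (cc (- p) 1 (2 * i)) + qt X Y (cc (- p) 1 (2 * i + 1))) (S m)).
{ rewrite (rsum_plus (fun i => qt X Y (cc (- p) 1 (2 * i)))).
  apply Rplus_le_compat.
  - rewrite rsum_S_l, Hc0. simpl (p ^ (2 * 0 + 1)). rewrite Rmult_1_r.
    assert (0 <= rsum (fun j => qt X Y (cc (- p) 1 (2 * S j))) m).
    { apply rsum_ge0. intros j _. now apply (qt_ge0 X Y b); try lra. }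
    lra.
  - cbn [rsum]. rewrite (rsum_ext _ (fun i => qt X Y (cc (- p) 1 (2 * i + 1))) m)
      by (intros j _; now rewrite Hc1).
    pose proof (qt_ge0 X Y b HX ltac:(lra) HY (cc (- p) 1 (2 * m + 1))). lra. }
assert (D : (qt X Y 1 - 1) + (qt X Y (- (p * 1)) - 1)
   + rsum (fun i => (qt X Y (p ^ (2 * i + 2)) - 1) + (qt X Y (- (p * p ^ (2 * i + 2))) - 1)) m
   = rsum (fun i => qt X Y (dd (- p) 1 (2 * i)) - 1 + (qt X Y (dd (- p) 1 (2 * i + 1)) - 1)) (S m)).
{ rewrite rsum_S_l, Hd0, Hd1. simpl (p ^ (2 * 0)). f_equal.
  apply rsum_ext. intros j _. rewrite Hd0, Hd1.
  replace (2 * S j)%nat with (2 * j + 2)%nat by lia. reflexivity. }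
unfold qgroup. rewrite rsum_plus. lra.
Qed.

(** With eps = - 1 the signs are reversed: [dd] takes the values - 1, p, - p^2, ..., so - 1 stays
    alone and the groups start at s = p. *)
Lemma Sfun_right (p X Y b : R) (m : nat) :
  0 < p < 1 -> X <= - b -> 2 <= b -> 0 < Y ->
  1 + (qt X Y (- 1) - 1) + rsum (fun i => qgroup X Y (p ^ (2 * i + 1)) p) m
  <= Sfun (- p) (- 1) (2 * S m) X Y.
Proof.
intros Hp HX Hb HY.
rewrite Sfun_qt, rsum_pairs.
assert (Hc0 : forall i, cc (- p) (- 1) (2 * i) = / p ^ (2 * i + 1)).
{ intros i. unfold cc. replace (S (2 * i)) with (2 * i + 1)%nat by lia.
  rewrite neg_pow_odd. field. apply pow_nonzero; lra. }
assert (Hd0 : forall i, dd (- p) (- 1) (2 * i + 2) = - (p * p ^ (2 * i + 1))).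
{ intros i. unfold dd. replace (2 * i + 2)%nat with (2 * (i + 1))%nat by lia.
  rewrite neg_pow_even. replace (2 * (i + 1))%nat with (S (2 * i + 1)) by lia. simpl. ring. }
assert (Hd1 : forall i, dd (- p) (- 1) (2 * i + 1) = p ^ (2 * i + 1)).
{ intros i. unfold dd. rewrite neg_pow_odd. ring. }
assert (A : rsum (fun i => qt X Y (/ p ^ (2 * i + 1))) m
   <= rsum (fun i => qt X Y (cc (- p) (- 1) (2 * i)) + qt X Y (cc (- p) (- 1) (2 * i + 1))) (S m)).
{ cbn [rsum].
  pose proof (qt_ge0 X Y b HX ltac:(lra) HY (cc (- p) (- 1) (2 * m))).
  pose proof (qt_ge0 X Y b HX ltac:(lra) HY (cc (- p) (- 1) (2 * m + 1))).
  assert (rsum (fun i => qt X Y (/ p ^ (2 * i + 1))) m <=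
    rsum (fun i => qt X Y (cc (- p) (- 1) (2 * i)) + qt X Y (cc (- p) (- 1) (2 * i + 1))) m); [|lra].
  apply rsum_le. intros j _. rewrite Hc0.
  pose proof (qt_ge0 X Y b HX ltac:(lra) HY (cc (- p) (- 1) (2 * j + 1))). lra. }
assert (D : (qt X Y (- 1) - 1)
   + rsum (fun i => (qt X Y (p ^ (2 * i + 1)) - 1) + (qt X Y (- (p * p ^ (2 * i + 1))) - 1)) m
   <= rsum (fun j => qt X Y (dd (- p) (- 1) j) - 1) (2 * S m)).
{ replace (2 * S m)%nat with (S (S (2 * m))) by lia. rewrite rsum_S_l. cbn [rsum].
  rewrite rsum_pairs.
  replace (dd (- p) (- 1) 0) with (- 1) by (unfold dd; simpl; ring).
  replace (S (2 * m)) with (2 * m + 1)%nat by lia. rewrite Hd1.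
  assert (1 <= qt X Y (p ^ (2 * m + 1))).
  { apply (qt_good X Y b); try lra. pose proof (pow_pos_le1 p (2 * m + 1) Hp). lra. }
  rewrite (rsum_ext (fun i => qt X Y (dd (- p) (- 1) (S (2 * i))) - 1
      + (qt X Y (dd (- p) (- 1) (S (2 * i + 1))) - 1))
    (fun i => (qt X Y (p ^ (2 * i + 1)) - 1) + (qt X Y (- (p * p ^ (2 * i + 1))) - 1))).
  - lra.
  - intros j _. replace (S (2 * j)) with (2 * j + 1)%nat by lia.
    replace (S (2 * j + 1)) with (2 * j + 2)%nat by lia. now rewrite Hd0, Hd1. }
unfold qgroup. rewrite rsum_plus. lra.
Qed.

Lemma inv_pow_le (p c : R) (i k : nat) :
  0 < p < 1 -> (i <= k)%nat -> / p ^ k <= c -> / p ^ i <= c.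
Proof.
intros Hp Hi Hc. eapply Rle_trans; [|exact Hc].
assert (H1 : 0 < p ^ k) by (apply pow_lt; lra).
apply Rinv_le_contravar; [exact H1|].
replace k with (i + (k - i))%nat by lia. rewrite pow_add.
pose proof (pow_pos_le1 p (k - i) Hp). assert (0 < p ^ i) by (apply pow_lt; lra). nra.
Qed.

Lemma groups_left (p X Y b : R) (k m : nat) :
  0 < p < 1 -> X <= - b -> 32 / 10 <= b -> 0 < Y -> / p ^ (2 * k) <= 2 * b -> (k <= m)%nat ->
  INR k * (804 / 1000) <= rsum (fun i => qgroup X Y (p ^ (2 * i + 2)) p) m.
Proof.
intros Hp HX Hb HY Hk Hm. apply rsum_first; [| |exact Hm].
- intros j. apply (qgroup_ge0 X Y b); try lra. now apply pow_pos_le1.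
- intros j Hj. apply (qgroup_good X Y b); try lra; [now apply pow_pos_le1|].
  apply (inv_pow_le p _ (2 * j + 2) (2 * k)); auto. lia.
Qed.

Lemma groups_right (p X Y b : R) (k m : nat) :
  0 < p < 1 -> X <= - b -> 32 / 10 <= b -> 0 < Y -> / p ^ (2 * k) <= 2 * b * / p -> (k <= m)%nat ->
  INR k * (804 / 1000) <= rsum (fun i => qgroup X Y (p ^ (2 * i + 1)) p) m.
Proof.
intros Hp HX Hb HY Hk Hm. apply rsum_first; [| |exact Hm].
- intros j. apply (qgroup_ge0 X Y b); try lra. now apply pow_pos_le1.
- intros j Hj. apply (qgroup_good X Y b); try lra; [now apply pow_pos_le1|].
  apply (inv_pow_le p _ (2 * j + 1) (2 * (k - 1) + 1)); auto; [lia|].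
  replace (2 * k)%nat with (S (2 * (k - 1) + 1)) in Hk by lia.
  simpl in Hk. rewrite Rinv_mult in Hk.
  apply Rmult_le_reg_l with (/ p); [apply Rinv_0_lt_compat; lra|]. simpl. lra.
Qed.

Lemma inv_pow_num (p c v : R) (k : nat) : 0 < c <= p -> 0 < v -> 1 <= v * c ^ k -> / p ^ k <= v.
Proof.
intros Hc Hv H. assert (H1 : 0 < c ^ k) by (apply pow_lt; lra).
assert (H2 : c ^ k <= p ^ k) by (apply pow_incr; lra).
apply Rmult_le_reg_r with (p ^ k); [lra|]. rewrite Rinv_l by lra. nra.
Qed.

Lemma Eb_num (P om e : R) : 0 <= P * om + P * P * om < 1 -> 0 <= P * P * om < 1 ->
  1 <= (e + / (1 - P * P * om) ^ 2) * (1 - (P * om + P * P * om)) ^ 2 -> Eb P om <= e.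
Proof.
intros H1 H2 H. unfold Eb.
assert (Hp : 0 < (1 - (P * om + P * P * om)) ^ 2) by (apply pow_lt; lra).
assert (/ (1 - (P * om + P * P * om)) ^ 2 <= e + / (1 - P * P * om) ^ 2); [|lra].
apply Rmult_le_reg_r with ((1 - (P * om + P * P * om)) ^ 2); [exact Hp|].
rewrite Rinv_l by lra. exact H.
Qed.

(** * Zero-free half-planes *)

Lemma far_base_points (q eps Q x0 : R) :
  x0 < - 1 -> 0 < Q <= 1 -> 1 <= Fr q (eps * x0) ->
  (forall x, x < - 1 -> exists N, forall m, (N <= m)%nat ->
     Ang q eps (2 * m) (x / Q) 0 = Ang q eps (2 * m) x 0 + 2 * PI) ->
  (forall x, x <= x0 -> 1 <= Fr q (eps * x) -> 1 <= Fr q (eps * (x / Q))) ->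
  forall k : nat, exists r, r <= x0 /\ 1 <= Fr q (eps * r) /\
     exists N, forall m, (N <= m)%nat ->
       Ang q eps (2 * m) r 0 = Ang q eps (2 * m) x0 0 + 2 * PI * INR k.
Proof.
intros Hx0 HQ HF Hs Hg k. induction k as [|k [r [Hr [HFr [N HN]]]]].
- exists x0. split; [lra|]. split; [exact HF|]. exists O. intros m _. simpl. ring.
- exists (r / Q). split; [|split; [now apply Hg|]].
  + apply Rle_trans with r; [|exact Hr].
    apply Rmult_le_reg_r with Q; [lra|]. unfold Rdiv. rewrite Rmult_assoc, Rinv_l by lra. nra.
  + destruct (Hs r) as [N' HN']; [lra|]. exists (Nat.max N N'). intros m Hm.
    rewrite HN', HN by lia. rewrite S_INR. ring.
Qed.

Lemma left_gap_pos (q x0 : R) : 0 < q < 1 -> x0 < - 5 -> x0 < - / q -> thr q x0 = 0 ->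
  exists d, 0 < d /\ forall x t, 0 < t -> theta q (x, t) = RtoC 0 -> x0 + d < x.
Proof.
intros Hq H5 Hi Hz.
assert (Hq' : 0 < Rabs q < 1) by (rewrite Rabs_pos_eq; lra).
assert (He : 1 = 1 \/ 1 = - 1) by now left.
set (B := Rmax 5 (/ q)).
assert (HB5 : 5 <= B) by apply Rmax_l. assert (HBq : / q <= B) by apply Rmax_r.
assert (HxB : x0 < - B).
{ unfold B. apply Rmax_case; lra. }
assert (Hom : / B <= / 5) by (apply Rinv_le_contravar; lra).
destruct (no_zero_left_of q 1 1 (/ 5) (1 / 2) B) with (x0 := x0) as [d [Hd Hd']]; auto; try lra.
(* With 1/|z| <= 1/5 the contribution of theta(1/x) is below 3/2, while the factor z and the nearest
   zero, at - 1/q, give at least 2; this leaves the margin 1/2. *)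
- exists 1%nat. intros m X Y Hm HX HY.
  assert (HE : Eb 1 (/ 5) <= 3 / 2) by (apply Eb_num; lra).
  rewrite Sfun_qt.
  assert (H1 : 0 <= rsum (fun j => qt X Y (dd q 1 j) - 1) (2 * m)).
  { apply rsum_ge0. intros j _.
    assert (1 <= qt X Y (dd q 1 j)); [|lra]. apply (qt_good X Y B); try lra.
    unfold dd. pose proof (pow_pos_le1 q j Hq). lra. }
  assert (H2 : 1 <= rsum (fun j => qt X Y (cc q 1 j)) (2 * m)).
  { replace 1 with (INR 1 * 1) at 1 by (simpl; ring). apply rsum_first; [| |lia].
    - intros j. apply (qt_ge0 X Y B); lra.
    - intros j Hj. replace j with O by lia. apply (qt_good X Y B); try lra.
      unfold cc. simpl. rewrite Rmult_1_r. unfold Rdiv. rewrite Rmult_1_l.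
      assert (0 < / q) by (apply Rinv_0_lt_compat; lra). lra. }
  lra.
- rewrite Rmult_1_l. exact Hz.
- apply (far_base_points q 1 (q ^ 2) x0); try lra; try nra.
  + right. symmetry. rewrite <- (Rmult_1_l x0) in Hz. apply (Fr_zero q 1 1 (/ 5) B); auto; lra.
  + intros x Hx. now apply Ang_shift_pos.
  + intros x Hx HF. apply Fr_grow_pos; auto. lra.
- exists d. split; [exact Hd|]. intros x t Ht HZ. apply (Hd' x t Ht).
  rewrite Cmult_1_l. exact HZ.
Qed.

Lemma gap_neg (q eps P om eta B x0 : R) :
  -1 < q < 0 -> eps = 1 \/ eps = - 1 -> - q <= P -> P <= 1 -> 24 / 10 <= B -> / B <= om ->
  P * om + P * P * om < 1 -> 0 < eta -> x0 < - B -> thr q (eps * x0) = 0 ->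
  (exists n0 : nat, forall m X Y, (n0 <= m)%nat -> X <= - B -> 0 < Y ->
     Eb P om + eta <= Sfun q eps (2 * m) X Y) ->
  exists d, 0 < d /\ forall x t, 0 < t -> theta q (RtoC eps * zpt x t)%C = RtoC 0 -> x0 + d < x.
Proof.
intros Hq He HP HP1 HB Hom Hc Heta HxB Hz HS.
assert (Hq' : 0 < Rabs q < 1) by (rewrite Rabs_left; lra).
assert (HqP : Rabs q <= P) by (rewrite Rabs_left; lra).
assert (Hq4 : 0 < q ^ 4 <= 1).
{ replace (q ^ 4) with ((q ^ 2) ^ 2) by ring. split; [apply pow_lt; nra|].
  rewrite <- (pow1 2). apply pow_incr. nra. }
apply (no_zero_left_of q eps P om eta B); auto; try lra.
apply (far_base_points q eps (q ^ 4) x0); try lra.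
- right. symmetry. apply (Fr_zero q eps P om B); auto; lra.
- intros x Hx. now apply Ang_shift_neg.
- intros x Hx HF. apply Fr_grow_neg; auto. lra.
Qed.

(** The range of p is cut so that a known number of zeros of J lies within twice the distance 2.4 or
    3.2; each case is then a numerical comparison with [Eb]. The cut 0.676 is just above the
    solution of p^(-4) = 4.8, from which on two groups count in full. *)
Lemma left_gap_neg (p x0 : R) : 0 < p < 1 -> x0 < - (24 / 10) -> x0 < - / p ^ 2 ->
  (3 / 4 < p -> x0 < - (32 / 10)) -> thr (- p) x0 = 0 ->
  exists d, 0 < d /\ forall x t, 0 < t -> theta (- p) (x, t) = RtoC 0 -> x0 + d < x.
Proof.
intros Hp H24 Hi H32 Hz.
assert (He : 1 = 1 \/ 1 = - 1) by now left.
assert (Hzz : thr (- p) (1 * x0) = 0) by (rewrite Rmult_1_l; exact Hz).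
assert (Hend : (exists d, 0 < d /\ forall x t, 0 < t ->
    theta (- p) (RtoC 1 * zpt x t)%C = RtoC 0 -> x0 + d < x) ->
  exists d, 0 < d /\ forall x t, 0 < t -> theta (- p) (x, t) = RtoC 0 -> x0 + d < x).
{ intros [d [Hd Hd']]. exists d. split; [exact Hd|]. intros x t Ht HZ. apply (Hd' x t Ht).
  rewrite Cmult_1_l. exact HZ. }
apply Hend. clear Hend.
assert (Hp2 : 0 < p ^ 2 <= 1) by now apply pow_pos_le1.
destruct (Rle_lt_dec p (676 / 1000)) as [C1|C1]; [|destruct (Rle_lt_dec p (3 / 4)) as [C2|C2];
  [|destruct (Rle_lt_dec p (9 / 10)) as [C3|C3]]].
- set (B := Rmax (24 / 10) (/ p ^ 2)).
  assert (HB5 : 24 / 10 <= B) by apply Rmax_l. assert (HBq : / p ^ 2 <= B) by apply Rmax_r.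
  assert (HxB : x0 < - B) by (unfold B; apply Rmax_case; lra).
  apply (gap_neg (- p) 1 (676 / 1000) (/ (24 / 10)) (1 / 10) B); auto; try lra.
  + apply Rinv_le_contravar; lra.
  + exists 2%nat. intros m X Y Hm HX HY.
    assert (HE : Eb (676 / 1000) (/ (24 / 10)) <= 21 / 10) by (apply Eb_num; lra).
    replace (2 * m)%nat with (2 * S (m - 1))%nat by lia.
    pose proof (Sfun_left p X Y B (m - 1) Hp HX ltac:(lra) HY) as HS.
    pose proof (qt_pair0 X Y B HX ltac:(lra) HY 1 p ltac:(lra) Hp ltac:(nra)) as HA.
    assert (HB : 1 <= rsum (fun i => qgroup X Y (p ^ (2 * i + 2)) p) (m - 1)).
    { replace 1 with (INR 1 * 1) at 1 by (simpl; ring). apply rsum_first; [| |lia].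
      - intros j. apply (qgroup_ge0 X Y B); try lra. now apply pow_pos_le1.
      - intros j Hj. replace j with O by lia. simpl (2 * 0 + 2)%nat. unfold qgroup.
        pose proof (qt_pair0 X Y B HX ltac:(lra) HY (p ^ 2) p Hp2 Hp ltac:(nra)).
        assert (1 <= qt X Y (/ p ^ 2)); [|lra].
        apply (qt_good X Y B); try lra. split; [left; apply Rinv_0_lt_compat; lra|lra]. }
    (* B >= 1/p^2 gives 1/p <= p B, so B / (B + 1/p) >= 1/(1 + p) >= 1/1.676. *)
    assert (HD : (5966 / 10000) ^ 2 <= qt X Y (- / p)).
    { apply (qt_back X Y B); try lra.
      - left; apply Rinv_0_lt_compat; lra.
      - assert (E : / p = p * / p ^ 2) by (field; lra).
        assert (0 < / p ^ 2) by (apply Rinv_0_lt_compat; lra). nra. }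
    lra.
- apply (gap_neg (- p) 1 (3 / 4) (/ (24 / 10)) (1 / 10) (24 / 10)); auto; try lra.
  exists 3%nat. intros m X Y Hm HX HY.
  assert (HE : Eb (3 / 4) (/ (24 / 10)) <= 3165 / 1000) by (apply Eb_num; lra).
  replace (2 * m)%nat with (2 * S (m - 1))%nat by lia.
  pose proof (Sfun_left p X Y (24 / 10) (m - 1) Hp HX ltac:(lra) HY) as HS.
  assert (HN : 576 / 100 <= X ^ 2 + Y ^ 2).
  { pose proof (N_ge X Y (24 / 10) HX ltac:(lra) HY). lra. }
  (* The bound of [qt_pair] at s = 1 is largest at p = 3/4, where it is (1 + p^2 - 4.8 (1 - p)) /
     2.4^2 < 0.064. *)
  assert (HA : - (64 / 1000) <= (qt X Y 1 - 1) + (qt X Y (- (p * 1)) - 1)).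
  { eapply Rle_trans; [|apply (qt_pair X Y (24 / 10) HX ltac:(lra) HY 1 p); lra].
    apply Ropp_le_contravar.
    apply Rmult_le_reg_r with (X ^ 2 + Y ^ 2); [lra|]. unfold Rdiv at 1.
    rewrite Rmult_assoc, Rinv_l, Rmult_1_r by lra. apply Rmax_lub; nra. }
  assert (HB : INR 2 * 1 <= rsum (fun i => qgroup X Y (p ^ (2 * i + 2)) p) (m - 1)).
  { apply rsum_first; [| |lia].
    - intros j. apply (qgroup_ge0 X Y (24 / 10)); try lra. now apply pow_pos_le1.
    - intros j Hj. unfold qgroup.
      assert (Hs : 0 < p ^ (2 * j + 2) <= 1) by now apply pow_pos_le1.
      assert (Hs2 : p ^ (2 * j + 2) <= 5625 / 10000).
      { rewrite pow_add. pose proof (pow_pos_le1 p (2 * j) Hp).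
        assert (p ^ 2 <= 5625 / 10000) by nra. nra. }
      pose proof (qt_pair0 X Y (24 / 10) HX ltac:(lra) HY (p ^ (2 * j + 2)) p Hs Hp ltac:(nra)).
      assert (1 <= qt X Y (/ p ^ (2 * j + 2))); [|lra].
      apply (qt_good X Y (24 / 10)); try lra.
      split; [left; apply Rinv_0_lt_compat; lra|].
      apply (inv_pow_le p _ (2 * j + 2) 4); [lra|lia|].
      apply (inv_pow_num p (676 / 1000)); lra. }
  (* 1/p <= 1.48 and 2.4 / (2.4 + 1.48) > 0.618. *)
  assert (HD : (618 / 1000) ^ 2 <= qt X Y (- / p)).
  { apply (qt_back X Y (24 / 10)); try lra.
    - left; apply Rinv_0_lt_compat; lra.
    - assert (/ p <= 148 / 100); [|lra].
      rewrite <- (pow_1 p). apply (inv_pow_num p (676 / 1000)); lra. }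
  simpl INR in HB. lra.
- apply (gap_neg (- p) 1 (9 / 10) (/ (32 / 10)) (3 / 10) (32 / 10)); auto; try lra.
  exists 5%nat. intros m X Y Hm HX HY.
  assert (HE : Eb (9 / 10) (/ (32 / 10)) <= 283 / 100) by (apply Eb_num; lra).
  replace (2 * m)%nat with (2 * S (m - 1))%nat by lia.
  pose proof (Sfun_left p X Y (32 / 10) (m - 1) Hp HX ltac:(lra) HY) as HS.
  pose proof (N_ge X Y (32 / 10) HX ltac:(lra) HY) as HN.
  pose proof (qt_pair2 X Y (32 / 10) HX ltac:(lra) HY 1 p ltac:(lra) Hp) as HA.
  assert (HA2 : 2 * 1 ^ 2 / (X ^ 2 + Y ^ 2) <= 196 / 1000).
  { apply Rmult_le_reg_r with (X ^ 2 + Y ^ 2); [lra|]. unfold Rdiv at 1.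
    rewrite Rmult_assoc, Rinv_l by lra. lra. }
  (* As 6.4 times 0.75^6 exceeds 1, three groups count; 0.804 + 3 times 0.804 exceeds 2.83 + 0.3. *)
  assert (HK : / p ^ (2 * 3) <= 2 * (32 / 10)) by (apply (inv_pow_num p (3 / 4)); simpl; lra).
  pose proof (groups_left p X Y (32 / 10) 3 (m - 1) Hp HX ltac:(lra) HY HK ltac:(lia)) as HB.
  pose proof (qt_ge0 X Y (32 / 10) HX ltac:(lra) HY (- / p)).
  simpl INR in HB. lra.
- apply (gap_neg (- p) 1 1 (/ (32 / 10)) (3 / 10) (32 / 10)); auto; try lra.
  exists 8%nat. intros m X Y Hm HX HY.
  assert (HE : Eb 1 (/ (32 / 10)) <= 5) by (apply Eb_num; lra).
  replace (2 * m)%nat with (2 * S (m - 1))%nat by lia.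
  pose proof (Sfun_left p X Y (32 / 10) (m - 1) Hp HX ltac:(lra) HY) as HS.
  pose proof (N_ge X Y (32 / 10) HX ltac:(lra) HY) as HN.
  pose proof (qt_pair2 X Y (32 / 10) HX ltac:(lra) HY 1 p ltac:(lra) Hp) as HA.
  assert (HA2 : 2 * 1 ^ 2 / (X ^ 2 + Y ^ 2) <= 196 / 1000).
  { apply Rmult_le_reg_r with (X ^ 2 + Y ^ 2); [lra|]. unfold Rdiv at 1.
    rewrite Rmult_assoc, Rinv_l by lra. lra. }
  (* Six groups count here; 7 times 0.804 exceeds 5 + 0.3. *)
  assert (HK : / p ^ (2 * 6) <= 2 * (32 / 10)) by (apply (inv_pow_num p (9 / 10)); simpl; lra).
  pose proof (groups_left p X Y (32 / 10) 6 (m - 1) Hp HX ltac:(lra) HY HK ltac:(lia)) as HB.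
  pose proof (qt_ge0 X Y (32 / 10) HX ltac:(lra) HY (- / p)).
  simpl INR in HB. lra.
Qed.

(** Under x = - z the right half-plane becomes a left one. For p <= 0.9 four groups are counted,
    which requires p^(-7) <= 2 B; for p >= 0.8 this holds with B = 3.2, and below 0.8 it is supplied
    by p^(-7) < x0. *)
Lemma right_gap_neg (p x0 : R) : 0 < p < 1 -> 32 / 10 < x0 ->
  (p < 8 / 10 -> / p ^ 7 < x0) -> thr (- p) x0 = 0 ->
  exists d, 0 < d /\ forall x t, 0 < t -> theta (- p) (x, t) = RtoC 0 -> x < x0 - d.
Proof.
intros Hp H32 H7 Hz.
assert (He : - 1 = 1 \/ - 1 = - 1) by now right.
assert (Hzz : thr (- p) (- 1 * - x0) = 0) by (replace (- 1 * - x0) with x0 by ring; exact Hz).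
assert (Hend : (exists d, 0 < d /\ forall x t, 0 < t ->
    theta (- p) (RtoC (- 1) * zpt x t)%C = RtoC 0 -> - x0 + d < x) ->
  exists d, 0 < d /\ forall x t, 0 < t -> theta (- p) (x, t) = RtoC 0 -> x < x0 - d).
{ intros [d [Hd Hd']]. exists d. split; [exact Hd|]. intros x t Ht HZ.
  assert (Hp' : 0 < Rabs (- p) < 1) by (rewrite Rabs_left; lra).
  (* Multiplication by - 1 would move a point of the upper half-plane to the lower one; conjugation
     brings it back. *)
  assert (- x0 + d < - x); [|lra]. apply (Hd' (- x) t Ht).
  replace (RtoC (- 1) * zpt (- x) t)%C with (Cconj (x, t)).
  - rewrite theta_conj, HZ by exact Hp'. unfold Cconj, RtoC. simpl. f_equal. ring.
  - unfold Cconj, zpt, RtoC, Cmult. simpl. f_equal; ring. }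
apply Hend. clear Hend.
assert (Hhead : forall X Y b, X <= - b -> 32 / 10 <= b -> 0 < Y -> - (42 / 100) <= qt X Y (- 1) - 1).
(* (3.2 / 4.2)^2 > 0.58. *)
{ intros X Y b HX Hb HY. assert (58 / 100 <= qt X Y (- 1)); [|lra].
  apply qt_lower; [exact HY|].
  assert (58 / 100 * (X + - 1) ^ 2 <= X ^ 2) by nra.
  pose proof (pow2_ge_0 Y). lra. }
destruct (Rle_lt_dec p (9 / 10)) as [C3|C3].
- set (B := if Rlt_dec p (8 / 10) then Rmax (32 / 10) (/ p ^ 7) else 32 / 10).
  assert (HB : 32 / 10 <= B) by (unfold B; destruct (Rlt_dec p (8 / 10)); [apply Rmax_l|lra]).
  assert (HxB : - x0 < - B).
  { unfold B; destruct (Rlt_dec p (8 / 10)) as [H|H]; [|lra].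
    specialize (H7 H). apply Rmax_case; lra. }
  assert (HBp : / p ^ 7 <= 2 * B).
  { unfold B; destruct (Rlt_dec p (8 / 10)) as [H|H].
    - pose proof (Rmax_r (32 / 10) (/ p ^ 7)). pose proof (Rmax_l (32 / 10) (/ p ^ 7)). lra.
    - apply (inv_pow_num p (8 / 10)); lra. }
  apply (gap_neg (- p) (- 1) (9 / 10) (/ (32 / 10)) (3 / 10) B); auto; try lra.
  + apply Rinv_le_contravar; lra.
  + exists 5%nat. intros m X Y Hm HX HY.
    assert (HE : Eb (9 / 10) (/ (32 / 10)) <= 283 / 100) by (apply Eb_num; lra).
    replace (2 * m)%nat with (2 * S (m - 1))%nat by lia.
    pose proof (Sfun_right p X Y B (m - 1) Hp HX ltac:(lra) HY) as HS.
    specialize (Hhead X Y B HX HB HY).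
    assert (HG := groups_right p X Y B 4 (m - 1) Hp HX ltac:(lra) HY).
    assert (INR 4 * (804 / 1000) <= rsum (fun i => qgroup X Y (p ^ (2 * i + 1)) p) (m - 1)) as HG'.
    { apply HG; [|lia]. replace (p ^ (2 * 4)) with (p * p ^ 7) by (simpl; ring).
      rewrite Rinv_mult. rewrite Rmult_comm. apply Rmult_le_compat_r; [|exact HBp].
      left; apply Rinv_0_lt_compat; lra. }
    simpl INR in HG'. lra.
- apply (gap_neg (- p) (- 1) 1 (/ (32 / 10)) (3 / 10) (32 / 10)); auto; try lra.
  exists 8%nat. intros m X Y Hm HX HY.
  assert (HE : Eb 1 (/ (32 / 10)) <= 5) by (apply Eb_num; lra).
  replace (2 * m)%nat with (2 * S (m - 1))%nat by lia.
  pose proof (Sfun_right p X Y (32 / 10) (m - 1) Hp HX ltac:(lra) HY) as HS.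
  specialize (Hhead X Y (32 / 10) HX ltac:(lra) HY).
  assert (HG := groups_right p X Y (32 / 10) 6 (m - 1) Hp HX ltac:(lra) HY).
  assert (INR 6 * (804 / 1000) <= rsum (fun i => qgroup X Y (p ^ (2 * i + 1)) p) (m - 1)) as HG'.
  { apply HG; [|lia]. replace (p ^ (2 * 6)) with (p * p ^ 11) by (simpl; ring).
    rewrite Rinv_mult. rewrite Rmult_comm. apply Rmult_le_compat_r.
    - left; apply Rinv_0_lt_compat; lra.
    - apply (inv_pow_num p (9 / 10)); lra. }
  simpl INR in HG'. lra.
Qed.

(** * Interval arithmetic for the product *)

(* Nonnegative reals are enclosed by integers scaled by 2^20; dn and up are the products rounded
   down and up. *)
Definition sc : Z := 1048576.
Definition dn (a b : Z) : Z := Z.shiftr (a * b) 20.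
Definition up (a b : Z) : Z := (dn a b + 1)%Z.

Arguments dn : simpl never.
Arguments up : simpl never.
Arguments sc : simpl never.

(** The sign conditions belong to the relations because multiplying endpoints is monotone only for
    nonnegative numbers. *)
Definition lo (x : R) (a : Z) : Prop := (0 <= a)%Z /\ IZR a <= x * IZR sc.
Definition hi (x : R) (a : Z) : Prop := 0 <= x /\ x * IZR sc <= IZR a.

Lemma sc_gt0 : 0 < IZR sc.
Proof. unfold sc. lra. Qed.

Lemma dn_bounds (a b : Z) : (dn a b * sc <= a * b < (dn a b + 1) * sc)%Z.
Proof.
unfold dn. rewrite Z.shiftr_div_pow2 by lia. change (2 ^ 20)%Z with sc.
assert (0 < sc)%Z by reflexivity.
pose proof (Z.div_mod (a * b) sc). pose proof (Z.mod_pos_bound (a * b) sc). lia.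
Qed.

Lemma lo_mul (x y : R) (a b : Z) : lo x a -> lo y b -> lo (x * y) (dn a b).
Proof.
intros [Ha Hx] [Hb Hy]. destruct (dn_bounds a b) as [H1 H2]. split.
- unfold dn. apply Z.shiftr_nonneg. lia.
- apply IZR_le in H1. rewrite !mult_IZR in H1. apply IZR_le in Ha, Hb.
  pose proof sc_gt0. apply Rmult_le_reg_r with (IZR sc); [lra|].
  apply Rle_trans with (1 := H1).
  replace (x * y * IZR sc * IZR sc) with ((x * IZR sc) * (y * IZR sc)) by ring.
  apply Rmult_le_compat; lra.
Qed.

Lemma hi_mul (x y : R) (a b : Z) : hi x a -> hi y b -> hi (x * y) (up a b).
Proof.
intros [Ha Hx] [Hb Hy]. destruct (dn_bounds a b) as [H1 H2]. split; [nra|].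
unfold up. apply Z.lt_le_incl, IZR_le in H2. rewrite !mult_IZR in H2.
pose proof sc_gt0. apply Rmult_le_reg_r with (IZR sc); [lra|].
apply Rle_trans with (2 := H2).
replace (x * y * IZR sc * IZR sc) with ((x * IZR sc) * (y * IZR sc)) by ring.
apply Rmult_le_compat; nra.
Qed.

Lemma hi_1plus (x : R) (a : Z) : hi x a -> hi (1 + x) (sc + a).
Proof. intros [H1 H2]. split; [lra|]. rewrite plus_IZR. lra. Qed.

Lemma hi_1minus (x : R) (a : Z) : x <= 1 -> lo x a -> hi (1 - x) (sc - a).
Proof. intros H [H1 H2]. split; [lra|]. rewrite minus_IZR. lra. Qed.

Lemma lo_minus1 (x : R) (a : Z) : (sc <= a)%Z -> lo x a -> lo (x - 1) (a - sc).
Proof. intros H [H1 H2]. split; [lia|]. rewrite minus_IZR. lra. Qed.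

Lemma hi_abs1 (x : R) (a b : Z) : lo x a -> hi x b -> hi (Rabs (1 - x)) (Z.max (sc - a) (b - sc)).
Proof.
intros [H1 H2] [H3 H4]. split; [apply Rabs_pos|]. pose proof sc_gt0.
assert (HA : IZR (sc - a) <= IZR (Z.max (sc - a) (b - sc))) by (apply IZR_le; lia).
assert (HB : IZR (b - sc) <= IZR (Z.max (sc - a) (b - sc))) by (apply IZR_le; lia).
rewrite minus_IZR in HA, HB.
unfold Rabs. destruct (Rcase_abs (1 - x)); lra.
Qed.

Lemma hi_le_1 (x : R) (a : Z) : hi x a -> (a <=? sc)%Z = true -> x <= 1.
Proof.
intros [H1 H2] H. apply Z.leb_le, IZR_le in H. pose proof sc_gt0.
apply Rmult_le_reg_r with (IZR sc); lra.
Qed.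

Lemma lo_ge_1 (x : R) (a : Z) : lo x a -> (sc <=? a)%Z = true -> 1 <= x.
Proof.
intros [H1 H2] H. apply Z.leb_le, IZR_le in H. pose proof sc_gt0.
apply Rmult_le_reg_r with (IZR sc); lra.
Qed.

Lemma hi_lt_lo (x y : R) (a b : Z) : hi x a -> lo y b -> (a <? b)%Z = true -> x < y.
Proof.
intros [H1 H2] [H3 H4] H. apply Z.ltb_lt, IZR_lt in H. pose proof sc_gt0.
apply Rmult_lt_reg_r with (IZR sc); lra.
Qed.

Lemma hi_const (x : R) (a : Z) : 0 <= x -> x * IZR sc <= IZR a -> hi x a.
Proof. split; assumption. Qed.

Definition inbox (p X : R) (pl ph Xl Xh : Z) : Prop := lo p pl /\ hi p ph /\ lo X Xl /\ hi X Xh.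

Section Bisection.

Variable leaf : Z -> Z -> Z -> Z -> bool.
Variable Good : R -> R -> Prop.
Hypothesis leafP : forall p X pl ph Xl Xh,
  inbox p X pl ph Xl Xh -> leaf pl ph Xl Xh = true -> Good p X.

(** The leaf test precedes any cut, so large boxes can be accepted early. A width in p weighs 32
    times a width in X, since p enters through many powers. *)
Fixpoint bisect (d : nat) (pl ph Xl Xh : Z) : bool :=
  if leaf pl ph Xl Xh then true else
  match d with
  | O => false
  | S d' =>
    if (Xh - Xl <? (ph - pl) * 32)%Z then
      let m := Z.div2 (pl + ph) in bisect d' pl m Xl Xh && bisect d' m ph Xl Xh
    else
      let m := Z.div2 (Xl + Xh) in bisect d' pl ph Xl m && bisect d' pl ph m Xh
  end%bool.

Lemma lo_hi_split (x : R) (a b m : Z) : lo x a -> hi x b -> (0 <= m)%Z ->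
  (lo x a /\ hi x m) \/ (lo x m /\ hi x b).
Proof.
intros [H1 H2] [H3 H4] Hm.
destruct (Rle_lt_dec (x * IZR sc) (IZR m)); [left|right]; repeat split; auto; lra.
Qed.

Lemma lo_hi_nonneg (x : R) (a b : Z) : lo x a -> hi x b -> (0 <= Z.div2 (a + b))%Z.
Proof.
intros [H1 H2] [H3 H4]. apply Z.div2_nonneg.
assert (0 <= b)%Z; [|lia]. apply le_IZR. pose proof sc_gt0. nra.
Qed.

Lemma bisectP (d : nat) : forall pl ph Xl Xh p X,
  bisect d pl ph Xl Xh = true -> inbox p X pl ph Xl Xh -> Good p X.
Proof.
induction d as [|d IH]; intros pl ph Xl Xh p X H HB; simpl in H.
- destruct (leaf pl ph Xl Xh) eqn:E; [|discriminate]. now apply (leafP p X pl ph Xl Xh).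
- destruct (leaf pl ph Xl Xh) eqn:E; [now apply (leafP p X pl ph Xl Xh)|].
  destruct HB as [A1 [A2 [A3 A4]]].
  destruct (Xh - Xl <? (ph - pl) * 32)%Z; apply andb_prop in H as [Ha Hb].
  + destruct (lo_hi_split p pl ph (Z.div2 (pl + ph)) A1 A2 (lo_hi_nonneg p pl ph A1 A2)) as [[U V]|[U V]].
    * apply (IH _ _ _ _ p X Ha). repeat split; try apply U; try apply V; try apply A3; apply A4.
    * apply (IH _ _ _ _ p X Hb). repeat split; try apply U; try apply V; try apply A3; apply A4.
  + destruct (lo_hi_split X Xl Xh (Z.div2 (Xl + Xh)) A3 A4 (lo_hi_nonneg X Xl Xh A3 A4)) as [[U V]|[U V]].
    * apply (IH _ _ _ _ p X Ha). repeat split; try apply U; try apply V; try apply A1; apply A2.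
    * apply (IH _ _ _ _ p X Hb). repeat split; try apply U; try apply V; try apply A1; apply A2.
Qed.

End Bisection.

Section ProductBound.

Variable gz : Z -> Z -> Z.
Variable g : R -> R.
Hypothesis gP : forall s sl sh, s <= 1 -> lo s sl -> hi s sh -> hi (g s) (gz sl sh).
Variables (m : R) (ml mh Xh stop : Z).
Hypotheses (Hml : lo m ml) (Hmh : hi m mh) (Hm1 : m <= 1).

(** The loop ends once X s is below [stop], where 131072 = 2^17 stands for 1/8; with [stop] = 0 it
    runs its full length, as [up] is at least 1 on nonnegative endpoints. The last s is returned so
    that the neglected factors can be shown to be at most 1. *)
Fixpoint pbound (n : nat) (sl sh acc : Z) : Z * Z :=
  match n with
  | O => (acc, sh)
  | S n' =>
    if (up Xh sh <=? stop)%Z then (acc, sh)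
    else pbound n' (dn sl ml) (up sh mh) (up acc (gz sl sh))
  end.

Lemma pboundP (n : nat) : forall s a sl sh acc, s <= 1 -> lo s sl -> hi s sh -> hi a acc ->
  exists k, hi (a * rprod (fun i => g (s * m ^ i)) k) (fst (pbound n sl sh acc)) /\
            hi (s * m ^ k) (snd (pbound n sl sh acc)).
Proof.
induction n as [|n IH].
all: intros s a sl sh acc Hs Hl Hh Ha.
all: cbn [pbound].
- exists O. cbn [rprod fst snd pow]. rewrite !Rmult_1_r. split; assumption.
- destruct (up Xh sh <=? stop)%Z.
  + exists O. cbn [rprod fst snd pow]. rewrite !Rmult_1_r; split; assumption.
  + assert (Hs' : s * m <= 1) by
      (rewrite <- (Rmult_1_r 1); apply Rmult_le_compat; [apply Hh|apply Hmh|assumption..]).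
    destruct (IH (s * m) (a * g s) (dn sl ml) (up sh mh) (up acc (gz sl sh)))
      as [k [H1 H2]]; [exact Hs'|now apply lo_mul|now apply hi_mul|apply hi_mul; [exact Ha|now apply gP]|].
    exists (S k). rewrite rprod_S_l, pow_O, Rmult_1_r. split.
    * rewrite <- Rmult_assoc.
      rewrite (rprod_ext _ (fun i => g (s * m * m ^ i))); [exact H1|].
      intros i _. f_equal. simpl. ring.
    * replace (s * m ^ S k) with (s * m * m ^ k) by (simpl; ring). exact H2.
Qed.

End ProductBound.

Definition pos_factor (X s : R) : R := (1 - s) * Rabs (1 - X * s).
(** Two neighbouring factors of the product for J with q = - p, without those in 1/X. On the left s
    runs through p^2, p^4, ..., on the right through p, p^3, ... . *)
Definition left_factor (p X s : R) : R := (1 - s) * (1 + p * s) * (Rabs (1 - X * s) * (1 + X * (p * s))).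
Definition right_factor (p X s : R) : R := (1 + s) * (1 - p * s) * (Rabs (1 - X * s) * (1 + X * (p * s))).
Definition residue_factor (r W s : R) : R := (1 - r * s) * Rabs (1 - W * s).

Definition pos_factor_up (Xl Xh sl sh : Z) : Z :=
  up (sc - sl) (Z.max (sc - dn Xl sl) (up Xh sh - sc)).
Definition left_factor_up (ph Xl Xh sl sh : Z) : Z :=
  let t := up ph sh in
  up (up (sc - sl) (sc + t)) (up (Z.max (sc - dn Xl sl) (up Xh sh - sc)) (sc + up Xh t)).
Definition right_factor_up (pl ph Xl Xh sl sh : Z) : Z :=
  let t := up ph sh in
  up (up (sc + sh) (sc - dn pl sl)) (up (Z.max (sc - dn Xl sl) (up Xh sh - sc)) (sc + up Xh t)).
Definition residue_factor_up (rl Wl Wh sl sh : Z) : Z :=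
  up (sc - dn rl sl) (Z.max (sc - dn Wl sl) (up Wh sh - sc)).

(* Boxes on which J has a sign that excludes a zero of theta need no bound on the product. *)
Definition pos_leaf (pl ph Xl Xh : Z) : bool :=
  if (up Xh ph <=? sc)%Z then true else
  (up (Xh - sc) (fst (pbound (pos_factor_up Xl Xh) pl ph Xh 0 12 pl ph sc)) <? sc)%Z.

Definition left_leaf (pl ph Xl Xh : Z) : bool :=
  let p2l := dn pl pl in let p2h := up ph ph in
  let p4l := dn p2l p2l in let p4h := up p2h p2h in
  if (up Xh p2h <=? sc)%Z then true else
  if ((sc <=? dn Xl p4l) && (up Xh (up p4h p2h) <=? sc))%Z%bool then true else
  let r := pbound (left_factor_up ph Xl Xh) p2l p2h Xh 131072 80 p2l p2h (up (sc + ph) (sc + up Xh ph)) in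
  ((up Xh (snd r) <=? sc) && (up (up Xh Xh) (fst r) <? Xl + sc))%Z%bool.

(** The two alternatives at the end match two lower bounds for theta(1/X): 1 - p/X - p^3/X^2 from
    [thr_pos_lower] and (p/2)(1 - 1/X) from [thr_right_lower]. *)
Definition right_leaf (pl ph Xl Xh : Z) : bool :=
  let p2l := dn pl pl in let p2h := up ph ph in
  let p4l := dn p2l p2l in let p4h := up p2h p2h in
  if (up Xh (up ph p2h) <=? sc)%Z then true else
  if ((sc <=? dn Xl (dn p4l pl)) && (up Xh (up p4h (up p2h ph)) <=? sc))%Z%bool then true else
  let r := pbound (right_factor_up pl ph Xl Xh) p2l p2h Xh 131072 80 pl ph sc in
  let b := up (up Xh (Xh + sc)) (fst r) in
  ((up Xh (snd r) <=? sc) && ((up Xh b <? dn Xl (Xl - ph) - up (up ph ph) ph)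
    || ((sc <=? Xl) && (2 * b <? dn pl (Xl - sc)))))%Z%bool.

(** 20971 is the integer part of 0.02 times 2^20. *)
Definition residue_leaf (rl rh Wl Wh : Z) : bool :=
  let r := pbound (residue_factor_up rl Wl Wh) rl rh Wh 131072 60 sc sc sc in
  ((up Wh (snd r) <=? sc) && (fst r <=? 20971))%Z%bool.

Lemma pos_leaf_correct (q X : R) (pl ph Xl Xh : Z) : 0 <= q <= 1 -> 1 <= X ->
  inbox q X pl ph Xl Xh -> pos_leaf pl ph Xl Xh = true ->
  X * q <= 1 \/ exists k, (X - 1) * rprod (fun i => pos_factor X (q * q ^ i)) k < 1.
Proof.
intros Hq HX [A1 [A2 [A3 A4]]] H. unfold pos_leaf in H.
destruct (up Xh ph <=? sc)%Z eqn:E.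
{ left. apply (hi_le_1 _ (up Xh ph)); [now apply hi_mul|exact E]. }
right.
destruct (pboundP (pos_factor_up Xl Xh) (pos_factor X)) with (m := q) (ml := pl) (mh := ph) (Xh := Xh) (stop := 0%Z)
  (n := 12%nat) (s := q) (a := 1) (sl := pl) (sh := ph) (acc := sc) as [k [H1 _]]; auto; try lra.
{ intros s sl sh Hs L1 L2. unfold pos_factor, pos_factor_up. apply hi_mul; [now apply hi_1minus|].
  apply hi_abs1; [now apply lo_mul|now apply hi_mul]. }
{ apply hi_const; lra. }
exists k. rewrite Rmult_1_l in H1.
assert (H2 : hi (X - 1) (Xh - sc)).
{ destruct A4. split; [lra|]. rewrite minus_IZR. lra. }
pose proof (hi_mul _ _ _ _ H2 H1) as [_ H3]. apply Z.ltb_lt, IZR_lt in H.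
pose proof sc_gt0. apply Rmult_lt_reg_r with (IZR sc); lra.
Qed.

Lemma left_leaf_correct (p X : R) (pl ph Xl Xh : Z) : 0 <= p <= 1 -> 1 <= X ->
  inbox p X pl ph Xl Xh -> left_leaf pl ph Xl Xh = true ->
  X * p ^ 2 <= 1 \/ (1 <= X * p ^ 4 /\ X * p ^ 6 <= 1) \/
  exists k, X * (p ^ 2 * (p ^ 2) ^ k) <= 1 /\
    X * X * ((1 + p) * (1 + X * p) * rprod (fun i => left_factor p X (p ^ 2 * (p ^ 2) ^ i)) k) < X + 1.
Proof.
intros Hp HX [A1 [A2 [A3 A4]]] H. unfold left_leaf in H.
assert (L2 : lo (p ^ 2) (dn pl pl)) by (replace (p ^ 2) with (p * p) by ring; now apply lo_mul).
assert (U2 : hi (p ^ 2) (up ph ph)) by (replace (p ^ 2) with (p * p) by ring; now apply hi_mul).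
set (p2l := dn pl pl) in *. set (p2h := up ph ph) in *.
assert (L4 : lo (p ^ 4) (dn p2l p2l)) by (replace (p ^ 4) with (p ^ 2 * p ^ 2) by ring; now apply lo_mul).
assert (U4 : hi (p ^ 4) (up p2h p2h)) by (replace (p ^ 4) with (p ^ 2 * p ^ 2) by ring; now apply hi_mul).
assert (U6 : hi (p ^ 6) (up (up p2h p2h) p2h)).
{ replace (p ^ 6) with (p ^ 4 * p ^ 2) by ring. now apply hi_mul. }
destruct (up Xh p2h <=? sc)%Z eqn:E.
{ left. apply (hi_le_1 _ (up Xh p2h)); [now apply hi_mul|exact E]. }
right. set (p4l := dn p2l p2l) in *. set (p4h := up p2h p2h) in *.
destruct ((sc <=? dn Xl p4l) && (up Xh (up p4h p2h) <=? sc))%Z%bool eqn:E2.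
{ left. apply andb_prop in E2 as [E2 E3]. split.
  - apply (lo_ge_1 _ (dn Xl p4l)); [now apply lo_mul|exact E2].
  - apply (hi_le_1 _ (up Xh (up p4h p2h))); [now apply hi_mul|exact E3]. }
right.
destruct (pboundP (left_factor_up ph Xl Xh) (left_factor p X)) with (m := p ^ 2) (ml := p2l) (mh := p2h) (Xh := Xh)
  (stop := 131072%Z) (n := 80%nat) (s := p ^ 2) (a := (1 + p) * (1 + X * p)) (sl := p2l) (sh := p2h)
  (acc := up (sc + ph) (sc + up Xh ph)) as [k [H1 H2]]; auto; try nra.
{ intros s sl sh Hs M1 M2. unfold left_factor, left_factor_up. assert (Ht := hi_mul _ _ _ _ A2 M2). apply hi_mul.
  - apply hi_mul; [now apply hi_1minus|now apply hi_1plus].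
  - apply hi_mul; [apply hi_abs1; [now apply lo_mul|now apply hi_mul]|].
    apply hi_1plus. now apply hi_mul. }
{ apply hi_mul; [now apply hi_1plus|]. apply hi_1plus. now apply hi_mul. }
exists k. apply andb_prop in H as [E3 E4]. split.
- refine (hi_le_1 _ _ (hi_mul _ _ _ _ A4 H2) E3).
- refine (hi_lt_lo _ _ _ _ (hi_mul _ _ _ _ (hi_mul _ _ _ _ A4 A4) H1) _ E4).
  destruct A3 as [B1 B2]. pose proof sc_gt0. split; [unfold sc; lia|]. rewrite plus_IZR. lra.
Qed.

Lemma right_leaf_correct (p X : R) (pl ph Xl Xh : Z) : 0 <= p <= 1 -> 1 <= X ->
  inbox p X pl ph Xl Xh -> right_leaf pl ph Xl Xh = true ->
  X * p ^ 3 <= 1 \/ (1 <= X * p ^ 5 /\ X * p ^ 7 <= 1) \/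
  exists k, X * (p * (p ^ 2) ^ k) <= 1 /\
    let b := X * (X + 1) * rprod (fun i => right_factor p X (p * (p ^ 2) ^ i)) k in
    X * b < X * (X - p) - p ^ 3 \/ 2 * b < p * (X - 1).
Proof.
intros Hp HX [A1 [A2 [A3 A4]]] H. unfold right_leaf in H.
assert (L2 : lo (p ^ 2) (dn pl pl)) by (replace (p ^ 2) with (p * p) by ring; now apply lo_mul).
assert (U2 : hi (p ^ 2) (up ph ph)) by (replace (p ^ 2) with (p * p) by ring; now apply hi_mul).
set (p2l := dn pl pl) in *. set (p2h := up ph ph) in *.
assert (L4 : lo (p ^ 4) (dn p2l p2l)) by (replace (p ^ 4) with (p ^ 2 * p ^ 2) by ring; now apply lo_mul).
assert (U4 : hi (p ^ 4) (up p2h p2h)) by (replace (p ^ 4) with (p ^ 2 * p ^ 2) by ring; now apply hi_mul).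
set (p4l := dn p2l p2l) in *. set (p4h := up p2h p2h) in *.
assert (L5 : lo (p ^ 5) (dn p4l pl)).
{ replace (p ^ 5) with (p ^ 4 * p) by ring. now apply lo_mul. }
assert (U3 : hi (p ^ 3) (up p2h ph)).
{ replace (p ^ 3) with (p ^ 2 * p) by ring. now apply hi_mul. }
assert (U3' : hi (p ^ 3) (up ph p2h)).
{ replace (p ^ 3) with (p * p ^ 2) by ring. now apply hi_mul. }
assert (U7 : hi (p ^ 7) (up p4h (up p2h ph))).
{ replace (p ^ 7) with (p ^ 4 * p ^ 3) by ring. now apply hi_mul. }
destruct (up Xh (up ph p2h) <=? sc)%Z eqn:E.
{ left. apply (hi_le_1 _ (up Xh (up ph p2h))); [now apply hi_mul|exact E]. }
right.
destruct ((sc <=? dn Xl (dn p4l pl)) && (up Xh (up p4h (up p2h ph)) <=? sc))%Z%bool eqn:E2.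
{ left. apply andb_prop in E2 as [E2 E3]. split.
  - refine (lo_ge_1 _ _ (lo_mul _ _ _ _ A3 L5) E2).
  - refine (hi_le_1 _ _ (hi_mul _ _ _ _ A4 U7) E3). }
right.
destruct (pboundP (right_factor_up pl ph Xl Xh) (right_factor p X)) with (m := p ^ 2) (ml := p2l) (mh := p2h) (Xh := Xh)
  (stop := 131072%Z) (n := 80%nat) (s := p) (a := 1) (sl := pl) (sh := ph)
  (acc := sc) as [k [H1 H2]]; auto; try nra.
{ intros s sl sh Hs M1 M2. unfold right_factor, right_factor_up. assert (Ht := hi_mul _ _ _ _ A2 M2). apply hi_mul.
  - apply hi_mul; [now apply hi_1plus|]. apply hi_1minus; [destruct M2; nra|now apply lo_mul].
  - apply hi_mul; [apply hi_abs1; [now apply lo_mul|now apply hi_mul]|].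
    apply hi_1plus. now apply hi_mul. }
{ pose proof sc_gt0. apply hi_const; lra. }
exists k. apply andb_prop in H as [E3 E4]. split.
- refine (hi_le_1 _ _ (hi_mul _ _ _ _ A4 H2) E3).
- rewrite Rmult_1_l in H1.
  assert (HX1 : hi (X + 1) (Xh + sc)).
  { destruct A4 as [B1 B2]. split; [lra|]. rewrite plus_IZR. lra. }
  assert (Hb := hi_mul _ _ _ _ (hi_mul _ _ _ _ A4 HX1) H1).
  set (b := X * (X + 1) * _) in *. set (bz := up (up Xh (Xh + sc)) _) in *.
  pose proof sc_gt0. apply Bool.orb_prop in E4 as [E4|E4].
  + left. destruct (hi_mul _ _ _ _ A4 Hb) as [C1 C2]. apply Z.ltb_lt, IZR_lt in E4.
    rewrite minus_IZR in E4. destruct U3 as [C3 C4].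
    change (up (up ph ph) ph) with (up p2h ph) in E4.
    destruct (Z.leb_spec ph Xl) as [E5|E5].
    * assert (L6 : lo (X - p) (Xl - ph)).
      { destruct A2, A3. split; [lia|]. rewrite minus_IZR. lra. }
      destruct (lo_mul _ _ _ _ A3 L6) as [C5 C6].
      apply Rmult_lt_reg_r with (IZR sc); lra.
    * exfalso. assert (dn Xl (Xl - ph) <= 0)%Z.
      { destruct (dn_bounds Xl (Xl - ph)) as [D1 D2]. destruct A3 as [C5 _].
        unfold sc in D1. nia. }
      apply IZR_le in H0. nra.
  + right. apply andb_prop in E4 as [E4 E5]. apply Z.leb_le in E4.
    destruct (lo_mul _ _ _ _ A1 (lo_minus1 _ _ E4 A3)) as [C5 C6].
    destruct Hb as [C1 C2]. apply Z.ltb_lt, IZR_lt in E5. rewrite mult_IZR in E5.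
    apply Rmult_lt_reg_r with (IZR sc); lra.
Qed.

Lemma residue_leaf_correct (r W : R) (rl rh Wl Wh : Z) : 0 <= r <= 1 ->
  inbox r W rl rh Wl Wh -> residue_leaf rl rh Wl Wh = true ->
  exists k, W * r ^ k <= 1 /\ rprod (fun i => residue_factor r W (r ^ i)) k <= 2 / 100.
Proof.
intros Hr [A1 [A2 [A3 A4]]] H. unfold residue_leaf in H.
destruct (pboundP (residue_factor_up rl Wl Wh) (residue_factor r W)) with (m := r) (ml := rl) (mh := rh) (Xh := Wh)
  (stop := 131072%Z) (n := 60%nat) (s := 1) (a := 1) (sl := sc) (sh := sc) (acc := sc)
  as [k [H1 H2]]; auto; try lra.
{ intros s sl sh Hs M1 M2. unfold residue_factor, residue_factor_up. apply hi_mul.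
  - apply hi_1minus; [destruct M2; nra|now apply lo_mul].
  - apply hi_abs1; [now apply lo_mul|now apply hi_mul]. }
{ split; [unfold sc; lia|lra]. }
{ pose proof sc_gt0. apply hi_const; lra. }
{ pose proof sc_gt0. apply hi_const; lra. }
exists k. apply andb_prop in H as [E3 E4]. rewrite Rmult_1_l in H1, H2. split.
- refine (hi_le_1 _ _ (hi_mul _ _ _ _ A4 H2) E3).
- destruct H1 as [C1 C2]. apply Z.leb_le, IZR_le in E4.
  rewrite (rprod_ext _ (fun i => residue_factor r W (1 * r ^ i))) by (intros i _; now rewrite Rmult_1_l).
  unfold sc in *. lra.
Qed.

Ltac inbox_tac := unfold inbox, lo, hi, sc; repeat split; try lia; lra.

(** The box starts at q = 0.2 because below it X <= 5 already gives X q <= 1. *)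
Lemma pos_product_bound (q X : R) : 2 / 10 <= q <= 1 -> 1 <= X <= 5 ->
  X * q <= 1 \/ exists k, (X - 1) * rprod (fun i => pos_factor X (q * q ^ i)) k < 1.
Proof.
intros Hq HX.
apply (bisectP pos_leaf (fun q X => 0 <= q <= 1 -> 1 <= X -> X * q <= 1 \/
  exists k, (X - 1) * rprod (fun i => pos_factor X (q * q ^ i)) k < 1)) with
  (d := 18%nat) (pl := 209715%Z) (ph := 1048576%Z) (Xl := 1048576%Z) (Xh := 5242880%Z); try lra.
- intros. eapply pos_leaf_correct; eauto.
- vm_compute. reflexivity.
- inbox_tac.
Qed.

Definition left_good (p X : R) : Prop :=
  X * p ^ 2 <= 1 \/ (1 <= X * p ^ 4 /\ X * p ^ 6 <= 1) \/
  exists k, X * (p ^ 2 * (p ^ 2) ^ k) <= 1 /\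
    X * X * ((1 + p) * (1 + X * p) * rprod (fun i => left_factor p X (p ^ 2 * (p ^ 2) ^ i)) k) < X + 1.

(** Below p = 0.645 one has 2.4 p^2 < 1. Above p = 0.98 the residue classes take over, as the number
    of relevant factors is unbounded when p tends to 1. *)
Lemma left_product_bound (p X : R) : 645 / 1000 <= p <= 98 / 100 -> 1 <= X <= 32 / 10 ->
  (p < 3 / 4 -> X <= 24 / 10) -> left_good p X.
Proof.
intros Hp HX H. destruct (Rlt_le_dec p (3 / 4)) as [C|C].
- specialize (H C).
  apply (bisectP left_leaf (fun p X => 0 <= p <= 1 -> 1 <= X -> left_good p X)) with
  (d := 18%nat) (pl := 676331%Z) (ph := 786432%Z) (Xl := 1048576%Z) (Xh := 2516583%Z); try lra.
  + intros. eapply left_leaf_correct; eauto.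
  + vm_compute. reflexivity.
  + inbox_tac.
- apply (bisectP left_leaf (fun p X => 0 <= p <= 1 -> 1 <= X -> left_good p X)) with
  (d := 18%nat) (pl := 786432%Z) (ph := 1027605%Z) (Xl := 1048576%Z) (Xh := 3355444%Z); try lra.
  + intros. eapply left_leaf_correct; eauto.
  + vm_compute. reflexivity.
  + inbox_tac.
Qed.

Definition right_good (p X : R) : Prop :=
  X * p ^ 3 <= 1 \/ (1 <= X * p ^ 5 /\ X * p ^ 7 <= 1) \/
  exists k, X * (p * (p ^ 2) ^ k) <= 1 /\
    let b := X * (X + 1) * rprod (fun i => right_factor p X (p * (p ^ 2) ^ i)) k in
    X * b < X * (X - p) - p ^ 3 \/ 2 * b < p * (X - 1).

Lemma right_product_bound (p X : R) : 8 / 10 <= p <= 98 / 100 -> 1 <= X <= 32 / 10 -> right_good p X.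
Proof.
intros Hp HX.
apply (bisectP right_leaf (fun p X => 0 <= p <= 1 -> 1 <= X -> right_good p X)) with
  (d := 18%nat) (pl := 838860%Z) (ph := 1027605%Z) (Xl := 1048576%Z) (Xh := 3355444%Z); try lra.
- intros. eapply right_leaf_correct; eauto.
- vm_compute. reflexivity.
- inbox_tac.
Qed.

(** 10.7 exceeds (3.2 / 0.98)^2, the largest argument that occurs. *)
Lemma residue_product_bound (r W : R) : 78 / 100 <= r <= 85 / 100 -> 0 <= W <= 107 / 10 ->
  exists k, W * r ^ k <= 1 /\ rprod (fun i => residue_factor r W (r ^ i)) k <= 2 / 100.
Proof.
intros Hr HW.
apply (bisectP residue_leaf (fun r W => 0 <= r <= 1 ->
    exists k, W * r ^ k <= 1 /\ rprod (fun i => residue_factor r W (r ^ i)) k <= 2 / 100)) with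
  (d := 18%nat) (pl := 817889%Z) (ph := 891290%Z) (Xl := 0%Z) (Xh := 11219764%Z); try lra.
- intros. eapply residue_leaf_correct; eauto.
- vm_compute. reflexivity.
- inbox_tac.
Qed.

(** * Bounds for J and the first zero *)

Definition Jterm (q x : R) (j : nat) : R := (1 - q ^ S j) * ((1 + q ^ S j * x) * (1 + q ^ j * / x)).

Lemma Jterm_lim (q x : R) (a b : nat) : 0 < Rabs q < 1 -> x <> 0 -> (0 < a)%nat ->
  is_lim_seq (fun m => rprod (Jterm q x) (a * m + b)) (Jr q x).
Proof.
intros Hq Hx Ha. apply (is_lim_seq_ext (fun m => qf q (a * m + b) * Qr q (a * m + b) x)).
- intros m. unfold qf, Qr, Jterm. symmetry.
  apply (rprod_mult (fun j => 1 - q ^ S j)).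
- apply (is_lim_seq_subseq (fun n => qf q n * Qr q n x) _ (fun m => (a * m + b)%nat)).
  + intros P [N HN]. exists N. intros n Hn. apply HN. nia.
  + now apply jacobi_lim_real.
Qed.

Lemma lim_le_const (u : nat -> R) (l c : R) (m0 : nat) :
  is_lim_seq u l -> (forall m, (m0 <= m)%nat -> u m <= c) -> l <= c.
Proof.
intros Hu H. apply (is_lim_seq_incr_n u m0) in Hu.
apply (is_lim_seq_le (fun n => u (n + m0)%nat) (fun _ => c) l c); [|exact Hu|apply is_lim_seq_const].
intros n. apply H. lia.
Qed.

Lemma lim_ge_const (u : nat -> R) (l c : R) (m0 : nat) :
  is_lim_seq u l -> (forall m, (m0 <= m)%nat -> c <= u m) -> c <= l.
Proof.
intros Hu H. apply (is_lim_seq_incr_n u m0) in Hu.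
apply (is_lim_seq_le (fun _ => c) (fun n => u (n + m0)%nat) c l); [|apply is_lim_seq_const|exact Hu].
intros n. apply H. lia.
Qed.

Lemma Jr_bound (q x c : R) (a b m0 : nat) : 0 < Rabs q < 1 -> x <> 0 -> (0 < a)%nat ->
  (forall m, (m0 <= m)%nat -> Rabs (rprod (Jterm q x) (a * m + b)) <= c) -> Rabs (Jr q x) <= c.
Proof.
intros Hq Hx Ha H. pose proof (Jterm_lim q x a b Hq Hx Ha) as HL.
apply Rabs_le. split.
- apply (lim_ge_const _ _ _ m0 HL). intros m Hm. specialize (H m Hm). apply Rabs_le_between in H. lra.
- apply (lim_le_const _ _ _ m0 HL). intros m Hm. specialize (H m Hm). apply Rabs_le_between in H. lra.
Qed.

Lemma Jr_ge0 (q x : R) (k : nat) : 0 < Rabs q < 1 -> x <> 0 ->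
  0 <= rprod (Jterm q x) k -> (forall j, (k <= j)%nat -> 0 <= Jterm q x j) -> 0 <= Jr q x.
Proof.
intros Hq Hx Hk Hj.
apply (lim_ge_const _ _ _ O (Jterm_lim q x 1 k Hq Hx ltac:(lia))). intros m _.
replace (1 * m + k)%nat with (k + m)%nat by lia. rewrite rprod_app.
apply Rmult_le_pos; [exact Hk|]. apply rprod_ge0. intros j _. apply Hj. lia.
Qed.

Lemma Jr_le0 (q x : R) (k : nat) : 0 < Rabs q < 1 -> x <> 0 ->
  rprod (Jterm q x) k <= 0 -> (forall j, (k <= j)%nat -> 0 <= Jterm q x j) -> Jr q x <= 0.
Proof.
intros Hq Hx Hk Hj.
apply (lim_le_const _ _ _ O (Jterm_lim q x 1 k Hq Hx ltac:(lia))). intros m _.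
replace (1 * m + k)%nat with (k + m)%nat by lia. rewrite rprod_app.
assert (0 <= rprod (fun j => Jterm q x (k + j)) m); [|nra].
apply rprod_ge0. intros j _. apply Hj. lia.
Qed.

(** A functional equation passes from c y to y. For large N the point c^N y lies where f > 0 by
    continuity, and N steps lead back to y. *)
Lemma descent_ge0 (f : R -> R) (c : R) : 0 <= c < 1 -> continuity_pt f 0 -> 0 < f 0 ->
  (forall y, 0 <= y <= 1 -> 0 <= f (c * y) -> 0 <= f y) -> forall y, 0 <= y <= 1 -> 0 <= f y.
Proof.
intros Hc Hf H0 Hd y Hy.
destruct (Hf (f 0) H0) as [d [Hd0 Hdd]]. simpl in Hdd. unfold Rdist in Hdd.
assert (Hnear : forall z, Rabs z < d -> 0 <= f z).
{ intros z Hz. destruct (Req_dec z 0) as [->|Hz0]; [lra|].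
  assert (HH : Rabs (f z - f 0) < f 0).
  { apply Hdd. split; [split; [exact I|auto]|]. now rewrite Rminus_0_r. }
  apply Rabs_def2 in HH. lra. }
destruct (pow_lt_1_zero c ltac:(rewrite Rabs_pos_eq; lra) d Hd0) as [N HN].
assert (HcN : 0 <= f (c ^ N * y)).
{ apply Hnear. specialize (HN N ltac:(lia)). rewrite Rabs_mult.
  rewrite (Rabs_pos_eq y) by lra. pose proof (Rabs_pos (c ^ N)). nra. }
clear HN Hnear. revert HcN. generalize N. clear N. intros N.
induction N as [|N IH]; intros HN; [now rewrite pow_O, Rmult_1_l in HN|].
apply IH. apply Hd.
- assert (0 <= c ^ N) by (apply pow_le; lra).
  assert (c ^ N <= 1) by (rewrite <- (pow1 N); apply pow_incr; lra). nra.
- now rewrite <- Rmult_assoc.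
Qed.

Lemma thr_cont_lin (q k : R) : 0 < Rabs q < 1 -> continuity_pt (fun y => thr q (k * y)) 0.
Proof.
intros Hq. apply (continuity_pt_comp (fun y => k * y) (thr q)).
- reg.
- now apply thr_continuity.
Qed.

(** Two steps of the functional equation give theta(- y) = 1 - q y + q^3 y^2 theta(- q^2 y), so
    nonnegativity descends with ratio q^2. *)
Lemma thr_alt_ge0 (q y : R) : 0 < q < 1 -> 0 <= y <= 1 -> 0 <= thr q (- y).
Proof.
intros Hq Hy. assert (Hq' : 0 < Rabs q < 1) by (rewrite Rabs_pos_eq; lra).
replace (- y) with (-1 * y) by ring.
apply (descent_ge0 (fun y => thr q (-1 * y)) (q * q)); auto.
- nra.
- now apply thr_cont_lin.
- rewrite Rmult_0_r, thr_0 by exact Hq'. lra.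
- intros w Hw H. rewrite thr_eq1 by exact Hq'. rewrite (thr_eq1 q (q * (-1 * w))) by exact Hq'.
  replace (q * (q * (-1 * w))) with (-1 * (q * q * w)) by ring.
  set (T := thr q _) in *. clearbody T.
  assert (0 <= q * w <= 1) by nra.
  assert (0 <= (q * w) * (q * q * w) * T) by (apply Rmult_le_pos; [|lra]; apply Rmult_le_pos; nra).
  nra.
Qed.

Lemma thr_alt_lower (q y : R) : 0 < q < 1 -> 0 <= y <= 1 -> 1 - q * y <= thr q (- y).
Proof.
intros Hq Hy. assert (Hq' : 0 < Rabs q < 1) by (rewrite Rabs_pos_eq; lra).
rewrite thr_eq1 by exact Hq'. rewrite (thr_eq1 q (q * - y)) by exact Hq'.
replace (q * (q * - y)) with (- (q * (q * y))) by ring.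
assert (HT : 0 <= thr q (- (q * (q * y)))) by (apply thr_alt_ge0; [exact Hq|nra]).
set (T := thr q _) in *. clearbody T.
assert (0 <= (q * y) * (q * q * y) * T) by (apply Rmult_le_pos; [|lra]; apply Rmult_le_pos; nra).
nra.
Qed.

Lemma thr_neg_eq2 (p w : R) : 0 < p < 1 ->
  thr (- p) (- w) = 1 + p * w - p ^ 3 * w ^ 2 * thr (- p) (- (p ^ 2 * w)).
Proof.
intros Hp. assert (Hq' : 0 < Rabs (- p) < 1) by (rewrite Rabs_left; lra).
rewrite thr_eq1 by exact Hq'. rewrite (thr_eq1 (- p) (- p * - w)) by exact Hq'.
replace (- p * (- p * - w)) with (- (p ^ 2 * w)) by ring. ring.
Qed.

(** In [thr_neg_eq2] the value at p^2 w enters with a minus sign, so two steps are composed and the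
    descent has ratio p^4. *)
Lemma thr_neg_ge0 (p w : R) : 0 < p < 1 -> 0 <= w <= 1 -> 0 <= thr (- p) (- w).
Proof.
intros Hp Hw. assert (Hq' : 0 < Rabs (- p) < 1) by (rewrite Rabs_left; lra).
replace (- w) with (-1 * w) by ring.
apply (descent_ge0 (fun y => thr (- p) (-1 * y)) (p ^ 4)); auto.
- assert (0 < p ^ 2 < 1) by nra. replace (p ^ 4) with (p ^ 2 * p ^ 2) by ring. split; nra.
- now apply thr_cont_lin.
- rewrite Rmult_0_r, thr_0 by exact Hq'. lra.
- intros y Hy H. replace (-1 * (p ^ 4 * y)) with (- (p ^ 2 * (p ^ 2 * y))) in H by ring.
  replace (-1 * y) with (- y) by ring. rewrite thr_neg_eq2 by exact Hp.
  rewrite (thr_neg_eq2 p (p ^ 2 * y)) by exact Hp.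
  set (T := thr (- p) _) in *. clearbody T.
  assert (0 <= p * y <= 1) by nra.
  assert (0 <= p ^ 3 * (p ^ 2 * y) ^ 2 * T).
  { apply Rmult_le_pos; [|exact H]. apply Rmult_le_pos; [|apply pow2_ge_0]. apply pow_le; lra. }
  assert (0 <= p ^ 3 * y ^ 2) by (apply Rmult_le_pos; [apply pow_le; lra|apply pow2_ge_0]).
  assert (p ^ 3 * y ^ 2 <= p * y).
  { assert (p ^ 3 * y ^ 2 = (p * y) * (p * (p * y))) as -> by ring.
    assert (0 <= p * (p * y) <= 1) by nra. nra. }
  assert (0 <= p ^ 2 <= 1) by nra. assert (0 <= p ^ 2 * y <= y) by nra.
  assert (p * (p ^ 2 * y) <= p * y) by nra.
  assert (p ^ 3 * y ^ 2 * (1 + p * (p ^ 2 * y)) <= p * y * (1 + p * y)) by (apply Rmult_le_compat; nra).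
  nra.
Qed.

(** The inner value at p^2 w is at most 1 + p^3 w <= 1 + p w. The factorised form is chosen because
    the factor 1 + p w, with w = 1/X, also occurs in the bound on J and cancels. *)
Lemma thr_neg_lower (p w : R) : 0 < p < 1 -> 0 <= w <= 1 ->
  (1 + p * w) * (1 - p ^ 3 * w ^ 2) <= thr (- p) (- w).
Proof.
intros Hp Hw. rewrite thr_neg_eq2 by exact Hp. rewrite (thr_neg_eq2 p (p ^ 2 * w)) by exact Hp.
assert (Hpw : 0 <= p ^ 2 * w <= 1) by (split; nra).
assert (HT : 0 <= thr (- p) (- (p ^ 2 * (p ^ 2 * w)))) by (apply thr_neg_ge0; nra).
set (T := thr (- p) _) in *. clearbody T.
assert (0 <= p ^ 3 * (p ^ 2 * w) ^ 2 * T).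
{ apply Rmult_le_pos; [|exact HT]. apply Rmult_le_pos; [|apply pow2_ge_0]. apply pow_le; lra. }
assert (0 <= p ^ 3) by (apply pow_le; lra).
assert (0 <= w ^ 2) by apply pow2_ge_0.
assert (p ^ 3 * w ^ 2 * (1 + p * (p ^ 2 * w) - p ^ 3 * (p ^ 2 * w) ^ 2 * T) <= p ^ 3 * w ^ 2 * (1 + p * w)); [|lra].
apply Rmult_le_compat_l; [apply Rmult_le_pos; lra|].
assert (p * (p ^ 2 * w) <= p * w); [|lra]. apply Rmult_le_compat_l; [lra|].
assert (0 <= p ^ 2 <= 1) by nra. nra.
Qed.

Lemma thr_neg_pos (p w : R) : 0 < p < 1 -> 0 <= w <= 1 -> 0 < thr (- p) (- w).
Proof.
intros Hp Hw. eapply Rlt_le_trans; [|now apply thr_neg_lower].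
assert (0 < p ^ 3 < 1).
{ split; [apply pow_lt; lra|]. replace (p ^ 3) with (p * (p * p)) by ring. assert (0 < p * p < 1) by nra. nra. }
assert (0 <= w ^ 2 <= 1) by nra.
apply Rmult_lt_0_compat; nra.
Qed.

Lemma thr_pos_lower (p y : R) : 0 < p < 1 -> 0 <= y <= 1 -> 1 - p * y - p ^ 3 * y ^ 2 <= thr (- p) y.
Proof.
intros Hp Hy. assert (Hq' : 0 < Rabs (- p) < 1) by (rewrite Rabs_left; lra).
rewrite thr_eq1 by exact Hq'. replace (- p * y) with (- (p * y)) by ring.
rewrite (thr_neg_eq2 p (p * y)) by exact Hp.
assert (HT : 0 <= thr (- p) (- (p ^ 2 * (p * y)))).
{ apply thr_neg_ge0; [exact Hp|]. assert (0 <= p * y <= 1) by nra. nra. }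
set (T := thr (- p) _) in *. clearbody T.
assert (0 <= p * y * (p ^ 3 * (p * y) ^ 2 * T)).
{ apply Rmult_le_pos; [nra|]. apply Rmult_le_pos; [|exact HT].
  apply Rmult_le_pos; [|apply pow2_ge_0]. apply pow_le; lra. }
nra.
Qed.

Lemma rprod_tail_le (f : nat -> R) (k m : nat) : (forall i, 0 <= f i) ->
  (forall i, (k <= i)%nat -> f i <= 1) -> (k <= m)%nat -> rprod f m <= rprod f k.
Proof.
intros H0 H1 Hm. replace m with (k + (m - k))%nat by lia. rewrite rprod_app.
assert (0 <= rprod f k) by (apply rprod_ge0; auto).
assert (rprod (fun j => f (k + j)%nat) (m - k) <= 1); [|nra].
apply rprod_le1. intros j _. split; [apply H0|apply H1; lia].
Qed.

Section NegativeQ.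

Variables p X : R.
Hypothesis Hp : 0 < p < 1.
Hypothesis HX : 1 <= X.

Lemma psq_range : 0 < p ^ 2 < 1.
Proof. nra. Qed.

Lemma ppow_range (i : nat) : 0 < (p ^ 2) ^ i <= 1.
Proof. apply pow_pos_le1, psq_range. Qed.

Lemma neg_q : 0 < Rabs (- p) < 1.
Proof. rewrite Rabs_left; lra. Qed.

(* Shifting the pairing by one makes the two nearly cancelling factors adjacent in the other
   order, (1 - a)(1 + p a) <= 1 - a^2. *)
Lemma shift_product (v : R) (k : nat) : 0 <= v <= 1 ->
  rprod (fun i => (1 + v * (p ^ 2) ^ i) * (1 - v * p * (p ^ 2) ^ i)) k
  <= (1 + v) * rprod (fun i => 1 - (v * p * (p ^ 2) ^ i) ^ 2) k.
Proof.
intros Hv.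
assert (Ha : forall i, 0 <= v * p * (p ^ 2) ^ i <= 1).
{ intros i. pose proof (ppow_range i). assert (0 <= v * p <= 1) by nra. nra. }
assert (H0 : forall k, 0 <= rprod (fun i => (1 + v * (p ^ 2) ^ i) * (1 - v * p * (p ^ 2) ^ i)) k).
{ intros n. apply rprod_ge0. intros i _. specialize (Ha i). pose proof (ppow_range i). nra. }
assert (H : rprod (fun i => (1 + v * (p ^ 2) ^ i) * (1 - v * p * (p ^ 2) ^ i)) k * (1 + v * (p ^ 2) ^ k)
  <= (1 + v) * rprod (fun i => 1 - (v * p * (p ^ 2) ^ i) ^ 2) k).
{ induction k as [|k IH]; [simpl; lra|]. cbn [rprod].
  set (F := rprod (fun i => (1 + v * (p ^ 2) ^ i) * (1 - v * p * (p ^ 2) ^ i)) k) in *.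
  set (G := rprod (fun i => 1 - (v * p * (p ^ 2) ^ i) ^ 2) k) in *.
  specialize (Ha k). set (a := v * p * (p ^ 2) ^ k) in *.
  replace (v * (p ^ 2) ^ S k) with (p * a) by (unfold a; simpl; ring).
  replace (F * ((1 + v * (p ^ 2) ^ k) * (1 - a)) * (1 + p * a))
    with ((F * (1 + v * (p ^ 2) ^ k)) * ((1 - a) * (1 + p * a))) by ring.
  replace ((1 + v) * (G * (1 - a ^ 2))) with ((1 + v) * G * (1 - a ^ 2)) by ring.
  pose proof (ppow_range k). assert (HF : 0 <= F) by exact (H0 k).
  assert (0 <= (1 - a) * (1 + p * a) <= 1 - a ^ 2).
  { split; [apply Rmult_le_pos; nra|]. assert (0 <= (1 - a) * (a * (1 - p))); [|lra].
    apply Rmult_le_pos; nra. }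
  assert (0 <= v * (p ^ 2) ^ k) by (apply Rmult_le_pos; lra).
  apply Rmult_le_compat; [apply Rmult_le_pos; lra|apply H1|exact IH|apply H1]. }
specialize (H0 k). pose proof (ppow_range k).
assert (0 <= v * (p ^ 2) ^ k) by (apply Rmult_le_pos; lra). nra.
Qed.

Lemma shift_product_le (v : R) (k : nat) : 0 <= v <= 1 ->
  0 <= rprod (fun i => (1 + v * (p ^ 2) ^ i) * (1 - v * p * (p ^ 2) ^ i)) k <= 1 + v.
Proof.
intros Hv.
assert (Ha : forall i, 0 <= v * p * (p ^ 2) ^ i <= 1).
{ intros i. pose proof (ppow_range i). assert (0 <= v * p <= 1) by nra. nra. }
split.
- apply rprod_ge0. intros i _. specialize (Ha i). pose proof (ppow_range i). nra.
- eapply Rle_trans; [now apply shift_product|].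
  assert (rprod (fun i => 1 - (v * p * (p ^ 2) ^ i) ^ 2) k <= 1); [|nra].
  apply rprod_le1. intros i _. specialize (Ha i). nra.
Qed.

Lemma neg_pow (i : nat) : (- p) ^ (2 * i) = (p ^ 2) ^ i.
Proof. rewrite pow_mult. f_equal. ring. Qed.

Lemma pair_range (a : R) : 0 <= a <= 1 -> 0 <= (1 - a) * (1 + p * a) <= 1 - a * (1 - p).
Proof.
intros Ha. split; [apply Rmult_le_pos; nra|].
assert (0 <= p * (a * a)) by (apply Rmult_le_pos; nra). lra.
Qed.

Lemma left_factor_ge0 (s : R) : 0 <= s <= 1 -> 0 <= left_factor p X s.
Proof.
intros Hs. unfold left_factor. pose proof (Rabs_pos (1 - X * s)).
assert (0 <= p * s) by nra. assert (0 <= X * (p * s)) by nra.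
repeat apply Rmult_le_pos; lra.
Qed.

Lemma right_factor_ge0 (s : R) : 0 <= s <= 1 -> 0 <= right_factor p X s.
Proof.
intros Hs. unfold right_factor. pose proof (Rabs_pos (1 - X * s)).
assert (0 <= p * s <= 1) by nra. assert (0 <= X * (p * s)) by nra.
repeat apply Rmult_le_pos; lra.
Qed.

Lemma left_factor_le1 (s : R) : 0 <= s -> X * s <= 1 -> left_factor p X s <= 1.
Proof.
intros Hs HXs. unfold left_factor. rewrite Rabs_pos_eq by lra.
assert (0 <= X * s) by nra. assert (s <= 1) by nra.
pose proof (pair_range s ltac:(lra)). pose proof (pair_range (X * s) ltac:(lra)).
replace (X * (p * s)) with (p * (X * s)) by ring.
assert (0 <= s * (1 - p)) by nra. assert (0 <= X * s * (1 - p)) by (apply Rmult_le_pos; lra).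
rewrite <- (Rmult_1_r 1). apply Rmult_le_compat; lra.
Qed.

(** With e = s (1 - p) the first pair is at most 1 + e and, because X >= 1, the second at most 1 -
    e. *)
Lemma right_factor_le1 (s : R) : 0 <= s -> X * s <= 1 -> right_factor p X s <= 1.
Proof.
intros Hs HXs. unfold right_factor. rewrite Rabs_pos_eq by lra.
assert (0 <= X * s) by nra. assert (s <= 1) by nra.
replace (X * (p * s)) with (p * (X * s)) by ring.
set (e := s * (1 - p)). assert (0 <= e <= 1) by (unfold e; nra).
assert (0 <= (1 + s) * (1 - p * s) <= 1 + e).
{ assert (0 <= p * s <= 1) by nra. unfold e. split; nra. }
assert (0 <= (1 - X * s) * (1 + p * (X * s)) <= 1 - e).
{ pose proof (pair_range (X * s) ltac:(lra)).
  assert (e <= X * s * (1 - p)) by (unfold e; apply Rmult_le_compat_r; nra). lra. }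
apply Rle_trans with ((1 + e) * (1 - e)); [apply Rmult_le_compat; lra|nra].
Qed.

(** Index 0 is split off so that each pair begins with an even power s of p, the one whose factor 1
    - X s can be negative. *)
Lemma J_left_product (k : nat) :
  Rabs (rprod (Jterm (- p) (- X)) (2 * k + 1)) =
  (1 + p) * (1 + X * p) * (1 - / X) *
  (rprod (fun i => left_factor p X (p ^ 2 * (p ^ 2) ^ i)) k *
   rprod (fun i => (1 + p / X * (p ^ 2) ^ i) * (1 - p / X * p * (p ^ 2) ^ i)) k).
Proof.
replace (2 * k + 1)%nat with (S (2 * k)) by lia. rewrite rprod_S_l, rprod_pairs, Rabs_mult, rprod_abs.
assert (Hi : 0 < / X <= 1).
{ split; [apply Rinv_0_lt_compat; lra|]. rewrite <- Rinv_1. apply Rinv_le_contravar; lra. }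
f_equal.
- unfold Jterm. rewrite Rinv_opp. rewrite Rabs_pos_eq; [simpl; ring|].
  simpl. apply Rmult_le_pos; [lra|]. apply Rmult_le_pos; nra.
- rewrite <- rprod_mult. apply rprod_ext. intros i _. unfold Jterm.
  replace (S (2 * i + 1)) with (2 * S i)%nat by lia. replace (2 * i + 1)%nat with (S (2 * i)) by lia.
  replace (S (S (S (2 * i)))) with (S (2 * S i)) by lia.
  replace (S (S (2 * i))) with (2 * S i)%nat by lia.
  change ((- p) ^ S (2 * S i)) with (- p * (- p) ^ (2 * S i)).
  change ((- p) ^ S (2 * i)) with (- p * (- p) ^ (2 * i)). rewrite !neg_pow, Rinv_opp.
  change ((p ^ 2) ^ S i) with (p ^ 2 * (p ^ 2) ^ i).
  pose proof (ppow_range i) as HQ. set (Q := (p ^ 2) ^ i) in *.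
  unfold left_factor, Rdiv. pose proof psq_range.
  assert (0 < p ^ 2 * Q <= 1) by nra.
  assert (0 <= p * / X * Q) by (apply Rmult_le_pos; nra).
  assert (0 <= p ^ 2 * Q * / X <= 1) by (split; nra).
  assert (0 <= p * (p ^ 2 * Q)) by nra.
  assert (0 <= X * (p * (p ^ 2 * Q))) by nra.
  rewrite !Rabs_mult.
  replace (1 + p ^ 2 * Q * - X) with (1 - X * (p ^ 2 * Q)) by ring.
  rewrite (Rabs_pos_eq (1 - p ^ 2 * Q)) by lra.
  rewrite (Rabs_pos_eq (1 + - p * Q * - / X)) by nra.
  rewrite (Rabs_pos_eq (1 - - p * (p ^ 2 * Q))) by lra.
  rewrite (Rabs_pos_eq (1 + - p * (p ^ 2 * Q) * - X)) by lra.
  rewrite (Rabs_pos_eq (1 + p ^ 2 * Q * - / X)) by lra. ring.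
Qed.

Lemma J_right_product (k : nat) :
  Rabs (rprod (Jterm (- p) X) (2 * k)) =
  rprod (fun i => right_factor p X (p * (p ^ 2) ^ i)) k *
   rprod (fun i => (1 + / X * (p ^ 2) ^ i) * (1 - / X * p * (p ^ 2) ^ i)) k.
Proof.
rewrite rprod_pairs, rprod_abs.
assert (Hi : 0 < / X <= 1).
{ split; [apply Rinv_0_lt_compat; lra|]. rewrite <- Rinv_1. apply Rinv_le_contravar; lra. }
rewrite <- rprod_mult. apply rprod_ext. intros i _. unfold Jterm.
replace (S (2 * i + 1)) with (2 * S i)%nat by lia. replace (2 * i + 1)%nat with (S (2 * i)) by lia.
change ((- p) ^ S (2 * i)) with (- p * (- p) ^ (2 * i)). rewrite !neg_pow.
change ((p ^ 2) ^ S i) with (p ^ 2 * (p ^ 2) ^ i).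
pose proof (ppow_range i) as HQ. set (Q := (p ^ 2) ^ i) in *.
unfold right_factor. pose proof psq_range.
assert (0 < p ^ 2 * Q <= 1) by nra.
assert (0 < p * Q <= 1) by nra.
assert (0 <= p * Q * / X <= 1) by (split; nra).
assert (0 <= X * (p ^ 2 * Q)) by nra.
rewrite !Rabs_mult.
replace (1 + - p * Q * X) with (1 - X * (p * Q)) by ring.
rewrite (Rabs_pos_eq (1 - - p * Q)) by lra.
rewrite (Rabs_pos_eq (1 + Q * / X)) by nra.
rewrite (Rabs_pos_eq (1 - p ^ 2 * Q)) by lra.
rewrite (Rabs_pos_eq (1 + p ^ 2 * Q * X)) by lra.
rewrite (Rabs_pos_eq (1 + - p * Q * / X)) by lra. ring.
Qed.

Lemma invX_range : 0 < / X <= 1.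
Proof.
split; [apply Rinv_0_lt_compat; lra|]. rewrite <- Rinv_1. apply Rinv_le_contravar; lra.
Qed.

Lemma J_left_bound (N m0 : nat) (c : R) : (0 < N)%nat ->
  (forall m, (m0 <= m)%nat -> rprod (fun i => left_factor p X (p ^ 2 * (p ^ 2) ^ i)) (N * m) <= c) ->
  Rabs (Jr (- p) (- X)) <= (1 + p) * (1 + X * p) * (1 - / X) * (c * (1 + p / X)).
Proof.
intros HN Hc. pose proof invX_range as Hi.
apply (Jr_bound _ _ _ (2 * N) 1 m0); [apply neg_q|lra|lia|].
intros m Hm. rewrite <- Nat.mul_assoc, J_left_product. apply Rmult_le_compat_l.
- apply Rmult_le_pos; [nra|lra].
- assert (0 <= p / X <= 1) by (unfold Rdiv; nra).
  apply Rmult_le_compat; [|now apply shift_product_le|now apply Hc|now apply shift_product_le].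
  apply rprod_ge0. intros i _. apply left_factor_ge0. pose proof (ppow_range i). pose proof psq_range. nra.
Qed.

Lemma J_right_bound (N m0 : nat) (c : R) : (0 < N)%nat ->
  (forall m, (m0 <= m)%nat -> rprod (fun i => right_factor p X (p * (p ^ 2) ^ i)) (N * m) <= c) ->
  Rabs (Jr (- p) X) <= c * (1 + / X).
Proof.
intros HN Hc. pose proof invX_range as Hi.
apply (Jr_bound _ _ _ (2 * N) 0 m0); [apply neg_q|lra|lia|].
intros m Hm. rewrite Nat.add_0_r, <- Nat.mul_assoc, J_right_product.
apply Rmult_le_compat; [|apply shift_product_le; lra|now apply Hc|apply shift_product_le; lra].
apply rprod_ge0. intros i _. apply right_factor_ge0. pose proof (ppow_range i). nra.
Qed.

Lemma left_factor_prod_tail (k m : nat) : X * (p ^ 2 * (p ^ 2) ^ k) <= 1 -> (k <= m)%nat ->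
  rprod (fun i => left_factor p X (p ^ 2 * (p ^ 2) ^ i)) m <= rprod (fun i => left_factor p X (p ^ 2 * (p ^ 2) ^ i)) k.
Proof.
intros Hk Hm. pose proof psq_range. apply rprod_tail_le; [| |exact Hm].
- intros i. apply left_factor_ge0. pose proof (ppow_range i). nra.
- intros i Hi. pose proof (ppow_range i). apply left_factor_le1; [nra|].
  apply Rle_trans with (2 := Hk). apply Rmult_le_compat_l; [lra|]. apply Rmult_le_compat_l; [lra|].
  replace i with (k + (i - k))%nat by lia. rewrite pow_add.
  pose proof (ppow_range k). pose proof (ppow_range (i - k)). nra.
Qed.

Lemma right_factor_prod_tail (k m : nat) : X * (p * (p ^ 2) ^ k) <= 1 -> (k <= m)%nat ->
  rprod (fun i => right_factor p X (p * (p ^ 2) ^ i)) m <= rprod (fun i => right_factor p X (p * (p ^ 2) ^ i)) k.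
Proof.
intros Hk Hm. pose proof psq_range. apply rprod_tail_le; [| |exact Hm].
- intros i. apply right_factor_ge0. pose proof (ppow_range i). nra.
- intros i Hi. pose proof (ppow_range i). apply right_factor_le1; [nra|].
  apply Rle_trans with (2 := Hk). apply Rmult_le_compat_l; [lra|]. apply Rmult_le_compat_l; [lra|].
  replace i with (k + (i - k))%nat by lia. rewrite pow_add.
  pose proof (ppow_range k). pose proof (ppow_range (i - k)). nra.
Qed.

End NegativeQ.

Lemma Jr_opp (q X : R) : X <> 0 -> thr q (- X) = Jr q (- X) + thr q (- / X) / X.
Proof. intros HX. unfold Jr. rewrite Rinv_opp. field. exact HX. Qed.

(** For X s > 1 the factor is at most (1 - s)(5 s - 1), whose maximum 4/5 is attained at s = 3/5.
    This permits discarding factors for X up to 5. *)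
Lemma pos_factor_range (X s : R) : 0 <= s <= 1 -> 1 <= X <= 5 -> 0 <= pos_factor X s <= 1.
Proof.
intros Hs HX. unfold pos_factor. split; [apply Rmult_le_pos; [lra|apply Rabs_pos]|].
unfold Rabs. destruct (Rcase_abs (1 - X * s)) as [C|C].
- apply Rle_trans with ((1 - s) * (5 * s - 1)); [apply Rmult_le_compat_l; nra|].
  pose proof (pow2_ge_0 (s - 6 / 10)). nra.
- assert (0 <= X * s) by nra. nra.
Qed.

(** theta(- X) = J(- X) + theta(- 1/X) / X. If X q <= 1, no factor of J is negative. Otherwise two
    factors in 1/X are retained: 1 - q/X matches the lower bound of theta(- 1/X), and 1 - 1/X
    reduces the claim to a bound on X - 1 times a finite product. *)
Lemma thr_pos_no_zero (q X : R) : 0 < q < 1 -> 0 <= X -> X <= 5 \/ X * q <= 1 -> 0 < thr q (- X).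
Proof.
intros Hq HX0 HX. assert (Hq' : 0 < Rabs q < 1) by (rewrite Rabs_pos_eq; lra).
destruct (Rle_lt_dec X 1) as [C|C].
{ pose proof (thr_alt_lower q X Hq ltac:(lra)). nra. }
assert (Hi : 0 < / X <= 1) by (apply invX_range; lra).
pose proof (thr_alt_lower q (/ X) Hq ltac:(lra)) as HT.
assert (HqX : 0 < 1 - q * / X) by nra.
rewrite Jr_opp by lra.
destruct (Rle_lt_dec (X * q) 1) as [C1|C1].
- assert (0 <= Jr q (- X)).
  { apply (Jr_ge0 q (- X) 0); [exact Hq'|lra|simpl; lra|]. intros j _. unfold Jterm. rewrite Rinv_opp.
    pose proof (pow_pos_le1 q j Hq). simpl.
    assert (q * q ^ j * X <= 1) by nra.
    apply Rmult_le_pos; [nra|]. apply Rmult_le_pos; nra. }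
  assert (0 < thr q (- / X) / X) by (apply Rdiv_lt_0_compat; lra). lra.
- assert (HX5 : X <= 5) by (destruct HX; lra).
  destruct (pos_product_bound q X) as [H|[k Hk]]; [nra|lra|lra|].
  assert (HB : Rabs (Jr q (- X)) <= rprod (fun i => pos_factor X (q * q ^ i)) k * ((1 - / X) * (1 - q * / X))).
  { apply (Jr_bound _ _ _ 1 2 k); [exact Hq'|lra|lia|]. intros m Hm.
    rewrite rprod_abs.
    rewrite (rprod_ext _ (fun i => pos_factor X (q * q ^ i) * (1 - q ^ i * / X))).
    2: { intros j _. unfold Jterm, pos_factor. rewrite Rinv_opp, !Rabs_mult.
      pose proof (pow_pos_le1 q j Hq). pose proof (pow_pos_le1 q (S j) Hq).
      change (q * q ^ j) with (q ^ S j).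
      rewrite (Rabs_pos_eq (1 - q ^ S j)) by lra. rewrite Rmult_assoc. f_equal. f_equal.
      - f_equal. ring.
      - rewrite Rabs_pos_eq; [ring|nra]. }
    rewrite rprod_mult.
    assert (Hf : forall i, 0 <= pos_factor X (q * q ^ i) <= 1).
    { intros i. apply pos_factor_range; [|lra]. pose proof (pow_pos_le1 q (S i) Hq). simpl in H. lra. }
    assert (Hg : forall i, 0 <= 1 - q ^ i * / X <= 1).
    { intros i. pose proof (pow_pos_le1 q i Hq). nra. }
    apply Rmult_le_compat.
    - apply rprod_ge0. intros i _. apply Hf.
    - apply rprod_ge0. intros i _. apply Hg.
    - apply rprod_tail_le; [|intros i _|lia]; apply Hf.
    - eapply Rle_trans; [apply (rprod_tail_le _ 2); [|intros i _|lia]; apply Hg|].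
      simpl. lra. }
  set (Pi := rprod _ k) in *.
  assert (HP : 0 <= Pi).
  { apply rprod_ge0. intros i _. apply pos_factor_range; [|lra].
    pose proof (pow_pos_le1 q (S i) Hq). simpl in H. lra. }
  assert (HJ : - (Pi * ((1 - / X) * (1 - q * / X))) <= Jr q (- X)).
  { apply Rabs_le_between in HB. lra. }
  assert (Pi * ((1 - / X) * (1 - q * / X)) < thr q (- / X) / X); [|lra].
  apply Rlt_le_trans with ((1 - q * / X) / X).
  + replace (Pi * ((1 - / X) * (1 - q * / X))) with ((X - 1) * Pi * ((1 - q * / X) / X)) by (field; lra).
    assert (0 < (1 - q * / X) / X) by (apply Rdiv_lt_0_compat; lra). nra.
  + unfold Rdiv. apply Rmult_le_compat_r; lra.
Qed.

Lemma rprod_regroup (f : nat -> R) (N m : nat) :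
  rprod f (N * m) = rprod (fun a => rprod (fun b => f (a + N * b)%nat) m) N.
Proof.
induction m as [|m IH].
- rewrite Nat.mul_0_r. simpl. clear. induction N as [|N IH]; simpl; lra.
- replace (N * S m)%nat with (N * m + N)%nat by lia. rewrite rprod_app, IH. simpl.
  rewrite rprod_mult. f_equal. apply rprod_ext. intros j _. f_equal. lia.
Qed.

(** The first power not exceeding 0.85 is at least 0.92 times 0.85, which is above 0.78. *)
Lemma exists_power_in (r : R) : 92 / 100 <= r < 1 ->
  exists N, (2 <= N)%nat /\ 78 / 100 <= r ^ N <= 85 / 100.
Proof.
intros Hr.
assert (H : forall n, r ^ n <= 85 / 100 -> exists N, (2 <= N)%nat /\ 78 / 100 <= r ^ N <= 85 / 100).
{ induction n as [|n IH]; intros Hn; [simpl in Hn; lra|].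
  destruct (Rle_lt_dec (r ^ n) (85 / 100)) as [C|C]; [now apply IH|].
  exists (S n). simpl in Hn |- *. split; [|nra].
  destruct n as [|n]; [simpl in *; lra|lia]. }
destruct (pow_lt_1_zero r ltac:(rewrite Rabs_pos_eq; lra) (85 / 100) ltac:(lra)) as [N HN].
apply (H N). specialize (HN N ltac:(lia)). rewrite Rabs_pos_eq in HN; [lra|apply pow_le; lra].
Qed.

Lemma bernoulli_le (r : R) (N : nat) : 0 <= r <= 1 -> 1 - r ^ N <= INR N * (1 - r).
Proof.
intros Hr. induction N as [|N IH]; [simpl; lra|].
rewrite S_INR. simpl. assert (0 <= r ^ N <= 1); [|nra].
split; [apply pow_le; lra|rewrite <- (pow1 N); apply pow_incr; lra].
Qed.

Lemma uniform_threshold (P : nat -> nat -> Prop) (n : nat) :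
  (forall a, (a < n)%nat -> exists m0, forall m, (m0 <= m)%nat -> P a m) ->
  exists m0, forall m, (m0 <= m)%nat -> forall a, (a < n)%nat -> P a m.
Proof.
induction n as [|n IH]; intros Hin; [exists O; intros; lia|].
destruct IH as [m1 H1]; [intros a Ha; apply Hin; lia|].
destruct (Hin n ltac:(lia)) as [m2 H2]. exists (Nat.max m1 m2). intros m Hm a Ha.
destruct (Nat.eq_dec a n) as [->|Hne]; [apply H2; lia|apply H1; lia].
Qed.

(* The indices k = a + N i of one residue class give a product with ratio r^N in [0.78, 0.85],
   a fixed range that residue_product_bound covers. *)
Lemma small_product (r Z : R) : 92 / 100 <= r < 1 -> 0 <= Z <= 107 / 10 ->
  exists N, (2 <= N)%nat /\ 15 / 100 <= INR N * (1 - r) /\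
  exists m0, forall m, (m0 <= m)%nat ->
    rprod (fun i => (1 - r * r ^ i) * Rabs (1 - Z * (r * r ^ i))) (N * m) <= (2 / 100) ^ N.
Proof.
intros Hr HZ. destruct (exists_power_in r Hr) as [N [HN HR]].
exists N. split; [exact HN|]. split; [pose proof (bernoulli_le r N ltac:(lra)); lra|].
set (rho := r ^ N) in *.
assert (Hinner : forall a, (a < N)%nat -> exists m0, forall m, (m0 <= m)%nat ->
  0 <= rprod (fun b => (1 - r * r ^ (a + N * b)) * Rabs (1 - Z * (r * r ^ (a + N * b)))) m <= 2 / 100).
{ intros a Ha.
  assert (Hra : 0 < r ^ S a <= 1) by (apply pow_pos_le1; lra).
  destruct (residue_product_bound rho (Z * r ^ S a) ltac:(lra) ltac:(nra)) as [k [Hk1 Hk2]].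
  exists k. intros m Hm.
  assert (HF : forall b, 0 <= (1 - r * r ^ (a + N * b)) * Rabs (1 - Z * (r * r ^ (a + N * b)))
     <= residue_factor rho (Z * r ^ S a) (rho ^ b)).
  { intros b. rewrite pow_add, pow_mult. fold rho.
    assert (HRb : 0 < rho ^ b <= 1) by (apply pow_pos_le1; lra).
    replace (r * (r ^ a * rho ^ b)) with (r ^ S a * rho ^ b) by (simpl; ring).
    unfold residue_factor. rewrite Rmult_assoc. pose proof (Rabs_pos (1 - Z * (r ^ S a * rho ^ b))).
    assert (r ^ S a * rho ^ b <= 1) by nra.
    (* As a + 1 <= N, the factor 1 - r^(a+1) rho^b is at most 1 - rho^(b+1); only the second factor
       still depends on the residue class. *)
    assert (rho <= r ^ S a).
    { unfold rho. replace N with (S a + (N - S a))%nat by lia. rewrite pow_add.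
      assert (0 < r ^ (N - S a) <= 1) by (apply pow_pos_le1; lra). nra. }
    split; [apply Rmult_le_pos; lra|]. apply Rmult_le_compat_r; [lra|]. nra. }
  split; [apply rprod_ge0; intros b _; apply HF|].
  eapply Rle_trans; [apply rprod_le; intros b _; apply HF|].
  eapply Rle_trans; [|exact Hk2].
  apply rprod_tail_le; [|intros b Hb|exact Hm].
  - intros b. eapply Rle_trans; apply HF.
  - unfold residue_factor. assert (HRb : 0 < rho ^ b <= 1) by (apply pow_pos_le1; lra).
    assert (HRk : rho ^ b <= rho ^ k).
    { replace b with (k + (b - k))%nat by lia. rewrite pow_add.
      assert (0 < rho ^ k <= 1) by (apply pow_pos_le1; lra).
      assert (0 < rho ^ (b - k) <= 1) by (apply pow_pos_le1; lra). nra. }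
    assert (0 <= Z * r ^ S a) by nra.
    assert (0 <= Z * r ^ S a * rho ^ b <= 1).
    { split; [apply Rmult_le_pos; lra|]. eapply Rle_trans; [|exact Hk1].
      apply Rmult_le_compat_l; lra. }
    rewrite Rabs_pos_eq by lra. assert (0 <= rho * rho ^ b <= 1) by nra. nra. }
assert (HM : exists m0, forall m, (m0 <= m)%nat -> forall a, (a < N)%nat ->
  0 <= rprod (fun b => (1 - r * r ^ (a + N * b)) * Rabs (1 - Z * (r * r ^ (a + N * b)))) m <= 2 / 100).
{ exact (uniform_threshold _ N Hinner). }
destruct HM as [m0 HM]. exists m0. intros m Hm. rewrite rprod_regroup.
eapply Rle_trans; [apply (rprod_le _ (fun _ => 2 / 100)); intros a Ha; now apply HM|].
clear. induction N as [|N IH]; simpl; lra.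
Qed.

Lemma small_geom (N : nat) : (2 <= N)%nat -> (2 / 100) ^ N <= 4 / 10000 /\ INR N * (2 / 100) ^ N <= 8 / 10000.
Proof.
intros HN. induction N as [|N IH]; [lia|]. destruct (Nat.eq_dec N 1) as [->|H].
- simpl. lra.
- destruct IH as [H1 H2]; [lia|]. rewrite S_INR. simpl.
  assert (0 <= (2 / 100) ^ N) by (apply pow_le; lra). split; lra.
Qed.

Lemma p4_pow (p : R) (i : nat) : p ^ 4 * (p ^ 4) ^ i = (p ^ 2 * (p ^ 2) ^ i) ^ 2.
Proof. replace (p ^ 4) with (p ^ 2 * p ^ 2) by ring. rewrite Rpow_mult_distr. ring. Qed.

Lemma p4_bounds (p : R) : 98 / 100 <= p < 1 -> 92 / 100 <= p ^ 4 < 1.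
Proof.
intros Hp. assert (98 / 100 * (98 / 100) <= p * p < 1) by nra.
replace (p ^ 4) with ((p * p) * (p * p)) by ring. nra.
Qed.

Lemma abs_pair_le (p X s : R) : 0 < p < 1 -> 0 <= X * s ->
  Rabs (1 - X * s) * (1 + X * (p * s)) <= Rabs (1 - (X * s) ^ 2).
Proof.
intros Hp H. replace (1 - (X * s) ^ 2) with ((1 - X * s) * (1 + X * s)) by ring.
rewrite Rabs_mult, (Rabs_pos_eq (1 + X * s)) by lra.
apply Rmult_le_compat_l; [apply Rabs_pos|]. nra.
Qed.

(** Replacing p s by s in 1 + p s and in 1 + X p s turns each pair into (1 - s^2) |1 - (X s)^2|, a
    product of ratio p^4 >= 0.92 to which the residue classes apply. *)
Lemma left_factor_small (p X : R) : 98 / 100 <= p < 1 -> 1 <= X <= 32 / 10 ->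
  exists N m0, (0 < N)%nat /\ forall m, (m0 <= m)%nat ->
    rprod (fun i => left_factor p X (p ^ 2 * (p ^ 2) ^ i)) (N * m) <= 4 / 10000.
Proof.
intros Hp HX.
destruct (small_product (p ^ 4) (X ^ 2) (p4_bounds p Hp) ltac:(nra)) as [N [HN [_ [m0 Hm0]]]].
exists N, m0. split; [lia|]. intros m Hm.
eapply Rle_trans; [|apply (proj1 (small_geom N HN))].
eapply Rle_trans; [|apply (Hm0 m Hm)].
apply rprod_le. intros i _. pose proof (ppow_range p ltac:(lra) i) as HQ.
pose proof (psq_range p ltac:(lra)) as HQ2.
rewrite p4_pow. set (s := p ^ 2 * (p ^ 2) ^ i).
assert (Hs : 0 <= s <= 1) by (unfold s; nra).
split; [apply left_factor_ge0; lra|]. unfold left_factor.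
replace (X ^ 2 * s ^ 2) with ((X * s) ^ 2) by ring.
assert (0 <= X * s) by nra. assert (0 <= X * (p * s)) by (assert (0 <= p * s) by nra; nra).
apply Rmult_le_compat.
- apply Rmult_le_pos; nra.
- apply Rmult_le_pos; [apply Rabs_pos|lra].
- replace (1 - s ^ 2) with ((1 - s) * (1 + s)) by ring. apply Rmult_le_compat_l; nra.
- apply abs_pair_le; [lra|nra].
Qed.

Lemma Jterm_left (p X : R) (i : nat) : 0 < p < 1 -> 1 <= X -> X * (p ^ 2) ^ S i <= 1 ->
  0 <= Jterm (- p) (- X) (2 * i) /\ 0 <= Jterm (- p) (- X) (2 * i + 1).
Proof.
intros Hp HX H. pose proof (ppow_range p Hp i) as HQ. pose proof (ppow_range p Hp (S i)) as HQ1.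
pose proof (invX_range X HX). unfold Jterm. rewrite Rinv_opp.
replace (S (2 * i + 1)) with (2 * S i)%nat by lia. replace (2 * i + 1)%nat with (S (2 * i)) by lia.
change ((- p) ^ S (2 * i)) with (- p * (- p) ^ (2 * i)). rewrite !neg_pow.
set (Q := (p ^ 2) ^ i) in *. set (Q1 := (p ^ 2) ^ S i) in *.
assert (0 < p * Q) by nra. assert (0 < p * Q * X) by nra. assert (0 < p * Q * / X) by nra.
assert (Q * / X <= 1) by nra.
split; (apply Rmult_le_pos; [lra|]); apply Rmult_le_pos; lra.
Qed.

Lemma Jterm_right (p X : R) (i : nat) : 0 < p < 1 -> 1 <= X -> X * (p * (p ^ 2) ^ i) <= 1 ->
  0 <= Jterm (- p) X (2 * i) /\ 0 <= Jterm (- p) X (2 * i + 1).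
Proof.
intros Hp HX H. pose proof (ppow_range p Hp i) as HQ. pose proof (ppow_range p Hp (S i)) as HQ1.
pose proof (invX_range X HX). unfold Jterm.
replace (S (2 * i + 1)) with (2 * S i)%nat by lia. replace (2 * i + 1)%nat with (S (2 * i)) by lia.
change ((- p) ^ S (2 * i)) with (- p * (- p) ^ (2 * i)). rewrite !neg_pow.
set (Q := (p ^ 2) ^ i) in *. set (Q1 := (p ^ 2) ^ S i) in *.
assert (0 < p * Q) by nra. assert (0 < Q1 * X) by nra. assert (0 < Q * / X) by nra.
assert (p * Q * / X <= 1) by nra.
split; (apply Rmult_le_pos; [lra|]); apply Rmult_le_pos; lra.
Qed.

Lemma Jterm_left_tail (p X : R) (k j : nat) : 0 < p < 1 -> 1 <= X -> X * (p ^ 2) ^ S k <= 1 ->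
  (2 * k <= j)%nat -> 0 <= Jterm (- p) (- X) j.
Proof.
intros Hp HX H Hj.
assert (Hi : forall i, (k <= i)%nat -> X * (p ^ 2) ^ S i <= 1).
{ intros i Hi. apply Rle_trans with (2 := H). apply Rmult_le_compat_l; [lra|].
  replace (S i) with (S k + (i - k))%nat by lia. rewrite pow_add.
  pose proof (ppow_range p Hp (S k)). pose proof (ppow_range p Hp (i - k)). nra. }
destruct (Nat.Even_or_Odd j) as [[i ->]|[i ->]]; apply Jterm_left; auto; apply Hi; lia.
Qed.

Lemma Jterm_right_tail (p X : R) (k j : nat) : 0 < p < 1 -> 1 <= X -> X * (p * (p ^ 2) ^ k) <= 1 ->
  (2 * k <= j)%nat -> 0 <= Jterm (- p) X j.
Proof.
intros Hp HX H Hj.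
assert (Hi : forall i, (k <= i)%nat -> X * (p * (p ^ 2) ^ i) <= 1).
{ intros i Hi. apply Rle_trans with (2 := H). apply Rmult_le_compat_l; [lra|].
  apply Rmult_le_compat_l; [lra|].
  replace i with (k + (i - k))%nat by lia. rewrite pow_add.
  pose proof (ppow_range p Hp k). pose proof (ppow_range p Hp (i - k)). nra. }
destruct (Nat.Even_or_Odd j) as [[i ->]|[i ->]]; apply Jterm_right; auto; apply Hi; lia.
Qed.

(** At - X only the factors 1 - X p^(2i) can be negative: none if X p^2 <= 1, and the two with p^2
    and p^4 between p^(-4) and p^(-6). *)
Lemma J_left_ge0 (p X : R) : 0 < p < 1 -> 1 <= X ->
  X * p ^ 2 <= 1 \/ (1 <= X * p ^ 4 /\ X * p ^ 6 <= 1) -> 0 <= Jr (- p) (- X).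
Proof.
intros Hp HX [H|[H1 H2]].
- apply (Jr_ge0 _ _ 0); [now apply neg_q|lra|simpl; lra|]. intros j _.
  apply (Jterm_left_tail p X 0); auto; [|lia]. now rewrite pow_1.
- apply (Jr_ge0 _ _ 4); [now apply neg_q|lra| |].
  + assert (Hp2 : 0 < p ^ 2 < 1) by now apply psq_range.
    assert (1 <= X * p ^ 2).
    { replace (X * p ^ 4) with (X * p ^ 2 * p ^ 2) in H1 by ring. assert (0 < X * p ^ 2) by nra. nra. }
    pose proof (invX_range X HX) as Hi.
    assert (Hp3 : 0 < p ^ 3) by (apply pow_lt; lra).
    assert (Hp4 : 0 < p ^ 4 <= 1) by (apply pow_pos_le1; lra).
    unfold Jterm. rewrite Rinv_opp. cbn [rprod].
    replace ((- p) ^ 1) with (- p) by ring. replace ((- p) ^ 2) with (p ^ 2) by ring.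
    replace ((- p) ^ 3) with (- p ^ 3) by ring. replace ((- p) ^ 4) with (p ^ 4) by ring.
    set (v := / X) in *. rewrite pow_O.
    assert (0 <= p * X) by nra. assert (0 <= p * v) by nra. assert (0 <= p ^ 3 * X) by nra.
    assert (0 <= p ^ 3 * v) by nra. assert (0 <= p ^ 2 * v <= 1) by nra.
    assert (A0 : 0 <= (1 - - p) * ((1 + - p * - X) * (1 + 1 * - v))).
    { apply Rmult_le_pos; [lra|]. apply Rmult_le_pos; lra. }
    assert (A1 : (1 - p ^ 2) * ((1 + p ^ 2 * - X) * (1 + - p * - v)) <= 0).
    { assert (0 <= (1 - p ^ 2) * (- (1 + p ^ 2 * - X) * (1 + - p * - v))); [|lra].
      apply Rmult_le_pos; [lra|]. apply Rmult_le_pos; lra. }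
    assert (A2 : 0 <= (1 - - p ^ 3) * ((1 + - p ^ 3 * - X) * (1 + p ^ 2 * - v))).
    { apply Rmult_le_pos; [lra|]. apply Rmult_le_pos; lra. }
    assert (A3 : (1 - p ^ 4) * ((1 + p ^ 4 * - X) * (1 + - p ^ 3 * - v)) <= 0).
    { assert (0 <= (1 - p ^ 4) * (- (1 + p ^ 4 * - X) * (1 + - p ^ 3 * - v))); [|lra].
      apply Rmult_le_pos; [lra|]. apply Rmult_le_pos; lra. }
    set (a0 := (1 - - p) * _) in *. set (a1 := (1 - p ^ 2) * _) in *.
    set (a2 := (1 - - p ^ 3) * _) in *. set (a3 := (1 - p ^ 4) * _) in *.
    clearbody a0 a1 a2 a3.
    replace (1 * a0 * a1 * a2 * a3) with (a0 * a2 * (- a1 * - a3)) by ring.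
    apply Rmult_le_pos; apply Rmult_le_pos; lra.
  + intros j Hj. apply (Jterm_left_tail p X 2); auto.
    replace ((p ^ 2) ^ 3) with (p ^ 6) by ring. exact H2.
Qed.

Lemma thr_left_pos (p X : R) : 0 < p < 1 -> 0 <= X ->
  X * p ^ 2 <= 1 \/ X <= 24 / 10 \/ (3 / 4 <= p /\ X <= 32 / 10) -> 0 < thr (- p) (- X).
Proof.
intros Hp HX0 HX. destruct (Rle_lt_dec X 1) as [C|C]; [apply thr_neg_pos; lra|].
assert (Hi : 0 < / X <= 1) by (apply invX_range; lra).
pose proof (thr_neg_lower p (/ X) Hp ltac:(lra)) as HT.
pose proof (thr_neg_pos p (/ X) Hp ltac:(lra)) as HTp.
rewrite Jr_opp by lra.
assert (HTX : 0 < thr (- p) (- / X) / X) by (apply Rdiv_lt_0_compat; lra).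
destruct (Rle_lt_dec (X * p ^ 2) 1) as [C1|C1].
{ pose proof (J_left_ge0 p X Hp ltac:(lra) (or_introl C1)). lra. }
assert (HX32 : X <= 32 / 10) by (destruct HX as [?|[?|?]]; lra).
assert (HX24 : p < 3 / 4 -> X <= 24 / 10) by (intros; destruct HX as [?|[?|?]]; lra).
assert (Hp645 : 645 / 1000 <= p).
{ destruct (Rle_lt_dec (645 / 1000) p) as [H|H]; [exact H|]. specialize (HX24 ltac:(lra)).
  assert (p ^ 2 < 4161 / 10000) by nra. nra. }
(* The lower bound of theta(- 1/X), weakened by p^3 <= 1, shares (1 + p/X)(1 - 1/X) with the bound
   on |J|. After division the condition on the product c is the one in [left_good]. *)
assert (Hkey : forall c, 0 <= c -> Rabs (Jr (- p) (- X)) <= (1 + p) * (1 + X * p) * (1 - / X) * (c * (1 + p / X)) ->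
  X * X * ((1 + p) * (1 + X * p) * c) < X + 1 -> 0 < Jr (- p) (- X) + thr (- p) (- / X) / X).
{ intros c Hc0 HJ Hc.
  apply Rabs_le_between in HJ as [HJ _].
  assert ((1 + p) * (1 + X * p) * (1 - / X) * (c * (1 + p / X)) < thr (- p) (- / X) / X); [|lra].
  apply Rlt_le_trans with ((1 + p * / X) * (1 - (/ X) ^ 2) / X).
  - replace ((1 + p) * (1 + X * p) * (1 - / X) * (c * (1 + p / X)))
      with (X * X * ((1 + p) * (1 + X * p) * c) * ((X - 1) * (1 + p / X) / (X * X * X))) by (field; lra).
    replace ((1 + p * / X) * (1 - (/ X) ^ 2) / X)
      with ((X + 1) * ((X - 1) * (1 + p / X) / (X * X * X))) by (field; lra).
    apply Rmult_lt_compat_r; [|exact Hc]. apply Rdiv_lt_0_compat; [|repeat apply Rmult_lt_0_compat; lra].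
    apply Rmult_lt_0_compat; [lra|]. unfold Rdiv. nra.
  - unfold Rdiv. apply Rmult_le_compat_r; [lra|]. eapply Rle_trans; [|exact HT].
    assert (0 < p ^ 3 <= 1) by (apply pow_pos_le1; lra).
    assert (0 <= (/ X) ^ 2) by apply pow2_ge_0.
    apply Rmult_le_compat_l; nra. }
destruct (Rle_lt_dec p (98 / 100)) as [C2|C2].
- destruct (left_product_bound p X ltac:(lra) ltac:(lra) HX24) as [H|[H|[k [Hk1 Hk2]]]].
  + lra.
  + pose proof (J_left_ge0 p X Hp ltac:(lra) (or_intror H)). lra.
  + apply (Hkey (rprod (fun i => left_factor p X (p ^ 2 * (p ^ 2) ^ i)) k)); [| |exact Hk2].
    * apply rprod_ge0. intros i _. pose proof (ppow_range p Hp i). pose proof (psq_range p Hp).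
      apply left_factor_ge0; [lra..|]. nra.
    * apply (J_left_bound p X Hp ltac:(lra) 1 k); [lia|]. intros m Hm. apply left_factor_prod_tail; [lra|lra|exact Hk1|lia].
- destruct (left_factor_small p X) as [N [m0 [HN Hm0]]]; [lra|lra|].
  apply (Hkey (4 / 10000)); [lra| |].
  + now apply (J_left_bound p X Hp ltac:(lra) N m0).
  + assert (X * X <= 1024 / 100) by nra. assert ((1 + p) * (1 + X * p) <= 9) by nra. nra.
Qed.

(** * Values of theta with a prescribed sign far out, and the first zero *)

Lemma Jr_sign (q x s r : R) (k : nat) : 0 < Rabs q < 1 -> x <> 0 -> 0 < r < 1 ->
  0 < s * rprod (Jterm q x) k -> (forall i, (1 - r ^ S i) ^ 3 <= Jterm q x (k + i)) -> 0 < s * Jr q x.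
Proof.
intros Hq Hx Hr Hk Hi.
(* A limit of positive products could be 0; the tail is bounded below by the cube of a partial Euler
   product in r, which stays above c^3. *)
destruct (qf_lower r) as [c [Hc Hc']]; [rewrite Rabs_pos_eq; lra|].
assert (H : s * rprod (Jterm q x) k * c ^ 3 <= s * Jr q x).
{ apply (lim_ge_const (fun m => s * rprod (Jterm q x) (1 * m + k)) _ _ O).
  - apply (is_lim_seq_scal_l _ s (Jr q x)). now apply Jterm_lim; [| |lia].
  - intros m _. replace (1 * m + k)%nat with (k + m)%nat by lia. rewrite rprod_app.
    rewrite <- Rmult_assoc. apply Rmult_le_compat_l; [lra|].
    apply Rle_trans with (qf r m ^ 3); [apply pow_incr; split; [lra|apply Hc']|].
    replace (qf r m ^ 3) with (rprod (fun i => (1 - r ^ S i) ^ 3) m).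
    + apply rprod_le. intros i _. split; [|apply Hi]. apply pow_le.
      pose proof (pow_pos_le1 r (S i) Hr). lra.
    + unfold qf. clear. induction m as [|m IH]; cbn [rprod]; [ring|]. rewrite IH. ring. }
assert (0 < c ^ 3) by now apply pow_lt. nra.
Qed.

Lemma cube_le (a b c e : R) : 0 <= e -> e <= a -> e <= b -> e <= c -> e ^ 3 <= a * (b * c).
Proof.
intros. replace (e ^ 3) with (e * (e * e)) by ring.
apply Rmult_le_compat; [lra|nra|lra|]. apply Rmult_le_compat; lra.
Qed.

Lemma Jr_div4 (q v : R) : 0 < Rabs q < 1 -> v <> 0 -> Jr q (v / q ^ 4) = v ^ 4 / q ^ 6 * Jr q v.
Proof.
intros Hq Hv. assert (Hq0 : q <> 0) by (intros E; rewrite E, Rabs_R0 in Hq; lra).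
assert (Hd : forall w, w <> 0 -> w / q <> 0).
{ intros w Hw. unfold Rdiv. apply Rmult_integral_contrapositive. split; [exact Hw|now apply Rinv_neq_0_compat]. }
replace (v / q ^ 4) with (v / q / q / q / q) by (field; exact Hq0).
rewrite !Jr_div by auto. field. exact Hq0.
Qed.

(** Since |v| >= |q|, each division of the argument w by q^4 multiplies J by w^4 / q^6 >= 1 /
    q^2. *)
Lemma Jr_far_growth (q v s : R) (m : nat) : 0 < Rabs q < 1 -> q ^ 4 <= v ^ 4 -> v <> 0 -> 0 < s * Jr q v ->
  s * Jr q v * / q ^ (2 * m) <= s * Jr q (v / q ^ (4 * m)).
Proof.
intros Hq Hv Hv0 HJ. assert (Hq0 : q <> 0) by (intros E; rewrite E, Rabs_R0 in Hq; lra).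
assert (Hq2 : 0 < q ^ 2 < 1).
{ replace (q ^ 2) with (Rabs q * Rabs q); [nra|]. rewrite <- Rabs_mult. rewrite Rabs_pos_eq; [ring|nra]. }
induction m as [|m IH].
- rewrite !Nat.mul_0_r, !pow_O. unfold Rdiv. rewrite !Rinv_1, !Rmult_1_r. lra.
- set (w := v / q ^ (4 * m)) in *.
  assert (Hw0 : w <> 0).
  { unfold w, Rdiv. apply Rmult_integral_contrapositive. split; [exact Hv0|].
    apply Rinv_neq_0_compat. now apply pow_nonzero. }
  replace (v / q ^ (4 * S m)) with (w / q ^ 4).
  2: { unfold w. replace (4 * S m)%nat with (4 * m + 4)%nat by lia. rewrite pow_add. field.
       split; [exact Hq0|now apply pow_nonzero]. }
  rewrite Jr_div4 by assumption.
  assert (Hw : q ^ 4 <= w ^ 4).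
  { unfold w. rewrite Rdiv_pow_distr || (unfold Rdiv; rewrite Rpow_mult_distr, pow_inv).
    rewrite <- pow_mult. replace (4 * m * 4)%nat with (2 * (8 * m))%nat by lia. rewrite pow_mult.
    assert (0 < (q ^ 2) ^ (8 * m) <= 1) by now apply pow_pos_le1.
    assert (1 <= / (q ^ 2) ^ (8 * m)) by (rewrite <- Rinv_1; apply Rinv_le_contravar; lra).
    assert (0 <= v ^ 4) by (replace (v ^ 4) with ((v ^ 2) ^ 2) by ring; apply pow2_ge_0).
    unfold Rdiv. nra. }
  assert (H1 : / q ^ 2 <= w ^ 4 / q ^ 6).
  { replace (/ q ^ 2) with (q ^ 4 / q ^ 6) by (field; exact Hq0). unfold Rdiv.
    apply Rmult_le_compat_r; [|exact Hw]. left. apply Rinv_0_lt_compat.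
    replace (q ^ 6) with ((q ^ 2) ^ 3) by ring. apply pow_lt; lra. }
  replace (/ q ^ (2 * S m)) with (/ q ^ (2 * m) * / q ^ 2).
  2: { replace (2 * S m)%nat with (2 * m + 2)%nat by lia. rewrite pow_add, Rinv_mult. ring. }
  assert (0 < / q ^ 2) by (apply Rinv_0_lt_compat; lra).
  assert (0 < / q ^ (2 * m)).
  { rewrite pow_mult. apply Rinv_0_lt_compat, pow_lt. lra. }
  replace (s * (w ^ 4 / q ^ 6 * Jr q w)) with (s * Jr q w * (w ^ 4 / q ^ 6)) by ring.
  rewrite <- Rmult_assoc. apply Rmult_le_compat; try lra.
  apply Rmult_le_pos; lra.
Qed.

Lemma thr_near0 (q : R) : 0 < Rabs q < 1 -> exists d, 0 < d <= 1 /\ forall w, Rabs w < d -> Rabs (thr q w) <= 2.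
Proof.
intros Hq. destruct (thr_continuity q Hq 0 1 Rlt_0_1) as [d [Hd Hdd]].
simpl in Hdd. unfold Rdist in Hdd. exists (Rmin d 1).
split; [split; [apply Rmin_case; lra|apply Rmin_r]|]. intros w Hw.
assert (Hw1 : Rabs w < d) by (pose proof (Rmin_l d 1); lra).
destruct (Req_dec w 0) as [->|Hw0].
- rewrite thr_0 by exact Hq. rewrite Rabs_R1. lra.
- assert (H : Rabs (thr q w - thr q 0) < 1).
  { apply Hdd. split; [split; [exact I|auto]|]. now rewrite Rminus_0_r. }
  rewrite thr_0 in H by exact Hq. apply Rabs_def2 in H. apply Rabs_le. lra.
Qed.

(** Along v / q^(4m) the function J grows geometrically while theta(1/x)/x is eventually at most 2
    in modulus, so theta inherits the sign of J at v. *)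
Lemma thr_far_sign (q v s : R) : 0 < Rabs q < 1 -> q ^ 4 <= v ^ 4 -> v <> 0 -> Rabs s = 1 -> 0 < s * Jr q v ->
  forall b, exists m, b < Rabs (v / q ^ (4 * m)) /\ 0 < s * thr q (v / q ^ (4 * m)).
Proof.
intros Hq Hv Hv0 Hs HJ b. assert (Hq0 : q <> 0) by (intros E; rewrite E, Rabs_R0 in Hq; lra).
destruct (thr_near0 q Hq) as [d [Hd Hdd]].
set (e := s * Jr q v) in *.
(* The three bounds yield in turn s J(x) > 4, |1/x| < d and |x| > b. *)
set (y := Rmin (e / 4) (Rmin (d * Rabs v / 2) (Rabs v / (Rabs b + 1)))).
assert (Hav : 0 < Rabs v) by now apply Rabs_pos_lt.
assert (Hb : 0 < Rabs b + 1) by (pose proof (Rabs_pos b); lra).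
assert (Hy : 0 < y).
{ unfold y. repeat apply Rmin_case; try lra; [nra|]. now apply Rdiv_lt_0_compat. }
assert (Hy1 : y <= e / 4) by apply Rmin_l.
assert (Hy2 : y <= d * Rabs v / 2) by (eapply Rle_trans; [apply Rmin_r|apply Rmin_l]).
assert (Hy3 : y <= Rabs v / (Rabs b + 1)) by (eapply Rle_trans; [apply Rmin_r|apply Rmin_r]).
destruct (pow_lt_1_zero q ltac:(lra) y Hy) as [N HN].
exists N. set (x := v / q ^ (4 * N)).
assert (HqN : q ^ N <> 0) by now apply pow_nonzero.
assert (HaN : 0 < Rabs (q ^ N)) by now apply Rabs_pos_lt.
assert (Hsm : forall k, (N <= k)%nat -> 0 < Rabs (q ^ k) < y).
{ intros k Hk. split; [apply Rabs_pos_lt; now apply pow_nonzero|]. apply HN. lia. }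
destruct (Hsm (4 * N)%nat ltac:(lia)) as [H4a H4].
assert (Ex : Rabs x = Rabs v * / Rabs (q ^ (4 * N))).
{ unfold x, Rdiv. now rewrite Rabs_mult, Rabs_inv. }
assert (Hx0 : x <> 0).
{ unfold x, Rdiv. apply Rmult_integral_contrapositive. split; [exact Hv0|].
  apply Rinv_neq_0_compat. now apply pow_nonzero. }
assert (Hix : Rabs (/ x) = Rabs (q ^ (4 * N)) / Rabs v).
{ rewrite Rabs_inv, Ex. field. lra. }
assert (Hixd : Rabs (/ x) < d).
{ rewrite Hix. apply Rmult_lt_reg_r with (Rabs v); [exact Hav|]. unfold Rdiv.
  rewrite Rmult_assoc, Rinv_l by lra. nra. }
split.
- rewrite Ex. apply Rle_lt_trans with (Rabs b); [apply Rle_abs|].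
  apply Rlt_le_trans with (Rabs b + 1); [lra|].
  apply Rmult_le_reg_r with (Rabs (q ^ (4 * N))); [exact H4a|].
  rewrite Rmult_assoc, Rinv_l, Rmult_1_r by lra.
  apply Rmult_le_compat_r with (r := Rabs b + 1) in Hy3; [|lra].
  unfold Rdiv in Hy3. rewrite Rmult_assoc, Rinv_l in Hy3 by lra. nra.
- pose proof (Jr_far_growth q v s N Hq Hv Hv0 HJ) as HG. fold e x in HG.
  destruct (Hsm (2 * N)%nat ltac:(lia)) as [H2a H2].
  rewrite Rabs_pos_eq in H2a, H2 by (rewrite pow_mult; apply pow_le, pow2_ge_0).
  assert (4 < s * Jr q x).
  { eapply Rlt_le_trans; [|exact HG]. apply Rmult_lt_reg_r with (q ^ (2 * N)); [exact H2a|].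
    rewrite Rmult_assoc, Rinv_l by lra. nra. }
  assert (HT : Rabs (s * (thr q (/ x) / x)) <= 2).
  { unfold Rdiv. rewrite !Rabs_mult, Hs. specialize (Hdd (/ x) Hixd).
    pose proof (Rabs_pos (thr q (/ x))). pose proof (Rabs_pos (/ x)).
    assert (Rabs (/ x) <= 1) by lra. nra. }
  apply Rabs_le_between in HT. unfold Jr in H. lra.
Qed.

Lemma first_zero (f : R -> R) (b c : R) : (forall x, continuity_pt f x) -> 0 <= b ->
  (forall x, 0 <= x <= b -> 0 < f x) -> 0 <= c -> f c < 0 ->
  exists a, b < a /\ f a = 0 /\ forall x, 0 <= x < a -> 0 < f x.
Proof.
intros Hf Hb Hpos Hc Hfc.
set (E := fun x => 0 <= x <= c /\ forall y, 0 <= y <= x -> 0 < f y).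
assert (Hbc : b < c).
{ destruct (Rle_lt_dec c b) as [H|H]; [|exact H]. specialize (Hpos c ltac:(lra)). lra. }
destruct (completeness E) as [a [Ha1 Ha2]].
- exists c. intros x [Hx _]. lra.
- exists b. split; [lra|]. intros y Hy. apply Hpos. lra.
- assert (Hba : b <= a) by (apply Ha1; split; [lra|]; intros y Hy; apply Hpos; lra).
  assert (Hac : a <= c) by (apply Ha2; intros x [Hx _]; lra).
  assert (Hlt : forall x, 0 <= x < a -> 0 < f x).
  { intros x Hx. destruct (Rlt_le_dec 0 (f x)) as [H|H]; [exact H|].
    exfalso. assert (a <= x); [|lra]. apply Ha2. intros y [Hy1 Hy2].
    destruct (Rle_lt_dec y x) as [H'|H']; [exact H'|]. specialize (Hy2 x ltac:(lra)). lra. }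
  assert (Hball : forall e, 0 < e -> exists d, 0 < d /\ forall y, Rabs (y - a) < d -> Rabs (f y - f a) < e).
  { intros e He. destruct (Hf a e He) as [d [Hd Hdd]]. exists d. split; [exact Hd|].
    intros y Hy. destruct (Req_dec y a) as [->|Hne].
    - rewrite Rminus_diag, Rabs_R0. exact He.
    - apply Hdd. split; [split; [exact I|auto]|exact Hy]. }
  assert (Hfa : f a = 0).
  { destruct (Rtotal_order (f a) 0) as [H|[H|H]]; [|exact H|]; exfalso.
    - destruct (Hball (- f a) ltac:(lra)) as [d [Hd Hdd]].
      assert (Ha0 : 0 < a).
      { destruct (Rle_lt_dec a 0) as [H'|H']; [|exact H']. assert (a = 0) by lra. subst a.
        specialize (Hpos 0 ltac:(lra)). lra. }
      set (y := a - Rmin (d / 2) (a / 2)).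
      assert (H1 : 0 < Rmin (d / 2) (a / 2)) by (apply Rmin_case; lra).
      pose proof (Rmin_l (d / 2) (a / 2)). pose proof (Rmin_r (d / 2) (a / 2)).
      specialize (Hdd y). rewrite Rabs_left in Hdd by (unfold y; lra).
      specialize (Hdd ltac:(unfold y; lra)). apply Rabs_def2 in Hdd.
      specialize (Hlt y ltac:(unfold y; lra)). lra.
    - destruct (Hball (f a) H) as [d [Hd Hdd]].
      assert (Hac' : a < c) by (destruct (Req_dec a c) as [E'|E']; [subst a; lra|lra]).
      set (z := Rmin (a + d / 2) c).
      assert (Hz1 : a < z) by (unfold z; apply Rmin_case; lra).
      assert (Hz2 : z <= c) by apply Rmin_r.
      assert (Hz3 : z <= a + d / 2) by apply Rmin_l.
      assert (z <= a); [|lra]. apply Ha1. split; [lra|]. intros y Hy.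
      destruct (Rlt_le_dec y a) as [Hya|Hya]; [apply Hlt; lra|].
      specialize (Hdd y). rewrite Rabs_pos_eq in Hdd by lra.
      specialize (Hdd ltac:(lra)). apply Rabs_def2 in Hdd. lra. }
  exists a. split; [|split; [exact Hfa|exact Hlt]].
  destruct (Req_dec a b) as [E'|E']; [|lra]. specialize (Hpos a ltac:(lra)). lra.
Qed.

Lemma negpow_bounds (p : R) (i n : nat) : 0 < p < 1 -> (i <= n)%nat -> - p ^ i <= (- p) ^ n <= p ^ i.
Proof.
intros Hp Hi.
assert (H : Rabs ((- p) ^ n) <= p ^ i).
{ rewrite <- RPow_abs, Rabs_Ropp, Rabs_pos_eq by lra.
  replace n with (i + (n - i))%nat by lia. rewrite pow_add.
  pose proof (pow_pos_le1 p i Hp). pose proof (pow_pos_le1 p (n - i) Hp). nra. }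
now apply Rabs_le_between in H.
Qed.

(** At x = - sqrt q the factor 1 + 1/x is negative and all others are positive. [thr_far_sign]
    carries this sign outwards and produces a negative value of theta. *)
Lemma J_seed_pos (r : R) : 0 < r < 1 -> 0 < - 1 * Jr (r ^ 2) (- r).
Proof.
intros Hr. assert (Hr2 : 0 < r ^ 2 < 1) by now apply psq_range.
apply (Jr_sign _ _ _ r 1); [rewrite Rabs_pos_eq; lra|lra|exact Hr| |].
- unfold Jterm. cbn [rprod]. rewrite pow_O, pow_1, Rinv_opp.
  replace (-1 * (1 * ((1 - r ^ 2) * ((1 + r ^ 2 * - r) * (1 + 1 * - / r)))))
    with ((1 - r ^ 2) * (1 - r ^ 2 * r) * (1 - r) * / r) by (field; lra).
  assert (0 < / r) by (apply Rinv_0_lt_compat; lra).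
  repeat apply Rmult_lt_0_compat; nra.
- intros i. unfold Jterm. pose proof (pow_pos_le1 r (S i) Hr) as H.
  apply cube_le; [lra| | |].
  + rewrite <- pow_mult. replace (2 * S (1 + i))%nat with (S i + (i + 3))%nat by lia. rewrite pow_add.
    pose proof (pow_pos_le1 r (i + 3) Hr). nra.
  + rewrite <- pow_mult. replace (2 * S (1 + i))%nat with (S i + (i + 3))%nat by lia. rewrite pow_add.
    pose proof (pow_pos_le1 r (i + 3) Hr).
    assert (r ^ S i * r ^ (i + 3) * r <= r ^ S i); [|lra].
    assert (0 <= r ^ (i + 3) * r <= 1) by nra. nra.
  + assert (E : (r ^ 2) ^ (1 + i) = r * (r ^ S i * r ^ i)).
    { rewrite <- pow_mult, <- pow_add. replace (2 * (1 + i))%nat with (S (S i + i)) by lia. reflexivity. }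
    rewrite E, Rinv_opp. replace (r * (r ^ S i * r ^ i) * - / r) with (- (r ^ S i * r ^ i)) by (field; lra).
    pose proof (pow_pos_le1 r i Hr). nra.
Qed.

(** At x = - p the only negative factor is 1 + 1/x = 1 - 1/p. *)
Lemma J_seed_left (p : R) : 0 < p < 1 -> 0 < - 1 * Jr (- p) (- p).
Proof.
intros Hp. apply (Jr_sign _ _ _ p 2); [now apply neg_q|lra|exact Hp| |].
- unfold Jterm. cbn [rprod].
  replace (-1 * (1 * ((1 - (- p) ^ 1) * ((1 + (- p) ^ 1 * - p) * (1 + (- p) ^ 0 * / - p)))
      * ((1 - (- p) ^ 2) * ((1 + (- p) ^ 2 * - p) * (1 + (- p) ^ 1 * / - p)))))
    with ((1 + p) * (1 + p * p) * (1 - p) * / p * ((1 - p * p) * (1 - p * p * p) * 2)) by (field; lra).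
  assert (0 < / p) by (apply Rinv_0_lt_compat; lra). assert (0 < p * p < 1) by nra.
  repeat apply Rmult_lt_0_compat; nra.
- intros i. unfold Jterm. pose proof (pow_pos_le1 p (S i) Hp) as H.
  replace ((- p) ^ S (2 + i) * - p) with ((- p) ^ (i + 4)) by (replace (i + 4)%nat with (S (S (2 + i))) by lia; simpl; ring).
  replace ((- p) ^ (2 + i) * / - p) with ((- p) ^ S i) by (simpl; field; lra).
  pose proof (negpow_bounds p (S i) (S (2 + i)) Hp ltac:(lia)).
  pose proof (negpow_bounds p (S i) (i + 4) Hp ltac:(lia)).
  pose proof (negpow_bounds p (S i) (S i) Hp ltac:(lia)).
  apply cube_le; lra.
Qed.

Lemma J_seed_right (p : R) : 0 < p < 1 -> 0 < 1 * Jr (- p) 1.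
Proof.
intros Hp. apply (Jr_sign _ _ _ p 1); [now apply neg_q|lra|exact Hp| |].
- unfold Jterm. cbn [rprod]. rewrite Rinv_1. simpl. nra.
- intros i. unfold Jterm. pose proof (pow_pos_le1 p (S i) Hp) as H. rewrite Rinv_1, !Rmult_1_r.
  pose proof (negpow_bounds p (S i) (S (1 + i)) Hp ltac:(lia)).
  pose proof (negpow_bounds p (S i) (1 + i) Hp ltac:(lia)).
  apply cube_le; lra.
Qed.

(** * The separating lines on the left *)

Lemma nonreal_from_upper (q : R) (P : R -> Prop) : 0 < Rabs q < 1 ->
  (forall x t, 0 < t -> theta q (x, t) = RtoC 0 -> P x) -> forall z, nonreal_zero q z -> P (Re z).
Proof.
intros Hq H [x t] [Hz Ht]. simpl in Ht |- *. destruct (Rlt_le_dec 0 t) as [C|C]; [now apply (H x t)|].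
apply (H x (- t)); [lra|]. change ((x, - t)) with (Cconj (x, t)). rewrite theta_conj, Hz by exact Hq.
unfold Cconj, RtoC. simpl. f_equal. ring.
Qed.

Lemma thr_continuity_left (q : R) : 0 < Rabs q < 1 -> forall x, continuity_pt (fun X => thr q (- X)) x.
Proof.
intros Hq x. apply (continuity_pt_comp (fun X => - X) (thr q)); [reg|now apply thr_continuity].
Qed.

Lemma thr_pos_pos (q x : R) : 0 < q < 1 -> 0 <= x -> 0 < thr q x.
Proof.
intros Hq Hx. assert (Hq' : 0 < Rabs q < 1) by (rewrite Rabs_pos_eq; lra).
assert (H : forall m y, 0 <= y -> q ^ m * y <= 1 -> 0 <= thr q y).
{ assert (H0 : forall y, 0 <= y <= 1 -> 0 <= thr q y).
  { intros y Hy. apply (descent_ge0 (thr q) q); auto; [lra|now apply thr_continuity| |].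
    - rewrite thr_0 by exact Hq'. lra.
    - intros w Hw HT. rewrite thr_eq1 by exact Hq'. assert (0 <= q * w) by nra. nra. }
  induction m as [|m IH]; intros y Hy Hm; [apply H0; simpl in Hm; lra|].
  rewrite thr_eq1 by exact Hq'. assert (0 <= q * y) by nra.
  assert (0 <= thr q (q * y)) by (apply IH; [lra|simpl in Hm; lra]). nra. }
rewrite thr_eq1 by exact Hq'. assert (0 <= q * x) by nra.
assert (0 <= thr q (q * x)); [|nra].
destruct (pow_lt_1_zero q ltac:(lra) (/ (q * x + 1))) as [N HN]; [apply Rinv_0_lt_compat; lra|].
apply (H N); [lra|]. specialize (HN N ltac:(lia)).
rewrite Rabs_pos_eq in HN by (apply pow_le; lra).
apply Rmult_lt_compat_r with (r := q * x + 1) in HN; [|lra]. rewrite Rinv_l in HN by lra.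
assert (0 <= q ^ N) by (apply pow_le; lra). nra.
Qed.

(** The half-plane argument works beyond b = max (5, 1/q). As theta has no zero in [- b, 0] and is
    negative somewhere beyond, it has a first zero - a with a > b. The line is shifted from - a to
    the right by less than both the gap d and a - b. *)
Lemma separating_line_exists (q : R) : 0 < q < 1 -> exists a, 5 <= a /\ separating_line q (- a).
Proof.
intros Hq. assert (Hq' : 0 < Rabs q < 1) by (rewrite Rabs_pos_eq; lra).
assert (Hiq : 0 < / q) by (apply Rinv_0_lt_compat; lra).
set (r := sqrt q).
assert (Hr : 0 < r < 1).
{ unfold r. split; [apply sqrt_lt_R0; lra|]. rewrite <- sqrt_1. apply sqrt_lt_1; lra. }
assert (Er : r ^ 2 = q) by (unfold r; apply pow2_sqrt; lra).
pose proof (J_seed_pos r Hr) as HJ. rewrite Er in HJ.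
destruct (thr_far_sign q (- r) (-1) Hq') with (b := 0) as [m [_ Hm]];
  [|lra|rewrite Rabs_left; lra|exact HJ|].
{ rewrite <- Er. replace ((- r) ^ 4) with (r ^ 4 * 1) by ring.
  replace ((r ^ 2) ^ 4) with (r ^ 4 * r ^ 4) by ring. assert (0 < r ^ 4 <= 1) by now apply pow_pos_le1. nra. }
set (b := Rmax 5 (/ q)).
assert (Hb5 : 5 <= b) by apply Rmax_l. assert (Hbq : / q <= b) by apply Rmax_r.
destruct (first_zero (fun X => thr q (- X)) b (r / q ^ (4 * m))) as [a [Ha1 [Ha2 Ha3]]].
- now apply thr_continuity_left.
- lra.
- intros X HX. apply thr_pos_no_zero; [exact Hq|lra|].
  unfold b in HX. destruct (Rle_lt_dec X 5) as [C|C]; [left; exact C|right].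
  destruct (Rle_lt_dec X (/ q)) as [C1|C1].
  + apply Rmult_le_reg_r with (/ q); [exact Hiq|]. rewrite Rmult_assoc, Rinv_r by lra. lra.
  + exfalso. destruct HX as [_ HX]. revert HX. apply Rmax_case; lra.
- apply Rmult_le_pos; [lra|]. left. apply Rinv_0_lt_compat, pow_lt; lra.
- replace (- (r / q ^ (4 * m))) with (- r / q ^ (4 * m)) by (unfold Rdiv; ring). lra.
- destruct (left_gap_pos q (- a)) as [d [Hd Hd']]; [exact Hq|lra|lra|exact Ha2|].
  set (e := Rmin (d / 2) ((a - b) / 2)).
  assert (He : 0 < e) by (apply Rmin_case; lra).
  assert (He1 : e <= d / 2) by apply Rmin_l. assert (He2 : e <= (a - b) / 2) by apply Rmin_r.
  exists (a - e). split; [lra|]. split.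
  + intros x Hx. apply real_zero_thr in Hx; [|exact Hq'].
    destruct (Rle_lt_dec 0 x) as [C|C]; [pose proof (thr_pos_pos q x Hq C); lra|].
    destruct (Rlt_le_dec (- x) a) as [C1|C1]; [|lra].
    specialize (Ha3 (- x) ltac:(lra)). rewrite Ropp_involutive in Ha3. lra.
  + apply nonreal_from_upper; [exact Hq'|]. intros x t Ht Hz. specialize (Hd' x t Ht Hz). lra.
Qed.

(** The start b is the larger of 1/p^2 and a constant, 2.4 or, for p >= 3/4, 3.2; up to there
    [thr_left_pos] excludes negative zeros, and beyond it [left_gap_neg] applies. *)
Lemma left_separating_line_exists (p : R) : 0 < p < 1 ->
  exists a, 24 / 10 <= a /\ left_separating_line (- p) (- a).
Proof.
intros Hp. assert (Hq' := neg_q p Hp).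
assert (Hp2 : 0 < p ^ 2 < 1) by now apply psq_range.
assert (Hip : 0 < / p ^ 2) by (apply Rinv_0_lt_compat; lra).
destruct (thr_far_sign (- p) (- p) (-1) Hq') with (b := 0) as [m [_ Hm]];
  [lra|lra|rewrite Rabs_left; lra|now apply J_seed_left|].
set (b0 := if Rlt_dec p (3 / 4) then 24 / 10 else 32 / 10).
assert (Hb0 : 24 / 10 <= b0) by (unfold b0; destruct (Rlt_dec p (3 / 4)); lra).
set (b := Rmax b0 (/ p ^ 2)).
assert (Hb5 : b0 <= b) by apply Rmax_l. assert (Hbq : / p ^ 2 <= b) by apply Rmax_r.
destruct (first_zero (fun X => thr (- p) (- X)) b (p / (- p) ^ (4 * m))) as [a [Ha1 [Ha2 Ha3]]].
- now apply thr_continuity_left.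
- lra.
- intros X HX. apply thr_left_pos; [exact Hp|lra|].
  destruct (Rle_lt_dec X (/ p ^ 2)) as [C1|C1].
  + left. apply Rmult_le_reg_r with (/ p ^ 2); [exact Hip|]. rewrite Rmult_assoc, Rinv_r by lra. lra.
  + right. assert (X <= b0) by (destruct HX as [_ HX]; revert HX; unfold b; apply Rmax_case; lra).
    unfold b0 in H. destruct (Rlt_dec p (3 / 4)); [left|right]; lra.
- apply Rmult_le_pos; [lra|]. left. apply Rinv_0_lt_compat. replace (4 * m)%nat with (2 * (2 * m))%nat by lia.
  rewrite neg_pow. apply pow_lt; lra.
- replace (- (p / (- p) ^ (4 * m))) with (- p / (- p) ^ (4 * m)) by (unfold Rdiv; ring). lra.
- destruct (left_gap_neg p (- a)) as [d [Hd Hd']]; [exact Hp|lra|lra| |exact Ha2|].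
  { intros H. unfold b0 in Hb5. destruct (Rlt_dec p (3 / 4)); lra. }
  set (e := Rmin (d / 2) ((a - b) / 2)).
  assert (He : 0 < e) by (apply Rmin_case; lra).
  assert (He1 : e <= d / 2) by apply Rmin_l. assert (He2 : e <= (a - b) / 2) by apply Rmin_r.
  exists (a - e). split; [lra|]. split; [|split].
  + intros x Hx Hx0. apply real_zero_thr in Hx; [|exact Hq'].
    destruct (Rlt_le_dec (- x) a) as [C1|C1]; [|lra].
    specialize (Ha3 (- x) ltac:(lra)). rewrite Ropp_involutive in Ha3. lra.
  + apply nonreal_from_upper; [exact Hq'|]. intros x t Ht Hz. specialize (Hd' x t Ht Hz). lra.
  + intros x _ Hx. lra.
Qed.

(** * The minimum principle *)

(* With q = -p and K(p,s) = s thr(-p)(-s), the function thr(-p)(x) is 1 - K(p, p x), and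
   2 p K_p = s^2 K_ss. Its s-derivative dK satisfies 2 p D_p = s^2 D_ss + 2 s D_s, to which the
   minimum principle applies. *)
Definition sgn (j : nat) : R := (-1) ^ (j + tri j).
Definition kcoef (p : R) (j : nat) : R := sgn j * p ^ tri j.
Definition dcoef (p : R) : nat -> R := PS_derive (PS_incr_1 (kcoef p)).
Definition dK (p s : R) : R := PSeries (dcoef p) s.
Definition dKp (p s : R) : R :=
  Series (fun j => sgn j * INR (S j) * (INR (tri j) * p ^ (tri j - 1)) * s ^ j).
(** Common majorant for the increments in p of the coefficients of [dK], for p <= P and s <= 1; the
    square of [tri j] serves the second-order remainder. *)
Definition wcoef (P : R) (j : nat) : R := INR (S j) * (INR (tri j) ^ 2 * P ^ tri j).

Lemma sgn_abs (j : nat) : Rabs (sgn j) = 1.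
Proof. apply pow_1_abs. Qed.

Lemma dcoef_eq (p : R) (j : nat) : dcoef p j = INR (S j) * kcoef p j.
Proof. reflexivity. Qed.

Lemma kcoef_thr (p s : R) : PSeries (kcoef p) s = thr (- p) (- s).
Proof.
apply Series_ext. intros j. unfold kcoef, sgn. rewrite pow_add.
replace (- p) with (-1 * p) by ring. replace (- s) with (-1 * s) by ring.
rewrite !Rpow_mult_distr. ring.
Qed.

Lemma kcoef_radius (p : R) : 0 < p < 1 -> CV_radius (kcoef p) = p_infty.
Proof.
intros Hp.
assert (H0 : forall n, kcoef p n <> 0).
{ intros n. unfold kcoef, sgn. apply Rmult_integral_contrapositive. split; apply pow_nonzero; lra. }
apply CV_radius_infinite_DAlembert; [exact H0|].
apply is_lim_seq_ext with (fun n => p ^ S n).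
- intros n. unfold Rdiv. rewrite Rabs_mult, Rabs_inv. unfold kcoef. rewrite !Rabs_mult, !sgn_abs.
  rewrite tri_S, pow_add. rewrite !Rabs_pos_eq; [field; apply pow_nonzero; lra|apply pow_le; lra|].
  apply Rmult_le_pos; apply pow_le; lra.
- apply (is_lim_seq_incr_1 (fun n => p ^ n)), is_lim_seq_geom. rewrite Rabs_pos_eq; lra.
Qed.

Lemma dcoef_radius (p : R) : 0 < p < 1 -> CV_radius (dcoef p) = p_infty.
Proof. intros Hp. unfold dcoef. rewrite CV_radius_derive, CV_radius_incr_1. now apply kcoef_radius. Qed.

Lemma pow2_ge (j : nat) : INR (S j) <= 2 ^ j /\ INR (tri j) <= 2 ^ j.
Proof.
induction j as [|j [H1 H2]]; [simpl; lra|]. rewrite tri_S, plus_INR, !S_INR in *. simpl.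
split; [|lra]. pose proof (pos_INR j). pose proof (pow_R1_Rle 2 j ltac:(lra)). lra.
Qed.

(** 8 = 2^3: each of j + 1 and the two factors [tri j] is at most 2^j. *)
Lemma wcoef_bounds (P : R) (j : nat) : 0 < P < 1 ->
  0 <= INR (S j) * P ^ tri j <= P ^ tri j * 8 ^ j /\
  0 <= INR (S j) * (INR (tri j) * P ^ tri j) <= wcoef P j /\ wcoef P j <= P ^ tri j * 8 ^ j.
Proof.
intros HP. destruct (pow2_ge j) as [H1 H2]. unfold wcoef.
pose proof (pos_INR (S j)). pose proof (pos_INR (tri j)).
assert (HPt : 0 <= P ^ tri j) by (apply pow_le; lra).
assert (E : 8 ^ j = 2 ^ j * (2 ^ j * 2 ^ j)) by (rewrite <- !Rpow_mult_distr; f_equal; ring).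
pose proof (pow_R1_Rle 2 j ltac:(lra)).
assert (Ht : INR (tri j) <= INR (tri j) ^ 2).
{ destruct (tri j) as [|n]; [simpl; lra|]. rewrite S_INR. pose proof (pos_INR n). nra. }
assert (1 <= 2 ^ j * 2 ^ j) by nra.
repeat split.
- now apply Rmult_le_pos.
- rewrite E, Rmult_comm. apply Rmult_le_compat_l; [exact HPt|]. nra.
- apply Rmult_le_pos; [lra|]. now apply Rmult_le_pos.
- apply Rmult_le_compat_l; [lra|]. now apply Rmult_le_compat_r.
- rewrite E. replace (INR (S j) * (INR (tri j) ^ 2 * P ^ tri j))
    with (P ^ tri j * (INR (S j) * (INR (tri j) * INR (tri j)))) by ring.
  apply Rmult_le_compat_l; [exact HPt|].
  apply Rmult_le_compat; [lra|nra|lra|apply Rmult_le_compat; lra].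
Qed.

Lemma ex_series_dom (a b : nat -> R) : (forall n, Rabs (a n) <= b n) -> ex_series b -> ex_series a.
Proof. intros H Hb. exact (@ex_series_le R_AbsRing R_CompleteNormedModule a b H Hb). Qed.

Lemma ex_series_8 (P : R) : 0 < P < 1 -> ex_series (fun j => P ^ tri j * 8 ^ j).
Proof. intros HP. apply ex_series_tri; lra. Qed.

Lemma ex_wcoef (P : R) : 0 < P < 1 -> ex_series (wcoef P).
Proof.
intros HP. apply ex_series_dom with (2 := ex_series_8 P HP). intros j.
destruct (wcoef_bounds P j HP) as [_ [[H1 H2] H3]]. rewrite Rabs_pos_eq; lra.
Qed.

Lemma pow_unit (s : R) (j : nat) : 0 <= s <= 1 -> 0 <= s ^ j <= 1.
Proof. intros Hs. split; [apply pow_le; lra|rewrite <- (pow1 j); apply pow_incr; lra]. Qed.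

Lemma ex_dK (P p s : R) : 0 < P < 1 -> 0 <= p <= P -> 0 <= s <= 1 ->
  ex_series (fun j => dcoef p j * s ^ j).
Proof.
intros HP Hp Hs. apply ex_series_dom with (2 := ex_series_8 P HP). intros j.
rewrite dcoef_eq. unfold kcoef. rewrite !Rabs_mult, sgn_abs.
destruct (wcoef_bounds P j HP) as [H1 _]. pose proof (pow_unit s j Hs).
pose proof (pos_INR (S j)). assert (0 <= p ^ tri j <= P ^ tri j) by (split; [apply pow_le|apply pow_incr]; lra).
rewrite !Rabs_pos_eq by lra. rewrite Rmult_1_l.
assert (0 <= INR (S j) * p ^ tri j <= INR (S j) * P ^ tri j).
{ split; [apply Rmult_le_pos; lra|apply Rmult_le_compat_l; lra]. }
nra.
Qed.

Lemma pow_pred_le (P p : R) (n : nat) : 0 < P -> 0 <= p <= P ->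
  0 <= INR n * p ^ (n - 1) /\ P * (INR n * p ^ (n - 1)) <= INR n * P ^ n.
Proof.
intros HP Hp. destruct n as [|n]; [simpl; lra|]. simpl (S n - 1)%nat. rewrite Nat.sub_0_r.
pose proof (pos_INR (S n)).
assert (0 <= p ^ n <= P ^ n) by (split; [apply pow_le|apply pow_incr]; lra).
split; [apply Rmult_le_pos; lra|]. change (P ^ S n) with (P * P ^ n).
assert (INR (S n) * p ^ n <= INR (S n) * P ^ n) by (apply Rmult_le_compat_l; lra). nra.
Qed.

Lemma ex_dKp (P p s : R) : 0 < P < 1 -> 0 <= p <= P -> 0 <= s <= 1 ->
  ex_series (fun j => sgn j * INR (S j) * (INR (tri j) * p ^ (tri j - 1)) * s ^ j).
Proof.
intros HP Hp Hs.
apply ex_series_dom with (fun j => / P * (P ^ tri j * 8 ^ j)).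
2: apply (ex_series_scal_l (V := R_NormedModule) (/ P)), (ex_series_8 P HP).
intros j. rewrite !Rabs_mult, sgn_abs, <- Rabs_mult.
destruct (wcoef_bounds P j HP) as [_ [H1 H2]]. pose proof (pow_unit s j Hs).
pose proof (pos_INR (S j)). destruct (pow_pred_le P p (tri j) ltac:(lra) Hp) as [H3 H4].
rewrite !Rabs_pos_eq by lra.
apply Rmult_le_reg_l with P; [lra|].
replace (P * (/ P * (P ^ tri j * 8 ^ j))) with (P ^ tri j * 8 ^ j) by (field; lra).
apply Rle_trans with (INR (S j) * (INR (tri j) * P ^ tri j)); [|lra].
replace (P * (1 * INR (S j) * (INR (tri j) * p ^ (tri j - 1)) * s ^ j))
  with (INR (S j) * (P * (INR (tri j) * p ^ (tri j - 1))) * s ^ j) by ring.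
assert (0 <= INR (S j) * (P * (INR (tri j) * p ^ (tri j - 1)))) by (apply Rmult_le_pos; nra).
assert (INR (S j) * (P * (INR (tri j) * p ^ (tri j - 1))) <= INR (S j) * (INR (tri j) * P ^ tri j))
  by (apply Rmult_le_compat_l; lra).
nra.
Qed.

(** Multiplication by P avoids the exponent n - 1, as P^2 avoids n - 2 in the second-order
    version. *)
Lemma pow_diff_le (P p p' : R) (n : nat) : 0 < P -> 0 <= p <= P -> 0 <= p' <= P ->
  Rabs (p ^ n - p' ^ n) * P <= INR n * P ^ n * Rabs (p - p').
Proof.
intros HP Hp Hp'. induction n as [|n IH].
- simpl. rewrite Rminus_diag, Rabs_R0. lra.
- simpl pow. replace (p * p ^ n - p' * p' ^ n) with (p * (p ^ n - p' ^ n) + (p - p') * p' ^ n) by ring.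
  rewrite S_INR. assert (0 <= p' ^ n <= P ^ n) by (split; [apply pow_le|apply pow_incr]; lra).
  pose proof (Rabs_triang (p * (p ^ n - p' ^ n)) ((p - p') * p' ^ n)) as HT.
  rewrite !Rabs_mult, (Rabs_pos_eq p), (Rabs_pos_eq (p' ^ n)) in HT by lra.
  pose proof (Rabs_pos (p - p')). pose proof (Rabs_pos (p ^ n - p' ^ n)).
  assert (p * Rabs (p ^ n - p' ^ n) <= P * Rabs (p ^ n - p' ^ n)) by (apply Rmult_le_compat_r; lra).
  assert (Rabs (p - p') * p' ^ n <= Rabs (p - p') * P ^ n) by (apply Rmult_le_compat_l; lra).
  nra.
Qed.

Lemma pow_taylor (P p p' : R) (n : nat) : 0 < P -> 0 <= p <= P -> 0 <= p' <= P ->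
  Rabs (p ^ n - p' ^ n - INR n * p' ^ (n - 1) * (p - p')) * P ^ 2 <= INR n ^ 2 * P ^ n * (p - p') ^ 2.
Proof.
intros HP Hp Hp'. induction n as [|n IH].
- simpl. replace (1 - 1 - 0 * 1 * (p - p')) with 0 by ring. rewrite Rabs_R0. lra.
- simpl (S n - 1)%nat. rewrite Nat.sub_0_r.
  set (r := p ^ n - p' ^ n - INR n * p' ^ (n - 1) * (p - p')) in *.
  assert (Hn : INR n * p' ^ n = INR n * p' ^ (n - 1) * p').
  { destruct n as [|n]; [simpl; ring|]. simpl (S n - 1)%nat. rewrite Nat.sub_0_r. simpl. ring. }
  replace (p ^ S n - p' ^ S n - INR (S n) * p' ^ n * (p - p'))
    with (p * r + INR n * p' ^ (n - 1) * (p - p') ^ 2).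
  2: { rewrite S_INR. replace ((INR n + 1) * p' ^ n) with (INR n * p' ^ n + p' ^ n) by ring. rewrite Hn.
       unfold r. simpl. ring. }
  destruct (pow_pred_le P p' n HP Hp') as [H1 H2].
  pose proof (pow2_ge_0 (p - p')) as Hd. set (d2 := (p - p') ^ 2) in *.
  pose proof (Rabs_triang (p * r) (INR n * p' ^ (n - 1) * d2)) as HT.
  rewrite Rabs_mult, (Rabs_pos_eq p), (Rabs_pos_eq (INR n * p' ^ (n - 1) * d2)) in HT by nra.
  pose proof (Rabs_pos r).
  assert (A1 : p * Rabs r * P ^ 2 <= P * (INR n ^ 2 * P ^ n * d2)).
  { rewrite Rmult_assoc. assert (0 <= Rabs r * P ^ 2) by (apply Rmult_le_pos; [lra|apply pow2_ge_0]).
    apply Rmult_le_compat; lra. }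
  assert (A2 : INR n * p' ^ (n - 1) * d2 * P ^ 2 <= INR n * P ^ n * P * d2).
  { replace (INR n * p' ^ (n - 1) * d2 * P ^ 2) with (P * (INR n * p' ^ (n - 1)) * (P * d2)) by ring.
    replace (INR n * P ^ n * P * d2) with (INR n * P ^ n * (P * d2)) by ring.
    apply Rmult_le_compat_r; [apply Rmult_le_pos; lra|exact H2]. }
  assert (A3 : INR n ^ 2 + INR n <= INR (S n) ^ 2) by (rewrite S_INR; pose proof (pos_INR n); nra).
  assert (A4 : 0 <= P * P ^ n * d2).
  { apply Rmult_le_pos; [|exact Hd]. apply Rmult_le_pos; [lra|]. apply pow_le; lra. }
  change (P ^ S n) with (P * P ^ n).
  assert (A5 : (INR n ^ 2 + INR n) * (P * P ^ n * d2) <= INR (S n) ^ 2 * (P * P ^ n * d2))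
    by (apply Rmult_le_compat_r; lra).
  assert (A6 : Rabs (p * r + INR n * p' ^ (n - 1) * d2) * P ^ 2 <= (p * Rabs r + INR n * p' ^ (n - 1) * d2) * P ^ 2)
    by (apply Rmult_le_compat_r; [apply pow2_ge_0|lra]).
  lra.
Qed.

Lemma dK_lipschitz (P p p' s : R) : 0 < P < 1 -> 0 <= p <= P -> 0 <= p' <= P -> 0 <= s <= 1 ->
  Rabs (dK p s - dK p' s) * P <= Series (wcoef P) * Rabs (p - p').
Proof.
intros HP Hp Hp' Hs. unfold dK, PSeries.
rewrite <- Series_minus by (apply (ex_dK P); assumption).
rewrite <- (Rabs_pos_eq P) at 1 by lra. rewrite <- Rabs_mult.
rewrite <- Series_scal_r, <- Series_scal_r.
assert (H : forall j, Rabs ((dcoef p j * s ^ j - dcoef p' j * s ^ j) * P) <= wcoef P j * Rabs (p - p')).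
{ intros j. rewrite !dcoef_eq. unfold kcoef.
  replace ((INR (S j) * (sgn j * p ^ tri j) * s ^ j - INR (S j) * (sgn j * p' ^ tri j) * s ^ j) * P)
    with (INR (S j) * sgn j * s ^ j * ((p ^ tri j - p' ^ tri j) * P)) by ring.
  rewrite !Rabs_mult, sgn_abs. pose proof (pos_INR (S j)). pose proof (pow_unit s j Hs).
  rewrite (Rabs_pos_eq (INR (S j))), (Rabs_pos_eq (s ^ j)), (Rabs_pos_eq P) by lra.
  pose proof (pow_diff_le P p p' (tri j) ltac:(lra) Hp Hp') as H1.
  destruct (wcoef_bounds P j HP) as [_ [[H2 H3] _]].
  pose proof (Rabs_pos (p ^ tri j - p' ^ tri j)). pose proof (Rabs_pos (p - p')).
  apply Rle_trans with (INR (S j) * (INR (tri j) * P ^ tri j) * Rabs (p - p'));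
    [|apply Rmult_le_compat_r; lra].
  rewrite !Rmult_assoc. apply Rmult_le_compat_l; [lra|]. rewrite Rmult_1_l, <- !Rmult_assoc.
  assert (0 <= Rabs (p ^ tri j - p' ^ tri j) * P) by (apply Rmult_le_pos; lra).
  rewrite Rmult_assoc. rewrite <- (Rmult_1_l (INR (tri j) * P ^ tri j * Rabs (p - p'))).
  apply Rmult_le_compat; lra. }
assert (Hex : ex_series (fun j => wcoef P j * Rabs (p - p'))) by (apply ex_series_scal_r, ex_wcoef, HP).
eapply Rle_trans; [apply Series_Rabs|apply Series_le; [|exact Hex]].
- apply ex_series_dom with (2 := Hex). intros j. rewrite Rabs_Rabsolu. apply H.
- intros j. split; [apply Rabs_pos|apply H].
Qed.

Lemma dK_taylor (P p p' s : R) : 0 < P < 1 -> 0 <= p <= P -> 0 <= p' <= P -> 0 <= s <= 1 ->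
  Rabs (dK p s - dK p' s - dKp p' s * (p - p')) * P ^ 2 <= Series (wcoef P) * (p - p') ^ 2.
Proof.
intros HP Hp Hp' Hs. unfold dK, dKp, PSeries.
assert (E1 : ex_series (fun j => dcoef p j * s ^ j)) by (apply (ex_dK P); assumption).
assert (E2 : ex_series (fun j => dcoef p' j * s ^ j)) by (apply (ex_dK P); assumption).
pose proof (ex_dKp P p' s HP Hp' Hs) as E3.
rewrite <- Series_minus by assumption. rewrite <- Series_scal_r.
rewrite <- Series_minus; [|now apply (ex_series_minus (V := R_NormedModule))|now apply ex_series_scal_r].
assert (HP2 : 0 < P ^ 2) by (apply pow_lt; lra).
rewrite <- (Rabs_pos_eq (P ^ 2)) at 1 by lra. rewrite <- Rabs_mult.
rewrite <- Series_scal_r, <- Series_scal_r.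
assert (H : forall j, Rabs ((dcoef p j * s ^ j - dcoef p' j * s ^ j
    - sgn j * INR (S j) * (INR (tri j) * p' ^ (tri j - 1)) * s ^ j * (p - p')) * P ^ 2)
    <= wcoef P j * (p - p') ^ 2).
{ intros j. rewrite !dcoef_eq. unfold kcoef, wcoef.
  replace ((INR (S j) * (sgn j * p ^ tri j) * s ^ j - INR (S j) * (sgn j * p' ^ tri j) * s ^ j
    - sgn j * INR (S j) * (INR (tri j) * p' ^ (tri j - 1)) * s ^ j * (p - p')) * P ^ 2)
    with (INR (S j) * sgn j * s ^ j * ((p ^ tri j - p' ^ tri j - INR (tri j) * p' ^ (tri j - 1) * (p - p')) * P ^ 2)) by ring.
  pose proof (pow_taylor P p p' (tri j) ltac:(lra) Hp Hp') as H1.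
  set (x := p ^ tri j - p' ^ tri j - _) in *. clearbody x.
  rewrite !Rabs_mult, sgn_abs. pose proof (pos_INR (S j)). pose proof (pow_unit s j Hs).
  rewrite (Rabs_pos_eq (INR (S j))), (Rabs_pos_eq (s ^ j)), (Rabs_pos_eq (P ^ 2)) by lra.
  rewrite !Rmult_assoc. apply Rmult_le_compat_l; [lra|]. rewrite Rmult_1_l.
  rewrite Rmult_assoc in H1. pose proof (Rabs_pos x).
  assert (0 <= Rabs x * P ^ 2) by (apply Rmult_le_pos; lra).
  rewrite <- (Rmult_1_l (INR (tri j) ^ 2 * (P ^ tri j * (p - p') ^ 2))).
  apply Rmult_le_compat; lra. }
assert (Hex : ex_series (fun j => wcoef P j * (p - p') ^ 2)) by (apply ex_series_scal_r, ex_wcoef, HP).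
eapply Rle_trans; [apply Series_Rabs|apply Series_le; [|exact Hex]].
- apply ex_series_dom with (2 := Hex). intros j. rewrite Rabs_Rabsolu. apply H.
- intros j. split; [apply Rabs_pos|apply H].
Qed.

Lemma inside_inf (a : nat -> R) (s : R) : CV_radius a = p_infty -> Rbar_lt (Rabs s) (CV_radius a).
Proof. intros ->. exact I. Qed.

Lemma ex_series_entire (a : nat -> R) (s : R) : CV_radius a = p_infty -> ex_series (fun n => a n * s ^ n).
Proof. intros H. apply ex_series_Rabs, CV_disk_inside. now apply inside_inf. Qed.

Lemma dK_derive (p s : R) : 0 < p < 1 -> is_derive (dK p) s (PSeries (PS_derive (dcoef p)) s).
Proof. intros Hp. apply is_derive_PSeries, inside_inf. now apply dcoef_radius. Qed.

Lemma dK_derive2 (p s : R) : 0 < p < 1 ->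
  is_derive (PSeries (PS_derive (dcoef p))) s (PSeries (PS_derive (PS_derive (dcoef p))) s).
Proof.
intros Hp. apply is_derive_PSeries, inside_inf. rewrite CV_radius_derive. now apply dcoef_radius.
Qed.

Lemma K_derive (p s : R) : 0 < p < 1 -> is_derive (fun s => s * thr (- p) (- s)) s (dK p s).
Proof.
intros Hp. apply is_derive_ext with (PSeries (PS_incr_1 (kcoef p))).
- intros t. rewrite PSeries_incr_1, kcoef_thr. reflexivity.
- apply is_derive_PSeries, inside_inf. rewrite CV_radius_incr_1. now apply kcoef_radius.
Qed.

Lemma dK_s0 (p : R) : dK p 0 = 1.
Proof.
unfold dK. rewrite PSeries_0, dcoef_eq. unfold kcoef, sgn. change (tri 0) with O. simpl. ring.
Qed.

Lemma dK_p0 (s : R) : 0 <= s <= 1 -> dK 0 s = 1.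
Proof.
intros Hs. unfold dK, PSeries. rewrite Series_incr_1 by (apply (ex_dK (1 / 2)); lra).
rewrite (Series_ext _ (fun _ => 0 * 0)).
- rewrite Series_scal_l, dcoef_eq. unfold kcoef, sgn. change (tri 0) with O. simpl. ring.
- intros n. rewrite dcoef_eq. unfold kcoef. rewrite tri_S.
  replace (tri n + S n)%nat with (S (tri n + n)) by lia. simpl. ring.
Qed.

(** Coefficient by coefficient this is 2 tri j = j (j - 1) + 2 j. *)
Lemma dK_pde (p s : R) : 0 < p < 1 -> 0 <= s <= 1 ->
  2 * p * dKp p s = s ^ 2 * PSeries (PS_derive (PS_derive (dcoef p))) s
    + 2 * s * PSeries (PS_derive (dcoef p)) s.
Proof.
intros Hp Hs.
replace (s ^ 2 * PSeries (PS_derive (PS_derive (dcoef p))) s)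
  with (PSeries (PS_incr_1 (PS_incr_1 (PS_derive (PS_derive (dcoef p))))) s)
  by (rewrite !PSeries_incr_1; ring).
replace (2 * s * PSeries (PS_derive (dcoef p)) s)
  with (2 * PSeries (PS_incr_1 (PS_derive (dcoef p))) s) by (rewrite PSeries_incr_1; ring).
unfold dKp, PSeries. rewrite <- !Series_scal_l.
rewrite <- Series_plus.
- apply Series_ext. intros j.
  assert (HT : p * (INR (tri j) * p ^ (tri j - 1)) = INR (tri j) * p ^ tri j).
  { destruct (tri j) as [|n]; [simpl; ring|]. simpl (S n - 1)%nat. rewrite Nat.sub_0_r. simpl. ring. }
  replace (2 * p * (sgn j * INR (S j) * (INR (tri j) * p ^ (tri j - 1)) * s ^ j))
    with (sgn j * INR (S j) * (2 * (p * (INR (tri j) * p ^ (tri j - 1)))) * s ^ j) by ring.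
  rewrite HT.
  assert (HD : 2 * INR (tri j) = INR j * (INR j + 1)).
  { pose proof (tri_double j) as E. apply (f_equal INR) in E.
    rewrite !mult_INR, plus_INR in E. simpl (INR 2) in E. simpl (INR 1) in E. exact E. }
  replace (2 * (INR (tri j) * p ^ tri j)) with (2 * INR (tri j) * p ^ tri j) by ring. rewrite HD.
  assert (E1 : PS_incr_1 (PS_derive (dcoef p)) j = INR j * dcoef p j).
  { destruct j as [|j]; [change (0 = INR 0 * dcoef p 0); simpl; ring|reflexivity]. }
  assert (E2 : PS_incr_1 (PS_incr_1 (PS_derive (PS_derive (dcoef p)))) j = INR j * (INR j - 1) * dcoef p j).
  { destruct j as [|[|j]].
    - change (0 = INR 0 * (INR 0 - 1) * dcoef p 0). simpl. ring.
    - change (0 = INR 1 * (INR 1 - 1) * dcoef p 1). simpl. ring.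
    - unfold PS_incr_1, PS_derive. refine (_ : @eq R _ _). rewrite !S_INR. ring. }
  rewrite E1, E2, dcoef_eq. unfold kcoef. rewrite S_INR. ring.
- apply (ex_series_entire (PS_incr_1 (PS_incr_1 (PS_derive (PS_derive (dcoef p)))))).
  rewrite !CV_radius_incr_1, !CV_radius_derive. now apply dcoef_radius.
- apply (ex_series_scal_l (V := R_NormedModule) 2).
  apply (ex_series_entire (PS_incr_1 (PS_derive (dcoef p)))).
  rewrite !CV_radius_incr_1, !CV_radius_derive. now apply dcoef_radius.
Qed.

Lemma second_derivative_min (g g1 : R -> R) (l c : R) :
  (forall x, is_derive g x (g1 x)) -> is_derive g1 c l -> 0 < c < 1 ->
  (forall x, 0 <= x <= 1 -> g c <= g x) -> g1 c = 0 /\ 0 <= l.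
Proof.
intros Hg Hg1 Hc Hmin.
assert (H0 : g1 c = 0).
{ assert (pr : derivable_pt g c) by (exists (g1 c); apply is_derive_Reals, Hg).
  rewrite <- (deriv_minimum g 0 1 c pr); [|lra|lra|intros x H1 H2; apply Hmin; lra].
  symmetry. apply derive_pt_eq_0, is_derive_Reals, Hg. }
split; [exact H0|].
destruct (Rle_lt_dec 0 l) as [C|C]; [exact C|exfalso].
apply is_derive_Reals in Hg1. destruct (Hg1 (- l / 2) ltac:(lra)) as [d Hd].
set (h := Rmin (d / 2) ((1 - c) / 2)).
assert (Hd0 := cond_pos d).
assert (Hh : 0 < h) by (apply Rmin_case; lra).
assert (Hh1 : h <= d / 2) by apply Rmin_l. assert (Hh2 : h <= (1 - c) / 2) by apply Rmin_r.
destruct (MVT_cor2 g g1 c (c + h) ltac:(lra)) as [x [Hx1 Hx2]].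
{ intros x _. apply is_derive_Reals, Hg. }
specialize (Hmin (c + h) ltac:(lra)).
assert (Hneg : g1 x < 0); [|nra].
specialize (Hd (x - c) ltac:(lra)). rewrite Rabs_pos_eq in Hd by lra. specialize (Hd ltac:(lra)).
replace (c + (x - c)) with x in Hd by ring. rewrite H0, Rminus_0_r in Hd.
apply Rabs_def2 in Hd as [Hd _].
assert (H : g1 x / (x - c) < l / 2) by lra.
apply Rmult_lt_compat_r with (r := x - c) in H; [|lra].
unfold Rdiv in H at 1. rewrite Rmult_assoc, Rinv_l, Rmult_1_r in H by lra. nra.
Qed.

(** On the parabolic boundary the function is 1 for s = 0 or p = 0 and at least k for s = 1. After
    adding e p, the first p at which the minimum over s drops to k would have it at an interior s,
    where the equation gives D_p >= 0; the perturbed function then increases strictly in p there,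
    although it was larger for smaller p. *)
Lemma dK_min_principle (k : R) : k < 1 -> (forall p, 0 < p < 1 -> k <= dK p 1) ->
  forall p s, 0 < p < 1 -> 0 <= s <= 1 -> k <= dK p s.
Proof.
intros Hk Hbd P s0 HP Hs0. apply le_epsilon. intros e He.
set (C := Rabs (Series (wcoef P)) + 1).
assert (HC : 0 < C) by (unfold C; pose proof (Rabs_pos (Series (wcoef P))); lra).
assert (HCw : Series (wcoef P) <= C) by (unfold C; pose proof (Rle_abs (Series (wcoef P))); lra).
set (h := fun p s => dK p s + e * p).
assert (HL : forall p p' s, 0 <= p <= P -> 0 <= p' <= P -> 0 <= s <= 1 ->
  Rabs (h p s - h p' s) <= (C / P + e) * Rabs (p - p')).
{ intros p p' s Hp Hp' Hs. unfold h.
  replace (dK p s + e * p - (dK p' s + e * p')) with ((dK p s - dK p' s) + e * (p - p')) by ring.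
  eapply Rle_trans; [apply Rabs_triang|]. rewrite Rabs_mult, (Rabs_pos_eq e) by lra.
  pose proof (dK_lipschitz P p p' s HP Hp Hp' Hs) as H. pose proof (Rabs_pos (p - p')).
  assert (Rabs (dK p s - dK p' s) <= C / P * Rabs (p - p')); [|lra].
  apply Rmult_le_reg_r with P; [lra|]. apply Rle_trans with (1 := H).
  replace (C / P * Rabs (p - p') * P) with (C * Rabs (p - p')) by (field; lra).
  now apply Rmult_le_compat_r. }
set (L := C / P + e) in *.
assert (HL0 : 0 < L) by (unfold L; assert (0 < C / P) by (apply Rdiv_lt_0_compat; lra); lra).
set (Q := fun p => forall s, 0 <= s <= 1 -> k < h p s).
assert (HQ0 : Q 0) by (intros s Hs; unfold h; rewrite dK_p0 by exact Hs; lra).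
assert (HQP : Q P).
{ set (E := fun p => 0 <= p <= P /\ forall p', 0 <= p' <= p -> Q p').
  assert (HE0 : E 0).
  { split; [lra|]. intros p' Hp'. replace p' with 0 by lra. exact HQ0. }
  destruct (completeness E) as [ps [Hps1 Hps2]]; [exists P; intros p [Hp _]; lra|now exists 0|].
  assert (Hps : 0 <= ps <= P) by (split; [now apply Hps1|apply Hps2; intros p [Hp _]; lra]).
  assert (Hlt : forall p, 0 <= p < ps -> Q p).
  { intros p Hp. destruct (classic (Q p)) as [H|H]; [exact H|exfalso].
    assert (ps <= p); [|lra]. apply Hps2. intros y [Hy1 Hy2].
    destruct (Rle_lt_dec y p) as [H'|H']; [exact H'|]. exfalso. apply H, Hy2. lra. }
  assert (Hge : forall s, 0 <= s <= 1 -> k <= h ps s).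
  { intros s Hs. destruct (Req_dec ps 0) as [E0|E0]; [rewrite E0; left; now apply HQ0|].
    apply le_epsilon. intros d Hd.
    set (p' := ps - Rmin ps (d / L)).
    assert (Hdl : 0 < d / L) by now apply Rdiv_lt_0_compat.
    assert (Hm : 0 < Rmin ps (d / L)) by (apply Rmin_case; lra).
    assert (Hm1 : Rmin ps (d / L) <= ps) by apply Rmin_l.
    assert (Hm2 : Rmin ps (d / L) <= d / L) by apply Rmin_r.
    pose proof (Hlt p' ltac:(unfold p'; lra) s Hs) as H1.
    pose proof (HL p' ps s ltac:(unfold p'; lra) Hps Hs) as H2.
    rewrite (Rabs_left (p' - ps)) in H2 by (unfold p'; lra).
    apply Rabs_le_between in H2 as [_ H2].
    assert (L * - (p' - ps) <= d); [|lra].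
    replace d with (L * (d / L)) by (field; lra). apply Rmult_le_compat_l; [lra|]. unfold p'. lra. }
  assert (Hps0 : 0 < ps).
  { destruct (Rle_lt_dec ps 0) as [C0|C0]; [exfalso|exact C0].
    assert (E0 : ps = 0) by lra.
    set (d := Rmin P ((1 - k) / (2 * L))).
    assert (0 < (1 - k) / (2 * L)) by (apply Rdiv_lt_0_compat; lra).
    assert (Hd : 0 < d) by (apply Rmin_case; lra).
    assert (Hd1 : d <= P) by apply Rmin_l. assert (Hd2 : d <= (1 - k) / (2 * L)) by apply Rmin_r.
    assert (d <= ps); [|lra]. apply Hps1. split; [lra|]. intros p' Hp' s Hs.
    pose proof (HL p' 0 s ltac:(lra) ltac:(lra) Hs) as H1.
    rewrite Rminus_0_r, (Rabs_pos_eq p') in H1 by lra. apply Rabs_le_between in H1 as [H1 _].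
    assert (h 0 s = 1) by (unfold h; rewrite dK_p0 by exact Hs; ring).
    assert (L * p' <= (1 - k) / 2); [|lra].
    apply Rle_trans with (L * ((1 - k) / (2 * L))); [apply Rmult_le_compat_l; lra|].
    right. field. lra. }
  assert (Hps' : 0 < ps < 1) by lra.
  destruct (continuity_ab_min (dK ps) 0 1 ltac:(lra)) as [c [Hc1 Hc2]].
  { intros x _. apply derivable_continuous_pt. exists (PSeries (PS_derive (dcoef ps)) x).
    now apply is_derive_Reals, dK_derive. }
  (* Either the minimum over s equals k at the supremum [ps], which the equation forbids, or it
     exceeds k and the Lipschitz bound in p extends the property beyond [ps] unless [ps] = P. *)
  destruct (Rle_lt_dec (h ps c) k) as [C1|C1].
  - exfalso. pose proof (Hge c Hc2) as C2.
    assert (Hcc : 0 < c < 1).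
    { assert (0 < e * ps) by nra. split.
      - destruct (Req_dec c 0) as [E0|E0]; [|lra]. unfold h in C1. rewrite E0, dK_s0 in C1. lra.
      - destruct (Req_dec c 1) as [E0|E0]; [|lra]. unfold h in C1. rewrite E0 in C1.
        specialize (Hbd ps Hps'). lra. }
    destruct (second_derivative_min (dK ps) (PSeries (PS_derive (dcoef ps)))
      (PSeries (PS_derive (PS_derive (dcoef ps))) c) c) as [D1 D2]; auto.
    { intros x. now apply dK_derive. }
    { now apply dK_derive2. }
    pose proof (dK_pde ps c Hps' ltac:(lra)) as HP1. rewrite D1 in HP1.
    assert (HDp : 0 <= dKp ps c).
    { assert (0 <= c ^ 2 * PSeries (PS_derive (PS_derive (dcoef ps))) c)
        by (apply Rmult_le_pos; [apply pow2_ge_0|exact D2]). nra. }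
    (* For steps up to e P^2 / C the quadratic remainder cannot absorb the linear term e d. *)
    set (d := Rmin ps (e * P ^ 2 / C)).
    assert (HP2 : 0 < P ^ 2) by (apply pow_lt; lra).
    assert (0 < e * P ^ 2 / C) by (apply Rdiv_lt_0_compat; nra).
    assert (Hd : 0 < d) by (apply Rmin_case; lra).
    assert (Hd1 : d <= ps) by apply Rmin_l. assert (Hd2 : d <= e * P ^ 2 / C) by apply Rmin_r.
    pose proof (Hlt (ps - d) ltac:(lra) c ltac:(lra)) as H1. unfold h in H1, C1, C2.
    pose proof (dK_taylor P (ps - d) ps c HP ltac:(lra) Hps ltac:(lra)) as H2.
    replace (ps - d - ps) with (- d) in H2 by ring.
    assert (H3 : e * d < dK (ps - d) c - dK ps c - dKp ps c * - d) by nra.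
    assert (H4 : (dK (ps - d) c - dK ps c - dKp ps c * - d) * P ^ 2 <= C * d ^ 2).
    { eapply Rle_trans; [apply Rmult_le_compat_r; [lra|apply Rle_abs]|].
      eapply Rle_trans; [exact H2|]. replace ((- d) ^ 2) with (d ^ 2) by ring.
      apply Rmult_le_compat_r; [apply pow2_ge_0|exact HCw]. }
    assert (H5 : C * d <= e * P ^ 2).
    { apply Rle_trans with (C * (e * P ^ 2 / C)); [apply Rmult_le_compat_l; lra|right; field; lra]. }
    assert (H6 : C * d ^ 2 <= e * P ^ 2 * d) by (replace (C * d ^ 2) with (C * d * d) by ring; nra).
    assert (H7 : e * d * P ^ 2 < (dK (ps - d) c - dK ps c - dKp ps c * - d) * P ^ 2)
      by (apply Rmult_lt_compat_r; lra).
    lra.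
  - assert (Hmin : forall s, 0 <= s <= 1 -> h ps c <= h ps s).
    { intros s Hs. unfold h. specialize (Hc1 s Hs). lra. }
    destruct (Req_dec ps P) as [E0|E0].
    { rewrite <- E0. intros s Hs. specialize (Hmin s Hs). lra. }
    exfalso.
    set (d := Rmin (P - ps) ((h ps c - k) / (2 * L))).
    assert (0 < (h ps c - k) / (2 * L)) by (apply Rdiv_lt_0_compat; lra).
    assert (Hd : 0 < d) by (apply Rmin_case; lra).
    assert (Hd1 : d <= P - ps) by apply Rmin_l. assert (Hd2 : d <= (h ps c - k) / (2 * L)) by apply Rmin_r.
    assert (ps + d <= ps); [|lra]. apply Hps1. split; [lra|]. intros p' Hp' s Hs.
    destruct (Rlt_le_dec p' ps) as [C2|C2]; [apply Hlt; [lra|exact Hs]|].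
    pose proof (HL p' ps s ltac:(lra) Hps Hs) as H1. rewrite (Rabs_pos_eq (p' - ps)) in H1 by lra.
    apply Rabs_le_between in H1 as [H1 _]. specialize (Hmin s Hs).
    assert (L * (p' - ps) <= (h ps c - k) / 2); [|lra].
    apply Rle_trans with (L * ((h ps c - k) / (2 * L))); [apply Rmult_le_compat_l; lra|].
    right. field. lra. }
specialize (HQP s0 Hs0). unfold h in HQP. nra.
Qed.

(* s J(-s) = K(s) - s K(1/s) vanishes at s = 1 and is nonnegative just above, and its derivative
   at 1 is 2 K'(1) - K(1). *)
Lemma dK_at1 (p : R) : 0 < p < 1 -> thr (- p) (- 1) / 2 <= dK p 1.
Proof.
intros Hp. set (K := fun s => s * thr (- p) (- s)).
assert (HG : is_derive (fun s => K s - s * K (/ s)) 1 (2 * dK p 1 - K 1)).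
{ assert (H1 : is_derive K 1 (dK p 1)) by now apply K_derive.
  assert (H2 : is_derive (fun s => K (/ s)) 1 (- dK p 1)).
  { evar_last.
    - apply (is_derive_comp K (fun s => / s)); [rewrite Rinv_1; now apply K_derive|].
      apply (is_derive_inv (fun s => s) 1 1); [apply (@is_derive_id R_AbsRing)|lra].
    - unfold scal. simpl. unfold mult. simpl. field. }
  evar_last.
  - apply (is_derive_minus K (fun s => s * K (/ s))); [exact H1|].
    apply (is_derive_mult (fun s => s) (fun s => K (/ s))); [apply (@is_derive_id R_AbsRing)|exact H2|].
    intros n m. apply Rmult_comm.
  - unfold minus, plus, opp, mult, one. simpl. unfold mult, one. simpl. rewrite Rinv_1. ring. }
destruct (Rle_lt_dec (thr (- p) (- 1) / 2) (dK p 1)) as [C|C]; [exact C|exfalso].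
assert (EK : K 1 = thr (- p) (- 1)) by (unfold K; rewrite Rmult_1_l; f_equal; ring).
apply is_derive_Reals in HG.
set (l := 2 * dK p 1 - K 1) in *.
assert (Hl : l < 0) by (unfold l; lra).
destruct (HG (- l) ltac:(lra)) as [d Hd].
assert (Hp2 : 0 < p ^ 2 < 1) by now apply psq_range.
assert (Hip : 1 < / p ^ 2) by (rewrite <- Rinv_1; apply Rinv_lt_contravar; lra).
set (x := Rmin (d / 2) (/ p ^ 2 - 1)).
assert (Hd0 := cond_pos d).
assert (Hh : 0 < x) by (apply Rmin_case; lra).
assert (Hh1 : x <= d / 2) by apply Rmin_l. assert (Hh2 : x <= / p ^ 2 - 1) by apply Rmin_r.
specialize (Hd x ltac:(lra)). rewrite Rabs_pos_eq in Hd by lra. specialize (Hd ltac:(lra)).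
rewrite Rinv_1 in Hd. apply Rabs_def2 in Hd as [Hd _].
set (y := 1 + x) in *.
assert (HJ : 0 <= Jr (- p) (- y)).
{ apply J_left_ge0; [exact Hp|unfold y; lra|]. left.
  apply Rmult_le_reg_r with (/ p ^ 2); [lra|]. rewrite Rmult_assoc, Rinv_r by lra. unfold y. lra. }
assert (E : K y - y * K (/ y) = y * Jr (- p) (- y)).
{ unfold K, Jr. rewrite Rinv_opp. unfold y. field. lra. }
rewrite E in Hd.
assert (H : (y * Jr (- p) (- y) - (K 1 - 1 * K 1)) / x < 0) by lra.
assert (0 <= (y * Jr (- p) (- y) - (K 1 - 1 * K 1)) / x); [|lra].
apply Rmult_le_pos; [|left; now apply Rinv_0_lt_compat].
assert (0 <= y * Jr (- p) (- y)) by (apply Rmult_le_pos; [unfold y; lra|exact HJ]). lra.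
Qed.

Lemma thr_right_K (p x : R) : 0 < p < 1 -> thr (- p) x = 1 - (p * x) * thr (- p) (- (p * x)).
Proof.
intros Hp. rewrite thr_eq1 by now apply neg_q. replace (- p * x) with (- (p * x)) by ring. ring.
Qed.

Lemma thr_right_diff (k p x y : R) : 0 < p < 1 -> (forall s, 0 <= s <= 1 -> k <= dK p s) ->
  0 <= x < y -> p * y <= 1 -> k * (p * (y - x)) <= thr (- p) x - thr (- p) y.
Proof.
intros Hp Hk Hx Hy. rewrite (thr_right_K p x Hp), (thr_right_K p y Hp).
assert (Hpx : 0 <= p * x) by nra.
destruct (MVT_cor2 (fun s => s * thr (- p) (- s)) (dK p) (p * x) (p * y) ltac:(nra)) as [c [Hc1 Hc2]].
{ intros c _. now apply is_derive_Reals, K_derive. }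
specialize (Hk c ltac:(lra)).
assert (k * (p * y - p * x) <= dK p c * (p * y - p * x)) by (apply Rmult_le_compat_r; lra). lra.
Qed.

Lemma thr_1_pos (p : R) : 0 < p < 1 -> 0 < thr (- p) 1.
Proof.
intros Hp. pose proof (J_seed_right p Hp) as H. unfold Jr in H. rewrite Rinv_1 in H. lra.
Qed.

(** Bootstrap. The bound at s = 1 first gives D >= 0, so theta is nonincreasing on [0, 1/p] and
    theta(p) >= theta(1) > 0. Then theta(- 1) = 1 + p theta(p) > 1, and the bound at s = 1 improves
    to 1/2. *)
Lemma dK_half (p s : R) : 0 < p < 1 -> 0 <= s <= 1 -> 1 / 2 <= dK p s.
Proof.
intros Hp Hs. apply dK_min_principle; [lra| |exact Hp|exact Hs]. clear p s Hp Hs.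
intros p Hp.
assert (H0 : forall s, 0 <= s <= 1 -> 0 <= dK p s).
{ intros s Hs. apply dK_min_principle; [lra| |exact Hp|exact Hs]. clear p s Hp Hs.
  intros p Hp. pose proof (dK_at1 p Hp). pose proof (thr_neg_ge0 p 1 Hp ltac:(lra)).
  replace (- (1)) with (- 1) in H0 by ring. lra. }
pose proof (dK_at1 p Hp) as H1. pose proof (thr_1_pos p Hp) as H2.
pose proof (thr_right_diff 0 p p 1 Hp H0 ltac:(lra) ltac:(lra)) as H3.
rewrite (thr_eq1 (- p) (- 1)) in H1 by now apply neg_q.
replace (- p * - 1) with p in H1 by ring.
assert (0 < p * thr (- p) p) by (apply Rmult_lt_0_compat; lra). lra.
Qed.

Lemma thr_right_lower (p w : R) : 0 < p < 1 -> 0 <= w <= 1 -> p / 2 * (1 - w) <= thr (- p) w.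
Proof.
intros Hp Hw. pose proof (thr_1_pos p Hp). destruct (Req_dec w 1) as [->|H1]; [lra|].
pose proof (thr_right_diff (1 / 2) p w 1 Hp (fun s => dK_half p s Hp) ltac:(lra) ltac:(lra)). lra.
Qed.

Lemma thr_right_pos (p w : R) : 0 < p < 1 -> 0 <= w <= 1 -> 0 < thr (- p) w.
Proof.
intros Hp Hw. destruct (Req_dec w 1) as [->|H1]; [now apply thr_1_pos|].
pose proof (thr_right_lower p w Hp Hw). nra.
Qed.

Lemma thr_right_decr (p x y : R) : 0 < p < 1 -> 0 <= x < y -> p * y <= 1 -> thr (- p) y < thr (- p) x.
Proof.
intros Hp Hx Hy. pose proof (thr_right_diff (1 / 2) p x y Hp (fun s => dK_half p s Hp) Hx Hy). nra.
Qed.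

(** theta(1/p) = 1 - theta(- 1) = - p theta(p). *)
Lemma thr_at_invp (p : R) : 0 < p < 1 -> thr (- p) (/ p) < 0.
Proof.
intros Hp. rewrite thr_right_K by exact Hp. rewrite Rinv_r by lra.
rewrite (thr_eq1 (- p) (- (1))) by now apply neg_q. replace (- p * - (1)) with p by ring.
pose proof (thr_right_pos p p Hp ltac:(lra)). nra.
Qed.

Lemma smallest_zero_exists (p : R) : 0 < p < 1 ->
  exists x1, 1 < x1 < / p /\ thr (- p) x1 = 0 /\
    forall x, 0 <= x <= / p -> thr (- p) x = 0 -> x = x1.
Proof.
intros Hp. assert (Hip : 1 < / p) by (rewrite <- Rinv_1; apply Rinv_lt_contravar; lra).
destruct (first_zero (thr (- p)) 1 (/ p)) as [x1 [H1 [H2 H3]]].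
- apply thr_continuity. now apply neg_q.
- lra.
- intros x Hx. now apply thr_right_pos.
- lra.
- now apply thr_at_invp.
- assert (Hx1 : x1 < / p).
  { destruct (Rlt_le_dec x1 (/ p)) as [C|C]; [exact C|]. pose proof (thr_at_invp p Hp).
    destruct (Req_dec x1 (/ p)) as [E|E]; [rewrite E in H2; lra|]. specialize (H3 (/ p) ltac:(lra)). lra. }
  assert (Hm : forall y, y <= / p -> p * y <= 1).
  { intros y Hy. apply Rmult_le_reg_l with (/ p); [lra|]. rewrite <- Rmult_assoc, Rinv_l by lra. lra. }
  exists x1. split; [lra|]. split; [exact H2|]. intros x Hx Hz.
  destruct (Rtotal_order x x1) as [C|[C|C]]; [|exact C|]; exfalso.
  + specialize (H3 x ltac:(lra)). lra.
  + pose proof (thr_right_decr p x1 x Hp ltac:(lra) (Hm x ltac:(lra))). lra.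
Qed.

(** * The sign of theta beyond the smallest positive zero *)

Lemma Jr_right (q X : R) : thr q X = Jr q X - thr q (/ X) / X.
Proof. unfold Jr. ring. Qed.

Section RightSigns.

Variables p X : R.
Hypothesis Hp : 0 < p < 1.
Hypothesis HX : 1 <= X.

(** At positive X only the factors 1 - X p^(2i+1) can be negative, and their number decides the sign
    of J: one between p^(-1) and p^(-3), three between p^(-5) and p^(-7). *)
Lemma Jterm_even_sign (i : nat) : 1 <= X * (p * (p ^ 2) ^ i) -> Jterm (- p) X (2 * i) <= 0.
Proof.
intros H. pose proof (ppow_range p Hp i) as HQ. pose proof (invX_range X HX). unfold Jterm.
change ((- p) ^ S (2 * i)) with (- p * (- p) ^ (2 * i)). rewrite !neg_pow.
set (Q := (p ^ 2) ^ i) in *.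
assert (0 < p * Q) by nra. assert (0 < Q * / X) by nra.
assert (0 <= (1 - - p * Q) * (- (1 + - p * Q * X) * (1 + Q * / X))); [|lra].
apply Rmult_le_pos; [lra|]. apply Rmult_le_pos; lra.
Qed.

Lemma Jterm_odd_sign (i : nat) : 0 <= Jterm (- p) X (2 * i + 1).
Proof.
pose proof (ppow_range p Hp i) as HQ. pose proof (ppow_range p Hp (S i)) as HQ1.
pose proof (invX_range X HX). unfold Jterm.
replace (S (2 * i + 1)) with (2 * S i)%nat by lia. replace (2 * i + 1)%nat with (S (2 * i)) by lia.
change ((- p) ^ S (2 * i)) with (- p * (- p) ^ (2 * i)). rewrite !neg_pow.
set (Q := (p ^ 2) ^ i) in *. set (Q1 := (p ^ 2) ^ S i) in *.
assert (0 < p * Q <= 1) by nra. assert (0 < Q1 * X) by nra.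
assert (p * Q * / X <= 1) by nra.
apply Rmult_le_pos; [lra|]. apply Rmult_le_pos; lra.
Qed.

Lemma J_right_le0_1 : 1 <= X * p -> X * p ^ 3 <= 1 -> Jr (- p) X <= 0.
Proof.
intros H1 H3. apply (Jr_le0 _ _ 2); [now apply neg_q|lra| |].
- cbn [rprod]. pose proof (Jterm_even_sign 0 ltac:(simpl; lra)) as A.
  pose proof (Jterm_odd_sign 0) as B. simpl in A, B. nra.
- intros j Hj. apply (Jterm_right_tail p X 1); auto. simpl in H3 |- *. lra.
Qed.

Lemma J_right_le0_2 : 1 <= X * p ^ 5 -> X * p ^ 7 <= 1 -> Jr (- p) X <= 0.
Proof.
intros H5 H7. assert (Hp2 : 0 < p ^ 2 < 1) by now apply psq_range.
assert (H3 : 1 <= X * p ^ 3).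
{ replace (X * p ^ 5) with (X * p ^ 3 * p ^ 2) in H5 by ring.
  assert (0 < X * p ^ 3) by (apply Rmult_lt_0_compat; [lra|apply pow_lt; lra]). nra. }
assert (H1 : 1 <= X * p).
{ replace (X * p ^ 3) with (X * p * p ^ 2) in H3 by ring. assert (0 < X * p) by nra. nra. }
apply (Jr_le0 _ _ 6); [now apply neg_q|lra| |].
- cbn [rprod].
  assert (A0 : Jterm (- p) X 0 <= 0) by (apply (Jterm_even_sign 0); simpl; lra).
  assert (A1 : Jterm (- p) X 2 <= 0) by (apply (Jterm_even_sign 1); simpl in *; lra).
  assert (A2 : Jterm (- p) X 4 <= 0) by (apply (Jterm_even_sign 2); simpl in *; lra).
  assert (B0 : 0 <= Jterm (- p) X 1) by apply (Jterm_odd_sign 0).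
  assert (B1 : 0 <= Jterm (- p) X 3) by apply (Jterm_odd_sign 1).
  assert (B2 : 0 <= Jterm (- p) X 5) by apply (Jterm_odd_sign 2).
  assert (0 <= - Jterm (- p) X 0 * Jterm (- p) X 1 * (- Jterm (- p) X 2 * Jterm (- p) X 3) * (- Jterm (- p) X 4 * Jterm (- p) X 5))
    by (set (f := Jterm (- p) X) in *; clearbody f; repeat apply Rmult_le_pos; lra). lra.
- intros j Hj. apply (Jterm_right_tail p X 3); auto. simpl in H7 |- *. lra.
Qed.

End RightSigns.

(** The power of N is kept together with N (1 - p^4) >= 0.15: the lower bound available for
    theta(1/X) is of order X - 1, which can be as small as a multiple of 1 - p, so a fixed bound on
    J would fail as p tends to 1. By [shift_product] both factors become functions of squares with
    ratio p^4. *)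
Lemma J_right_small (p X : R) : 98 / 100 <= p < 1 -> 1 <= X <= 32 / 10 ->
  exists N, (2 <= N)%nat /\ 15 / 100 <= INR N * (1 - p ^ 4) /\
    Rabs (Jr (- p) X) <= (2 / 100) ^ N * ((1 + p) * (1 + / X)).
Proof.
intros Hp HX. assert (Hp' : 0 < p < 1) by lra. pose proof (invX_range X ltac:(lra)) as Hi.
assert (Hip : 0 < / p <= 103 / 100).
{ split; [apply Rinv_0_lt_compat; lra|]. apply Rmult_le_reg_r with p; [lra|]. rewrite Rinv_l; lra. }
assert (HZ : 0 <= (X / p) ^ 2 <= 107 / 10).
{ split; [apply pow2_ge_0|]. apply Rmult_le_reg_r with (p ^ 2); [nra|].
  replace ((X / p) ^ 2 * p ^ 2) with (X ^ 2) by (field; lra). nra. }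
destruct (small_product (p ^ 4) ((X / p) ^ 2) (p4_bounds p Hp) HZ) as [N [HN [H15 [m0 Hm0]]]].
exists N. split; [exact HN|]. split; [exact H15|].
apply (Jr_bound _ _ _ (2 * N) 0 m0); [now apply neg_q|lra|lia|].
intros m Hm. rewrite Nat.add_0_r, <- Nat.mul_assoc, J_right_product by lra.
assert (HS : forall i, 0 < p * (p ^ 2) ^ i <= 1) by (intros i; pose proof (ppow_range p Hp' i); nra).
replace (rprod (fun i => right_factor p X (p * (p ^ 2) ^ i)) (N * m))
  with (rprod (fun i => (1 + p * (p ^ 2) ^ i) * (1 - p * p * (p ^ 2) ^ i)) (N * m) *
        rprod (fun i => Rabs (1 - X * (p * (p ^ 2) ^ i)) * (1 + X * (p * (p * (p ^ 2) ^ i)))) (N * m)).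
2: { rewrite <- rprod_mult. apply rprod_ext. intros i _. unfold right_factor. f_equal. ring. }
pose proof (shift_product p Hp' p (N * m) ltac:(lra)) as H1.
pose proof (shift_product_le p Hp' p (N * m) ltac:(lra)) as H1'.
pose proof (shift_product_le p Hp' (/ X) (N * m) ltac:(lra)) as H2.
set (S1 := rprod (fun i => (1 + p * (p ^ 2) ^ i) * (1 - p * p * (p ^ 2) ^ i)) (N * m)) in *.
set (S2 := rprod (fun i => (1 + / X * (p ^ 2) ^ i) * (1 - / X * p * (p ^ 2) ^ i)) (N * m)) in *.
set (S3 := rprod (fun i => Rabs (1 - X * (p * (p ^ 2) ^ i)) * (1 + X * (p * (p * (p ^ 2) ^ i)))) (N * m)).
set (G := rprod (fun i => 1 - (p * p * (p ^ 2) ^ i) ^ 2) (N * m)) in *.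
assert (HS3 : 0 <= S3 <= rprod (fun i => Rabs (1 - (X * (p * (p ^ 2) ^ i)) ^ 2)) (N * m)).
{ split.
  - apply rprod_ge0. intros i _. specialize (HS i). apply Rmult_le_pos; [apply Rabs_pos|].
    assert (0 <= p * (p * (p ^ 2) ^ i)) by nra. nra.
  - apply rprod_le. intros i _. specialize (HS i).
    assert (0 <= X * (p * (p ^ 2) ^ i)) by nra. split; [|apply abs_pair_le; lra].
    apply Rmult_le_pos; [apply Rabs_pos|]. assert (0 <= p * (p * (p ^ 2) ^ i)) by nra. nra. }
set (S4 := rprod (fun i => Rabs (1 - (X * (p * (p ^ 2) ^ i)) ^ 2)) (N * m)) in *.
assert (HG4 : G * S4 <= (2 / 100) ^ N).
{ eapply Rle_trans; [|apply (Hm0 m Hm)]. unfold G, S4. rewrite <- rprod_mult. right.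
  apply rprod_ext. intros i _. rewrite p4_pow. f_equal; [ring|]. f_equal. field. lra. }
assert (HG0 : 0 <= G).
{ apply rprod_ge0. intros i _. specialize (HS i). replace (p * p * (p ^ 2) ^ i) with (p * (p * (p ^ 2) ^ i)) by ring.
  assert (0 <= p * (p * (p ^ 2) ^ i) <= 1) by nra. nra. }
assert (HA : S1 * S3 <= (1 + p) * (2 / 100) ^ N).
{ apply Rle_trans with ((1 + p) * G * S4); [apply Rmult_le_compat; lra|].
  rewrite Rmult_assoc. apply Rmult_le_compat_l; lra. }
replace ((2 / 100) ^ N * ((1 + p) * (1 + / X))) with ((1 + p) * (2 / 100) ^ N * (1 + / X)) by ring.
apply Rmult_le_compat; try lra. apply Rmult_le_pos; lra.
Qed.

Lemma thr_right_neg_large (p X : R) : 8 / 10 <= p < 1 -> / p <= X <= 32 / 10 -> thr (- p) X < 0.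
Proof.
intros Hp HX. assert (Hp' : 0 < p < 1) by lra.
assert (Hip : 1 < / p) by (rewrite <- Rinv_1; apply Rinv_lt_contravar; lra).
assert (HX1 : 1 < X) by lra. pose proof (invX_range X ltac:(lra)) as Hi.
assert (HXp : 1 <= X * p).
{ apply Rmult_le_reg_r with (/ p); [lra|]. rewrite Rmult_assoc, Rinv_r by lra. lra. }
rewrite Jr_right. pose proof (thr_right_pos p (/ X) Hp' ltac:(lra)) as HT.
assert (HTX : 0 < thr (- p) (/ X) / X) by (apply Rdiv_lt_0_compat; lra).
destruct (Rle_lt_dec (X * p ^ 3) 1) as [C3|C3].
{ pose proof (J_right_le0_1 p X Hp' ltac:(lra) HXp C3). lra. }
assert (HTl := thr_right_lower p (/ X) Hp' ltac:(lra)).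
assert (Hkey : X * Rabs (Jr (- p) X) < thr (- p) (/ X) -> Jr (- p) X - thr (- p) (/ X) / X < 0).
{ intros H. pose proof (Rle_abs (Jr (- p) X)).
  assert (Rabs (Jr (- p) X) < thr (- p) (/ X) / X); [|lra].
  apply Rmult_lt_reg_l with X; [lra|]. unfold Rdiv. rewrite (Rmult_comm _ (/ X)), <- Rmult_assoc, Rinv_r by lra. lra. }
destruct (Rle_lt_dec p (98 / 100)) as [C2|C2].
- destruct (right_product_bound p X ltac:(lra) ltac:(lra)) as [H|[[H5 H7]|[k [Hk1 Hk2]]]].
  + lra.
  + pose proof (J_right_le0_2 p X Hp' ltac:(lra) H5 H7). lra.
  + apply Hkey. pose proof (J_right_bound p X Hp' ltac:(lra) 1 k
      (rprod (fun i => right_factor p X (p * (p ^ 2) ^ i)) k) ltac:(lia)) as HB.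
    specialize (HB ltac:(intros m Hm; apply right_factor_prod_tail; [lra|lra|exact Hk1|lia])).
    set (c := rprod _ k) in *. cbv zeta in Hk2.
    apply Rle_lt_trans with ((X + 1) * c).
    * replace ((X + 1) * c) with (X * (c * (1 + / X))) by (field; lra). apply Rmult_le_compat_l; lra.
    * destruct Hk2 as [Hk2|Hk2].
      -- pose proof (thr_pos_lower p (/ X) Hp' ltac:(lra)) as HL.
         eapply Rlt_le_trans; [|exact HL]. apply Rmult_lt_reg_l with (X * X); [nra|].
         replace (X * X * (1 - p * / X - p ^ 3 * (/ X) ^ 2)) with (X * (X - p) - p ^ 3) by (field; lra). lra.
      -- eapply Rlt_le_trans; [|exact HTl]. apply Rmult_lt_reg_l with (2 * X); [lra|].
         replace (2 * X * (p / 2 * (1 - / X))) with (p * (X - 1)) by (field; lra). lra.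
- destruct (J_right_small p X ltac:(lra) ltac:(lra)) as [N [HN [H15 HJ]]]. apply Hkey.
  destruct (small_geom N HN) as [_ HG].
  eapply Rlt_le_trans; [|exact HTl].
  apply Rle_lt_trans with ((2 / 100) ^ N * ((1 + p) * (X + 1))).
  + replace ((2 / 100) ^ N * ((1 + p) * (X + 1))) with (X * ((2 / 100) ^ N * ((1 + p) * (1 + / X)))) by (field; lra).
    apply Rmult_le_compat_l; lra.
  + apply Rmult_lt_reg_l with (2 * X); [lra|].
    replace (2 * X * (p / 2 * (1 - / X))) with (p * (X - 1)) by (field; lra).
    assert (Hg0 : 0 < (2 / 100) ^ N) by (apply pow_lt; lra).
    set (g := (2 / 100) ^ N) in *.
    (* X > p^(-3) >= 1 + 3 (1 - p). With 1 - p^4 <= 4 (1 - p) this bounds N (X - 1) from below,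
       while N times 0.02^N is tiny. *)
    assert (HXm : 3 * (1 - p) <= X - 1).
    { assert (1 < X * (p * p * p)) by (simpl in C3; lra). assert (0 < p * p * p < 1) by nra.
      assert ((1 + 3 * (1 - p)) * (p * p * p) <= 1); [|nra].
      assert (0 <= (1 - p) ^ 2 * (1 + 2 * p + 3 * p ^ 2)) by (apply Rmult_le_pos; [apply pow2_ge_0|nra]). nra. }
    assert (H4 : 1 - p ^ 4 <= 4 * (1 - p)).
    { assert (0 <= (1 - p) ^ 2 * (3 + 2 * p + p ^ 2)) by (apply Rmult_le_pos; [apply pow2_ge_0|nra]). nra. }
    assert (HN0 : 2 <= INR N) by (change 2 with (INR 2); now apply le_INR).
    assert (HNp : 15 / 400 <= INR N * (1 - p)) by nra.
    apply Rmult_lt_reg_l with (INR N); [lra|].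
    assert (H6 : 2 * X * ((1 + p) * (X + 1)) <= 54) by (assert (X * (X + 1) <= 1344 / 100) by nra; nra).
    assert (H7 : INR N * (2 * X * (g * ((1 + p) * (X + 1)))) <= 54 * (8 / 10000)).
    { replace (INR N * (2 * X * (g * ((1 + p) * (X + 1))))) with (2 * X * ((1 + p) * (X + 1)) * (INR N * g)) by ring.
      apply Rmult_le_compat; try lra; [|nra]. apply Rmult_le_pos; [lra|nra]. }
    assert (H8 : 98 / 100 * (3 * (15 / 400)) <= INR N * (p * (X - 1))).
    { replace (INR N * (p * (X - 1))) with (p * (INR N * (X - 1))) by ring.
      apply Rmult_le_compat; try lra. apply Rle_trans with (INR N * (3 * (1 - p))); [lra|].
      apply Rmult_le_compat_l; lra. }
    lra.
Qed.

(** * Monotonicity of F along x = p^(-s) *)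

(** This is p^c in the variable L = - ln p, in which all powers of p are exponentials and a smaller
    p means a larger L. *)
Definition Ex (c L : R) : R := exp (- (c * L)).

Lemma Ex_pos (c L : R) : 0 < Ex c L.
Proof. apply exp_pos. Qed.

Lemma Ex_plus (c d L : R) : Ex (c + d) L = Ex c L * Ex d L.
Proof. unfold Ex. rewrite <- exp_plus. f_equal. ring. Qed.

Lemma exp_le (x y : R) : x <= y -> exp x <= exp y.
Proof. intros [H| ->]; [left; now apply exp_increasing|right; reflexivity]. Qed.

Lemma exp_opp_l (x : R) : exp (- x) * exp x = 1.
Proof. rewrite <- exp_plus. replace (- x + x) with 0 by ring. apply exp_0. Qed.

Lemma Ex_decr (c a b : R) : 0 <= c -> a <= b -> Ex c b <= Ex c a.
Proof. intros Hc Hab. apply exp_le. nra. Qed.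

Lemma Ex_decr_l (c d L : R) : 0 <= L -> c <= d -> Ex d L <= Ex c L.
Proof. intros HL Hcd. apply exp_le. nra. Qed.

Lemma Ex_0 (L : R) : Ex 0 L = 1.
Proof. unfold Ex. rewrite Rmult_0_l, Ropp_0. apply exp_0. Qed.

Lemma Ex_le1 (c L : R) : 0 <= c -> 0 <= L -> Ex c L <= 1.
Proof. intros Hc HL. rewrite <- (Ex_0 L). now apply Ex_decr_l. Qed.

Lemma Ex_pow (L : R) (n : nat) : exp (- L) ^ n = Ex (INR n) L.
Proof.
unfold Ex. induction n as [|n IH]; [simpl; rewrite Rmult_0_l, Ropp_0, exp_0; reflexivity|].
rewrite S_INR. simpl. rewrite IH, <- exp_plus. f_equal. ring.
Qed.

Lemma mono_of_derive (f df : R -> R) (a b : R) : a <= b ->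
  (forall c, a <= c <= b -> is_derive f c (df c)) -> (forall c, a <= c <= b -> 0 <= df c) -> f a <= f b.
Proof.
intros [Hab| ->] Hd Hp; [|lra].
destruct (MVT_cor2 f df a b Hab) as [c [Hc1 Hc2]].
{ intros c Hc. now apply is_derive_Reals, Hd. }
specialize (Hp c ltac:(lra)). nra.
Qed.

Definition pairE (c L : R) : R := (1 - Ex c L) * (1 + Ex (c + 1) L).

(** Alone, 1 + p^(c+1) decreases in L; its neighbour 1 - p^c makes the product increase. *)
Lemma pairE_mono (c a b : R) : 0 < c -> 0 <= a <= b -> 0 <= pairE c a <= pairE c b.
Proof.
intros Hc Hab. split.
- unfold pairE. pose proof (Ex_le1 c a). pose proof (Ex_pos (c + 1) a). apply Rmult_le_pos; lra.
- apply (mono_of_derive (pairE c) (fun L => c * Ex c L * (1 + Ex (c + 1) L)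
     + (1 - Ex c L) * (- (c + 1) * Ex (c + 1) L))); [lra| |].
  + intros L _. unfold pairE, Ex. auto_derive; [auto|]. ring.
  + intros L HL. rewrite Ex_plus. pose proof (Ex_pos c L) as H1. pose proof (Ex_pos 1 L) as H2.
    set (u := Ex c L) in *. set (v := Ex 1 L) in *.
    (* Young's inequality c e^L + e^(-cL) >= c + 1, multiplied by e^(-L) *)
    assert (HY : (c + 1) * v <= c + u * v).
    { assert (Hu : 1 - c * L <= u).
      { unfold u, Ex. pose proof (exp_ineq1_le (- (c * L))). lra. }
      assert (Hv : v * (1 + L) <= 1).
      { assert (E : v * exp L = 1) by (unfold v, Ex; rewrite Rmult_1_l; apply exp_opp_l).
        pose proof (exp_ineq1_le L). nra. }
      assert (v * (1 - c * L) <= v * u) by (apply Rmult_le_compat_l; lra).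
      assert (c * (v * (1 + L)) <= c * 1) by (apply Rmult_le_compat_l; lra). lra. }
    replace (c * u * (1 + u * v) + (1 - u) * (- (c + 1) * (u * v)))
      with (u * (c + u * v - (c + 1) * v + u * v * (2 * c))) by ring.
    assert (0 <= u * v) by nra. apply Rmult_le_pos; [lra|]. nra.
Qed.

Lemma exp_sum_mono (c d a b : R) : 0 <= c -> - c <= d -> 0 <= a <= b ->
  exp (c * a) + exp (d * a) <= exp (c * b) + exp (d * b).
Proof.
intros Hc Hd Hab. apply (mono_of_derive (fun L => exp (c * L) + exp (d * L))
  (fun L => c * exp (c * L) + d * exp (d * L))); [lra| |].
- intros L _. auto_derive; [auto|]. ring.
- intros L HL. destruct (Rle_lt_dec 0 d) as [C|C].
  + pose proof (exp_pos (c * L)). pose proof (exp_pos (d * L)). nra.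
  + assert (exp (d * L) <= exp (c * L)) by (apply exp_le; nra).
    pose proof (exp_pos (d * L)). nra.
Qed.

Lemma exp_over_mono (c a b : R) : 0 < a <= b -> (exp (c * a) - 1) * b <= (exp (c * b) - 1) * a.
Proof.
intros Hab.
assert (H : exp (c * a) * (1 + c * (b - a)) <= exp (c * b)).
{ replace (c * b) with (c * a + c * (b - a)) by ring. rewrite exp_plus.
  apply Rmult_le_compat_l; [left; apply exp_pos|apply exp_ineq1_le]. }
assert (H2 : exp (c * a) * (1 - c * a) <= 1).
{ pose proof (exp_ineq1_le (- (c * a))) as H2. pose proof (exp_pos (c * a)) as H3.
  assert (E : exp (c * a) * exp (- (c * a)) = 1) by (rewrite Rmult_comm; apply exp_opp_l). nra. }
assert (H3 : exp (c * a) * (1 - c * a) * (b - a) <= 1 * (b - a)) by (apply Rmult_le_compat_r; lra).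
assert (H4 : exp (c * a) * (1 + c * (b - a)) * a <= exp (c * b) * a) by (apply Rmult_le_compat_r; lra).
lra.
Qed.

(** L >= ln (5/4) means p <= 4/5, the range in which the zeros between p^(-3) and p^(-5) are
    excluded through the coalescence. *)
Definition ln54 : R := ln (5 / 4).

Lemma ln54_bounds : 0 < ln54 <= 1 / 4.
Proof.
unfold ln54. split; [rewrite <- ln_1; apply ln_increasing; lra|].
pose proof (exp_ineq1_le (1 / 4)). rewrite <- (ln_exp (1 / 4)). destruct (Req_dec (5 / 4) (exp (1 / 4))) as [->|H1].
- lra.
- left. apply ln_increasing; lra.
Qed.

Lemma Ex_ln54 (n : nat) : Ex (INR n) ln54 = (4 / 5) ^ n.
Proof.
rewrite <- Ex_pow. f_equal. unfold ln54. rewrite <- ln_Rinv by lra. rewrite exp_ln; lra.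
Qed.

Lemma Ex_small (n : nat) (c L : R) : INR n <= c -> ln54 <= L -> Ex c L <= (4 / 5) ^ n.
Proof.
intros Hc HL. pose proof ln54_bounds. rewrite <- Ex_ln54.
apply Rle_trans with (Ex (INR n) L); [apply Ex_decr_l; lra|]. apply Ex_decr; [apply pos_INR|lra].
Qed.

Section Decay.

Variable s : R.
Hypothesis Hs : 3 < s < 5.

(* 1 - p^(1+s) - p^(3+2s) with p = e^(-L): the first three terms of theta(p^s). *)
Definition theta_head (L : R) : R := 1 - Ex (1 + s) L - Ex (3 + 2 * s) L.

Lemma theta_head_pos (L : R) : ln54 <= L -> 0 < theta_head L.
Proof.
intros HL. unfold theta_head.
pose proof (Ex_small 4 (1 + s) L ltac:(simpl; lra) HL). pose proof (Ex_small 9 (3 + 2 * s) L ltac:(simpl; lra) HL).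
lra.
Qed.

Lemma theta_head_mono (a b : R) : 0 <= a <= b -> theta_head a <= theta_head b.
Proof.
intros Hab. unfold theta_head. pose proof (Ex_decr (1 + s) a b ltac:(lra) ltac:(lra)).
pose proof (Ex_decr (3 + 2 * s) a b ltac:(lra) ltac:(lra)). lra.
Qed.

Lemma y_exp_bound (c L : R) (n : nat) : (2 <= n)%nat -> INR n <= c -> ln54 <= L ->
  (2 + c * L) * Ex c L <= (2 + INR n * / 4) * (4 / 5) ^ n.
Proof.
intros Hn Hc HL. pose proof ln54_bounds as H0. pose proof (pos_INR n).
set (y := c * L). set (y0 := INR n * ln54).
assert (Hy : y0 <= y) by (unfold y, y0; apply Rmult_le_compat; lra).
assert (E : Ex c L = (4 / 5) ^ n * exp (- (y - y0))).
{ rewrite <- Ex_ln54. unfold Ex. rewrite <- exp_plus. f_equal. unfold y, y0. ring. }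
rewrite E.
assert (Hd : (1 + (y - y0)) * exp (- (y - y0)) <= 1).
{ pose proof (exp_ineq1_le (y - y0)). pose proof (exp_pos (- (y - y0))).
  assert (exp (y - y0) * exp (- (y - y0)) = 1) by (rewrite Rmult_comm; apply exp_opp_l). nra. }
pose proof (exp_pos (- (y - y0))). set (e := exp (- (y - y0))) in *.
assert (Hp : 0 < (4 / 5) ^ n) by (apply pow_lt; lra).
assert (Hy0 : 0 <= y0 <= INR n * / 4) by (unfold y0; nra).
assert ((2 + y) * e <= 2 + y0).
{ apply Rle_trans with ((2 + y0) * ((1 + (y - y0)) * e)); [|nra].
  rewrite <- Rmult_assoc. apply Rmult_le_compat_r; nra. }
nra.
Qed.

(** The derivative of head / L^2 has the sign of the sum of (2 + y) e^(-y) over y = (1 + s) L and y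
    = (3 + 2 s) L, minus 2; that sum is at most 3 times 0.8^4 plus 4.25 times 0.8^9, below 1.8. *)
Lemma theta_head_over_sq (a b : R) : ln54 <= a -> a <= b -> theta_head b * a ^ 2 <= theta_head a * b ^ 2.
Proof.
intros Ha Hab. pose proof ln54_bounds as H0.
assert (H : - (theta_head a / a ^ 2) <= - (theta_head b / b ^ 2)).
{ apply (mono_of_derive (fun L => - (theta_head L / L ^ 2)) (fun L => (2 * theta_head L
    - ((1 + s) * L * Ex (1 + s) L + (3 + 2 * s) * L * Ex (3 + 2 * s) L)) / L ^ 3)); [exact Hab| |].
  - intros L HL. unfold theta_head, Ex. auto_derive; [simpl; nra|]. field. lra.
  - intros L HL. apply Rmult_le_pos; [|left; apply Rinv_0_lt_compat, pow_lt; lra].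
    pose proof (y_exp_bound (1 + s) L 4 ltac:(lia) ltac:(simpl; lra) ltac:(lra)).
    pose proof (y_exp_bound (3 + 2 * s) L 9 ltac:(lia) ltac:(simpl; lra) ltac:(lra)).
    unfold theta_head. simpl INR in *. lra. }
assert (0 < a ^ 2) by (apply pow_lt; lra). assert (0 < b ^ 2) by (apply pow_lt; lra).
apply Ropp_le_cancel in H.
apply Rmult_le_compat_r with (r := a ^ 2 * b ^ 2) in H; [|nra].
replace (theta_head b / b ^ 2 * (a ^ 2 * b ^ 2)) with (theta_head b * a ^ 2) in H by (field; lra).
replace (theta_head a / a ^ 2 * (a ^ 2 * b ^ 2)) with (theta_head a * b ^ 2) in H by (field; lra). exact H.
Qed.

Definition cexpo (j : nat) : R := INR (tri j) + INR j * s.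

(** The derivative has the sign of (c + d) e^(-dL) - c, and e^(-dL) <= 0.8^4 < 1/2 while c + d <= 2
    c. *)
Lemma Ex_diff_mono (c d a b : R) : 0 <= d <= c -> 4 <= d -> ln54 <= a -> a <= b ->
  Ex c b - Ex (c + d) b <= Ex c a - Ex (c + d) a.
Proof.
intros Hd Hd4 Ha Hab.
assert (H : - (Ex c a - Ex (c + d) a) <= - (Ex c b - Ex (c + d) b)); [|lra].
apply (mono_of_derive (fun L => - (Ex c L - Ex (c + d) L))
  (fun L => c * Ex c L - (c + d) * Ex (c + d) L)); [exact Hab| |].
- intros L _. unfold Ex. auto_derive; [auto|]. ring.
- intros L HL. rewrite Ex_plus. pose proof (Ex_small 4 d L ltac:(simpl; lra) ltac:(lra)) as H1.
  pose proof (Ex_pos c L). pose proof (Ex_pos d L).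
  assert (Ex d L <= 1 / 2) by lra.
  assert ((c + d) * Ex d L <= c) by nra.
  replace (c * Ex c L - (c + d) * (Ex c L * Ex d L)) with (Ex c L * (c - (c + d) * Ex d L)) by ring. nra.
Qed.

(** The difference is 2 j + 3 + 2 s. At j = 3 the upper bound reads 9 + 2 s <= 6 + 3 s, which is s
    >= 3. *)
Lemma cexpo_gap (j : nat) : (3 <= j)%nat ->
  4 <= cexpo (j + 2) - cexpo j <= cexpo j.
Proof.
intros Hj. unfold cexpo. replace (j + 2)%nat with (S (S j)) by lia.
rewrite !tri_S, !plus_INR, !S_INR.
apply le_INR in Hj. simpl in Hj. split; [nra|].
pose proof (tri_double j) as E. apply (f_equal INR) in E.
rewrite !mult_INR, plus_INR in E. simpl in E.
assert (0 <= (INR j - 3) * (INR j - 3)) by nra. nra.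
Qed.

Lemma term_E (L : R) (j : nat) : exp (- L) ^ tri j * Ex s L ^ j = Ex (cexpo j) L.
Proof.
rewrite Ex_pow. unfold cexpo. rewrite Ex_plus. f_equal.
induction j as [|j IH]; [simpl; now rewrite Rmult_0_l, Ex_0|].
rewrite S_INR, Rmult_plus_distr_r, Rmult_1_l, Ex_plus, <- IH. simpl. ring.
Qed.

Lemma sgn_period (j k : nat) : (-1) ^ tri (j + 4 * k) = (-1) ^ tri j.
Proof.
induction k as [|k IH]; [now rewrite Nat.mul_0_r, Nat.add_0_r|].
replace (j + 4 * S k)%nat with (S (S (S (S (j + 4 * k))))) by lia. rewrite !tri_S, <- IH.
set (n := (j + 4 * k)%nat). replace (tri n + S n + S (S n) + S (S (S n)) + S (S (S (S n))))%nat
  with (tri n + 2 * (2 * n + 5))%nat by lia.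
rewrite pow_add, pow_1_even. ring.
Qed.

(** The signs (-1)^(tri j) have period 4 and read + + - - from j = 3 on; each index is compared with
    the one two further. *)
Definition theta_rest (L : R) (m : nat) : R :=
  rsum (fun k => Ex (cexpo (3 + 4 * k)) L + Ex (cexpo (4 + 4 * k)) L
               - Ex (cexpo (5 + 4 * k)) L - Ex (cexpo (6 + 4 * k)) L) m.

Lemma partial_theta (L : R) (m : nat) :
  rsum (fun j => (- exp (- L)) ^ tri j * Ex s L ^ j) (3 + 4 * m) = theta_head L + theta_rest L m.
Proof.
assert (HT : forall j, (- exp (- L)) ^ tri j * Ex s L ^ j = (-1) ^ tri j * Ex (cexpo j) L).
{ intros j. rewrite <- term_E. replace (- exp (- L)) with (-1 * exp (- L)) by ring.
  rewrite Rpow_mult_distr. ring. }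
induction m as [|m IH].
- rewrite Nat.mul_0_r. unfold theta_rest. change (3 + 0)%nat with 3%nat. cbn [rsum]. rewrite !HT. unfold cexpo, theta_head.
  change (tri 0) with 0%nat. change (tri 1) with 1%nat. change (tri 2) with 3%nat. simpl.
  replace (0 + 0 * s) with 0 by ring. rewrite Ex_0.
  replace (1 + 1 * s) with (1 + s) by ring. replace (1 + 1 + 1 + (1 + 1) * s) with (3 + 2 * s) by ring. ring.
- replace (3 + 4 * S m)%nat with (S (S (S (S (3 + 4 * m))))) by lia.
  unfold theta_rest in *. cbn [rsum]. rewrite IH, !HT.
  change (S (3 + 4 * m)) with (4 + 4 * m)%nat. change (S (4 + 4 * m)) with (5 + 4 * m)%nat.
  change (S (5 + 4 * m)) with (6 + 4 * m)%nat. rewrite !sgn_period.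
  change (tri 3) with 6%nat. change (tri 4) with 10%nat. change (tri 5) with 15%nat. change (tri 6) with 21%nat.
  simpl pow. ring.
Qed.

Lemma theta_rest_mono (a b : R) (m : nat) : ln54 <= a -> a <= b -> theta_rest b m <= theta_rest a m.
Proof.
intros Ha Hab. unfold theta_rest. apply rsum_le. intros k _.
assert (HH : forall j, (3 <= j)%nat -> Ex (cexpo j) b - Ex (cexpo (j + 2)) b <= Ex (cexpo j) a - Ex (cexpo (j + 2)) a).
{ intros j Hj. pose proof (cexpo_gap j Hj).
  replace (cexpo (j + 2)) with (cexpo j + (cexpo (j + 2) - cexpo j)) by ring. apply Ex_diff_mono; lra. }
pose proof (HH (3 + 4 * k)%nat ltac:(lia)) as H1. pose proof (HH (4 + 4 * k)%nat ltac:(lia)) as H2.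
replace (3 + 4 * k + 2)%nat with (5 + 4 * k)%nat in H1 by lia.
replace (4 + 4 * k + 2)%nat with (6 + 4 * k)%nat in H2 by lia. lra.
Qed.

(** The head of theta(p^s) increases with L, so monotonicity is claimed only after division by L^2:
    head / L^2 decreases, and the rest is nonnegative and nonincreasing. The factor L^2 is paid for
    by [lobe_head_growth]. *)
Lemma theta_inv_mono (a b : R) : ln54 <= a -> a <= b ->
  thr (- exp (- b)) (Ex s b) * a ^ 2 <= thr (- exp (- a)) (Ex s a) * b ^ 2.
Proof.
intros Ha Hab. pose proof ln54_bounds as H0.
assert (Hp : forall L, ln54 <= L -> 0 < Rabs (- exp (- L)) < 1).
{ intros L HL. rewrite Rabs_left by (pose proof (exp_pos (- L)); lra). rewrite Ropp_involutive.
  split; [apply exp_pos|]. rewrite <- exp_0. apply exp_increasing. lra. }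
assert (Hlim : forall L, ln54 <= L -> is_lim_seq (fun m => theta_head L + theta_rest L m) (thr (- exp (- L)) (Ex s L))).
{ intros L HL. apply (is_lim_seq_ext (fun m => rsum (fun j => (- exp (- L)) ^ tri j * Ex s L ^ j) (3 + 4 * m))).
  - intros m. apply partial_theta.
  - apply (is_lim_seq_subseq (rsum (fun j => (- exp (- L)) ^ tri j * Ex s L ^ j)) _ (fun m => (3 + 4 * m)%nat)).
    + intros P [N HN]. exists N. intros n Hn. apply HN. lia.
    + apply thr_lim. now apply Hp. }
set (Ta := thr (- exp (- a)) (Ex s a)). set (Tb := thr (- exp (- b)) (Ex s b)).
assert (Hdiff : Tb - theta_head b <= Ta - theta_head a).
{ assert (Hl : is_lim_seq (fun m => theta_rest a m - theta_rest b m) (Ta - theta_head a - (Tb - theta_head b))).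
  { apply (is_lim_seq_ext (fun m => (theta_head a + theta_rest a m - theta_head a) - (theta_head b + theta_rest b m - theta_head b))); [intros m; ring|].
    apply is_lim_seq_minus'; (apply is_lim_seq_minus'; [apply Hlim; lra|apply is_lim_seq_const]). }
  pose proof (lim_ge_const _ _ 0 O Hl) as H.
  assert (0 <= Ta - theta_head a - (Tb - theta_head b)); [|lra]. apply H. intros m _.
  pose proof (theta_rest_mono a b m Ha Hab). lra. }
assert (Hta : theta_head a <= Ta).
{ apply (lim_ge_const _ _ _ O (Hlim a Ha)). intros m _.
  assert (0 <= theta_rest a m); [|lra]. apply rsum_ge0. intros k _.
  assert (HH : forall j, (3 <= j)%nat -> Ex (cexpo (j + 2)) a <= Ex (cexpo j) a).
  { intros j Hj. pose proof (cexpo_gap j Hj). apply Ex_decr_l; lra. }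
  pose proof (HH (3 + 4 * k)%nat ltac:(lia)) as H1. pose proof (HH (4 + 4 * k)%nat ltac:(lia)) as H2.
  replace (3 + 4 * k + 2)%nat with (5 + 4 * k)%nat in H1 by lia.
  replace (4 + 4 * k + 2)%nat with (6 + 4 * k)%nat in H2 by lia. lra. }
pose proof (theta_head_pos a Ha) as H1. pose proof (theta_head_mono a b ltac:(lra)) as H2.
pose proof (theta_head_over_sq a b Ha Hab) as H3.
assert (HA : 0 < a ^ 2) by (apply pow_lt; lra).
assert (HB : a ^ 2 <= b ^ 2) by (apply pow_incr; lra).
apply Rle_trans with ((Ta - theta_head a + theta_head b) * a ^ 2); [apply Rmult_le_compat_r; lra|].
replace ((Ta - theta_head a + theta_head b) * a ^ 2) with ((Ta - theta_head a) * a ^ 2 + theta_head b * a ^ 2) by ring.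
replace (Ta * b ^ 2) with ((Ta - theta_head a) * b ^ 2 + theta_head a * b ^ 2) by ring.
apply Rplus_le_compat; [apply Rmult_le_compat_l; lra|exact H3].
Qed.

End Decay.

Definition mono (f : R -> R) : Prop := forall a b, 0 < a -> a <= b -> 0 <= f a <= f b.

Lemma mono_mult (f g : R -> R) : mono f -> mono g -> mono (fun L => f L * g L).
Proof.
intros Hf Hg a b Ha Hab. specialize (Hf a b Ha Hab). specialize (Hg a b Ha Hab).
split; [apply Rmult_le_pos; lra|apply Rmult_le_compat; lra].
Qed.

Lemma mono_rprod (f : nat -> R -> R) (n : nat) : (forall i, mono (f i)) -> mono (fun L => rprod (fun i => f i L) n).
Proof.
intros H a b Ha Hab. split.
- apply rprod_ge0. intros i _. now apply (H i a b).
- apply rprod_le. intros i _. now apply (H i a b).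
Qed.

Lemma mono_pairE (c : R) : 0 < c -> mono (pairE c).
Proof. intros Hc a b Ha Hab. apply pairE_mono; lra. Qed.

Lemma mono_1mEx (c : R) : 0 < c -> mono (fun L => 1 - Ex c L).
Proof.
intros Hc a b Ha Hab. pose proof (Ex_le1 c a ltac:(lra) ltac:(lra)).
pose proof (Ex_decr c a b ltac:(lra) Hab). lra.
Qed.

Section Lobe.

Variable s : R.
Hypothesis Hs : 3 < s < 5.

(** For X = p^(-s): the factors 1 + q^j X with j = 1, ..., 4, the two negative ones reversed, and
    the factor 1 - q = 1 + e^(-L). *)
Definition lobe_head (L : R) : R :=
  (exp ((s - 1) * L) - 1) * (1 + exp (- L)) * ((1 + exp ((s - 2) * L)) * (1 + exp ((s - 4) * L)))
  * (exp ((s - 3) * L) - 1).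

Definition lobe_tail (m : nat) (L : R) : R :=
  rprod (fun i => pairE (INR (2 * i + 2)) L) (m + 2) * rprod (fun i => pairE (INR (2 * i + 1) + s) L) (m + 2)
  * rprod (fun i => pairE (INR (2 * i + 5) - s) L) m * (1 - Ex (INR (2 * m + 5) - s) L).

Lemma INR_ge5 (n : nat) : (5 <= n)%nat -> 5 <= INR n.
Proof. intros H. apply le_INR in H. simpl in H. lra. Qed.

Lemma lobe_tail_mono (m : nat) : mono (lobe_tail m).
Proof.
unfold lobe_tail.
apply (mono_mult (fun L => rprod (fun i => pairE (INR (2 * i + 2)) L) (m + 2)
  * rprod (fun i => pairE (INR (2 * i + 1) + s) L) (m + 2) * rprod (fun i => pairE (INR (2 * i + 5) - s) L) m)).
- apply (mono_mult (fun L => rprod (fun i => pairE (INR (2 * i + 2)) L) (m + 2)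
    * rprod (fun i => pairE (INR (2 * i + 1) + s) L) (m + 2))).
  + apply mono_mult; apply mono_rprod; intros i; apply mono_pairE.
    * apply lt_0_INR. lia.
    * pose proof (pos_INR (2 * i + 1)). lra.
  + apply mono_rprod. intros i. apply mono_pairE. pose proof (INR_ge5 (2 * i + 5) ltac:(lia)). lra.
- apply mono_1mEx. pose proof (INR_ge5 (2 * m + 5) ltac:(lia)). lra.
Qed.

Lemma expm1_pos (c L : R) : 0 < c -> 0 < L -> 0 < exp (c * L) - 1.
Proof. intros Hc HL. assert (0 < c * L) by nra. pose proof (exp_ineq1 (c * L) ltac:(lra)). lra. Qed.

Lemma lobe_head_pos (L : R) : 0 < L -> 0 < lobe_head L.
Proof.
intros HL. unfold lobe_head. pose proof (expm1_pos (s - 1) L ltac:(lra) HL). pose proof (expm1_pos (s - 3) L ltac:(lra) HL).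
pose proof (exp_pos (- L)). pose proof (exp_pos ((s - 2) * L)). pose proof (exp_pos ((s - 4) * L)).
repeat apply Rmult_lt_0_compat; lra.
Qed.

(** Two factors e^(cL) - 1 grow at least linearly in L. One is split from e^((s-1)L) - 1 = (e^(hL) -
    1)(e^(hL) + 1), and the spare e^(hL) + 1 outweighs the decreasing 1 + e^(-L); likewise
    e^((s-2)L) outweighs e^((s-4)L) when s < 4. *)
Lemma lobe_head_growth (a b : R) : 0 < a -> a <= b -> lobe_head a * b ^ 2 <= lobe_head b * a ^ 2.
Proof.
intros Ha Hab. set (h := (s - 1) / 2).
set (U := fun L => exp (h * L) - 1). set (V := fun L => exp ((s - 3) * L) - 1).
set (W := fun L => (exp (h * L) + 1) * (1 + exp (- L)) * ((1 + exp ((s - 2) * L)) * (1 + exp ((s - 4) * L)))).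
assert (HG : forall L, lobe_head L = U L * V L * W L).
{ intros L. unfold lobe_head, U, V, W. replace ((s - 1) * L) with (h * L + h * L) by (unfold h; field).
  rewrite exp_plus. ring. }
assert (HW : 0 <= W a <= W b).
{ unfold W. pose proof (exp_pos (h * a)). pose proof (exp_pos (- a)).
  pose proof (exp_pos ((s - 2) * a)). pose proof (exp_pos ((s - 4) * a)).
  assert (A1 : (exp (h * a) + 1) * (1 + exp (- a)) <= (exp (h * b) + 1) * (1 + exp (- b))).
  { assert (E : forall L, (exp (h * L) + 1) * (1 + exp (- L)) = exp (h * L) + exp (-1 * L) + 1 + exp ((h - 1) * L)).
    { intros L. replace ((h - 1) * L) with (h * L + -1 * L) by ring. rewrite exp_plus.
      replace (- L) with (-1 * L) by ring. ring. }
    rewrite !E. pose proof (exp_sum_mono h (-1) a b ltac:(unfold h; lra) ltac:(unfold h; lra) ltac:(lra)).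
    assert (exp ((h - 1) * a) <= exp ((h - 1) * b)) by (apply exp_le; unfold h; nra). lra. }
  assert (A2 : (1 + exp ((s - 2) * a)) * (1 + exp ((s - 4) * a)) <= (1 + exp ((s - 2) * b)) * (1 + exp ((s - 4) * b))).
  { assert (E : forall L, (1 + exp ((s - 2) * L)) * (1 + exp ((s - 4) * L))
      = 1 + (exp ((s - 2) * L) + exp ((s - 4) * L)) + exp ((2 * s - 6) * L)).
    { intros L. replace ((2 * s - 6) * L) with ((s - 2) * L + (s - 4) * L) by ring. rewrite exp_plus. ring. }
    rewrite !E. pose proof (exp_sum_mono (s - 2) (s - 4) a b ltac:(lra) ltac:(lra) ltac:(lra)).
    assert (exp ((2 * s - 6) * a) <= exp ((2 * s - 6) * b)) by (apply exp_le; nra). lra. }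
  split; [repeat apply Rmult_le_pos; lra|].
  apply Rmult_le_compat; [apply Rmult_le_pos; lra|apply Rmult_le_pos; lra|exact A1|exact A2]. }
pose proof (exp_over_mono h a b ltac:(lra)) as HU. pose proof (exp_over_mono (s - 3) a b ltac:(lra)) as HV.
fold (U a) (U b) in HU. fold (V a) (V b) in HV.
assert (HU0 : 0 < U a) by (apply expm1_pos; unfold h; lra).
assert (HV0 : 0 < V a) by (apply expm1_pos; lra).
rewrite !HG.
replace (U a * V a * W a * b ^ 2) with ((U a * b) * (V a * b) * W a) by ring.
replace (U b * V b * W b * a ^ 2) with ((U b * a) * (V b * a) * W b) by ring.
apply Rmult_le_compat; [apply Rmult_le_pos; nra|lra| |lra].
apply Rmult_le_compat; nra.
Qed.

Lemma neg_pow_even_E (L : R) (i : nat) : (- exp (- L)) ^ (2 * i) = Ex (INR (2 * i)) L.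
Proof. rewrite neg_pow_even. apply Ex_pow. Qed.

Lemma neg_pow_odd_E (L : R) (i : nat) : (- exp (- L)) ^ (2 * i + 1) = - Ex (INR (2 * i + 1)) L.
Proof. rewrite neg_pow_odd. now rewrite Ex_pow. Qed.

Lemma Ex_times_X (c L : R) : Ex c L * exp (s * L) = Ex (c - s) L.
Proof. unfold Ex. rewrite <- exp_plus. f_equal. ring. Qed.

Lemma Ex_over_X (c L : R) : Ex c L * / exp (s * L) = Ex (c + s) L.
Proof. rewrite <- exp_Ropp. unfold Ex. rewrite <- exp_plus. f_equal. ring. Qed.

(** With an odd number of indices the factors in q^j and in q^j / X are one exceptional factor and
    complete pairs; those in q^j X are four exceptional ones, pairs, and one left over, which is the
    last factor of [lobe_tail]. *)
Lemma Jterm_factored (m : nat) (L : R) :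
  exp (s * L) * rprod (Jterm (- exp (- L)) (exp (s * L))) (2 * (m + 2) + 1)
  = (exp (s * L) + 1) * lobe_head L * lobe_tail m L.
Proof.
set (q := - exp (- L)). set (X := exp (s * L)). assert (HX : 0 < X) by apply exp_pos.
unfold Jterm. rewrite (rprod_mult (fun j => 1 - q ^ S j)), (rprod_mult (fun j => 1 + q ^ S j * X)).
assert (HA : rprod (fun j => 1 - q ^ S j) (2 * (m + 2) + 1)
  = (1 + exp (- L)) * rprod (fun i => pairE (INR (2 * i + 2)) L) (m + 2)).
{ replace (2 * (m + 2) + 1)%nat with (S (2 * (m + 2))) by lia. rewrite rprod_S_l, rprod_pairs. f_equal.
  - unfold q. simpl. ring.
  - apply rprod_ext. intros i _. unfold pairE, q.
    replace (S (S (2 * i))) with (2 * (i + 1))%nat by lia.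
    replace (S (S (2 * i + 1))) with (2 * (i + 1) + 1)%nat by lia.
    rewrite neg_pow_even_E, neg_pow_odd_E. replace (2 * (i + 1))%nat with (2 * i + 2)%nat by lia.
    rewrite (plus_INR (2 * i + 2) 1). simpl (INR 1). ring. }
assert (HC : rprod (fun j => 1 + q ^ j * / X) (2 * (m + 2) + 1)
  = (1 + / X) * rprod (fun i => pairE (INR (2 * i + 1) + s) L) (m + 2)).
{ replace (2 * (m + 2) + 1)%nat with (S (2 * (m + 2))) by lia. rewrite rprod_S_l, rprod_pairs. f_equal.
  - simpl. ring.
  - apply rprod_ext. intros i _. unfold pairE, q, X.
    replace (S (2 * i)) with (2 * i + 1)%nat by lia.
    replace (S (2 * i + 1)) with (2 * (i + 1))%nat by lia.
    rewrite neg_pow_even_E, neg_pow_odd_E.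
    rewrite Ex_over_X, Ropp_mult_distr_l_reverse, Ex_over_X.
    replace (INR (2 * (i + 1)) + s) with (INR (2 * i + 1) + s + 1)
      by (replace (2 * (i + 1))%nat with (2 * i + 1 + 1)%nat by lia; rewrite (plus_INR (2 * i + 1) 1); simpl (INR 1); ring).
    reflexivity. }
assert (HB : rprod (fun j => 1 + q ^ S j * X) (2 * (m + 2) + 1)
  = (1 - exp ((s - 1) * L)) * (1 + exp ((s - 2) * L)) * (1 - exp ((s - 3) * L)) * (1 + exp ((s - 4) * L))
    * rprod (fun i => pairE (INR (2 * i + 5) - s) L) m * (1 - Ex (INR (2 * m + 5) - s) L)).
{ replace (2 * (m + 2) + 1)%nat with (S (4 + 2 * m)) by lia. cbn [rprod]. rewrite rprod_app, rprod_pairs.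
  assert (HO : forall i, q ^ (2 * i + 1) * X = - Ex (INR (2 * i + 1) - s) L).
  { intros i. unfold q, X. rewrite neg_pow_odd_E, Ropp_mult_distr_l_reverse, Ex_times_X. reflexivity. }
  assert (HE : forall i, q ^ (2 * i) * X = Ex (INR (2 * i) - s) L).
  { intros i. unfold q, X. rewrite neg_pow_even_E, Ex_times_X. reflexivity. }
  f_equal; [f_equal|].
  - cbn [rprod]. pose proof (HO 0%nat) as H1. pose proof (HE 1%nat) as H2.
    pose proof (HO 1%nat) as H3. pose proof (HE 2%nat) as H4.
    simpl in H1, H2, H3, H4.
    replace (q ^ 1) with (q * 1) by ring. rewrite H1.
    replace (q ^ 2) with (q * (q * 1)) by ring. rewrite H2.
    replace (q ^ 3) with (q * (q * (q * 1))) by ring. rewrite H3.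
    replace (q ^ 4) with (q * (q * (q * (q * 1)))) by ring. rewrite H4.
    unfold Ex. rewrite Rmult_1_l.
    replace (- ((1 - s) * L)) with ((s - 1) * L) by ring.
    replace (- ((1 + 1 - s) * L)) with ((s - 2) * L) by ring.
    replace (- ((1 + 1 + 1 - s) * L)) with ((s - 3) * L) by ring.
    replace (- ((1 + 1 + 1 + 1 - s) * L)) with ((s - 4) * L) by ring. ring.
  - apply rprod_ext. intros i _. unfold pairE.
    replace (S (4 + 2 * i)) with (2 * (i + 2) + 1)%nat by lia. rewrite HO.
    replace (S (4 + (2 * i + 1))) with (2 * (i + 3))%nat by lia. rewrite HE.
    replace (2 * (i + 2) + 1)%nat with (2 * i + 5)%nat by lia.
    replace (2 * (i + 3))%nat with (2 * i + 5 + 1)%nat by lia. rewrite (plus_INR (2 * i + 5) 1). simpl (INR 1).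
    replace (INR (2 * i + 5) + 1 - s) with (INR (2 * i + 5) - s + 1) by ring. ring.
  - replace (S (4 + 2 * m)) with (2 * (m + 2) + 1)%nat by lia. rewrite HO.
    replace (2 * (m + 2) + 1)%nat with (2 * m + 5)%nat by lia. ring. }
rewrite HA, HB, HC. unfold lobe_head, lobe_tail.
assert (E : X + 1 = X * (1 + / X)) by (field; lra). rewrite E.
generalize (rprod (fun i => pairE (INR (2 * i + 2)) L) (m + 2)) (rprod (fun i => pairE (INR (2 * i + 1) + s) L) (m + 2))
  (rprod (fun i => pairE (INR (2 * i + 5) - s) L) m) (Ex (INR (2 * m + 5) - s) L)
  (exp ((s - 1) * L)) (exp ((s - 2) * L)) (exp ((s - 3) * L)) (exp ((s - 4) * L)) (exp (- L)) (/ X).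
intros. ring.
Qed.

(** After cross-multiplication both sides are limits of one and the same positive constant times
    [lobe_tail]. *)
Lemma J_lobe_mono (a b : R) : 0 < a -> a <= b ->
  exp (s * a) * Jr (- exp (- a)) (exp (s * a)) * ((exp (s * b) + 1) * lobe_head b)
  <= exp (s * b) * Jr (- exp (- b)) (exp (s * b)) * ((exp (s * a) + 1) * lobe_head a).
Proof.
intros Ha Hab.
assert (Hp : forall L, 0 < L -> 0 < Rabs (- exp (- L)) < 1).
{ intros L HL. rewrite Rabs_left by (pose proof (exp_pos (- L)); lra). rewrite Ropp_involutive.
  split; [apply exp_pos|]. rewrite <- exp_0. apply exp_increasing. lra. }
assert (Hl : forall L, 0 < L -> is_lim_seq (fun m => (exp (s * L) + 1) * lobe_head L * lobe_tail m L)
   (exp (s * L) * Jr (- exp (- L)) (exp (s * L)))).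
{ intros L HL. apply (is_lim_seq_ext (fun m => exp (s * L) * rprod (Jterm (- exp (- L)) (exp (s * L))) (2 * m + 5))).
  - intros m. rewrite <- Jterm_factored. replace (2 * (m + 2) + 1)%nat with (2 * m + 5)%nat by lia. reflexivity.
  - apply (is_lim_seq_scal_l _ _ (Jr (- exp (- L)) (exp (s * L)))). apply Jterm_lim; [now apply Hp| |lia].
    pose proof (exp_pos (s * L)). lra. }
pose proof (lobe_head_pos a Ha) as Ga. pose proof (lobe_head_pos b ltac:(lra)) as Gb.
pose proof (exp_pos (s * a)). pose proof (exp_pos (s * b)).
set (ka := (exp (s * a) + 1) * lobe_head a) in *. set (kb := (exp (s * b) + 1) * lobe_head b) in *.
assert (Hka : 0 < ka) by (apply Rmult_lt_0_compat; lra).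
assert (Hkb : 0 < kb) by (apply Rmult_lt_0_compat; lra).
pose proof (is_lim_seq_scal_r _ kb _ (Hl a Ha)) as La.
pose proof (is_lim_seq_scal_r _ ka _ (Hl b ltac:(lra))) as Lb.
apply (is_lim_seq_le _ _ _ _) with (2 := La) (3 := Lb).
intros m. fold ka. fold kb. pose proof (lobe_tail_mono m a b Ha Hab) as HG.
replace (ka * lobe_tail m a * kb) with (ka * kb * lobe_tail m a) by ring.
replace (kb * lobe_tail m b * ka) with (ka * kb * lobe_tail m b) by ring.
apply Rmult_le_compat_l; [nra|lra].
Qed.

(* Along x = p^(-s) the function F is decreasing in p. *)
Lemma thr_neg_beyond_zero (a b : R) : ln54 <= a -> a < b ->
  thr (- exp (- b)) (exp (s * b)) = 0 -> thr (- exp (- a)) (exp (s * a)) < 0.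
Proof.
intros Ha Hab Hz. pose proof ln54_bounds as H0.
assert (HE : forall L, / exp (s * L) = Ex s L) by (intros L; now rewrite <- exp_Ropp).
rewrite Jr_right in Hz |- *. rewrite HE in Hz |- *.
pose proof (J_lobe_mono a b ltac:(lra) ltac:(lra)) as HJ.
pose proof (theta_inv_mono s Hs a b Ha ltac:(lra)) as HT.
pose proof (lobe_head_pos b ltac:(lra)) as Gb. pose proof (lobe_head_growth a b ltac:(lra) ltac:(lra)) as HG.
assert (Hpa : 0 < exp (- a) < 1).
{ split; [apply exp_pos|]. rewrite <- exp_0. apply exp_increasing. lra. }
assert (HTa : 0 < thr (- exp (- a)) (Ex s a)).
{ apply thr_right_pos; [exact Hpa|]. split; [left; apply Ex_pos|apply Ex_le1; lra]. }
assert (HTb : 0 <= thr (- exp (- b)) (Ex s b)).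
{ left. apply thr_right_pos; [|split; [left; apply Ex_pos|apply Ex_le1; lra]].
  split; [apply exp_pos|]. rewrite <- exp_0. apply exp_increasing. lra. }
assert (HX : exp (s * a) < exp (s * b)) by (apply exp_increasing; nra).
pose proof (exp_pos (s * a)) as HXa.
set (Xa := exp (s * a)) in *. set (Xb := exp (s * b)) in *.
set (Ja := Jr _ Xa) in *. set (Jb := Jr _ Xb) in *.
set (Ta := thr _ (Ex s a)) in *. set (Tb := thr _ (Ex s b)) in *.
set (ga := lobe_head a) in *. set (gb := lobe_head b) in *.
(* A zero at b means F = 1 there. The chain uses that the tail is monotone, that the head gains a
   factor L^2 and that theta(p^s) loses at most L^2; strictness comes from X + 1, which increases
   with L. *)
assert (HJb : Xb * Jb = Tb).
{ replace Jb with (Tb / Xb) by lra. field. lra. }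
rewrite HJb in HJ.
assert (Hb2 : 0 < b ^ 2) by (apply pow_lt; lra).
assert (H1 : Xa * Ja * ((Xb + 1) * gb) * b ^ 2 <= Tb * (Xa + 1) * (gb * a ^ 2)).
{ apply Rle_trans with (Tb * ((Xa + 1) * ga) * b ^ 2); [apply Rmult_le_compat_r; lra|].
  replace (Tb * ((Xa + 1) * ga) * b ^ 2) with (Tb * (Xa + 1) * (ga * b ^ 2)) by ring.
  apply Rmult_le_compat_l; [|exact HG]. apply Rmult_le_pos; lra. }
assert (H2 : Tb * (Xa + 1) * (gb * a ^ 2) <= Ta * b ^ 2 * ((Xa + 1) * gb)).
{ replace (Tb * (Xa + 1) * (gb * a ^ 2)) with (Tb * a ^ 2 * ((Xa + 1) * gb)) by ring.
  apply Rmult_le_compat_r; [apply Rmult_le_pos; lra|exact HT]. }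
assert (H3 : Xa * Ja * (Xb + 1) <= Ta * (Xa + 1)).
{ apply Rmult_le_reg_r with (gb * b ^ 2); [apply Rmult_lt_0_compat; lra|].
  replace (Xa * Ja * (Xb + 1) * (gb * b ^ 2)) with (Xa * Ja * ((Xb + 1) * gb) * b ^ 2) by ring.
  replace (Ta * (Xa + 1) * (gb * b ^ 2)) with (Ta * b ^ 2 * ((Xa + 1) * gb)) by ring. lra. }
assert (H4 : Ta * (Xa + 1) < Ta * (Xb + 1)) by (apply Rmult_lt_compat_l; lra).
assert (H5 : Xa * Ja < Ta) by (apply Rmult_lt_reg_r with (Xb + 1); lra).
assert (Ja < Ta / Xa); [|lra].
apply Rmult_lt_reg_l with Xa; [lra|]. unfold Rdiv. rewrite (Rmult_comm Ta), <- Rmult_assoc, Rinv_r; lra.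
Qed.

End Lobe.

(** * The followed zeros *)

Definition ppow (s q : R) : R := exp (s * ln (- q)).

Lemma ppow_nat (n : nat) (q : R) : q < 0 -> ppow (INR n) q = (- q) ^ n.
Proof.
intros Hq. unfold ppow. induction n as [|n IH]; [simpl; rewrite Rmult_0_l; apply exp_0|].
rewrite S_INR, Rmult_plus_distr_r, Rmult_1_l, exp_plus, IH, exp_ln by lra. simpl. ring.
Qed.

Lemma ppow_plus (s t q : R) : ppow (s + t) q = ppow s q * ppow t q.
Proof. unfold ppow. rewrite <- exp_plus. f_equal. ring. Qed.

Lemma ppow_small (c e : R) : 0 < c -> 0 < e -> exists d, 0 < d /\ forall q, - d < q < 0 -> ppow c q < e.
Proof.
intros Hc He. exists (exp (ln e / c)). split; [apply exp_pos|]. intros q Hq.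
assert (H : ln (- q) < ln e / c) by (rewrite <- (ln_exp (ln e / c)); apply ln_increasing; lra).
rewrite <- (exp_ln e He). apply exp_increasing.
apply Rmult_lt_compat_l with (r := c) in H; [|exact Hc].
replace (c * (ln e / c)) with (ln e) in H by (field; lra). exact H.
Qed.

Lemma followed_asymptotics (j : nat) (q0 : R) (x : R -> R) : followed_zero j q0 x ->
  exists d, 0 < d /\ forall q, - d < q < 0 -> Rabs (- / q ^ j - x q) <= / 2 * Rabs (- / q ^ j).
Proof.
intros [_ [_ H]]. destruct (H (mkposreal (/ 2) ltac:(lra))) as [d Hd].
exists d. split; [apply cond_pos|]. intros q Hq. apply (Hd q); [|lra].
change (Rabs (minus q 0) < d). unfold minus, plus, opp. simpl. rewrite Rabs_left; lra.
Qed.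

Lemma ppow_continuous (s q : R) : q < 0 -> continuous (ppow s) q.
Proof.
intros Hq. apply continuity_pt_filterlim. unfold ppow.
apply derivable_continuous_pt. exists (exp (s * ln (- q)) * (s * / q)).
apply is_derive_Reals. auto_derive; [lra|]. field. lra.
Qed.

(** The sign [sg] records on which side of the curve the limit xi lies; near q = 0 the path is on
    the other side. The intermediate value theorem is applied on a compact subinterval, since
    continuity of the path is given only inside (q0, 0). *)
Lemma followed_ivt (j : nat) (q0 xi s sg : R) (x : R -> R) :
  -1 < q0 < 0 -> followed_zero j q0 x -> filterlim x (at_right q0) (locally xi) -> sg = 1 \/ sg = - 1 ->
  0 < sg * (xi * ppow s q0 - 1) ->
  (exists d, 0 < d /\ forall q, - d < q < 0 -> sg * (x q * ppow s q - 1) < 0) ->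
  exists q, q0 < q < 0 /\ thr q (x q) = 0 /\ x q * ppow s q = 1.
Proof.
intros Hq0 Hx Hlim Hsg Hxi [d [Hd Hdd]].
set (q1 := Rmax (- d / 2) (q0 / 2)).
assert (H1 : q0 / 2 <= q1) by apply Rmax_r. assert (H1' : - d / 2 <= q1) by apply Rmax_l.
assert (H2 : q1 < 0) by (unfold q1; apply Rmax_case; lra).
assert (HL : filterlim (fun q => x q * ppow s q) (at_right q0) (locally (xi * ppow s q0))).
{ apply (filterlim_comp_2 (FF := _) (G := locally xi) (H := locally (ppow s q0)) x (ppow s) Rmult).
  - exact Hlim.
  - apply (filterlim_filter_le_1 (F := locally q0)); [apply filter_le_within|]. apply ppow_continuous. lra.
  - apply (filterlim_mult (K := R_AbsRing) xi (ppow s q0)). }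
assert (Hex : exists q, q0 < q < q1 /\ 0 < sg * (x q * ppow s q - 1)).
{ assert (He : 0 < Rabs (xi * ppow s q0 - 1)).
  { apply Rabs_pos_lt. intros E. rewrite E in Hxi. lra. }
  assert (HA : at_right q0 (fun q => Rabs (x q * ppow s q - xi * ppow s q0) < Rabs (xi * ppow s q0 - 1))).
  { apply (HL (fun v => Rabs (v - xi * ppow s q0) < Rabs (xi * ppow s q0 - 1))). exists (mkposreal _ He). intros y Hy. exact Hy. }
  assert (HB : at_right q0 (fun q => q < q1)).
  { assert (Hpos : 0 < q1 - q0) by lra. exists (mkposreal _ Hpos). intros y Hy _.
    change (Rabs (minus y q0) < q1 - q0) in Hy. unfold minus, plus, opp in Hy. simpl in Hy.
    apply Rabs_def2 in Hy. lra. }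
  assert (HC : at_right q0 (fun q => q0 < q)) by (exists (mkposreal 1 Rlt_0_1); intros y _ Hy; exact Hy).
  destruct (filter_ex _ (filter_and _ _ HA (filter_and _ _ HB HC))) as [q [A [B C]]].
  exists q. split; [lra|].
  destruct Hsg as [-> | ->].
  - rewrite (Rabs_pos_eq (xi * ppow s q0 - 1)) in A by lra. apply Rabs_def2 in A. lra.
  - rewrite (Rabs_left (xi * ppow s q0 - 1)) in A by lra. apply Rabs_def2 in A. lra. }
destruct Hex as [q2 [Hq2 Hpos2]].
specialize (Hdd q1 ltac:(lra)).
destruct Hx as [Hz [Hc _]].
destruct (IVT_interv (fun q => - (sg * (x q * ppow s q - 1))) q2 q1) as [z [Hz1 Hz2]]; [| lra|lra|lra|].
{ intros a Ha. apply continuity_pt_opp. apply (continuity_pt_mult (fun _ => sg)); [apply continuity_pt_const; intros ? ?; reflexivity|].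
  apply (continuity_pt_minus (fun q => x q * ppow s q) (fun _ => 1)); [|apply continuity_pt_const; intros ? ?; reflexivity].
  apply continuity_pt_mult; apply continuity_pt_filterlim; [apply Hc; lra|apply ppow_continuous; lra]. }
exists z. split; [lra|]. split.
- destruct (Hz z ltac:(lra)) as [Hz0 _]. apply real_zero_thr; [rewrite Rabs_left; lra|exact Hz0].
- destruct Hsg as [-> | ->]; lra.
Qed.

(* The two followed zeros start on both sides of the curve x = |q|^(-s) and meet at q0, so one
   of them crosses it. *)
Lemma path_covers (q0 s : R) : is_q_bar_2 q0 -> 3 < s < 5 ->
  exists q x, q0 <= q < 0 /\ thr q x = 0 /\ x * ppow s q = 1.
Proof.
intros [Hq0 [x [y [xi [Hx [Hy [Lx [Ly [[Hxi _] _]]]]]]]]] Hs.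
destruct (Rtotal_order (xi * ppow s q0 - 1) 0) as [C|[C|C]].
(* The meeting point lies below the curve, whereas x_5 |q|^s behaves like |q|^(s-5) and tends to
   infinity at 0. *)
- destruct (followed_ivt 5 q0 xi s (- 1) y) as [q [H1 [H2 H3]]]; auto; [lra| |exists q, (y q); repeat split; lra].
  destruct (followed_asymptotics 5 q0 y Hy) as [d1 [Hd1 Ha]].
  destruct (ppow_small (5 - s) (/ 2) ltac:(lra) ltac:(lra)) as [d2 [Hd2 Hb]].
  exists (Rmin d1 d2). split; [apply Rmin_case; lra|]. intros q Hq.
  pose proof (Rmin_l d1 d2). pose proof (Rmin_r d1 d2).
  specialize (Ha q ltac:(lra)). specialize (Hb q ltac:(lra)).
  assert (Hg : - / q ^ 5 = / (- q) ^ 5) by (field; lra). rewrite Hg in Ha.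
  assert (Hp5 : 0 < (- q) ^ 5) by (apply pow_lt; lra).
  assert (Hi5 : 0 < / (- q) ^ 5) by now apply Rinv_0_lt_compat.
  rewrite (Rabs_pos_eq (/ (- q) ^ 5)) in Ha by lra. apply Rabs_le_between in Ha.
  assert (E : ppow s q * ppow (5 - s) q = (- q) ^ 5).
  { rewrite <- ppow_plus. replace (s + (5 - s)) with (INR 5) by (simpl; ring). apply ppow_nat. lra. }
  assert (Hps : 0 < ppow s q) by apply exp_pos.
  assert (/ 2 * / (- q) ^ 5 * ppow s q <= y q * ppow s q) by (apply Rmult_le_compat_r; lra).
  assert (Hb' : 0 < ppow (5 - s) q) by apply exp_pos.
  assert (/ (- q) ^ 5 * ppow s q = / ppow (5 - s) q) by (rewrite <- E; field; lra).
  assert (2 < / ppow (5 - s) q) by (rewrite <- (Rinv_inv 2); apply Rinv_lt_contravar; [apply Rmult_lt_0_compat; lra|lra]).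
  lra.
- exists q0, xi. split; [lra|]. split; [|lra]. apply real_zero_thr; [rewrite Rabs_left; lra|exact Hxi].
(* The meeting point lies above the curve, whereas x_3 |q|^s behaves like |q|^(s-3) and tends to
   0. *)
- destruct (followed_ivt 3 q0 xi s 1 x) as [q [H1 [H2 H3]]]; auto; [lra| |exists q, (x q); repeat split; lra].
  destruct (followed_asymptotics 3 q0 x Hx) as [d1 [Hd1 Ha]].
  destruct (ppow_small (s - 3) (/ 2) ltac:(lra) ltac:(lra)) as [d2 [Hd2 Hb]].
  exists (Rmin d1 d2). split; [apply Rmin_case; lra|]. intros q Hq.
  pose proof (Rmin_l d1 d2). pose proof (Rmin_r d1 d2).
  specialize (Ha q ltac:(lra)). specialize (Hb q ltac:(lra)).
  assert (Hg : - / q ^ 3 = / (- q) ^ 3) by (field; lra). rewrite Hg in Ha.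
  assert (Hp3 : 0 < (- q) ^ 3) by (apply pow_lt; lra).
  assert (Hi3 : 0 < / (- q) ^ 3) by now apply Rinv_0_lt_compat.
  rewrite (Rabs_pos_eq (/ (- q) ^ 3)) in Ha by lra. apply Rabs_le_between in Ha.
  assert (E : ppow s q = ppow (s - 3) q * (- q) ^ 3).
  { rewrite <- (ppow_nat 3) by lra. rewrite <- ppow_plus. f_equal. simpl. ring. }
  assert (Hps : 0 < ppow s q) by apply exp_pos.
  assert (x q * ppow s q <= 3 / 2 * / (- q) ^ 3 * ppow s q) by (apply Rmult_le_compat_r; lra).
  assert (/ (- q) ^ 3 * ppow s q = ppow (s - 3) q) by (rewrite E; field; lra).
  lra.
Qed.

(** The exponent s = ln X / ln (1/p) lies in (3, 5). A zero sits on the curve of this exponent at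
    some |q| <= - q0 < p, and by the monotonicity of F along the curve theta is negative at p. *)
Lemma thr_neg_after_coalescence (q0 p X : R) : is_q_bar_2 q0 -> - q0 < p <= 8 / 10 ->
  1 < X * p ^ 3 -> X * p ^ 5 < 1 -> thr (- p) X < 0.
Proof.
intros Hq0 Hp H3 H5. assert (Hq0' := Hq0). destruct Hq0' as [Hq0r _].
set (L := - ln p).
assert (HL : ln54 <= L).
{ unfold L, ln54. rewrite <- ln_Rinv by lra. destruct (Req_dec p (8 / 10)) as [->|Hne].
  - right. f_equal. field.
  - left. apply ln_increasing; [lra|]. apply Rmult_lt_reg_r with p; [lra|]. rewrite Rinv_l; lra. }
pose proof ln54_bounds as H0.
assert (Hp3 : 0 < p ^ 3) by (apply pow_lt; lra). assert (Hp5 : 0 < p ^ 5) by (apply pow_lt; lra).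
assert (HX : 0 < X) by nra.
assert (EpL : p = exp (- L)) by (unfold L; rewrite Ropp_involutive, exp_ln; lra).
assert (Hpn : forall n, p ^ n = Ex (INR n) L) by (intros n; rewrite EpL; apply Ex_pow).
set (s := ln X / L).
assert (EX : X = exp (s * L)).
{ unfold s. replace (ln X / L * L) with (ln X) by (field; lra). now rewrite exp_ln. }
assert (Hs : 3 < s < 5).
{ rewrite Hpn, EX in H3, H5.
  assert (H3' : exp 0 < exp (s * L + - (INR 3 * L))) by (rewrite exp_0, exp_plus; exact H3).
  assert (H5' : exp (s * L + - (INR 5 * L)) < exp 0) by (rewrite exp_0, exp_plus; exact H5).
  apply exp_lt_inv in H3', H5'. simpl INR in H3', H5'. split; nra. }
destruct (path_covers q0 s Hq0 Hs) as [q [x [Hq [Hz Hx]]]].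
set (b := - ln (- q)).
assert (Eqb : q = - exp (- b)) by (unfold b; rewrite Ropp_involutive, exp_ln; lra).
assert (Ex' : x = exp (s * b)).
{ assert (E : exp (s * b) * ppow s q = 1).
  { unfold ppow, b. rewrite <- exp_plus. rewrite <- exp_0. f_equal. ring. }
  assert (0 < ppow s q) by apply exp_pos. apply Rmult_eq_reg_r with (ppow s q); lra. }
rewrite Eqb, Ex' in Hz. rewrite EpL, EX.
apply (thr_neg_beyond_zero s Hs L b); [exact HL| |exact Hz].
unfold L, b. apply Ropp_lt_contravar. apply ln_increasing; lra.
Qed.

(** Below p^(-3) and from p^(-5) to p^(-7) the sign of J decides; the interval in between is closed
    by the coalescence. *)
Lemma thr_right_neg_small (q0 p X : R) : is_q_bar_2 q0 -> - q0 < p < 8 / 10 ->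
  / p <= X <= / p ^ 7 -> thr (- p) X < 0.
Proof.
intros Hq0 Hp HX. assert (Hq0' := Hq0). destruct Hq0' as [Hq0r _].
assert (Hp' : 0 < p < 1) by lra.
assert (Hip : 1 < / p) by (rewrite <- Rinv_1; apply Rinv_lt_contravar; lra).
assert (HX1 : 1 < X) by lra. pose proof (invX_range X ltac:(lra)) as Hi.
assert (HXp : 1 <= X * p).
{ apply Rmult_le_reg_r with (/ p); [lra|]. rewrite Rmult_assoc, Rinv_r by lra. lra. }
assert (H7 : X * p ^ 7 <= 1).
{ assert (0 < p ^ 7) by (apply pow_lt; lra).
  apply Rle_trans with (/ p ^ 7 * p ^ 7); [apply Rmult_le_compat_r; lra|]. rewrite Rinv_l; lra. }
destruct (Rlt_le_dec 1 (X * p ^ 3)) as [C3|C3]; [destruct (Rlt_le_dec (X * p ^ 5) 1) as [C5|C5]|].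
- now apply (thr_neg_after_coalescence q0); [|lra| |].
- rewrite Jr_right. pose proof (J_right_le0_2 p X Hp' ltac:(lra) C5 H7).
  assert (0 < thr (- p) (/ X) / X); [|lra]. apply Rdiv_lt_0_compat; [|lra]. apply thr_right_pos; lra.
- rewrite Jr_right. pose proof (J_right_le0_1 p X Hp' ltac:(lra) HXp C3).
  assert (0 < thr (- p) (/ X) / X); [|lra]. apply Rdiv_lt_0_compat; [|lra]. apply thr_right_pos; lra.
Qed.

Lemma right_separating_line_exists (q0 p : R) : is_q_bar_2 q0 -> - q0 < p < 1 ->
  exists a, 32 / 10 <= a /\ right_separating_line (- p) a.
Proof.
intros Hq0 Hp. assert (Hq0' := Hq0). destruct Hq0' as [Hq0r _].
assert (Hp' : 0 < p < 1) by lra. assert (Hq' := neg_q p Hp').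
assert (Hip : 1 < / p) by (rewrite <- Rinv_1; apply Rinv_lt_contravar; lra).
(* 3.2 times 0.8^7 is below 1, so p^(-7) exceeds 3.2 for p < 0.8. In both cases theta is negative on
   [1/p, b] and the half-plane argument starts at b. *)
set (b := if Rlt_dec p (8 / 10) then / p ^ 7 else 32 / 10).
assert (Hb : 32 / 10 <= b /\ / p < b /\ (p < 8 / 10 -> / p ^ 7 <= b) /\
  forall X, / p <= X <= b -> thr (- p) X < 0).
{ unfold b. destruct (Rlt_dec p (8 / 10)) as [C|C].
  - assert (Hp7 : 0 < p ^ 7) by (apply pow_lt; lra).
    assert (H7 : 32 / 10 * p ^ 7 <= 1).
    { assert (p ^ 7 <= (8 / 10) ^ 7) by (apply pow_incr; lra). lra. }
    split; [|split; [|split]].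
    + apply Rmult_le_reg_r with (p ^ 7); [exact Hp7|]. rewrite Rinv_l; lra.
    + apply Rinv_lt_contravar; [nra|]. simpl.
      assert (0 < p * p < 1) by nra. assert (0 < p * p * (p * p) < 1) by nra.
      assert (0 < p * p * (p * p) * (p * p) < 1) by nra. nra.
    + lra.
    + intros X HX. apply (thr_right_neg_small q0); [exact Hq0|lra|exact HX].
  - assert (/ p <= 125 / 100).
    { apply Rmult_le_reg_r with p; [lra|]. rewrite Rinv_l; lra. }
    split; [lra|split; [lra|split; [lra|]]]. intros X HX. apply thr_right_neg_large; lra. }
destruct Hb as [Hb32 [Hbp [Hb7 Hneg]]].
destruct (thr_far_sign (- p) 1 1 Hq') with (b := / p) as [m [Hm1 Hm2]];
  [|lra|apply Rabs_R1|now apply J_seed_right|].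
{ rewrite pow1. replace ((- p) ^ 4) with (p ^ 4) by ring. apply pow_pos_le1; lra. }
set (xc := 1 / (- p) ^ (4 * m)) in *.
assert (Hxc : 0 < xc).
{ unfold xc. apply Rdiv_lt_0_compat; [lra|]. replace (4 * m)%nat with (2 * (2 * m))%nat by lia.
  rewrite neg_pow. apply pow_lt. nra. }
rewrite Rabs_pos_eq in Hm1 by lra.
(* theta is positive before its smallest zero, so the search for the next one starts at 1/p, where
   it is negative, with the sign reversed. *)
destruct (first_zero (fun t => - thr (- p) (/ p + t)) (b - / p) (xc - / p)) as [t [Ht1 [Ht2 Ht3]]].
- intros x. apply continuity_pt_opp. apply (continuity_pt_comp (fun t => / p + t) (thr (- p))); [reg|].
  now apply thr_continuity.
- lra.
- intros x Hx. specialize (Hneg (/ p + x) ltac:(lra)). lra.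
- lra.
- replace (/ p + (xc - / p)) with xc by ring. lra.
- set (x0 := / p + t) in *.
  destruct (right_gap_neg p x0) as [d [Hd Hd']]; [exact Hp'|unfold x0; lra| |lra|].
  { intros C. specialize (Hb7 C). unfold x0. lra. }
  set (e := Rmin (d / 2) ((x0 - b) / 2)).
  assert (He : 0 < e) by (apply Rmin_case; unfold x0; lra).
  assert (He1 : e <= d / 2) by apply Rmin_l. assert (He2 : e <= (x0 - b) / 2) by apply Rmin_r.
  assert (Hbx : b < x0) by (unfold x0; lra).
  destruct (smallest_zero_exists p Hp') as [x1 [Hx1 [Hz1 Hu1]]].
  assert (Hzero : forall x, real_zero (- p) x -> 0 < x -> x = x1 \/ x0 <= x).
  { intros x Hx Hx0. apply real_zero_thr in Hx; [|exact Hq'].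
    destruct (Rle_lt_dec x (/ p)) as [C|C]; [left; apply Hu1; [lra|exact Hx]|right].
    destruct (Rlt_le_dec x x0) as [C1|C1]; [exfalso|exact C1].
    specialize (Ht3 (x - / p) ltac:(unfold x0 in C1; lra)).
    replace (/ p + (x - / p)) with x in Ht3 by ring. lra. }
  exists (x0 - e). split; [lra|]. split; [|split].
  + intros x _ Hx. lra.
  + apply (nonreal_from_upper (- p) (fun x => x < x0 - e)); [exact Hq'|]. intros x u Hu Hz. specialize (Hd' x u Hu Hz). lra.
  + exists x1. split; [|split].
    * split; [now apply real_zero_thr|]. split; [lra|]. intros y Hy Hy0.
      destruct (Hzero y Hy Hy0) as [->|H]; lra.
    * lra.
    * intros x Hx Hx0 Hne. destruct (Hzero x Hx Hx0) as [H|H]; [contradiction|lra].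
Qed.

Theorem theorem9 (q_tilde_1 q_bar_1 q_bar_2 : R)
    (Hq_tilde_1 : is_q_tilde_1 q_tilde_1)
    (Hq_bar_1 : is_q_bar_1 q_bar_1)
    (Hq_bar_2 : is_q_bar_2 q_bar_2) :
  (forall q : R, q_tilde_1 < q < 1 ->
     exists a : R, 5 <= a /\ separating_line q (- a)) /\
  (forall q : R, -1 < q < q_bar_1 ->
     exists a : R, 24 / 10 <= a /\ left_separating_line q (- a)) /\
  (forall q : R, -1 < q < q_bar_2 ->
     exists a : R, 32 / 10 <= a /\ right_separating_line q a).
Proof.
split; [|split]; intros q Hq.
- destruct Hq_tilde_1 as [H _]. apply separating_line_exists. lra.
- destruct Hq_bar_1 as [H _]. rewrite <- (Ropp_involutive q). apply left_separating_line_exists. lra.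
- destruct (Hq_bar_2) as [H _]. rewrite <- (Ropp_involutive q). apply (right_separating_line_exists q_bar_2); [exact Hq_bar_2|lra].
Qed.
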